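(* Let $n\ge 2$ and $m\ge 1$ be integers, $Q\in\mathcal{K}_o^{1,m}$, and $K\in\mathcal{L}_o^{n,1}$. Then $$\frac{C_{1,Q}(K)}{C_{1,Q}(B_2^n)}\le\frac{\Phi_{1,Q}(K)}{\Phi_{1,Q}(B_2^n)},$$ with equality if $K$ is an origin-symmetric ellipsoid.
   Context: $M_{n,m}(\mathbb{R})$ is the space of real $n\times m$ matrices with inner product $\mathrm{tr}(x^{\mathrm T}y)$ and the induced norm; $S^{nm-1}$ is its unit sphere and $du$ the spherical (Hausdorff) measure on it. $M_{n,1}(\mathbb{R})$ and $M_{1,m}(\mathbb{R})$ are identified with $\mathbb{R}^n$ and $\mathbb{R}^m$. $B_2^n$ is the Euclidean unit ball of $\mathbb{R}^n$. An origin-symmetric ellipsoid is a set $\phi B_2^n$ with $\phi$ an invertible real $n\times n$ matrix. $\mathcal{K}_o^{1,m}$ is the set of compact convex sets with nonempty interior in $M_{1,m}(\mathbb{R})$ containing the origin $o$. The support function is $h_Q(x)=\max\{x\cdot y:y\in Q\}$. For a smooth compactly supported $f:\mathbb{R}^n\to\mathbb{R}$ (i.e. $f\in C_c^\infty$) and $u\in S^{nm-1}$, put $\nabla_u f(x)=(\nabla f(x))^{\mathrm T}u\in M_{1,m}(\mathbb{R})$ (matrix product). For compact $K\subset\mathbb{R}^n$, the $m$th order $1$-affine capacity is $$C_{1,Q}(K)=\inf\Big\{\Big(\int_{S^{nm-1}}\Big(\int_{\mathbb{R}^n}h_Q(\nabla_u f(x))\,dx\Big)^{-nm}\,du\Big)^{-\frac{1}{nm}}: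 f\in C_c^\infty,\ f\ge 1\text{ on }K\Big\}.$$ $\mathcal{L}_o^{n,1}$ is the set of Lipschitz star bodies about $o$ in $\mathbb{R}^n$: compact sets $K$ that are star-shaped about $o$, whose radial function $\rho_K(x)=\sup\{\lambda\ge0:\lambda x\in K\}$ is strictly positive and continuous on $S^{n-1}$, and whose boundary is Lipschitz, i.e. $\rho_K|_{S^{n-1}}$ is Lipschitz. For such $K$, $\partial^*K=\{x\in\partial K:\nabla\rho_K(x)\text{ exists}\}$, which is $\mathcal{H}^{n-1}$-almost all of $\partial K$, and $\nu_K(z)$ is the outer unit normal at $z\in\partial^*K$. For $x\in M_{n,m}(\mathbb{R})$, $$h_{\Pi_{1,Q}K}(x)=\int_{\partial^*K}h_Q(\nu_K(z)^{\mathrm T}x)\,d\mathcal{H}^{n-1}(z),$$ and the $m$th order $1$-integral affine surface area is $\Phi_{1,Q}(K)=\Big(\int_{S^{nm-1}}h_{\Pi_{1,Q}K}(u)^{-nm}\,du\Big)^{-\frac{1}{nm}}$. *)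

(* Defs.v *)
From HB Require Import structures.
From mathcomp Require Export all_boot all_order all_algebra.
From mathcomp Require Export all_classical all_reals all_analysis.
Export numFieldNormedType.Exports.

Set Implicit Arguments.
Unset Strict Implicit.
Unset Printing Implicit Defensive.

Import Order.TTheory GRing.Theory Num.Theory.

Local Open Scope classical_set_scope.
Local Open Scope ring_scope.

(* The topology on matrices is the library's one. Its norm is the sup norm, so
   the Euclidean structure tr(x^T y) is introduced separately; all metric
   notions below (balls, spheres, diameters, Lipschitz constants) use it.
   R^n is 'cV[R]_n, and M_{1,m}(R) is 'rV[R]_m. *)

Section euclidean.
Context {R : realType}.

Definition mxdot p q (x y : 'M[R]_(p, q)) : R := \tr (x^T *m y).

Definition enorm p q (x : 'M[R]_(p, q)) : R := Num.sqrt (mxdot x x).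

Definition esphere p q : set 'M[R]_(p, q) := [set u | enorm u = 1].

Definition eball n : set 'cV[R]_n := [set x | enorm x <= 1].

Definition ediam p q (A : set 'M[R]_(p, q)) : \bar R :=
  ereal_sup [set (enorm (x.1 - x.2))%:E | x in A `*` A].

End euclidean.

Section method1.
Local Open Scope ereal_scope.
Context {T : pointedType} {R : realType}.

Definition method1 (tau : set T -> \bar R) (A : set T) : \bar R :=
  ereal_inf [set \sum_(k <oo) tau (F k) | F in
    [set F : (set T)^nat | A `<=` \bigcup_k F k]].

(* [mu_ext] for the semiring of all sets *)
Lemma method1E (tau : set T -> \bar R) :
  method1 tau = mu_ext (tau : set (g_sigma_algebraType [set: set T]) -> \bar R).
Proof.
apply/funext => A; rewrite /method1 /mu_ext; congr (ereal_inf (image _ _)).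
by apply/seteqP; split => [F AF|F []//]; split => // i; exact: sub_sigma_algebra.
Qed.

Variable tau : set T -> \bar R.
Hypotheses (tau0 : tau set0 = 0) (tau_ge0 : forall A, 0 <= tau A).

Lemma method1_0 : method1 tau set0 = 0.
Proof. by rewrite method1E mu_ext0. Qed.

Lemma method1_ge0 A : 0 <= method1 tau A.
Proof. by rewrite method1E mu_ext_ge0. Qed.

Lemma le_method1 : {homo method1 tau : A B / A `<=` B >-> A <= B}.
Proof. by move=> A B AB; rewrite method1E le_mu_ext. Qed.

Lemma method1_sigma_subadditive : sigma_subadditive (method1 tau).
Proof.
rewrite method1E.
exact: (@mu_ext_sigma_subadditive _ (g_sigma_algebraType [set: set T]) R).
Qed.

End method1.

Section lebesgue_cV.
Local Open Scope ereal_scope.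
Context {R : realType} (n : nat).

Definition box (a b : 'cV[R]_n) : set 'cV[R]_n :=
  [set x | forall i, (a i 0 <= x i 0 <= b i 0)%R].

(* +oo on sets that are neither empty nor boxes *)
Definition box_gauge (A : set 'cV[R]_n) : \bar R :=
  if A == set0 then 0 else
  ereal_inf [set (\prod_(i < n) (ab.2 i 0 - ab.1 i 0)%R)%:E | ab in
    [set ab : 'cV[R]_n * 'cV[R]_n | (forall i, (ab.1 i 0 <= ab.2 i 0)%R) /\ A = box ab.1 ab.2]].

Definition lebesgue_cV : set 'cV[R]_n -> \bar R := method1 box_gauge.

Lemma box_gauge0 : box_gauge set0 = 0.
Proof. by rewrite /box_gauge eqxx. Qed.

Lemma box_gauge_ge0 A : 0 <= box_gauge A.
Proof.
rewrite /box_gauge; case: ifP => // _.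
apply: le_ereal_inf_tmp => _ [[a b] /= [ab _] <-].
by rewrite lee_fin; apply: prodr_ge0 => i _; rewrite subr_ge0.
Qed.

HB.instance Definition _ := isOuterMeasure.Build R 'cV[R]_n lebesgue_cV
  (method1_0 box_gauge0 box_gauge_ge0) (method1_ge0 box_gauge_ge0)
  (@le_method1 _ _ box_gauge) (method1_sigma_subadditive box_gauge_ge0).

Definition lebesgue_int (D : set 'cV[R]_n) (f : 'cV[R]_n -> \bar R) : \bar R :=
  integral (T := caratheodory_type lebesgue_cV) lebesgue_cV D f.

End lebesgue_cV.

(* s-dimensional Hausdorff measure for the Euclidean distance, normalised by
   the volume of the unit ball of R^s so that it agrees with surface area *)
Section hausdorff.
Local Open Scope ereal_scope.
Context {R : realType} (p q s : nat).
Local Notation V := 'M[R]_(p, q).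

Definition hausdorff_gauge (delta : R) (A : set V) : \bar R :=
  if A == set0 then 0 else
  if ediam A <= delta%:E then
    lebesgue_cV (@eball R s) * ((fine (ediam A) / 2) ^+ s)%:E
  else +oo.

Definition hausdorff (A : set V) : \bar R :=
  ereal_sup [set method1 (hausdorff_gauge delta) A | delta in
    [set delta : R | (0 < delta)%R]].

Lemma hausdorff_gauge0 delta : hausdorff_gauge delta set0 = 0.
Proof. by rewrite /hausdorff_gauge eqxx. Qed.

Lemma hausdorff_gauge_ge0 delta A : 0 <= hausdorff_gauge delta A.
Proof.
rewrite /hausdorff_gauge; case: ifP => [//|/eqP/eqP/set0P[x Ax]].
case: ifP => _; last exact: leey.
rewrite mule_ge0 ?outer_measure_ge0// lee_fin exprn_ge0// divr_ge0//.
apply/fine_ge0/(@le_trans _ _ (enorm (x - x))%:E).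
  by rewrite lee_fin sqrtr_ge0.
by apply: ereal_sup_ubound; exists (x, x).
Qed.

Lemma hausdorff0 : hausdorff set0 = 0.
Proof.
apply/eqP; rewrite eq_le; apply/andP; split.
  apply: ge_ereal_sup => _ [d d0 <-].
  by rewrite (method1_0 (hausdorff_gauge0 d) (hausdorff_gauge_ge0 d)).
apply: ereal_sup_ubound; exists 1%R => //=.
by rewrite (method1_0 (hausdorff_gauge0 _) (hausdorff_gauge_ge0 _)).
Qed.

Lemma hausdorff_ge0 A : 0 <= hausdorff A.
Proof.
apply: (le_trans (method1_ge0 (hausdorff_gauge_ge0 1) A)).
by apply: ereal_sup_ubound; exists 1%R => /=.
Qed.

Lemma le_hausdorff : {homo hausdorff : A B / A `<=` B >-> A <= B}.
Proof.
move=> A B AB; apply: ge_ereal_sup => _ [d d0 <-].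
apply: (le_trans (le_method1 (hausdorff_gauge d) AB)).
by apply: ereal_sup_ubound; exists d.
Qed.

Lemma hausdorff_sigma_subadditive : sigma_subadditive hausdorff.
Proof.
move=> F; apply: ge_ereal_sup => _ [d d0 <-].
apply: (le_trans (method1_sigma_subadditive (hausdorff_gauge_ge0 d) F)).
apply: lee_nneseries => [i _ _|i _].
  exact: (method1_ge0 (hausdorff_gauge_ge0 d)).
by apply: ereal_sup_ubound; exists d.
Qed.

HB.instance Definition _ := isOuterMeasure.Build R V hausdorff
  hausdorff0 hausdorff_ge0 le_hausdorff hausdorff_sigma_subadditive.

Definition hausdorff_int (D : set V) (f : V -> \bar R) : \bar R :=
  integral (T := caratheodory_type hausdorff) hausdorff D f.

End hausdorff.

Section test_functions.
Context {R : realType} (n : nat).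
Implicit Type f : 'cV[R]_n -> R^o.

Definition partial (i : 'I_n) f : 'cV[R]_n -> R^o := 'D_(delta_mx i 0) f.

Definition grad f (x : 'cV[R]_n) : 'cV[R]_n := \col_i partial i f x.

Fixpoint Ck (k : nat) f : Prop :=
  continuous f /\
  if k is k'.+1 then
    forall i : 'I_n,
      (forall x, derivable f x (delta_mx i 0)) /\ Ck k' (partial i f)
  else True.

Definition smooth f : Prop := forall k, Ck k f.

Definition compactly_supported f : Prop :=
  compact (closure [set x | f x != 0]).

End test_functions.

Section star_bodies.
Context {R : realType} (n : nat).
Implicit Type K : set 'cV[R]_n.

Definition star_shaped K : Prop :=
  K 0 /\ forall x t, K x -> 0 <= t <= 1 -> K (t *: x).

(* only meaningful away from the origin *)
Definition radial K (x : 'cV[R]_n) : R^o :=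
  sup [set t : R | 0 <= t /\ K (t *: x)].

Definition lipschitz_star_body K : Prop :=
  [/\ compact K,
      star_shaped K,
      (forall x, esphere x -> 0 < radial K x),
      {within (@esphere R n 1), continuous (radial K)} &
      exists L : R, forall x y : 'cV[R]_n, esphere x -> esphere y ->
        `|radial K x - radial K y| <= L * enorm (x - y)].

Definition frontier K : set 'cV[R]_n := closure K `\` interior K.

Definition regular_frontier K : set 'cV[R]_n :=
  [set z | frontier K z /\ differentiable (radial K) z].

(* Away from the origin, K is the superlevel set {radial K >= 1}, so the outer
   normal points along minus the gradient of the radial function. *)
Definition outer_normal K (z : 'cV[R]_n) : 'cV[R]_n :=
  - (enorm (grad (radial K) z))^-1 *: grad (radial K) z.

Definition origin_symmetric_ellipsoid K : Prop :=
  exists2 phi : 'M[R]_n, phi \in unitmx &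
    K = [set phi *m x | x in @eball R n].

End star_bodies.

Section affine_capacity.
Local Open Scope ereal_scope.
Context {R : realType} (n m : nat).
Implicit Types (Q : set 'rV[R]_m) (K : set 'cV[R]_n).

Definition convex_body_o Q : Prop :=
  [/\ compact Q, convex_set Q, interior Q !=set0 & Q 0%R].

Definition support Q (x : 'rV[R]_m) : R := sup [set mxdot x y | y in Q].

(* x to the power -r, for r > 0, with 0 sent to +oo and +oo to 0;
   x `^ (- r) would send 0 to 0 and +oo to +oo *)
Definition npowe (x : \bar R) (r : R) : \bar R := x^-1 `^ r.

Definition sphere_mean (g : 'M[R]_(n, m) -> \bar R) : \bar R :=
  npowe (hausdorff_int (n * m).-1 (@esphere R n m)
           (fun u => npowe (g u) (n * m)%:R))
        (n * m)%:R^-1.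

Definition directional_energy Q (f : 'cV[R]_n -> R^o) (u : 'M[R]_(n, m)) :=
  lebesgue_int setT (fun x => (support Q ((grad f x)^T *m u))%:E).

Definition affine_capacity Q K : \bar R :=
  ereal_inf [set sphere_mean (directional_energy Q f) | f in
    [set f : 'cV[R]_n -> R^o |
      [/\ smooth f, compactly_supported f & forall x, K x -> (1 <= f x)%R]]].

Definition support_projection_body Q K (x : 'M[R]_(n, m)) : \bar R :=
  hausdorff_int n.-1 (regular_frontier K)
    (fun z => (support Q ((outer_normal K z)^T *m x))%:E).

Definition integral_affine_surface_area Q K : \bar R :=
  sphere_mean (support_projection_body Q K).

End affine_capacity.

(* Main.v *)
(* Let kappa = 1/alpha, where alpha is the constant by which the normalised (n-1)-dimensional
   Hausdorff measure differs from Lebesgue measure on hyperplanes; its value is irrelevant.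
   Two facts suffice: C(K) <= kappa Phi(K) for every Lipschitz star body K, with equality for
   origin-symmetric ellipsoids, in particular for the ball.

   Let p be the gauge of K. Applying the area formula to the boundary of K, one sees that the
   projection body integral in direction -u is alpha times n J(u), with J(u) the integral over
   {p < 1} of h(- grad p) and h(v) = h_Q(v^T u). Piecewise linear functions of p that equal 1
   on K have energy close to n J(u); mollifying them does not increase the energy, by Jensen's
   inequality, so their mollifications are admissible and give the upper bound.

   For an ellipsoid K = phi B put A = phi phi^T and H(x) = h(- A^-1 x). As H is sublinear,
   h(v) >= - v . A grad H(x) for all v, with equality at v = - A^-1 x, the direction of - grad p.
   Thus the energy of f dominates - int grad f^+ . A grad H, which is nondecreasing in f^+
   because H is convex, and f^+ dominates a piecewise linear function of p for which all these
   inequalities are equalities. *)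

Require Import Defs.
From HB Require Import structures.
From mathcomp Require Import measurable_realfun ring lra.

Set Implicit Arguments.
Unset Strict Implicit.
Unset Printing Implicit Defensive.

Import Order.TTheory GRing.Theory Num.Theory.

Local Open Scope classical_set_scope.
Local Open Scope ring_scope.

(** * Lipschitz functions of one variable *)

Section lipschitz_line.
Context {R : realType}.
Notation mu := (@lebesgue_measure R).

(** The body is only Lipschitz, so its gauge is differentiable merely almost everywhere.
    Rademacher's theorem is derived from the one-variable case by integrating along lines and by
    testing additivity of directional derivatives against Lipschitz functions. The area formula uses
    volumes instead of Jacobians: the boundary is cut into pieces of nearly constant gradient; the
    shell swept by dilating a piece has a volume known exactly from the scaling of the cone below
    it, and it is bi-Lipschitz, with constants near 1, to a sheared cylinder over a projection of
    the piece. The mean over the sphere is taken of functions of [u] whose measurability is left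
    open; it enters only through monotonicity, scaling and invariance under [u -> - u]. So both
    energy bounds are proved for every [u], the upper one with a single test function for all [u].
    In the lower bound H is only Lipschitz and convex, so the integration by parts is carried out on
    difference quotients, where convexity is the sign of a second difference. *)

Lemma lebesgue_stieltjes_measure_oc (f : cumulative R R) (a b : R) : a <= b ->
  lebesgue_stieltjes_measure f `]a, b] = (f b - f a)%:E.
Proof.
move=> ab; rewrite /lebesgue_stieltjes_measure /measure_extension.
rewrite measurable_mu_extE/=; last exact: is_ocitv.
by rewrite wlength_itv_bnd.
Qed.

Section cumul.
Variables (f : R -> R) (c : R).
Hypothesis c0 : 0 < c.
Hypothesis fL : forall x y, `|f x - f y| <= c * `|x - y|.

(** For [f] Lipschitz with constant [c] this is nondecreasing, and its companion for [- f] completes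
    it to the identity. Hence its Stieltjes measure lies below Lebesgue measure, which replaces
    absolute continuity of [f]. *)
Definition half_cumul (x : R) : R := (x + f x / c) / 2.

Let nd : {homo half_cumul : x y / x <= y}.
Proof.
move=> x y xy; rewrite /half_cumul ler_pM2r; last by rewrite invr_gt0.
rewrite -subr_ge0.
have -> : y + f y / c - (x + f x / c) = (y - x) - (f x - f y) / c by field; rewrite gt_eqF.
rewrite subr_ge0 ler_pdivrMr// mulrC.
by rewrite (le_trans (ler_norm _))// (le_trans (fL _ _))// distrC ger0_norm// subr_ge0.
Qed.

Lemma lipschitz_half_cumul x y : `|half_cumul x - half_cumul y| <= `|x - y|.
Proof.
rewrite /half_cumul.
have -> : (x + f x / c) / 2 - (y + f y / c) / 2 = (x - y) / 2 + (f x - f y) / c / 2.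
  by field; rewrite gt_eqF.
rewrite (le_trans (ler_normD _ _))//.
rewrite !normrM (@gtr0_norm _ (2^-1)) ?invr_gt0// (@gtr0_norm _ (c^-1)) ?invr_gt0//.
have : `|f x - f y| / c <= `|x - y| by rewrite ler_pdivrMr// mulrC.
lra.
Qed.

Let rc : right_continuous half_cumul.
Proof.
move=> x; apply: cvg_at_right_filter.
apply/cvgrPdist_le => e e0; near=> y.
rewrite (le_trans (lipschitz_half_cumul _ _))//.
Unshelve. all: by end_near. Qed.

HB.instance Definition _ := isCumulative.Build R _ R half_cumul nd rc.
Definition half_cumulative : cumulative R R := half_cumul.
End cumul.

(** A Stieltjes measure is determined by its values on half-open intervals, and the two cumulative
    functions add up to the identity. The purpose is the domination of the first summand by [mu]. *)
Lemma half_cumul_add (f : R -> R) (c : R) (c0 : 0 < c)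
    (fL : forall x y, `|f x - f y| <= c * `|x - y|)
    (gL : forall x y, `|(- f x) - (- f y)| <= c * `|x - y|) A : measurable A ->
  mu A = (lebesgue_stieltjes_measure (half_cumulative c0 fL) A
  + lebesgue_stieltjes_measure (half_cumulative c0 gL) A)%E.
Proof.
rewrite -measure_addE.
apply: lebesgue_stieltjes_measure_unique => // X [[a b] _ <-] /=.
rewrite [RHS]measure_addE.
have [ab|ba] := leP a b.
  transitivity ((half_cumulative c0 fL b - half_cumulative c0 fL a)%:E + (half_cumulative c0 gL b - half_cumulative c0 gL a)%:E)%E; last first.
    by congr (_ + _)%E; rewrite -lebesgue_stieltjes_measure_oc.
  rewrite lebesgue_stieltjes_measure_oc// -EFinD; congr EFin.
  by rewrite /half_cumulative/= /half_cumul/=; field; rewrite gt_eqF.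
by rewrite set_itv_ge ?measure0 ?adde0// bnd_simp -leNgt ltW.
Qed.

(** Radon-Nikodym writes [half_cumul f] as an indefinite integral, which Lebesgue's theorem
    differentiates almost everywhere; [f] is an affine combination of [half_cumul f] and the
    identity. *)
Lemma lipschitz_derivable_ae (f : R -> R^o) (c : R) :
  (forall x y, `|f x - f y| <= c * `|x - y|) ->
  {ae mu, forall x, derivable f x 1}.
Proof.
move=> fL0.
(* [half_cumul] divides by the constant, and [c] may vanish. *)
pose c' := `|c| + 1.
have c0 : 0 < c' by rewrite ltr_pwDr.
have fL x y : `|f x - f y| <= c' * `|x - y|.
  rewrite (le_trans (fL0 _ _))// ler_wpM2r// (le_trans (ler_norm _))//.
  by rewrite lerDl.
have gL x y : `|(- f x) - (- f y)| <= c' * `|x - y|.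
  by rewrite opprK addrC distrC.
pose g : R -> R := half_cumul f c'.
pose nu := lebesgue_stieltjes_measure (half_cumulative c0 fL).
(* On a bounded interval the Stieltjes measure is finite, as Radon-Nikodym requires. *)
suff H (N : nat) : {ae mu, forall x, - N%:R < x < N%:R -> derivable f x 1}.
  have := ae_foralln H; apply: filterS => x Hx.
  have [N xN] : exists N : nat, `|x| < N%:R.
    by exists (Num.bound `|x|); exact: archi_boundP.
  by apply: (Hx N); rewrite -ltr_norml.
pose D := `](- N%:R : R), N%:R]%classic.
have mD : measurable (D : set (measurableTypeR R)) by exact: measurable_itv.
have DE : nu D = (g N%:R - g (- N%:R))%:E.
  by rewrite /nu lebesgue_stieltjes_measure_oc// (@le_trans _ _ 0)// oppr_le0.
have nuD : (nu D < +oo)%E by rewrite DE ltry.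
pose nuN : {finite_measure set (measurableTypeR R) -> \bar R} := mfrestr mD nuD.
have dom : charge_of_finite_measure nuN `<< mu.
  apply/null_content_dominatesP => A mA A0.
  apply/eqP; rewrite eq_le measure_ge0 andbT.
  rewrite -A0 [leRHS](half_cumul_add c0 fL gL)//=.
  rewrite (@le_trans _ _ (nu A))//.
    rewrite /charge_of_finite_measure /nuN/= /mfrestr /mrestr.
    by apply: le_measure; rewrite ?inE//; exact: measurableI.
  by rewrite leeDl.
have intk := Radon_Nikodym_integrable dom.
have kE A (mA : measurable A) := Radon_Nikodym_integral dom mA.
have kfin x := Radon_Nikodym_fin_num x dom.
set k := Radon_Nikodym _ _ in intk kE kfin.
have kfE : k = EFin \o (fine \o k).
  by apply/funext => x /=; rewrite fineK.
have intfk : mu.-integrable setT (EFin \o (fine \o k)) by rewrite -kfE.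
have lock : locally_integrable [set: R] (fine \o k).
  by apply: open_integrable_locally => //; exact: openT.
have intF (y : R) : mu.-integrable [set` Interval (BRight (- N%:R)) (BRight y)] (EFin \o (fine \o k)).
  exact: (integrableS measurableT).
have := FTC1 intF lock.
apply: filterS; first exact: (ae_filter_ringOfSetsType mu).
move=> x Hx /andP[Nx xN].
have Nx' : (BRight (- N%:R : R) < BRight x)%O by rewrite bnd_simp.
have [+ _] := Hx Nx'.
set F := (F in derivable F _ _) => dF.
have FE y : - N%:R < y < N%:R -> F y = g y - g (- N%:R).
  move=> /andP[Ny yN]; rewrite /F /Rintegral.
  under eq_integral do rewrite -[(fine \o k) _]/((fine (k _))) fineK//.
  rewrite -(kE _ (measurable_itv `]- N%:R, y])).
  rewrite /charge_of_finite_measure /nuN/= /mfrestr /mrestr.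
  rewrite (_ : _ `&` _ = `]- N%:R, y]%classic).
    by rewrite lebesgue_stieltjes_measure_oc// ltW.
  apply/setIidPl => z /=; rewrite /D /= !in_itv/= => /andP[-> zy]/=.
  by rewrite (le_trans zy)// ltW.
have fE : \forall y \near x, c' *: (2 *: (F y + g (- N%:R)) - y) = f y :> R^o.
  near=> y.
  have yN : - N%:R < y < N%:R.
    apply/andP; split; near: y; [exact: lt_nbhsr|exact: lt_nbhsl].
  rewrite FE// subrK /g /half_cumul /= /GRing.scale/=.
  by field; rewrite gt_eqF.
apply: (@near_eq_derivable _ R^o R^o _ _ x 1 fE).
apply: derivableZ; apply: derivableB; last exact: derivable_id.
by apply: derivableZ; apply: derivableD; [exact: dF|exact: derivable_cst].
Unshelve. all: by end_near. Qed.
End lipschitz_line.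

(** * Euclidean norm *)

Section euclid.
Context {R : realType}.

Section space.
Variables p q : nat.
Implicit Types x y z : 'M[R]_(p, q).

Lemma mxdotE x y : mxdot x y = \sum_i \sum_j x i j * y i j.
Proof.
rewrite /mxdot /mxtrace exchange_big/=; apply: eq_bigr => j _.
by rewrite mxE; apply: eq_bigr => i _; rewrite mxE.
Qed.

Lemma mxdotC x y : mxdot x y = mxdot y x.
Proof. by rewrite !mxdotE; do 2![apply: eq_bigr => ? _]; rewrite mulrC. Qed.

Lemma mxdotDr x y z : mxdot x (y + z) = mxdot x y + mxdot x z.
Proof. by rewrite /mxdot mulmxDr mxtraceD. Qed.

Lemma mxdotDl x y z : mxdot (x + y) z = mxdot x z + mxdot y z.
Proof. by rewrite mxdotC mxdotDr !(mxdotC z). Qed.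

Lemma mxdotZr (a : R) x y : mxdot x (a *: y) = a * mxdot x y.
Proof. by rewrite /mxdot -scalemxAr mxtraceZ. Qed.

Lemma mxdotZl (a : R) x y : mxdot (a *: x) y = a * mxdot x y.
Proof. by rewrite mxdotC mxdotZr mxdotC. Qed.

Lemma mxdotNr x y : mxdot x (- y) = - mxdot x y.
Proof. by rewrite -scaleN1r mxdotZr mulN1r. Qed.

Lemma mxdotNl x y : mxdot (- x) y = - mxdot x y.
Proof. by rewrite mxdotC mxdotNr mxdotC. Qed.

Lemma mxdotBr x y z : mxdot x (y - z) = mxdot x y - mxdot x z.
Proof. by rewrite mxdotDr mxdotNr. Qed.

Lemma mxdotBl x y z : mxdot (x - y) z = mxdot x z - mxdot y z.
Proof. by rewrite mxdotDl mxdotNl. Qed.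

Lemma mxdot0r x : mxdot x 0 = 0.
Proof. by rewrite /mxdot mulmx0 mxtrace0. Qed.

Lemma mxdot0l x : mxdot 0 x = 0.
Proof. by rewrite mxdotC mxdot0r. Qed.

Lemma mxdot_ge0 x : 0 <= mxdot x x.
Proof. by rewrite mxdotE; do 2![apply: sumr_ge0 => ? _]; rewrite -expr2 sqr_ge0. Qed.

Lemma enorm_ge0 x : 0 <= enorm x.
Proof. exact: sqrtr_ge0. Qed.

Lemma sqr_enorm x : enorm x ^+ 2 = mxdot x x.
Proof. by rewrite sqr_sqrtr ?mxdot_ge0. Qed.

Lemma coord_le_enorm x i j : `|x i j| <= enorm x.
Proof.
rewrite -(@ler_pXn2r _ 2) ?nnegrE ?enorm_ge0// sqr_enorm mxdotE.
rewrite (bigD1 i)//= (bigD1 j)//= real_normK ?num_real// expr2 -addrA lerDl.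
by rewrite addr_ge0//; do ?[apply: sumr_ge0 => ? _]; rewrite -expr2 sqr_ge0.
Qed.

Lemma enorm0 : enorm (0 : 'M[R]_(p, q)) = 0.
Proof. by rewrite /enorm mxdot0r sqrtr0. Qed.

Lemma enorm_eq0 x : (enorm x == 0) = (x == 0).
Proof.
apply/idP/eqP => [/eqP x0|->]; last by rewrite enorm0.
apply/matrixP => i j; rewrite mxE; apply/eqP; rewrite -normr_le0 -x0.
exact: coord_le_enorm.
Qed.

Lemma enorm_gt0 x : (0 < enorm x) = (x != 0).
Proof. by rewrite lt_def enorm_ge0 enorm_eq0 andbT. Qed.

Lemma enormZ (a : R) x : enorm (a *: x) = `|a| * enorm x.
Proof.
by rewrite /enorm mxdotZl mxdotZr mulrA -expr2 sqrtrM ?sqr_ge0// sqrtr_sqr.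
Qed.

Lemma enormN x : enorm (- x) = enorm x.
Proof. by rewrite -scaleN1r enormZ normrN1 mul1r. Qed.

Lemma enormBC x y : enorm (x - y) = enorm (y - x).
Proof. by rewrite -opprB enormN. Qed.

Lemma normr_mxdot x y : `|mxdot x y| <= enorm x * enorm y.
Proof.
have [->|x0] := eqVneq x 0; first by rewrite mxdot0l enorm0 normr0 mul0r.
rewrite -(@ler_pXn2r _ 2) ?nnegrE ?mulr_ge0 ?enorm_ge0// exprMn !sqr_enorm.
rewrite real_normK ?num_real//.
(* Cauchy-Schwarz: this vector is a multiple of the component of [y] orthogonal to [x]. *)
have := mxdot_ge0 (mxdot x x *: y - mxdot x y *: x).
rewrite !mxdotBl !mxdotBr !mxdotZl !mxdotZr (mxdotC y x).
have : 0 < mxdot x x by rewrite -sqr_enorm exprn_gt0// enorm_gt0.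
set a := mxdot x x; set b := mxdot y y; set c := mxdot x y => a0.
rewrite (_ : _ - _ = a * (a * b - c ^+ 2)); last by ring.
by rewrite pmulr_rge0// subr_ge0.
Qed.

Lemma mxdot_le x y : mxdot x y <= enorm x * enorm y.
Proof. exact: le_trans (ler_norm _) (normr_mxdot _ _). Qed.

Lemma enormD x y : enorm (x + y) <= enorm x + enorm y.
Proof.
rewrite -(@ler_pXn2r _ 2) ?nnegrE ?addr_ge0 ?enorm_ge0//.
rewrite sqrrD !sqr_enorm mxdotDl !mxdotDr (mxdotC y x).
have := mxdot_le x y; lra.
Qed.

Lemma enormB x y : enorm (x - y) <= enorm x + enorm y.
Proof. by rewrite -[enorm y]enormN enormD. Qed.

Lemma enorm_triangle y x z : enorm (x - z) <= enorm (x - y) + enorm (y - z).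
Proof. by rewrite -[x - z](subrKA y) enormD. Qed.

Lemma ler_enorm_dist x y : `|enorm x - enorm y| <= enorm (x - y).
Proof.
rewrite ler_norml; apply/andP; split.
  by rewrite lerNl opprB lerBlDr enormBC -{1}(subrK x y) enormD.
by rewrite lerBlDr -{1}(subrK y x) enormD.
Qed.

Lemma enorm_sum (I : Type) (r : seq I) (P : pred I) (F : I -> 'M[R]_(p, q)) :
  enorm (\sum_(i <- r | P i) F i) <= \sum_(i <- r | P i) enorm (F i).
Proof.
elim/big_ind2 : _ => [|x a y b xa yb|//]; first by rewrite enorm0.
by rewrite (le_trans (enormD _ _))// lerD.
Qed.

Lemma enorm_le_sum x : enorm x <= \sum_i \sum_j `|x i j|.
Proof.
rewrite {1}(matrix_sum_delta x) (le_trans (enorm_sum _ _ _))//.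
apply: ler_sum => i _; rewrite (le_trans (enorm_sum _ _ _))//.
apply: ler_sum => j _; rewrite enormZ ler_piMr//.
rewrite /enorm mxdotE (bigD1 i)//= (bigD1 j)//= !mxE !eqxx/= mulr1.
rewrite !big1 ?addr0 ?sqrtr1// => [i' /negPf i'i|j' /negPf j'j].
  by rewrite big1// => j' _; rewrite !mxE i'i mulr0.
by rewrite !mxE j'j andbF mulr0.
Qed.

Lemma coord_le_mxnorm x i j : `|x i j| <= `|x|.
Proof.
rewrite [leRHS]/Num.norm/= mx_normrE.
by rewrite (le_bigmax_cond _ (fun k : 'I_p * 'I_q => `|x k.1 k.2|) (j := (i, j))).
Qed.

Lemma mxnorm_le x (e : R) : 0 <= e -> (forall i j, `|x i j| <= e) -> `|x| <= e.
Proof.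
move=> e0 xe; rewrite [leLHS]/Num.norm/= mx_normrE.
by apply: bigmax_le => // -[].
Qed.

Lemma mxnorm_le_enorm x : `|x| <= enorm x.
Proof. by apply: mxnorm_le => [|i j]; [exact: enorm_ge0|exact: coord_le_enorm]. Qed.

Lemma enorm_le_mxnorm x : enorm x <= (p * q)%:R * `|x|.
Proof.
rewrite (le_trans (enorm_le_sum _))//.
rewrite (@le_trans _ _ (\sum_(i < p) \sum_(j < q) `|x|))//.
  by apply: ler_sum => i _; apply: ler_sum => j _; exact: coord_le_mxnorm.
by rewrite !sumr_const !card_ord -mulrnA mulr_natl mulnC.
Qed.

(** Bridge between the two norms: continuity refers to the topology of the sup norm, Lipschitz
    constants to [enorm]. *)
Lemma elipschitz_continuous (V : normedModType R) (f : 'M[R]_(p, q) -> V) (c : R) :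
  (forall x y, `|f x - f y| <= c * enorm (x - y)) -> continuous f.
Proof.
move=> fc x; apply/(@cvgrPdist_le _ _ _ (nbhs x)) => e e0.
pose d := `|c| * (p * q)%:R + 1.
have d0 : 0 < d by rewrite ltr_pwDr// mulr_ge0.
near=> y.
rewrite (le_trans (fc _ _))// (@le_trans _ _ (d * `|x - y|))//.
  rewrite (@le_trans _ _ (`|c| * enorm (x - y)))//.
    by rewrite ler_wpM2r ?enorm_ge0// ler_norm.
  rewrite mulrDl mul1r -mulrA (@le_trans _ _ (`|c| * ((p * q)%:R * `|x - y|)))//.
    by rewrite ler_wpM2l// enorm_le_mxnorm.
  by rewrite lerDl.
rewrite -ler_pdivlMl//; near: y.
by apply: (@cvgr_dist_le _ _ _ _ _ id) => //; rewrite mulr_gt0 ?invr_gt0.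
Unshelve. all: by end_near. Qed.

Lemma continuous_enorm : continuous (@enorm R p q : _ -> R^o).
Proof.
apply: (@elipschitz_continuous _ _ 1) => x y.
by rewrite mul1r; exact: ler_enorm_dist.
Qed.

Lemma continuous_mxdot x : continuous (mxdot x : _ -> R^o).
Proof.
apply: (@elipschitz_continuous _ _ (enorm x)) => y z.
by rewrite -mxdotBr normr_mxdot.
Qed.

Lemma nbhs_eball x (U : set 'M[R]_(p, q)) : nbhs x U <->
  exists2 e : R, 0 < e & forall y, enorm (x - y) < e -> U y.
Proof.
split.
  rewrite -nbhs_ballE => -[e /= e0 eU]; exists e => // y xy; apply: eU.
  by rewrite mx_norm_ball; rewrite /ball_/= (le_lt_trans (mxnorm_le_enorm _)).
move=> [e e0 eU].
have c : continuous (fun y => enorm (x - y) : R^o).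
  apply: (@elipschitz_continuous _ _ 1) => y z; rewrite mul1r.
  by rewrite (le_trans (ler_enorm_dist _ _))// opprB addrC subrKA enormBC.
have : (\forall y \near x, enorm (x - y) < e).
  by apply: (cvgr_lt _ (c x)); rewrite subrr enorm0.
by apply: filterS => y; exact: eU.
Qed.

End space.

Lemma enorm_mul p q r (A : 'M[R]_(p, q)) (B : 'M[R]_(q, r)) :
  enorm (A *m B) <= enorm A * enorm B.
Proof.
rewrite -(@ler_pXn2r _ 2) ?nnegrE ?mulr_ge0 ?enorm_ge0// exprMn !sqr_enorm.
have dotE i j : (A *m B) i j = mxdot (row i A)^T (col j B).
  rewrite mxE mxdotE; apply: eq_bigr => k _.
  by rewrite big_ord1 !mxE.
have normA : mxdot A A = \sum_i mxdot (row i A)^T (row i A)^T.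
  rewrite mxdotE; apply: eq_bigr => i _; rewrite mxdotE; apply: eq_bigr => k _.
  by rewrite big_ord1 !mxE.
have normB : mxdot B B = \sum_j mxdot (col j B) (col j B).
  rewrite mxdotE exchange_big; apply: eq_bigr => i _; rewrite mxdotE; apply: eq_bigr => k _.
  by rewrite big_ord1 !mxE.
rewrite mxdotE normA normB mulr_suml; apply: ler_sum => i _.
rewrite mulr_sumr; apply: ler_sum => j _.
rewrite dotE -expr2 -!sqr_enorm -exprMn -real_normK ?num_real//.
by rewrite ler_pXn2r ?nnegrE ?mulr_ge0 ?enorm_ge0// normr_mxdot.
Qed.

Lemma mxdot_mul p q r (A : 'M[R]_(p, q)) (B : 'M[R]_(q, r)) C :
  mxdot (A *m B) C = mxdot B (A^T *m C).
Proof. by rewrite /mxdot trmx_mul mulmxA. Qed.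

Lemma enorm_tr p q (A : 'M[R]_(p, q)) : enorm A^T = enorm A.
Proof. by rewrite /enorm /mxdot trmxK mxtrace_mulC. Qed.

End euclid.

(** * Lebesgue measure *)

Section method1_theory.
Local Open Scope ereal_scope.
Context {R : realType}.

Section one.
Context {T : pointedType} (tau : set T -> \bar R).
Hypotheses (tau0 : tau set0 = 0) (tau_ge0 : forall A, 0 <= tau A).

Lemma method1_le_cover A (F : (set T)^nat) : A `<=` \bigcup_k F k ->
  method1 tau A <= \sum_(k <oo) tau (F k).
Proof. by move=> AF; apply: ereal_inf_lbound; exists F. Qed.

Lemma method1_ge A x : (forall F : (set T)^nat, A `<=` \bigcup_k F k ->
  x <= \sum_(k <oo) tau (F k)) -> x <= method1 tau A.
Proof. by move=> H; apply: le_ereal_inf_tmp => _ [F AF <-]; exact: H. Qed.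

Lemma method1_cover A (e : R) : (0 < e)%R -> method1 tau A < +oo ->
  exists2 F : (set T)^nat, A `<=` \bigcup_k F k &
    \sum_(k <oo) tau (F k) <= method1 tau A + e%:E.
Proof.
move=> e0 Aoo.
have Afin : method1 tau A \is a fin_num by rewrite ge0_fin_numE// method1_ge0.
have [_ [F AF <-] Fe] := @lb_ereal_inf_adherent _ _ _ e0 Afin.
by exists F => //; exact: ltW.
Qed.

Lemma method1_le A : method1 tau A <= tau A.
Proof.
pose F k := if k is 0%N then A else set0.
rewrite (le_trans (@method1_le_cover A F _))//; first by move=> x Ax; exists 0%N.
rewrite nneseries_recl//= eseries0 ?adde0// => -[|i]//= _ _.
Qed.

End one.

(** Common source of the bounds for affine and for Lipschitz maps: a cover is transported piece by
    piece through [phi], at the cost of a factor [c] in the gauge. *)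
Lemma method1_map (T T' : pointedType) (tau : set T -> \bar R)
    (tau' : set T' -> \bar R) (A : set T) (A' : set T') (c : R)
    (phi : set T -> set T') : (0 < c)%R ->
  tau set0 = 0 -> (forall A, 0 <= tau A) ->
  (forall F, tau' (phi F) <= c%:E * tau F) ->
  (forall F : (set T)^nat, A `<=` \bigcup_k F k -> A' `<=` \bigcup_k phi (F k)) ->
  (forall F, 0 <= tau' F) ->
  method1 tau' A' <= c%:E * method1 tau A.
Proof.
move=> c0 tau0 tau_ge0 phic phiA tau'_ge0.
rewrite -lee_pdivrMl//; apply: method1_ge => F AF.
rewrite lee_pdivrMl// -nneseriesZl//.
rewrite (le_trans (method1_le_cover _ (phiA _ AF)))//.
exact: lee_nneseries.
Qed.

End method1_theory.

(** * Boxes and their affine images *)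

Section box.
Context {R : realType} (n : nat).
Implicit Types (a b x : 'cV[R]_n) (A F : set 'cV[R]_n).

(** A nonempty box determines its two corners, so the infimum in [box_gauge] runs over a single
    pair. *)
Lemma box_gauge_box a b : (forall i, a i 0 <= b i 0) ->
  box_gauge (box a b) = (\prod_(i < n) (b i 0 - a i 0))%:E.
Proof.
move=> ab; rewrite /box_gauge; case: ifPn => [/eqP|_].
  have : box a b a by move=> i; rewrite lexx ab.
  by move=> + box0; rewrite box0.
apply/eqP; rewrite eq_le; apply/andP; split.
  by apply: ereal_inf_lbound; exists (a, b).
apply: le_ereal_inf_tmp => _ [[a' b'] /= [ab' E] <-].
suff [-> ->] : a = a' /\ b = b' by [].
have aa (x y x' y' : 'cV[R]_n) : (forall i, x i 0 <= y i 0) -> (forall i, x' i 0 <= y' i 0) ->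
    box x y = box x' y' -> forall i, x' i 0 <= x i 0 /\ y i 0 <= y' i 0.
  move=> xy xy' H i.
  have : box x' y' x by rewrite -H => j; rewrite lexx xy.
  have : box x' y' y by rewrite -H => j; rewrite lexx xy.
  by move=> /(_ i)/andP[_ ->] /(_ i)/andP[->].
by split; apply/colP => i; apply/eqP; rewrite eq_le;
  case: (aa _ _ _ _ ab ab' E i) => p1 p2; case: (aa _ _ _ _ ab' ab (esym E) i) => p3 p4;
  apply/andP.
Qed.

Lemma box_gaugeP F : [\/ F = set0,
   exists a b, [/\ forall i, a i 0 <= b i 0, F = box a b &
     box_gauge F = (\prod_(i < n) (b i 0 - a i 0))%:E] | box_gauge F = +oo%E].
Proof.
have [->|F0] := eqVneq F set0; first by constructor 1.
have [[a [b [ab FE]]]|nF] := pselect (exists a b, (forall i, a i 0 <= b i 0) /\ F = box a b).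
  by constructor 2; exists a, b; split => //; rewrite FE box_gauge_box.
constructor 3; rewrite /box_gauge (negbTE F0).
rewrite (_ : [set _ | _ in _] = set0) ?ereal_inf0//.
apply/seteqP; split => // _ [[a b] /= [ab FE] _].
by apply: nF; exists a, b.
Qed.

Lemma lebesgue_cV_box_le a b : (forall i, a i 0 <= b i 0) ->
  (lebesgue_cV (box a b) <= (\prod_(i < n) (b i 0 - a i 0))%:E)%E.
Proof.
by move=> ab; rewrite -box_gauge_box//; apply: method1_le;
  [exact: box_gauge0|exact: box_gauge_ge0].
Qed.

Lemma lebesgue_cV_affine_le (t : R) (v : 'cV[R]_n) A : 0 < t ->
  (lebesgue_cV [set (t *: x + v)%R | x in A] <= (t ^+ n)%:E * lebesgue_cV A)%E.
Proof.
move=> t0; apply: (@method1_map _ _ _ _ _ _ _ _ (fun F => [set (t *: x + v)%R | x in F])).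
- exact: exprn_gt0.
- exact: box_gauge0.
- exact: box_gauge_ge0.
- move=> F; have [->|[a [b [ab -> _]]]|->] := box_gaugeP F.
  + by rewrite image_set0 box_gauge0 mule0.
  + rewrite (_ : [set _ | _ in _] = box (t *: a + v) (t *: b + v)).
      rewrite !box_gauge_box => [|//|i]; last by rewrite !mxE lerD2r ler_pM2l.
      rewrite -EFinM lee_fin -[X in _ <= t ^+ X * _](card_ord n).
      rewrite -prodr_const -big_split/=.
      under eq_bigr do rewrite !mxE opprD addrACA subrr addr0 -mulrBr.
      exact: lexx.
    apply/seteqP; split => [_ [x xab <-] i|x xab].
      by rewrite !mxE !lerD2r !ler_pM2l.
    exists (t^-1 *: (x - v)).
      move=> i; have := xab i; rewrite !mxE => /andP[h1 h2].
      by rewrite ler_pdivlMl// ler_pdivrMl// lerBrDr h1 lerBlDr h2.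
    by rewrite scalerA divff ?gt_eqF// scale1r subrK.
  + by rewrite gt0_muley ?leey// lte_fin exprn_gt0.
- move=> F AF _ [x Ax <-]; have [k _ Fkx] := AF _ Ax.
  by exists k => //; exists x.
- exact: box_gauge_ge0.
Qed.

Lemma lebesgue_cV_affine (t : R) (v : 'cV[R]_n) A : 0 < t ->
  lebesgue_cV [set (t *: x + v)%R | x in A] = ((t ^+ n)%:E * lebesgue_cV A)%E.
Proof.
move=> t0; apply/eqP; rewrite eq_le lebesgue_cV_affine_le//=.
have tn0 : 0 < t ^+ n by rewrite exprn_gt0.
rewrite -lee_pdivlMl//.
have t'0 : 0 < t^-1 by rewrite invr_gt0.
have := lebesgue_cV_affine_le (- (t^-1 *: v)) [set (t *: x + v)%R | x in A] t'0.
rewrite exprVn [X in (lebesgue_cV X <= _)%E -> _](_ : _ = A)//.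
apply/seteqP; split => [_ [_ [x Ax <-] <-]|x Ax].
  by rewrite /= scalerDr scalerA mulVf ?gt_eqF// scale1r addrK.
exists (t *: x + v); first by exists x.
by rewrite scalerDr scalerA mulVf ?gt_eqF// scale1r addrK.
Qed.

Lemma lebesgue_cV_translate (v : 'cV[R]_n) A :
  lebesgue_cV [set (x + v)%R | x in A] = lebesgue_cV A.
Proof.
have := lebesgue_cV_affine v A ltr01.
rewrite expr1n mul1e => <-; congr lebesgue_cV.
by apply: eq_imagel => x _; rewrite scale1r.
Qed.

Lemma lebesgue_cV_scale (t : R) A : 0 < t ->
  lebesgue_cV [set (t *: x)%R | x in A] = ((t ^+ n)%:E * lebesgue_cV A)%E.
Proof.
move=> t0; rewrite -(lebesgue_cV_affine 0)//; congr lebesgue_cV.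
by apply: eq_imagel => x _; rewrite addr0.
Qed.

End box.

(** * Borel sets *)

Notation borel_mx p q := (g_sigma_algebraType (@open 'M[_]_(p, q))).

Lemma nneseries_tail_le (R : realType) (f : (\bar R)^nat) (e : R) : 0 < e ->
  (\sum_(0 <= k <oo) f k < +oo)%E -> (forall k, 0 <= f k)%E ->
  \forall N \near \oo, (\sum_(N <= k <oo) f k <= e%:E)%E.
Proof.
move=> e0 foo f0.
have : (\sum_(N <= k <oo) f k)%E @[N --> \oo] --> 0%E by exact: nneseries_tail_cvg.
move=> /(_ [set x | (x < e%:E)%E]) /= H.
have : nbhs 0%E [set x | (x < e%:E)%E].
  by apply: open_ereal_lt'; rewrite lte_fin.
by move=> /H; apply: (@filterS _ \oo) => N /= /ltW.
Qed.

Lemma measurable_fun_gt d (T : measurableType d) (R : realType) (D : set T) (f : T -> R) :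
  (forall c, measurable (D `&` [set x | c < f x])) -> measurable_fun D f.
Proof.
move=> mf mD; apply: (measurability _ (RGenOInfty.measurableE R)) => // _ [_ [c ->] <-].
by rewrite preimage_itvoy.
Qed.

Lemma big_setU_nat T (F : nat -> set T) N x : (\big[setU/set0]_(0 <= k < N) F k) x ->
  exists2 k, (k < N)%N & F k x.
Proof. by rewrite big_mkord -(bigcup_mkord N F) => -[k]; exists k. Qed.

Section borel.
Context {R : realType} (p q : nat).

(** A countable basis of the topology; it reduces Borel measurability of matrix-valued maps to
    measurability of the entries. *)
Definition rational_cube (kr : 'M[rat]_(p, q) * rat) : set 'M[R]_(p, q) :=
  [set x | forall i j, `|x i j - ratr (kr.1 i j)| < ratr kr.2].

Lemma open_rational_cubes (U : set 'M[R]_(p, q)) : open U ->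
  U = \bigcup_kr (if `[< rational_cube kr `<=` U >] then rational_cube kr else set0).
Proof.
move=> oU; apply/seteqP; split => [x Ux|x [kr _]]; last by case: asboolP => // krU; exact: krU.
have [e e0 eU] : exists2 e : R, 0 < e & forall y, `|x - y| < e -> U y.
  have := open_nbhs_nbhs (conj oU Ux); rewrite -nbhs_ballE => -[e /= e0 eU].
  by exists e => // y xy; apply: eU; rewrite mx_norm_ball.
have [r re] : exists r : rat, 0 < (ratr r : R) < e / 2.
  have /rat_in_itvoo[r] : (0 : R) < e / 2 by rewrite divr_gt0.
  by rewrite in_itv/= => re; exists r.
have [r0 re2] := andP re.
have H i j : exists k : rat, `|x i j - ratr k| < ratr r.
  have /rat_in_itvoo[k] : x i j - ratr r < x i j + ratr r by rewrite ltrD2l; lra.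
  by rewrite in_itv/= => kx; exists k; rewrite distrC ltr_distl.
exists (\matrix_(i, j) projT1 (cid (H i j)), r) => //.
case: asboolP => [_|[]] /=.
  by move=> i j /=; rewrite mxE; case: cid.
move=> y Hy; apply: eU; apply: (@le_lt_trans _ _ (2 * ratr r)); last by lra.
apply: mxnorm_le => [|i j]; first by lra.
have := Hy i j; rewrite /= !mxE; case: cid => k /= xk yk.
rewrite (le_trans (ler_distD (ratr k) _ _))// (distrC _ (y i j)); lra.
Qed.

Lemma measurable_rational_cubes d (T : measurableType d) (f : T -> 'M[R]_(p, q)) D kr :
  measurable D -> (forall i j, measurable_fun D (fun x => f x i j)) ->
  measurable (D `&` f @^-1` rational_cube kr).
Proof.
move=> mD mf.
rewrite (_ : _ `&` _ = \bigcap_(ij : 'I_p * 'I_q) (D `&` (fun x => f x ij.1 ij.2) @^-1`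
   [set t | `|t - ratr (kr.1 ij.1 ij.2)| < ratr kr.2]) `&` D); last first.
  apply/seteqP; split => [x [Dx fx]|x [fx Dx]]; first by split => // -[i j] _; split => //; exact: fx.
  by split => // i j; have [] := fx (i, j) I.
apply: measurableI => //; apply: fin_bigcap_measurable => [|[i j] _]; first exact: finite_finset.
apply: mf => //.
rewrite (_ : [set t | _] = ball (ratr (kr.1 i j) : R) (ratr kr.2)); first exact: measurable_ball.
by apply/seteqP; split => t; rewrite /ball/= distrC.
Qed.

Lemma measurable_fun_mx d (T : measurableType d) (f : T -> 'M[R]_(p, q)) D :
  (forall i j, measurable_fun D (fun x => f x i j)) ->
  measurable_fun D (f : T -> borel_mx p q).
Proof.
move=> mf mD; move: (mD).
apply: (@measurability _ _ T (borel_mx p q) D f (@open 'M[R]_(p, q))) => // _ [U oU <-].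
rewrite (open_rational_cubes oU) preimage_bigcup setI_bigcupr.
apply: countable_bigcupT_measurable => [|kr]; first exact: countableP.
by case: asboolP => // _; [exact: measurable_rational_cubes|rewrite preimage_set0 setI0].
Qed.

Lemma measurable_coord i j : measurable_fun setT (fun x : borel_mx p q => x i j : R).
Proof.
apply: measurable_fun_gt => c; rewrite setTI; apply: sub_sigma_algebra.
apply: (@open_comp _ _ (fun x : 'M[R]_(p, q) => x i j) [set t | c < t]) => [x _|].
  exact: coord_continuous.
exact: open_gt.
Qed.

Lemma continuous_measurable_mx (f : 'M[R]_(p, q) -> R) : continuous f ->
  measurable_fun setT (f : borel_mx p q -> R).
Proof.
move=> cf; apply: measurable_fun_gt => c; rewrite setTI; apply: sub_sigma_algebra.
by apply: (@open_comp _ _ f [set t | c < t]) => [x _|]; [exact: cf|exact: open_gt].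
Qed.

(** The integrals of the definitions live on Carathéodory sigma-algebras, so Borel sets must be
    shown to belong to them. Coordinate half-spaces suffice, because they make the entries of the
    identity map measurable. *)
Lemma borel_sub_caratheodory (mu : {outer_measure set 'M[R]_(p, q) -> \bar R}) :
  (forall i j c, mu.-caratheodory [set x : 'M[R]_(p, q) | x i j <= c]) ->
  (@measurable _ (borel_mx p q) : set (set 'M[R]_(p, q))) `<=` mu.-cara.-measurable.
Proof.
move=> H A mA.
suff : measurable_fun setT (id : caratheodory_type mu -> borel_mx p q).
  by move=> /(_ measurableT A mA); rewrite setTI.
apply: (@measurable_fun_mx _ (caratheodory_type mu)) => i j.
apply: measurable_fun_gt => c.
rewrite setTI (_ : [set x | _] = ~` [set x : 'M[R]_(p, q) | x i j <= c]).
  by apply: measurableC; exact: H.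
by apply/seteqP; split => x /=; rewrite ltNge => /negP.
Qed.


(** Carathéodory's criterion for metric outer measures, specialised to half-spaces: the part of [X]
    close to the boundary of the half-space is exhausted by layers whose measures are summable,
    hence it is negligible in the limit. *)
Lemma separated_caratheodory (mu : {outer_measure set 'M[R]_(p, q) -> \bar R}) :
  (forall (A B : set 'M[R]_(p, q)) (d : R), 0 < d ->
    (forall x y, A x -> B y -> d <= enorm (x - y)) ->
    (mu A + mu B <= mu (A `|` B))%E) ->
  forall i j c, mu.-caratheodory [set x : 'M[R]_(p, q) | x i j <= c].
Proof.
move=> sep i j c; apply: le_caratheodory_measurable => X.
set C := [set x | _].
have [->|Xoo] := eqVneq (mu X) +oo%E; first by rewrite leey.
have {}Xoo : (mu X < +oo)%E by rewrite lt_neqAle Xoo leey.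
pose r (k : nat) : R := k.+1%:R^-1.
have rS k : r k.+1 < r k by rewrite /r ltf_pV2 ?posrE// ltr_nat.
have rle k l : (k <= l)%N -> r l <= r k by move=> kl; rewrite /r lef_pV2 ?posrE// ler_nat ltnS.
have r0 k : 0 < r k by rewrite invr_gt0.
pose S k := X `&` [set x : 'M[R]_(p, q) | c + r k < x i j].
(* Layers of [X] accumulating from outside at the boundary of [C]. *)
pose T k := X `&` [set x : 'M[R]_(p, q) | c + r k.+1 < x i j <= c + r k].
have SE k : (mu (X `&` C) + mu (S k) <= mu X)%E.
  rewrite (le_trans (sep _ _ (r k) _ _))//.
    move=> x y [_ /= xc] [_ /= yc]; rewrite enormBC (le_trans _ (coord_le_enorm _ i j))//.
    by move: xc; rewrite /C /= => xc; rewrite !mxE (le_trans _ (ler_norm _))//; lra.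
  by apply: le_outer_measure => x [[]|[]].
(* Layers of equal parity are at positive distance from each other, so the measure is superadditive
   on them and their sums stay below [mu X]. *)
have sumT b N : (b <= 1)%N ->
    (\sum_(0 <= k < N) mu (T (k.*2 + b)%N) <= mu (\big[setU/set0]_(0 <= k < N) T (k.*2 + b)%N))%E.
  move=> b1; elim: N => [|N IH]; first by rewrite !big_nil.
  rewrite !big_nat_recr//= (le_trans (leeD2r _ IH))//.
  have [->|N0] := posnP N; first by rewrite !big_geq// outer_measure0 set0U add0e.
  apply: (sep _ _ (r (N.*2.-1 + b)%N - r (N.*2 + b)%N)).
    by rewrite subr_gt0 -{1}(prednK (n := N.*2)) ?double_gt0// addSn rS.
  move=> x y xU [_ /= /andP[_ yN]]; have [k kN [_ /= /andP[xk _]]] := big_setU_nat xU.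
  rewrite (le_trans _ (coord_le_enorm _ i j))// !mxE (le_trans _ (ler_norm _))//.
  have : r (N.*2.-1 + b)%N <= r (k.*2 + b).+1.
    apply: rle; rewrite -addSn leq_add2r.
    by rewrite ltn_predRL -doubleS leq_double.
  lra.
have sumT2 b : (b <= 1)%N -> (\sum_(0 <= k <oo) mu (T (k.*2 + b)%N) <= mu X)%E.
  move=> b1; apply: lime_le; first exact: is_cvg_nneseries.
  apply: nearW => N; rewrite (le_trans (sumT b N b1))//; apply: le_outer_measure.
  by move=> x xU; have [k _ []] := big_setU_nat xU.
apply/lee_addgt0Pr => e e0.
have e20 : 0 < e / 2 by rewrite divr_gt0.
have tail b : (b <= 1)%N -> \forall K \near \oo, (\sum_(K <= k <oo) mu (T (k.*2 + b)%N) <= (e / 2)%:E)%E.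
  move=> b1; apply: nneseries_tail_le => //; exact: le_lt_trans (sumT2 b b1) Xoo.
have [K _ /(_ K (leqnn K))[t0 t1]] := filterI (tail 0%N (leq0n _)) (tail 1%N (leqnn _)).
(* A point outside [C] and outside [S K.*2] lies in layer [m], where [m.+1] is the least [l] with
   [c + r l < x i j]. Then [K.*2 <= m], and the layer belongs to one of the two small tails. *)
have XC : X `&` ~` C `<=` S K.*2 `|` (\bigcup_(k in ~` `I_K) T (k.*2 + 0)%N) `|`
    (\bigcup_(k in ~` `I_K) T (k.*2 + 1)%N).
  move=> x [Xx /= /negP]; rewrite -ltNge => cx.
  have [l lx] : exists l, c + r l < x i j.
    exists (Num.bound (x i j - c)^-1).
    rewrite -ltrBrDl /r invf_plt ?posrE ?ltr0n ?subr_gt0//.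
    rewrite (lt_le_trans (archi_boundP _)) ?ler_nat// invr_ge0 subr_ge0; exact: ltW.
  have [|xS] := boolP (c + r K.*2 < x i j); first by left; left.
  have ex : exists l, c + r l < x i j by exists l.
  have l0 : (0 < ex_minn ex)%N.
    case: ex_minnP => -[|//] m0 _; exfalso; move/negP: xS; apply.
    by rewrite (le_lt_trans _ m0)// lerD2l rle.
  case: ex_minnP l0 => -[//|m] lm mmin _.
  have mK : (K.*2 <= m)%N.
    rewrite leqNgt; apply/negP => mK; move/negP: xS; apply.
    by rewrite (le_lt_trans _ lm)// lerD2l rle.
  have xm : x i j <= c + r m.
    by rewrite leNgt; apply/negP => /mmin; rewrite ltnn.
  have xT : T m x by split => //=; rewrite lm.
  have mK2 : (~` `I_K) m./2.
    by apply/negP; rewrite -leqNgt -(doubleK K); exact: half_leq.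
  have mE := odd_double_half m; case: (odd m) mE => /= mE.
    by right; exists m./2 => //; rewrite addnC mE.
  by left; right; exists m./2 => //; rewrite addn0; rewrite add0n in mE; rewrite mE.
rewrite (@le_trans _ _ (mu (X `&` C) + (mu (S K.*2) + (e / 2)%:E + (e / 2)%:E))%E)//.
  apply: leeD2l; rewrite (le_trans (le_outer_measure mu _ _ XC))//.
  rewrite (le_trans (outer_measureU2 _ _ _))// leeD//.
    rewrite (le_trans (outer_measureU2 _ _ _))// leeD//.
    exact: le_trans (outer_measure_sigma_subadditive_tail mu K (fun k => T (k.*2 + 0)%N)) t0.
  exact: le_trans (outer_measure_sigma_subadditive_tail mu K (fun k => T (k.*2 + 1)%N)) t1.
by rewrite -addeA -EFinD -splitr addeA leeD2r.
Qed.


End borel.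

Section lebesgue_borel.
Context {R : realType} (n : nat).
Notation lam := (@lebesgue_cV R n).

(** A coordinate hyperplane cuts a box into two boxes whose volumes add up to that of the box;
    applied to each member of a cover. *)
Lemma lebesgue_cV_caratheodory (i : 'I_n) (j : 'I_1) c :
  lam.-caratheodory [set x : 'cV[R]_n | x i j <= c].
Proof.
rewrite (ord1 j); apply: le_caratheodory_measurable => X; set H := [set x | _].
apply: method1_ge => F XF.
have gle : (\sum_(k <oo) (lam (F k `&` H) + lam (F k `&` ~` H)) <= \sum_(k <oo) box_gauge (F k))%E.
  apply: lee_nneseries => [k _ _|k _]; first by rewrite adde_ge0// outer_measure_ge0.
  have [->|[a [b [ab FE ->]]]|->] := box_gaugeP (F k).
  - by rewrite !set0I outer_measure0 adde0 box_gauge_ge0.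
  - have [bc|cb] := leP (b i 0) c.
      rewrite (_ : _ `&` ~` H = set0) ?outer_measure0 ?adde0.
        apply: le_trans (lebesgue_cV_box_le ab); apply: le_outer_measure.
        by rewrite FE; exact: subIsetl.
      apply/seteqP; split => // x []; rewrite FE => /(_ i)/andP[_ xb] /=; apply.
      exact: le_trans xb bc.
    have [ac|ca] := leP (a i 0) c; last first.
      rewrite (_ : _ `&` H = set0) ?outer_measure0 ?add0e.
        apply: le_trans (lebesgue_cV_box_le ab); apply: le_outer_measure.
        by rewrite FE; exact: subIsetl.
      apply/seteqP; split => // x []; rewrite FE => /(_ i)/andP[ax _].
      by rewrite /H /= leNgt (lt_le_trans ca).
    pose b' := \col_l (if l == i then c else b l 0).
    pose a' := \col_l (if l == i then c else a l 0).
    have ab' l : a l 0 <= b' l 0 by rewrite mxE; case: eqP => // ->.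
    have a'b l : a' l 0 <= b l 0 by rewrite mxE; case: eqP => // ->; exact: ltW.
    rewrite (@le_trans _ _ (lam (box a b') + lam (box a' b))%E)//.
      apply: leeD; apply: le_outer_measure; rewrite FE => x [xab].
        move=> xc l; rewrite mxE; case: eqP => [->|_]; last exact: xab.
        by have /andP[-> _] := xab i.
      move=> /= /negP; rewrite -ltNge => cx l; rewrite mxE; case: eqP => [->|_]; last exact: xab.
      by rewrite (ltW cx); have /andP[_ ->] := xab i.
    rewrite (le_trans (leeD (lebesgue_cV_box_le ab') (lebesgue_cV_box_le a'b)))//.
    rewrite -EFinD lee_fin (bigD1 i)//= [X in _ + X](bigD1 i)//= [leRHS](bigD1 i)//=.
    rewrite !mxE eqxx.
    under eq_bigr => l /negPf ki do rewrite mxE ki.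
    under [X in _ + _ * X]eq_bigr => l /negPf ki do rewrite mxE ki.
    by rewrite -mulrDl addrC subrKA.
  - by rewrite leey.
rewrite (le_trans _ gle)// nneseriesD//; last 2 first.
- by move=> k _ _; exact: outer_measure_ge0.
- by move=> k _ _; exact: outer_measure_ge0.
apply: leeD; (apply: le_trans (outer_measure_sigma_subadditive lam _); apply: le_outer_measure).
  by move=> x [Xx Hx]; have [k _ Fk] := XF _ Xx; exists k.
by move=> x [Xx Hx]; have [k _ Fk] := XF _ Xx; exists k.
Qed.

Lemma borel_lebesgue_cV (A : set (borel_mx n 1)) : measurable A -> lam.-cara.-measurable A.
Proof. exact/borel_sub_caratheodory/lebesgue_cV_caratheodory. Qed.

End lebesgue_borel.

Section hausdorff_borel.
Context {R : realType} (p q s : nat).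
Notation H := (@hausdorff R p q s).
Notation H_ delta := (method1 (@hausdorff_gauge R p q s delta)).

Lemma hausdorff_ge delta A : 0 < delta -> (H_ delta A <= H A)%E.
Proof. by move=> d0; apply: ereal_sup_ubound; exists delta. Qed.

Lemma hausdorff_le A x : (forall delta, 0 < delta -> (H_ delta A <= x)%E) -> (H A <= x)%E.
Proof. by move=> Hx; apply: ge_ereal_sup => _ [d d0 <-]; exact: Hx. Qed.

Lemma hausdorff_gauge_mono d e (F : set 'M[R]_(p, q)) : d <= e ->
  (hausdorff_gauge s e F <= hausdorff_gauge s d F)%E.
Proof.
move=> de; rewrite /hausdorff_gauge; case: ifP => // _.
have [Fd|_] := leP (ediam F) d%:E; last by rewrite leey.
by rewrite (le_trans Fd)// lee_fin.
Qed.

Lemma method1_hausdorff_mono d e (A : set 'M[R]_(p, q)) : d <= e -> (H_ e A <= H_ d A)%E.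
Proof.
move=> de; apply: method1_ge => F AF.
apply: le_trans (method1_le_cover _ AF) _.
by apply: lee_nneseries => [k _ _|k _]; [exact: hausdorff_gauge_ge0|exact: hausdorff_gauge_mono].
Qed.

Lemma ediam_ge (A : set 'M[R]_(p, q)) x y : A x -> A y -> ((enorm (x - y))%:E <= ediam A)%E.
Proof. by move=> Ax Ay; apply: ereal_sup_ubound; exists (x, y). Qed.

(** A covering set of diameter at most [e < d] cannot meet both [A] and [B], so every cover splits
    into two. *)
Lemma method1_hausdorff_separated d e (A B : set 'M[R]_(p, q)) : 0 < d -> e < d ->
  (forall x y, A x -> B y -> d <= enorm (x - y)) ->
  (H_ e A + H_ e B <= H_ e (A `|` B))%E.
Proof.
move=> d0 ed AB; apply: method1_ge => F ABF.
pose FA (X : set 'M[R]_(p, q)) k := if `[< F k `&` X !=set0 >] then F k else set0.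
have FAE X : X `<=` A `|` B -> (H_ e X <= \sum_(k <oo) hausdorff_gauge s e (FA X k))%E.
  move=> XAB; apply: method1_le_cover => x Xx; have [k _ Fkx] := ABF _ (XAB _ Xx).
  by exists k => //; rewrite /FA; case: asboolP => // -[]; exists x.
rewrite (le_trans (leeD (FAE A _) (FAE B _)))//.
rewrite -nneseriesD; last 2 first.
- by move=> k _ _; exact: hausdorff_gauge_ge0.
- by move=> k _ _; exact: hausdorff_gauge_ge0.
apply: lee_nneseries => [k _ _|k _]; first by rewrite adde_ge0// hausdorff_gauge_ge0.
rewrite /FA; case: asboolP => [[x [Fx Ax]]|_]; case: asboolP => [[y [Fy By]]|_];
  rewrite ?hausdorff_gauge0 ?adde0 ?add0e ?hausdorff_gauge_ge0//.
rewrite {3}/hausdorff_gauge ifF; last by apply/eqP => F0; rewrite F0 in Fx.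
rewrite ifF ?leey//; apply/negbTE; rewrite -ltNge.
rewrite (lt_le_trans _ (ediam_ge Fx Fy))// lte_fin (lt_le_trans ed)//; exact: AB.
Qed.

Lemma hausdorff_separated (A B : set 'M[R]_(p, q)) (d : R) : 0 < d ->
  (forall x y, A x -> B y -> d <= enorm (x - y)) -> (H A + H B <= H (A `|` B))%E.
Proof.
move=> d0 AB.
have [->|ABoo] := eqVneq (H (A `|` B)) +oo%E; first by rewrite leey.
have fin X : X `<=` A `|` B -> H X \is a fin_num.
  move=> XAB; rewrite ge0_fin_numE ?outer_measure_ge0//.
  by rewrite (le_lt_trans (le_outer_measure H _ _ XAB))// lt_neqAle ABoo leey.
rewrite -leeBrDr ?fin//; apply: hausdorff_le => d1 d10.
rewrite leeBrDr ?fin// addeC -leeBrDr; last first.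
  rewrite ge0_fin_numE ?method1_ge0//; last exact: hausdorff_gauge_ge0.
  rewrite (le_lt_trans (hausdorff_ge A d10))// -ge0_fin_numE ?outer_measure_ge0// fin//.
apply: hausdorff_le => d2 d20.
(* The approximating measures increase as the mesh decreases, so the two meshes may be replaced by a
   common one below [d]. *)
pose e := Num.min d1 (Num.min d2 (d / 2)).
have e0 : 0 < e by rewrite !lt_min d10 d20 divr_gt0.
have ed : e < d by rewrite !gt_min; apply/orP; right; apply/orP; right; lra.
rewrite leeBrDr; last first.
  rewrite ge0_fin_numE ?method1_ge0//; last exact: hausdorff_gauge_ge0.
  rewrite (le_lt_trans (hausdorff_ge A d10))// -ge0_fin_numE ?outer_measure_ge0// fin//.
rewrite addeC (le_trans _ (hausdorff_ge _ e0))// (le_trans _ (method1_hausdorff_separated d0 ed AB))//.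
by apply: leeD; apply: method1_hausdorff_mono; rewrite !ge_min lexx ?orbT.
Qed.

Lemma borel_hausdorff (A : set (borel_mx p q)) : measurable A -> H.-cara.-measurable A.
Proof.
exact/borel_sub_caratheodory/separated_caratheodory/hausdorff_separated.
Qed.

End hausdorff_borel.

(** * Hausdorff measure and Lipschitz maps *)

Section hausdorff_lipschitz.
Context {R : realType}.
Implicit Types (p q s : nat) (L : R).

Lemma ediam_fin p q (F : set 'M[R]_(p, q)) (d : R) : F !=set0 -> (ediam F <= d%:E)%E ->
  exists2 e : R, ediam F = e%:E & 0 <= e.
Proof.
move=> [x Fx] Fd.
have F0 : (0 <= ediam F)%E by have := ediam_ge Fx Fx; rewrite subrr enorm0.
have Ff : ediam F \is a fin_num by rewrite ge0_fin_numE// (le_lt_trans Fd)// ltry.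
by exists (fine (ediam F)); rewrite ?fineK ?fine_ge0.
Qed.

Lemma ediam_le p q (F : set 'M[R]_(p, q)) (d : R) :
  (forall x y, F x -> F y -> enorm (x - y) <= d) -> (ediam F <= d%:E)%E.
Proof.
by move=> Fd; apply: ge_ereal_sup => _ [[x y] [/= Fx Fy] <-]; rewrite lee_fin; exact: Fd.
Qed.

Lemma lebesgue_eball_ge0 s : (0 <= lebesgue_cV (@eball R s))%E.
Proof. exact: outer_measure_ge0. Qed.

Lemma hausdorff_gauge_le p q s (F : set 'M[R]_(p, q)) (delta d : R) : 0 <= d -> d <= delta ->
  (forall x y, F x -> F y -> enorm (x - y) <= d) ->
  (hausdorff_gauge s delta F <= lebesgue_cV (@eball R s) * ((d / 2) ^+ s)%:E)%E.
Proof.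
move=> d0 dd Fd; rewrite /hausdorff_gauge; case: ifPn => [_|/set0P F0].
  by rewrite mule_ge0 ?lebesgue_eball_ge0// lee_fin exprn_ge0// divr_ge0.
have Fd' := ediam_le Fd.
rewrite ifT; last by rewrite (le_trans Fd')// lee_fin.
have [e eE e0] := ediam_fin F0 Fd'.
rewrite lee_wpmul2l ?lebesgue_eball_ge0// lee_fin lerXn2r ?nnegrE ?divr_ge0// eE//.
by rewrite ler_pM2r ?invr_gt0//=; rewrite eE lee_fin in Fd'.
Qed.

(** Both sets are images of one index set: a comparison of two parametrisations then covers inverses
    of injective maps without constructing them. A covering set of the first image is pulled back to
    the indices and pushed to the second. *)
Lemma lipschitz_hausdorff (I : Type) p q p' q' s (S : set I)
    (a : I -> 'M[R]_(p, q)) (b : I -> 'M[R]_(p', q')) L : 0 < L ->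
  (forall i j, S i -> S j -> enorm (b i - b j) <= L * enorm (a i - a j)) ->
  (hausdorff s (b @` S) <= (L ^+ s)%:E * hausdorff s (a @` S))%E.
Proof.
move=> L0 abL; apply: hausdorff_le => delta d0.
have dL0 : 0 < delta / L by rewrite divr_gt0.
apply: (@le_trans _ _ ((L ^+ s)%:E * method1 (hausdorff_gauge s (delta / L)) (a @` S))%E); last first.
  by rewrite lee_wpmul2l ?hausdorff_ge// lee_fin exprn_ge0// ltW.
apply: (@method1_map _ _ _ _ _ _ _ _ (fun F => b @` (S `&` a @^-1` F))).
- exact: exprn_gt0.
- exact: hausdorff_gauge0.
- exact: hausdorff_gauge_ge0.
- move=> F; have [->|/set0P F0] := eqVneq F set0.
    by rewrite preimage_set0 setI0 image_set0 !hausdorff_gauge0 mule0.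
  rewrite [in leRHS]/hausdorff_gauge ifF; last by apply/eqP => F0'; case: F0 => x; rewrite F0'.
  case: ifPn => Fd; last by rewrite gt0_muley ?leey// lte_fin exprn_gt0.
  have [e eE e0] := ediam_fin F0 Fd.
  rewrite eE lee_fin in Fd.
  rewrite (le_trans (@hausdorff_gauge_le _ _ s _ delta (L * e) _ _ _))//.
  + by rewrite mulr_ge0// ltW.
  + by rewrite mulrC -ler_pdivlMr.
  + move=> _ _ [i [Si /= Fi] <-] [j [Sj /= Fj] <-].
    rewrite (le_trans (abL _ _ Si Sj))// ler_pM2l// -lee_fin -eE.
    exact: ediam_ge.
  + by rewrite muleCA -EFinM -exprMn eE/= mulrA.
- move=> F SF _ [i Si <-]; have [|k _ Fk] := SF (a i); first by exists i.
  by exists k => //; exists i.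
- exact: hausdorff_gauge_ge0.
Qed.

Lemma isometry_hausdorff (I : Type) p q p' q' s (S : set I)
    (a : I -> 'M[R]_(p, q)) (b : I -> 'M[R]_(p', q')) :
  (forall i j, S i -> S j -> enorm (b i - b j) = enorm (a i - a j)) ->
  hausdorff s (b @` S) = hausdorff s (a @` S).
Proof.
move=> ab; apply/eqP; rewrite eq_le; apply/andP; split.
  have := @lipschitz_hausdorff _ _ _ _ _ s S a b 1 ltr01.
  by rewrite expr1n mul1e; apply => i j Si Sj; rewrite mul1r ab.
have := @lipschitz_hausdorff _ _ _ _ _ s S b a 1 ltr01.
by rewrite expr1n mul1e; apply => i j Si Sj; rewrite mul1r ab.
Qed.

Lemma hausdorff_scale p q s (t : R) (A : set 'M[R]_(p, q)) : 0 < t ->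
  hausdorff s [set t *: x | x in A] = ((t ^+ s)%:E * hausdorff s A)%E.
Proof.
move=> t0; have t'0 : 0 < t^-1 by rewrite invr_gt0.
apply/eqP; rewrite eq_le; apply/andP; split.
  have := @lipschitz_hausdorff _ _ _ _ _ s A id (fun x => t *: x) t t0.
  rewrite image_id; apply => i j _ _.
  by rewrite -scalerBr enormZ gtr0_norm.
rewrite -lee_pdivlMl ?exprn_gt0//.
have := @lipschitz_hausdorff _ _ _ _ _ s A (fun x => t *: x) id t^-1 t'0.
rewrite image_id exprVn; apply => i j _ _.
by rewrite -scalerBr enormZ gtr0_norm// mulrA mulVf ?mul1r// gt_eqF.
Qed.

Lemma hausdorff_translate p q s (v : 'M[R]_(p, q)) (A : set 'M[R]_(p, q)) :
  hausdorff s [set x + v | x in A] = hausdorff s A.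
Proof.
rewrite -[in RHS](image_id A); apply: isometry_hausdorff => i j _ _.
by rewrite opprD addrACA subrr addr0.
Qed.

(** Closures have the same diameter, so the sets of a nearly optimal cover may be taken closed; the
    intersection over finer and finer covers is Borel. It lets arbitrary sets be treated by
    additivity. *)
Lemma hausdorff_hull p q s (A : set 'M[R]_(p, q)) :
  exists B : set (borel_mx p q), [/\ measurable B, A `<=` B & hausdorff s B = hausdorff s A].
Proof.
have [Aoo|Aoo] := eqVneq (hausdorff s A) +oo%E.
  exists setT; split => //; apply/eqP; rewrite eq_le Aoo leey/= -Aoo.
  exact: le_outer_measure.
have Afin : (hausdorff s A < +oo)%E by rewrite lt_neqAle Aoo leey.
pose d (k : nat) : R := k.+1%:R^-1.
have d0 k : 0 < d k by rewrite invr_gt0.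
have H k : exists F : (set 'M[R]_(p, q))^nat, A `<=` \bigcup_j F j /\
    (\sum_(j <oo) hausdorff_gauge s (d k) (F j) <= hausdorff s A + (d k)%:E)%E.
  have Ak := hausdorff_ge s A (d0 k).
  have [F AF FA] := @method1_cover _ _ _ (hausdorff_gauge_ge0 s (d k)) A _ (d0 k) (le_lt_trans Ak Afin).
  by exists F; split => //; rewrite (le_trans FA)// leeD2r.
pose F k := projT1 (cid (H k)).
have FA k : A `<=` \bigcup_j F k j by rewrite /F; case: cid => ? [].
have Fs k : (\sum_(j <oo) hausdorff_gauge s (d k) (F k j) <= hausdorff s A + (d k)%:E)%E.
  by rewrite /F; case: cid => ? [].
exists (\bigcap_k \bigcup_j closure (F k j)); split.
- apply: bigcapT_measurable => k; apply: bigcupT_measurable => j.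
  rewrite -[closure _]setCK; apply: measurableC; apply: sub_sigma_algebra.
  by apply: closed_openC; exact: closed_closure.
- by move=> x Ax k _; have [j _ Fx] := FA k _ Ax; exists j => //; exact: subset_closure.
apply/eqP; rewrite eq_le; apply/andP; split; last first.
  apply: le_outer_measure => x Ax k _; have [j _ Fx] := FA k _ Ax.
  by exists j => //; exact: subset_closure.
apply/lee_addgt0Pr => e e0; apply: hausdorff_le => delta delta0.
have [k kd] : exists k, d k <= Num.min delta e.
  exists (Num.bound (Num.min delta e)^-1).
  have m0 : 0 < Num.min delta e by rewrite lt_min delta0.
  rewrite /d -[leRHS]invrK lef_pV2 ?posrE ?invr_gt0//.
  by rewrite ltW// (lt_le_trans (archi_boundP _)) ?ler_nat ?invr_ge0 ?ltW.
move: kd; rewrite le_min => /andP[kd ke].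
apply: le_trans (method1_hausdorff_mono _ _ kd) _.
apply: (@le_trans _ _ (hausdorff s A + (d k)%:E)%E); last by rewrite leeD2l// lee_fin.
apply: le_trans (Fs k).
apply: le_trans (method1_le_cover (F := fun j => closure (F k j)) _ _) _.
  by move=> x /(_ k I).
apply: lee_nneseries => [j _ _|j _]; first exact: hausdorff_gauge_ge0.
rewrite [in leRHS]/hausdorff_gauge; have [->|/set0P F0] := eqVneq (F k j) set0.
  by rewrite closure0 hausdorff_gauge0.
case: ifPn => [Fd|_]; last by rewrite leey.
have [c cE c0] := ediam_fin F0 Fd.
rewrite cE lee_fin in Fd; rewrite cE/=.
apply: hausdorff_gauge_le => // x y Fx Fy.
rewrite leNgt; apply/negP => cxy.
pose r := (enorm (x - y) - c) / 2.
have r0 : 0 < r by rewrite divr_gt0// subr_gt0.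
have Fnear z : closure (F k j) z -> exists2 z', F k j z' & enorm (z - z') < r.
  move=> /(_ [set z' | enorm (z - z') < r])[|z' [Fz' /= zz']]; last by exists z'.
  by apply/nbhs_eball; exists r.
have [x' Fx' xx'] := Fnear _ Fx; have [y' Fy' yy'] := Fnear _ Fy.
have : enorm (x' - y') <= c by rewrite -lee_fin -cE; exact: ediam_ge.
have := enorm_triangle x' x y; have := enorm_triangle y' x' y.
rewrite (enormBC y' y) /r in xx' yy' *; lra.
Qed.

End hausdorff_lipschitz.

(** * Volumes of sheared cylinders and of boxes *)

Section cylinder.
Context {R : realType} (s : nat).

(** Linear model of a thin shell over a piece of the boundary: [B] is the projection of the piece to
    the tangent hyperplane, and the direction of the sweep has normal component [c] and tangential
    component [v]. *)
Definition sheared_cylinder (c d : R) (v : 'cV[R]_s) (B : set 'cV[R]_s) : set 'cV[R]_(1 + s) :=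
  [set x | exists t b, [/\ 0 <= t < d, B b & x = col_mx (c * t)%:M (b + t *: v)]].

(** Slicing of one member of a cover. The slices are bounded by a measurable function [g], since
    their own measures need not depend measurably on the height when the set is not a box. *)
Lemma cut_box_integral (F : set 'cV[R]_(1 + s)) : exists g : R -> \bar R,
  [/\ measurable_fun setT g, (forall t, 0 <= g t)%E,
    (forall t, lebesgue_cV [set y : 'cV[R]_s | F (col_mx t%:M y)] <= g t)%E &
    (\int[lebesgue_measure]_t g t <= box_gauge F)%E].
Proof.
have [->|[a [b [ab FE ->]]]|->] := box_gaugeP F.
- exists (cst 0%E); split => //; last by rewrite integral0 box_gauge_ge0.
  by move=> t; rewrite (_ : [set _ | _] = set0) ?outer_measure0//; apply/seteqP.
- pose V := (\prod_(i < s) (b (rshift 1 i) 0 - a (rshift 1 i) 0)).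
  have V0 : 0 <= V by apply: prodr_ge0 => i _; rewrite subr_ge0.
  pose i0 : 'I_(1 + s) := lshift s ord0.
  exists (fun t => (V * \1_`[a i0 0, b i0 0] t)%:E); split.
  + by apply/measurable_EFinP; apply: measurable_funM => //; exact: measurable_indic.
  + by move=> t; rewrite lee_fin mulr_ge0.
  + move=> t; have [tab|tab] := boolP (t \in `[a i0 0, b i0 0]).
      rewrite indicE mem_set// mulr1.
      have le i : (dsubmx a : 'cV_s) i 0 <= (dsubmx b : 'cV_s) i 0 by rewrite !mxE.
      apply: (@le_trans _ _ (lebesgue_cV (box (dsubmx a) (dsubmx b)))).
        apply: le_outer_measure => y /=; rewrite FE => yab i.
        by have := yab (rshift 1 i); rewrite col_mxEd !mxE.
      rewrite (le_trans (lebesgue_cV_box_le le))// lee_fin /V.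
      by under eq_bigr do rewrite !mxE.
    rewrite (_ : [set _ | _] = set0) ?outer_measure0 ?lee_fin ?mulr_ge0//.
    apply/seteqP; split => // y /=; rewrite FE => /(_ i0).
    by rewrite col_mxEu mxE eqxx mulr1n => tab'; move: tab; rewrite in_itv/= tab'.
  + under eq_integral do rewrite EFinM.
    rewrite ge0_integralZl//; last by apply/measurable_EFinP; exact: measurable_indic.
    rewrite integral_indic//= setIT /= lebesgue_measure_itv/= lte_fin.
    rewrite big_split_ord/= big_ord1 EFinM muleC.
    case: ifPn => [_|]; first by rewrite EFinB.
    by rewrite -leNgt => ba; rewrite mul0e lee_fin mulr_ge0// subr_ge0.
- by exists (cst +oo%E); split => [|t|t|]; [exact: measurable_cst|exact: leey|exact: leey|exact: leey].
Qed.

(** Every slice at a height in [[0, c * d[] is a translate of [B] and is covered by the slices of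
    the covering sets; integration over the height bounds the sum of the gauges. *)
Lemma sheared_cylinder_ge c d v B : 0 < c -> 0 <= d ->
  ((c * d)%:E * lebesgue_cV B <= lebesgue_cV (sheared_cylinder c d v B))%E.
Proof.
move=> c0 d0; apply: method1_ge => F BF.
have /choice[g gP] := fun k => cut_box_integral (F k).
have mg k : measurable_fun setT (g k) by case: (gP k).
have g0 k t : (0 <= g k t)%E by case: (gP k).
rewrite (@le_trans _ _ (\sum_(k <oo) \int[lebesgue_measure]_t g k t)%E)//; last first.
  by apply: lee_nneseries => [k _ _|k _]; [exact: integral_ge0|case: (gP k)].
rewrite -integral_nneseries//.
have mS : measurable_fun setT (fun t => \sum_(k <oo) g k t)%E by exact: ge0_emeasurable_sum.
have S0 t : (0 <= \sum_(k <oo) g k t)%E by exact: nneseries_ge0.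
pose J := `[0, c * d[%classic : set R.
have mJ : measurable J by exact: measurable_itv.
apply: (@le_trans _ _ (\int[lebesgue_measure]_(t in J) \sum_(k <oo) g k t)%E); last first.
  exact: (@ge0_subset_integral _ _ R (@lebesgue_measure R) _ _ mJ measurableT _ mS (fun t _ => S0 t) (@subsetT _ _)).
have -> : ((c * d)%:E * lebesgue_cV B = \int[lebesgue_measure]_(t in J) (cst (lebesgue_cV B) t))%E.
  rewrite integral_cst//= /J lebesgue_measure_itv/= lte_fin muleC.
  case: ifPn => [_|]; first by rewrite sube0.
  by rewrite -leNgt => cd; rewrite (_ : c * d = 0)//; apply/eqP; rewrite eq_le cd mulr_ge0// ltW.
apply: ge0_le_integral => //.
- by move=> t _; exact: outer_measure_ge0.
- exact: measurable_funTS.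
move=> t; rewrite /J /= in_itv/= => /andP[t0 tcd].
apply: (@le_trans _ _ (lebesgue_cV [set b + (t / c) *: v | b in B])).
  by rewrite lebesgue_cV_translate.
apply: (@le_trans _ _ (\sum_(k <oo) lebesgue_cV [set y : 'cV[R]_s | F k (col_mx t%:M y)])%E); last first.
  by apply: lee_nneseries => [k _ _|k _]; [exact: outer_measure_ge0|case: (gP k)].
apply: le_trans (outer_measure_sigma_subadditive _ _); apply: le_outer_measure.
move=> _ [b Bb <-].
have [|k _ Fk] := BF (col_mx t%:M (b + (t / c) *: v)); last by exists k.
exists (t / c), b; split => //; first by rewrite divr_ge0 ?(ltW c0)//= ltr_pdivrMr// mulrC.
by rewrite (mulrC c) divfK// gt_eqF.
Qed.

End cylinder.

Section box_volume.
Context {R : realType}.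

(** The lower bound is an induction on the dimension: a translate of the unsheared cylinder over the
    lower-dimensional box fits into the box. *)
Lemma lebesgue_cV_box n (a b : 'cV[R]_n) : (forall i, a i 0 <= b i 0) ->
  lebesgue_cV (box a b) = (\prod_(i < n) (b i 0 - a i 0))%:E.
Proof.
move=> ab; apply/eqP; rewrite eq_le lebesgue_cV_box_le//=.
elim: n => [|s IH] in a b ab *.
  rewrite big_ord0; apply: method1_ge => F /(_ a)[|k _ Fa]; first by case.
  rewrite (@le_trans _ _ (box_gauge (F k)))//; last first.
    rewrite (nneseriesD1 (n := k))// => [|i _]; last exact: box_gauge_ge0.
    by rewrite leeDl// nneseries_ge0// => i _ _; exact: box_gauge_ge0.
  have [Fk0|[a' [b' [ab' FE ->]]]|->] := box_gaugeP (F k); first by rewrite Fk0 in Fa.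
    by rewrite big_ord0.
  by rewrite leey.
pose i0 : 'I_(1 + s) := lshift s ord0.
pose a' : 'cV[R]_s := dsubmx (a : 'cV_(1 + s)); pose b' : 'cV[R]_s := dsubmx (b : 'cV_(1 + s)).
have ab' i : a' i 0 <= b' i 0 by rewrite !mxE.
have := @sheared_cylinder_ge R s 1 (b i0 0 - a i0 0) 0 (box a' b') ltr01.
rewrite subr_ge0 mul1r => /(_ (ab _)) H.
rewrite (@le_trans _ _ ((b i0 0 - a i0 0)%:E * lebesgue_cV (box a' b'))%E)//.
  rewrite (@big_split_ord _ _ _ 1 s)/= big_ord1 EFinM lee_wpmul2l ?lee_fin ?subr_ge0//.
  rewrite (le_trans _ (IH _ _ ab'))// lee_fin.
  by under [leRHS]eq_bigr do rewrite !mxE.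
rewrite (le_trans H)// -(lebesgue_cV_translate (col_mx (a i0 0)%:M 0 : 'cV_(1 + s))).
apply: le_outer_measure => _ [_ [t [y [/andP[t0 tab] yab ->]]] <-] i.
have [j ->|j ->] := @split_ordP 1 s i.
  rewrite mxE !col_mxEu (ord1 j) !mxE eqxx !mulr1n mul1r lerDr t0/= -lerBrDr ltW//.
rewrite mxE !col_mxEd !mxE mulr0 !addr0.
by have := yab j; rewrite !mxE.
Qed.

Lemma lebesgue_eball_fin s : (lebesgue_cV (@eball R s) < +oo)%E.
Proof.
have ab (i : 'I_s) : (const_mx (-1) : 'cV[R]_s) i 0 <= (const_mx 1 : 'cV[R]_s) i 0.
  by rewrite !mxE; lra.
rewrite (@le_lt_trans _ _ (lebesgue_cV (box (const_mx (-1)) (const_mx 1 : 'cV[R]_s))))//.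
  apply: le_outer_measure => x /= x1 i; rewrite !mxE -ler_norml.
  exact: le_trans (coord_le_enorm _ _ _) x1.
by rewrite lebesgue_cV_box// ltry.
Qed.

Lemma lebesgue_eball_gt0 s : (0 < lebesgue_cV (@eball R s))%E.
Proof.
pose k : R := s.+1%:R^-1; have k0 : 0 < k by rewrite invr_gt0.
have ab (i : 'I_s) : (const_mx (- k) : 'cV[R]_s) i 0 <= (const_mx k : 'cV[R]_s) i 0.
  by rewrite !mxE; lra.
rewrite (@lt_le_trans _ _ (lebesgue_cV (box (const_mx (- k)) (const_mx k : 'cV[R]_s))))//.
  by rewrite lebesgue_cV_box// lte_fin prodr_gt0// => i _; rewrite !mxE; lra.
apply: le_outer_measure => x xab; rewrite /eball /=.
rewrite (le_trans (enorm_le_mxnorm _))// muln1.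
apply: (@le_trans _ _ (s%:R * k)).
  rewrite ler_wpM2l//; apply: mxnorm_le; first exact: ltW.
  by move=> i j; rewrite (ord1 j) ler_norml; have := xab i; rewrite !mxE.
by rewrite /k ler_pdivrMr// mul1r ler_nat.
Qed.

End box_volume.

(** * Area of graphs *)

Lemma cvg_prod (R : realType) (I : Type) (r : seq I) (T : Type) (F : set_system T)
    {FF : Filter F} (f : I -> T -> R) (a : I -> R) :
  (forall i, f i x @[x --> F] --> a i) ->
  \prod_(i <- r) f i x @[x --> F] --> \prod_(i <- r) a i.
Proof.
move=> fa; elim: r => [|i r IH].
  by rewrite big_nil; under eq_fun do rewrite big_nil; exact: cvg_cst.
by rewrite big_cons; under eq_fun do rewrite big_cons; exact: cvgM.
Qed.

Lemma lee_cvg_EFin (R : realType) (x : \bar R) (u : nat -> R) (l : R) :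
  (forall N, (x <= (u N)%:E)%E) -> u @ \oo --> l -> (x <= l%:E)%E.
Proof.
move=> xu ul; apply/lee_addgt0Pr => e e0.
have /cvgrPdist_le/(_ e e0)[N _ /(_ N (leqnn N)) uN] := ul.
rewrite (le_trans (xu N))// -EFinD lee_fin.
have := ler_norm (u N - l); rewrite distrC => H; lra.
Qed.

(** Subdivision into [N.+1] parts or with mesh [1 / N.+1] costs an error of that order in each side
    length; this lets [N] tend to infinity. *)
Lemma lee_prod_perturb (R : realType) (s : nat) (x : \bar R) (c : R) (l w : 'I_s -> R) :
  (forall N : nat, (x <= (c * \prod_(i < s) (l i + N.+1%:R^-1 * w i))%:E)%E) ->
  (x <= (c * \prod_(i < s) l i)%:E)%E.
Proof.
move=> H; apply: (lee_cvg_EFin H); apply: cvgMr; apply: cvg_prod => i.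
rewrite -[X in _ --> X]addr0 -[X in _ --> _ + X](mul0r (w i)).
apply: cvgD; first exact: cvg_cst.
by apply: cvgMl; exact: cvg_harmonic.
Qed.

Section cylinder_le.
Context {R : realType} (s : nat).

(** The cylinder is cut into [N.+1] layers of thickness [d * e]. Within a layer the shear moves the
    base by at most [d * e] times the absolute values of the entries of [v], so each layer lies in a
    slightly enlarged box. *)
Lemma sheared_cylinder_box c d (v g h : 'cV[R]_s) : 0 < c -> 0 <= d ->
  (forall i, g i 0 <= h i 0) ->
  (lebesgue_cV (sheared_cylinder c d v (box g h)) <= (c * d * \prod_(i < s) (h i 0 - g i 0))%:E)%E.
Proof.
move=> c0 d0 gh.
apply: (@lee_prod_perturb _ _ _ _ _ (fun i => 2 * d * `|v i 0|)) => N.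
set e := N.+1%:R^-1 : R; have e0 : 0 < e by rewrite invr_gt0.
have Ne : N.+1%:R * e = 1 by rewrite /e divff.
pose lo (j : nat) : 'cV[R]_(1 + s) := col_mx (c * (j%:R * d * e))%:M
  (g + (j%:R * d * e) *: v - (d * e) *: map_mx Num.norm v).
pose hi (j : nat) : 'cV[R]_(1 + s) := col_mx (c * (j.+1%:R * d * e))%:M
  (h + (j%:R * d * e) *: v + (d * e) *: map_mx Num.norm v).
have lohi j i : lo j i 0 <= hi j i 0.
  have [k ->|k ->] := @split_ordP 1 s i.
    rewrite !col_mxEu (ord1 k) !mxE eqxx !mulr1n ler_pM2l// -!mulrA ler_wpM2r ?ler_nat//.
    by rewrite mulr_ge0// ltW.
  rewrite !col_mxEd !mxE; have := gh k.
  have : 0 <= d * e * `|v k 0| by rewrite !mulr_ge0// ltW.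
  lra.
apply: (@le_trans _ _ (lebesgue_cV (\big[setU/set0]_(j < N.+1) box (lo j) (hi j)))).
  apply: le_outer_measure => _ [t [b [/andP[t0 td] bgh ->]]].
  have dp : 0 < d by exact: le_lt_trans td.
  have de0 : 0 < d * e by rewrite mulr_gt0.
  have := truncn_itv (divr_ge0 t0 (ltW de0)); set k := Num.truncn _ => /andP[kt tk].
  have kN : (k < N.+1)%N.
    by rewrite -(ltr_nat R) (le_lt_trans kt)// ltr_pdivrMr// mulrCA Ne mulr1.
  rewrite -(bigcup_mkord N.+1 (fun j => box (lo j) (hi j))); exists k => //.
  rewrite ler_pdivlMr// in kt; rewrite ltr_pdivrMr// in tk.
  move=> i; have [l ->|l ->] := @split_ordP 1 s i.
    by rewrite !col_mxEu (ord1 l) !mxE eqxx !mulr1n !ler_pM2l// -!mulrA kt ltW.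
  rewrite !col_mxEd !mxE.
  have /andP[gb bh] := bgh l.
  have tv : `|(t - k%:R * d * e) * v l 0| <= d * e * `|v l 0|.
    rewrite normrM ler_wpM2r// ger0_norm; last by rewrite -mulrA; lra.
    by move: tk; rewrite -natr1 mulrDl mul1r -mulrA; lra.
  by move: tv; rewrite ler_norml => /andP[tv1 tv2]; apply/andP; split; lra.
have H := outer_measure_subadditive (@lebesgue_cV R (1 + s)) (fun j => box (lo j) (hi j)) N.+1.
rewrite (le_trans H)//.
rewrite (@le_trans _ _ (\sum_(j < N.+1) (c * d * e * \prod_(i < s) (h i 0 - g i 0 + e * (2 * d * `|v i 0|)))%:E)%E)//.
  apply: lee_sum => j _; rewrite (le_trans (lebesgue_cV_box_le (lohi j)))// lee_fin.
  rewrite (@big_split_ord _ _ _ 1 s)/= big_ord1 !col_mxEu !mxE eqxx !mulr1n.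
  rewrite -natr1 (_ : c * _ - _ = c * d * e); last by ring.
  rewrite ler_wpM2l ?mulr_ge0 ?(ltW c0) ?(ltW e0)// le_eqVlt; apply/orP; left; apply/eqP.
  by apply: eq_bigr => i _; rewrite !col_mxEd !mxE; ring.
rewrite sumEFin sumr_const card_ord lee_fin -[leLHS]mulr_natl.
have cancel (x y z u w : R) : x * u = 1 -> x * (y * z * u * w) = y * z * w.
  by move=> xu; rewrite (_ : _ * (_ * _) = y * z * (x * u) * w); [rewrite xu mulr1|ring].
by rewrite (cancel _ _ _ _ _ Ne).
Qed.

Lemma sheared_cylinder_le c d (v : 'cV[R]_s) B : 0 < c -> 0 < d ->
  (lebesgue_cV (sheared_cylinder c d v B) <= (c * d)%:E * lebesgue_cV B)%E.
Proof.
move=> c0 d0; have cd0 : 0 < c * d by rewrite mulr_gt0.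
rewrite -lee_pdivrMl//; apply: method1_ge => F BF; rewrite lee_pdivrMl//.
apply: (@le_trans _ _ (lebesgue_cV (\bigcup_k sheared_cylinder c d v (F k)))).
  apply: le_outer_measure => _ [t [b [td Bb ->]]]; have [k _ Fk] := BF _ Bb.
  by exists k => //; exists t, b.
apply: le_trans (outer_measure_sigma_subadditive _ _) _.
rewrite -nneseriesZl//; last by move=> k _; exact: box_gauge_ge0.
apply: lee_nneseries => [k _ _|k _]; first exact: outer_measure_ge0.
have [->|[g [h [gh -> ->]]]|->] := box_gaugeP (F k).
- rewrite (_ : sheared_cylinder _ _ _ _ = set0) ?outer_measure0 ?mule_ge0 ?lee_fin ?(ltW cd0)//.
    exact: box_gauge_ge0.
  by apply/seteqP; split => // x [t [b []]].
- by rewrite -EFinM sheared_cylinder_box// ltW.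
- by rewrite gt0_muley ?lte_fin// leey.
Qed.

Lemma lebesgue_sheared_cylinder c d (v : 'cV[R]_s) B : 0 < c -> 0 < d ->
  lebesgue_cV (sheared_cylinder c d v B) = ((c * d)%:E * lebesgue_cV B)%E.
Proof.
move=> c0 d0; apply/eqP; rewrite eq_le sheared_cylinder_le//=.
by apply: sheared_cylinder_ge => //; exact: ltW.
Qed.

End cylinder_le.

(** Covering by a grid of cubes of side [r]. It is stated for a set function [mu] in order to serve
    both the Hausdorff measure and its approximations with a fixed mesh. *)
Lemma grid_le (R : realType) (s : nat) (mu : set 'cV[R]_s -> \bar R) (a b : 'cV[R]_s) (r : R) v :
  mu set0 = 0%E -> {homo mu : A B / A `<=` B >-> (A <= B)%E} ->
  (forall A B, mu (A `|` B) <= mu A + mu B)%E ->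
  0 < r -> (0 <= v)%E ->
  (forall x, mu (box x (x + const_mx r)) <= v)%E ->
  (forall i, a i 0 <= b i 0) ->
  (mu (box a b) <= (\prod_(i < s) ((b i 0 - a i 0) / r + 1))%:E * v)%E.
Proof.
move=> mu0 mumono muU r0 v0 muv ab.
have b0 i : 0 <= (b i 0 - a i 0) / r by rewrite divr_ge0 ?(ltW r0)// subr_ge0.
pose m (i : 'I_s) := (Num.truncn ((b i 0 - a i 0) / r)).+1.
pose M := (\max_(i < s) m i)%N.
have mM i : (m i <= M)%N by exact: leq_bigmax.
(* All coordinates count in a common ['I_M], and cells outside the grid are replaced by the empty
   set; the number of cubes then factors by [bigA_distr_bigA]. *)
pose C (f : {ffun 'I_s -> 'I_M}) := if [forall i, f i < m i]%N then
  box (a + \col_i (r * (f i)%:R)) (a + \col_i (r * (f i)%:R) + const_mx r) else set0.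
apply: (@le_trans _ _ (mu (\big[setU/set0]_(f : {ffun 'I_s -> 'I_M}) C f))).
  apply: mumono => x xab.
  have x0 i : 0 <= (x i 0 - a i 0) / r.
    by rewrite divr_ge0 ?(ltW r0)// subr_ge0; have /andP[] := xab i.
  have km i : (Num.truncn ((x i 0 - a i 0) / r)%R < m i)%N.
    rewrite -(ltr_nat R); have /andP[h1 _] := truncn_itv (x0 i).
    have /andP[_ h2] := truncn_itv (b0 i).
    rewrite (le_lt_trans h1)// (le_lt_trans _ h2)// ler_pM2r ?invr_gt0// lerD2r.
    by have /andP[] := xab i.
  pose f : {ffun 'I_s -> 'I_M} := [ffun i => Ordinal (leq_trans (km i) (mM i))].
  rewrite (bigD1 f)//=; left; rewrite /C ifT; last by apply/forallP => i; rewrite ffunE; exact: km.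
  move=> i; rewrite !mxE ffunE/=.
  have /andP[h1 h2] := truncn_itv (x0 i).
  rewrite ler_pdivlMr// in h1; rewrite ltr_pdivrMr// -natr1 mulrDl mul1r in h2.
  by rewrite mulrC; apply/andP; split; lra.
apply: (@le_trans _ _ (\sum_(f : {ffun 'I_s -> 'I_M}) mu (C f))%E).
  by elim/big_ind2 : _ => [|A x B y Ax By|//]; rewrite ?mu0// (le_trans (muU _ _))// leeD.
apply: (@le_trans _ _ (\sum_(f : {ffun 'I_s -> 'I_M}) (\prod_i (f i < m i)%N%:R)%:E * v)%E).
  apply: lee_sum => f _; rewrite /C; case: ifPn => [/forallP fm|fm].
    by rewrite big1 ?mul1e// => i _; rewrite fm.
  by rewrite mu0 mule_ge0// lee_fin prodr_ge0.
rewrite -ge0_sume_distrl; last by move=> f _; rewrite lee_fin prodr_ge0.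
rewrite sumEFin -(bigA_distr_bigA (fun i (j : 'I_M) => (j < m i)%N%:R))/=.
apply: lee_wpmul2r => //; rewrite lee_fin; apply: ler_prod => i _.
rewrite -natr_sum -big_mkcond/= -(big_ord_widen _ (fun=> 1%N) (mM i)) sum1_card card_ord.
rewrite ler0n/= /m -natr1 lerD2r.
by have /andP[] := truncn_itv (b0 i).
Qed.

(** * Hausdorff measure of flat pieces *)

Section hausdorff_lebesgue.
Context {R : realType} (s : nat).
Hypothesis s0 : (0 < s)%N.
Notation H := (@hausdorff R s 1 s).
Notation lam := (@lebesgue_cV R s).
Notation ucube := (box 0 (const_mx 1 : 'cV[R]_s)).

Lemma cube_image (x : 'cV[R]_s) (r : R) : 0 < r ->
  box x (x + const_mx r) = [set y + x | y in [set r *: y | y in ucube]].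
Proof.
move=> r0; apply/seteqP; split => [y yx|_ [_ [y y01 <-] <-] i].
  exists (y - x); last by rewrite subrK.
  exists (r^-1 *: (y - x)); last by rewrite scalerA divff ?gt_eqF// scale1r.
  move=> i; have := yx i; rewrite !mxE => /andP[h1 h2].
  rewrite ler_pdivrMl// mulr1 mulr_ge0 ?invr_ge0 ?(ltW r0)//= ?subr_ge0//.
  by rewrite lerBlDl.
have := y01 i; rewrite !mxE => /andP[h1 h2].
by rewrite lerDr mulr_ge0 ?(ltW r0)//= addrC lerD2l -[leRHS]mulr1 ler_pM2l.
Qed.

Lemma hausdorff_cube (x : 'cV[R]_s) (r : R) : 0 < r ->
  H (box x (x + const_mx r)) = ((r ^+ s)%:E * H ucube)%E.
Proof. by move=> r0; rewrite cube_image// hausdorff_translate hausdorff_scale. Qed.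

Lemma enorm_box_le (x y z : 'cV[R]_s) (r : R) : 0 <= r ->
  box x (x + const_mx r) y -> box x (x + const_mx r) z -> enorm (y - z) <= s%:R * r.
Proof.
move=> r0 xy xz; rewrite (le_trans (enorm_le_mxnorm _))// muln1 ler_wpM2l//.
apply: mxnorm_le => // i j; rewrite (ord1 j) ler_norml.
by have := xy i; have := xz i; rewrite !mxE => /andP[h1 h2] /andP[h3 h4]; apply/andP; split; lra.
Qed.

Let c := fine (lam (@eball R s)).
Let cE : lam (@eball R s) = c%:E.
Proof. by rewrite fineK// ge0_fin_numE ?outer_measure_ge0 ?lebesgue_eball_fin. Qed.
Let c0 : 0 < c.
Proof. by rewrite -lte_fin -cE lebesgue_eball_gt0. Qed.

Lemma hausdorff_ucube_fin : (H ucube < +oo)%E.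
Proof.
apply: (@le_lt_trans _ _ (c * s%:R ^+ s)%:E); last by rewrite ltry.
apply: hausdorff_le => d d0.
have g0 := @hausdorff_gauge0 R s 1 s d; have gg := @hausdorff_gauge_ge0 R s 1 s d.
have sR : 0 < s%:R :> R by rewrite ltr0n.
(* Cubes of side [r] have diameter at most [s * r <= d]. Their total gauge is at most
   [c * (s * (1 + r) / 2) ^ s], and [r <= 1] bounds this by [c * s ^ s] whatever [d] is. *)
pose r := Num.min 1 (d / s%:R).
have r0 : 0 < r by rewrite lt_min ltr01 divr_gt0.
have r1 : r <= 1 by rewrite ge_min lexx.
have rd : s%:R * r <= d by rewrite mulrC -ler_pdivlMr// ge_min lexx orbT.
have v0 : 0 <= c * ((s%:R * r / 2) ^+ s) by rewrite mulr_ge0 ?(ltW c0)// exprn_ge0// !mulr_ge0 ?ltW.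
have := @grid_le R s (method1 (hausdorff_gauge s d)) 0 (const_mx 1) r (c * ((s%:R * r / 2) ^+ s))%:E.
have e : (1 / r + 1) ^+ s * (c * (s%:R * r / 2) ^+ s) <= c * s%:R ^+ s.
  rewrite mulrCA ler_pM2l// -exprMn.
  have -> : (1 / r + 1) * (s%:R * r / 2) = s%:R * ((1 + r) / 2) by field; rewrite gt_eqF.
  by apply: lerXn2r; rewrite ?nnegrE; nra.
move=> G; apply: le_trans (G _ _ _ r0 _ _ _) _.
- exact: method1_0 g0 gg.
- exact: le_method1.
- move=> A B.
  have := method1_sigma_subadditive gg (bigcup2 A B).
  rewrite bigcup2E => /le_trans; apply.
  rewrite (nneseries_split _ 2); last by move=> k _; exact: method1_ge0 gg _.
  rewrite add0n big_nat_recl//= big_nat_recl//= big_geq// adde0.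
  rewrite eseries0 ?adde0// => -[|[|k]]// _ _.
  exact: method1_0 g0 gg.
- by rewrite lee_fin.
- move=> x; apply: le_trans (method1_le g0 gg _) _.
  rewrite EFinM -cE; apply: hausdorff_gauge_le => //; first by rewrite mulr_ge0 ?ltW.
  by move=> y z; exact: enorm_box_le (ltW r0).
- by move=> i; rewrite !mxE ler01.
- by rewrite -EFinM lee_fin; under eq_bigr do rewrite !mxE subr0; rewrite prodr_const card_ord.
Qed.

Lemma lebesgue_ucube : lam ucube = 1%E.
Proof.
rewrite lebesgue_cV_box => [|i]; last by rewrite !mxE ler01.
by rewrite big1// => i _; rewrite !mxE subr0.
Qed.

(** A set of diameter [e] lies in a cube of side [2 * e], of volume [4 ^+ s * (e / 2) ^+ s]. So the
    gauge dominates a fixed positive multiple of Lebesgue measure. *)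
Lemma hausdorff_ucube_gt0 : (0 < H ucube)%E.
Proof.
apply: (@lt_le_trans _ _ (c / 4 ^+ s)%:E).
  by rewrite lte_fin divr_gt0// exprn_gt0.
apply: le_trans (hausdorff_ge s ucube (ltr01 : 0 < (1 : R))).
apply: method1_ge => F UF.
apply: (@le_trans _ _ ((c / 4 ^+ s)%:E * \sum_(k <oo) lam (F k))%E).
  rewrite -[leLHS]mule1 lee_pmul2l ?lte_fin ?divr_gt0 ?exprn_gt0//.
  rewrite -lebesgue_ucube (le_trans _ (outer_measure_sigma_subadditive _ _))//.
  exact: le_outer_measure.
rewrite -nneseriesZl//; last by move=> k _; exact: outer_measure_ge0.
apply: lee_nneseries => [k _ _|k _].
  by rewrite mule_ge0 ?outer_measure_ge0// lee_fin divr_ge0 ?exprn_ge0// ltW.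
rewrite /hausdorff_gauge; case: ifPn => [/eqP->|/set0P F0]; first by rewrite outer_measure0 mule0.
case: ifPn => [Fd|_]; last by rewrite leey.
have [e eE e0] := ediam_fin F0 Fd; rewrite eE/= cE -EFinM.
have [x Fx] := F0.
have xe i : (x - const_mx e) i 0 <= (x + const_mx e) i 0 by rewrite !mxE; lra.
apply: (@le_trans _ _ ((c / 4 ^+ s)%:E * (\prod_(i < s) ((x + const_mx e) i 0 - (x - const_mx e) i 0))%:E)%E).
  rewrite lee_pmul2l ?lte_fin ?divr_gt0 ?exprn_gt0//.
  rewrite -(lebesgue_cV_box xe); apply: le_outer_measure => y Fy i; rewrite !mxE.
  have := le_trans (coord_le_enorm (y - x) i 0) _; rewrite !mxE => /(_ e).
  have -> : enorm (y - x) <= e by rewrite -lee_fin -eE; exact: ediam_ge.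
  by move=> /(_ isT); rewrite ler_norml => /andP[h1 h2]; apply/andP; split; lra.
rewrite -EFinM lee_fin (eq_bigr (fun=> 4 * (e / 2))); last by move=> i _; rewrite !mxE; field.
by rewrite prodr_const card_ord exprMn -mulrA (mulrA _ (4 ^+ s)) mulVf ?mul1r.
Qed.

Definition hausdorff_density : R := fine (H ucube).
Notation alpha := hausdorff_density.

Lemma hausdorff_ucubeE : H ucube = alpha%:E.
Proof. by rewrite fineK// ge0_fin_numE ?hausdorff_ucube_fin// ltW// hausdorff_ucube_gt0. Qed.

Lemma hausdorff_density_gt0 : 0 < alpha.
Proof. by rewrite -lte_fin -hausdorff_ucubeE hausdorff_ucube_gt0. Qed.

Lemma hausdorff_box_le (a b : 'cV[R]_s) : (forall i, a i 0 <= b i 0) ->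
  (H (box a b) <= (alpha * \prod_(i < s) (b i 0 - a i 0))%:E)%E.
Proof.
move=> ab.
apply: (@lee_prod_perturb _ _ _ _ _ (fun=> 1)) => N.
set e := N.+1%:R^-1 : R; have e0 : 0 < e by rewrite invr_gt0.
have := @grid_le R s H a b e (e ^+ s * alpha)%:E.
move=> G; apply: le_trans (G _ _ _ e0 _ _ ab) _.
- exact: outer_measure0.
- exact: le_outer_measure.
- exact: outer_measureU2.
- by rewrite lee_fin mulr_ge0 ?exprn_ge0 ?ltW ?hausdorff_density_gt0.
- by move=> x; rewrite hausdorff_cube// hausdorff_ucubeE.
rewrite -EFinM lee_fin mulrA mulrC ler_pM2l ?hausdorff_density_gt0//.
rewrite -[X in _ * _ ^+ X](card_ord s) -prodr_const -big_split/= le_eqVlt; apply/orP; left; apply/eqP.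
by apply: eq_bigr => i _; field; rewrite gt_eqF.
Qed.

Lemma hausdorff_le_lebesgue A : (H A <= alpha%:E * lam A)%E.
Proof.
rewrite -lee_pdivrMl ?hausdorff_density_gt0//; apply: method1_ge => F AF.
rewrite lee_pdivrMl ?hausdorff_density_gt0//.
apply: (@le_trans _ _ (H (\bigcup_k F k))); first exact: le_outer_measure.
apply: le_trans (outer_measure_sigma_subadditive _ _) _.
rewrite -nneseriesZl//; last by move=> k _; exact: box_gauge_ge0.
apply: lee_nneseries => [k _ _|k _]; first exact: outer_measure_ge0.
have [->|[g [h [gh -> ->]]]|->] := box_gaugeP (F k).
- by rewrite outer_measure0 mule_ge0 ?box_gauge_ge0// lee_fin ltW ?hausdorff_density_gt0.
- by rewrite -EFinM hausdorff_box_le.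
- by rewrite gt0_muley ?lte_fin ?hausdorff_density_gt0// leey.
Qed.

Lemma measurable_box (a b : 'cV[R]_s) : measurable (box a b : set (borel_mx s 1)).
Proof.
rewrite (_ : box a b = \bigcap_(i : 'I_s) [set x : 'cV[R]_s | a i 0 <= x i 0 <= b i 0]).
  apply: fin_bigcap_measurable => [|i _]; first exact: finite_finset.
  have := @measurable_coord R s 1 i 0 measurableT _ (measurable_itv `[a i 0, b i 0]).
  by rewrite setTI; congr measurable; apply/seteqP; split => x /=; rewrite in_itv.
by apply/seteqP; split => x /= H i; [move=> _; exact: H|exact: (H i I)].
Qed.

(** The inequality [hausdorff_le_lebesgue] is an equality on cubes; applied to the complement in a
    cube and subtracted, it gives the reverse inequality. Subtraction needs measurability, hence the
    Borel hull [B] of [A]. *)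
Lemma hausdorff_lebesgue (A : set 'cV[R]_s) (r : R) : (forall x, A x -> enorm x <= r) ->
  H A = (alpha%:E * lam A)%E.
Proof.
move=> Ar; apply/eqP; rewrite eq_le hausdorff_le_lebesgue/=.
pose x0 : 'cV[R]_s := const_mx (- (`|r| + 1)); pose l := (`|r| + 1) * 2.
have l0 : 0 < l by rewrite mulr_gt0// ltr_pwDr.
pose J := box x0 (x0 + const_mx l).
have AJ : A `<=` J.
  move=> x /Ar xr i; rewrite !mxE.
  have : `|x i 0| <= `|r| + 1.
    rewrite (le_trans (coord_le_enorm _ _ _))// (le_trans xr)//.
    by rewrite (le_trans (ler_norm _))// lerDl.
  by rewrite ler_norml /l => /andP[h1 h2]; apply/andP; split; lra.
have [B [mB AB HB]] := @hausdorff_hull R s 1 s A.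
have mBJ : measurable (B `&` J : set (borel_mx s 1)) by apply: measurableI => //; exact: measurable_box.
have HBJ : H (B `&` J) = H A.
  apply/eqP; rewrite eq_le; apply/andP; split.
    by rewrite -HB; apply: le_outer_measure; exact: subIsetl.
  by apply: le_outer_measure; rewrite subsetI.
have lamJ : lam J = (l ^+ s)%:E.
  rewrite lebesgue_cV_box => [|i]; last by rewrite !mxE; lra.
  by rewrite -[X in _ ^+ X](card_ord s) -prodr_const; congr EFin; apply: eq_bigr => i _; rewrite !mxE; ring.
have HJ : H J = (alpha * l ^+ s)%:E.
  by rewrite hausdorff_cube// hausdorff_ucubeE -EFinM mulrC.
have lamJoo : (lam J < +oo)%E by rewrite lamJ ltry.
have HJoo : (H J < +oo)%E by rewrite HJ ltry.
have lamfin X : X `<=` J -> lam X \is a fin_num.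
  move=> XJ; rewrite ge0_fin_numE ?outer_measure_ge0//.
  exact: le_lt_trans (le_outer_measure lam _ _ XJ) lamJoo.
have HJE : H J = (H (B `&` J) + H (J `\` B))%E.
  rewrite [LHS](borel_hausdorff s mB) (setIC J) -setDE//.
have lamJE : lam J = (lam (B `&` J) + lam (J `\` B))%E.
  by rewrite [LHS](borel_lebesgue_cV mB) (setIC J) -setDE.
apply: (@le_trans _ _ (alpha%:E * lam (B `&` J))%E).
  rewrite lee_pmul2l ?lte_fin ?hausdorff_density_gt0//; apply: le_outer_measure.
  by rewrite subsetI.
rewrite -HBJ.
have := hausdorff_le_lebesgue (J `\` B).
have f1 : lam (B `&` J) \is a fin_num by apply: lamfin; exact: subIsetr.
have f2 : lam (J `\` B) \is a fin_num by apply: lamfin; exact: subDsetl.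
have f3 : H (J `\` B) \is a fin_num.
  rewrite ge0_fin_numE ?outer_measure_ge0//.
  by apply: le_lt_trans HJoo; apply: le_outer_measure; exact: subDsetl.
have f4 : H (B `&` J) \is a fin_num.
  rewrite ge0_fin_numE ?outer_measure_ge0//.
  by apply: le_lt_trans HJoo; apply: le_outer_measure; exact: subIsetr.
move: HJE lamJE; rewrite HJ lamJ -(fineK f1) -(fineK f2) -(fineK f3) -(fineK f4).
rewrite -!EFinD -!EFinM !lee_fin => -[e1] [e2] e3; rewrite e2 in e1; lra.
Qed.

End hausdorff_lebesgue.

(** * Outer measures restricted to the Borel sets *)

Section borel_restriction.
Context {R : realType} (p q : nat).
Variable mu : {outer_measure set 'M[R]_(p, q) -> \bar R}.
Hypothesis mu_borel : forall A : set (borel_mx p q), measurable A -> mu.-cara.-measurable A.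

(** The inclusion of the Borel sets is an argument of the term, so that the measure structure
    declared below can be inferred from it. *)
Definition borel_restriction & (forall A : set (borel_mx p q), measurable A -> mu.-cara.-measurable A) :
  set (borel_mx p q) -> \bar R := mu.

Notation nu := (borel_restriction mu_borel).

Let nu0 : nu set0 = 0%E. Proof. exact: outer_measure0. Qed.
Let nu_ge0 A : (0 <= nu A)%E. Proof. exact: outer_measure_ge0. Qed.
Let nu_sigma_additive : semi_sigma_additive nu.
Proof.
move=> F mF tF mUF; apply: (@caratheodory_measure_sigma_additive _ _ mu F) => //.
- by move=> i; exact: mu_borel.
- exact: mu_borel.
Qed.

HB.instance Definition _ := isMeasure.Build _ _ _ nu nu0 nu_ge0 nu_sigma_additive.

(** The identity is measurable from the Carathéodory to the Borel sigma-algebra, and the restricted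
    measure is its push-forward. *)
Lemma borel_restriction_integral (D : set (borel_mx p q)) (f : borel_mx p q -> \bar R) :
  measurable D -> measurable_fun D f -> (forall x, D x -> 0 <= f x)%E ->
  integral (T := caratheodory_type mu) mu D f = (\int[nu]_(x in D) f x)%E.
Proof.
move=> mD mf f0.
have mid : measurable_fun setT (id : caratheodory_type mu -> borel_mx p q).
  by move=> _ A mA; rewrite setTI; exact: mu_borel.
by rewrite -[LHS](ge0_integral_pushforward mid)// => x; rewrite inE; exact: f0.
Qed.

End borel_restriction.

Section lebesgue_measure_cV.
Context {R : realType} (n : nat).

Definition leb : set (borel_mx n 1) -> \bar R := borel_restriction (@borel_lebesgue_cV R n).
HB.instance Definition _ := Measure.on leb.

Definition cbox (r : R) : set 'cV[R]_n := box (const_mx (- r)) (const_mx r).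

Lemma measurable_cbox r : measurable (cbox r : set (borel_mx n 1)).
Proof. exact: measurable_box. Qed.

Lemma leb_cbox (r : R) : 0 <= r -> leb (cbox r) = ((2 * r) ^+ n)%:E.
Proof.
move=> r0; rewrite /leb/= /borel_restriction lebesgue_cV_box => [|i]; last by rewrite !mxE; lra.
rewrite (eq_bigr (fun=> 2 * r)); last by move=> i _; rewrite !mxE; ring.
by rewrite prodr_const card_ord.
Qed.

Lemma cboxP (r : R) x : 0 <= r -> cbox r x <-> `|x| <= r.
Proof.
move=> r0; split => [xr|xr i].
  apply: mxnorm_le => // i j; rewrite (ord1 j) ler_norml; by have := xr i; rewrite !mxE.
by rewrite !mxE -ler_norml (le_trans (coord_le_mxnorm x i 0)).
Qed.

Lemma leb_sigma_finite : sigma_finite setT leb.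
Proof.
exists (fun k => cbox k%:R); last first.
  by move=> k; split; [exact: measurable_cbox|rewrite leb_cbox ?ltry].
apply/esym; rewrite -subTset => x _; exists (Num.bound `|x|) => //.
by apply/cboxP => //; rewrite ltW// archi_boundP.
Qed.

HB.instance Definition _ := @Measure_isSigmaFinite.Build _ _ _ leb leb_sigma_finite.

Lemma leb_bounded (A : set 'cV[R]_n) (r : R) : (forall x, A x -> enorm x <= r) -> (leb A < +oo)%E.
Proof.
move=> Ar; apply: (@le_lt_trans _ _ (leb (cbox `|r|))); last by rewrite leb_cbox ?ltry.
apply: (le_outer_measure (@lebesgue_cV R n)) => x /Ar xr; apply/cboxP => //.
by rewrite (le_trans (mxnorm_le_enorm _))// (le_trans xr)// ler_norm.
Qed.

Lemma lebesgue_intE (f : 'cV[R]_n -> \bar R) : measurable_fun setT (f : borel_mx n 1 -> \bar R) ->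
  (forall x, 0 <= f x)%E -> lebesgue_int setT f = (\int[leb]_x f x)%E.
Proof. by move=> mf f0; apply: borel_restriction_integral. Qed.

Lemma continuous_measurable_mxmx p q (f : 'cV[R]_n -> 'M[R]_(p, q)) : continuous f ->
  measurable_fun setT (f : borel_mx n 1 -> borel_mx p q).
Proof.
move=> cf; apply: (@measurability _ _ (borel_mx n 1) (borel_mx p q) setT f (@open 'M[R]_(p, q))) => //.
move=> _ [U oU <-]; rewrite setTI; apply: sub_sigma_algebra.
by apply: open_comp => // x _; exact: cf.
Qed.

Lemma continuous_affine (t : R) (v : 'cV[R]_n) : continuous (fun x : 'cV[R]_n => t *: x + v).
Proof.
apply: (@elipschitz_continuous _ _ _ _ _ `|t|) => x y.
rewrite opprD addrACA subrr addr0 -scalerBr (le_trans (mxnorm_le_enorm _))//.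
by rewrite enormZ.
Qed.

Lemma measurable_affine (t : R) (v : 'cV[R]_n) :
  measurable_fun setT (fun x : borel_mx n 1 => t *: (x : 'cV[R]_n) + v : borel_mx n 1).
Proof. by apply: continuous_measurable_mxmx; exact: continuous_affine. Qed.

Lemma ge0_integral_affine (t : R) (v : 'cV[R]_n) (f : borel_mx n 1 -> \bar R) : 0 < t ->
  measurable_fun setT f -> (forall x, 0 <= f x)%E ->
  (\int[leb]_x f (t *: (x : 'cV[R]_n) + v)%R = ((t^-1) ^+ n)%:E * \int[leb]_x f x)%E.
Proof.
move=> t0 mf f0; have mphi := measurable_affine t v.
have := @ge0_integral_pushforward _ _ _ _ R _ mphi leb setT f measurableT mf (fun y _ => f0 y).
rewrite preimage_setT => <-.
have tn0 : 0 <= (t^-1) ^+ n by rewrite exprn_ge0// invr_ge0 ltW.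
have <- := @ge0_integral_mscale _ _ R leb setT measurableT (NngNum tn0) f mf (fun x _ => f0 x).
apply: eq_measure_integral => A mA _.
have t'0 : 0 < t^-1 by rewrite invr_gt0.
transitivity ((t^-1 ^+ n)%:E * lebesgue_cV (A : set 'cV[R]_n))%E; last by [].
have := lebesgue_cV_affine (- (t^-1 *: v)) (A : set 'cV[R]_n) t'0.
move=> <-; congr (lebesgue_cV _); apply/seteqP; split => [x Ax|_ [x Ax <-]] /=.
  by exists (t *: x + v) => //; rewrite scalerDr scalerA mulVf ?gt_eqF// scale1r addrK.
by rewrite scalerBr !scalerA divff ?gt_eqF// !scale1r subrK.
Qed.

Lemma ge0_integral_translate (v : 'cV[R]_n) (f : borel_mx n 1 -> \bar R) :
  measurable_fun setT f -> (forall x, 0 <= f x)%E ->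
  (\int[leb]_x f ((x : 'cV[R]_n) + v)%R = \int[leb]_x f x)%E.
Proof.
move=> mf f0; have := ge0_integral_affine v ltr01 mf f0.
by rewrite invr1 expr1n mul1e => <-; apply: eq_integral => x _; rewrite scale1r.
Qed.

End lebesgue_measure_cV.
Arguments leb {R}.

(** * Rademacher's theorem *)

(** Completeness in terms of approximate values: [Q e u] says that [u] is a candidate with error
    [e]. The limit is the supremum of the lower bounds [u - e]. It produces directional derivatives
    and, coordinate by coordinate, gradients. *)
Lemma cauchy_net (R : realType) (Q : R -> R -> Prop) :
  (forall e, 0 < e -> exists u, Q e u) ->
  (forall e e' u u', 0 < e -> 0 < e' -> Q e u -> Q e' u' -> `|u - u'| <= e + e') ->
  exists l, forall e u, 0 < e -> Q e u -> `|u - l| <= e.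
Proof.
move=> exQ QQ; pose S := [set x | exists e u, [/\ 0 < e, Q e u & x = u - e]].
have [u1 Qu1] := exQ 1 ltr01.
have S0 : S !=set0 by exists (u1 - 1), 1, u1.
have ubS e u : 0 < e -> Q e u -> ubound S (u + e).
  move=> e0 Qu _ [e' [u' [e'0 Qu' ->]]].
  by have := QQ _ _ _ _ e'0 e0 Qu' Qu; rewrite ler_norml => /andP[_ ?]; lra.
exists (sup S) => e u e0 Qu.
have h1 : sup S <= u + e by apply: ge_sup => //; exact: ubS.
have h2 : u - e <= sup S.
  by apply: ub_le_sup; [exists (u + e); exact: ubS|exists e, u].
by rewrite ler_norml; apply/andP; split; lra.
Qed.

Section directional.
Context {R : realType} (n : nat).
Implicit Types (f : 'cV[R]_n -> R^o) (x v : 'cV[R]_n).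

Definition elipschitz f (L : R) := forall x y, `|f x - f y| <= L * enorm (x - y).

Definition quo f v x (t : R) : R := (f (x + t *: v) - f x) / t.

Lemma quoP f v x l : derivable f x v /\ 'D_v f x = l <->
  forall e : R, 0 < e -> exists2 r : R, 0 < r & forall t, 0 < `|t| < r -> `|quo f v x t - l| <= e.
Proof.
have quoE t : t^-1 *: ((f \o shift x) (t *: v) - f x) = quo f v x t.
  by rewrite /quo /GRing.scale/= mulrC (addrC x).
split=> [[dfv Dfl] e e0|H].
  have /cvgrPdist_le/(_ e e0) := dfv; rewrite -/('D_v f x) Dfl.
  rewrite /dnbhs near_withinE near_nbhs.
  move=> -[r /= r0 rH]; exists r => // t /andP[t0 tr].
  have := rH t; rewrite /= sub0r normrN => /(_ tr); rewrite -normr_gt0 => /(_ t0).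
  by rewrite quoE distrC.
have cl : (t^-1 *: ((f \o shift x) (t *: v) - f x)) @[t --> 0^'] --> l.
  apply/cvgrPdist_le => e e0; have [r r0 rH] := H e e0.
  rewrite /dnbhs near_withinE; exists r => //= t /=.
  rewrite sub0r normrN => tr; rewrite -normr_gt0 => t0.
  by rewrite quoE distrC rH// t0.
by split; [apply/cvg_ex; exists l|exact: cvg_lim].
Qed.

Lemma quo_le f L v x t : elipschitz f L -> `|quo f v x t| <= L * enorm v.
Proof.
move=> fL; have [->|t0] := eqVneq t 0.
  have := le_trans (normr_ge0 _) (fL v 0); rewrite subr0 => Lv.
  by rewrite /quo invr0 mulr0 normr0.
rewrite normrM normfV ler_pdivrMr ?normr_gt0//.
rewrite (le_trans (fL _ _))// addrAC subrr add0r enormZ; lra.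
Qed.

Lemma elipschitz_cont f L : elipschitz f L -> continuous f.
Proof. exact: elipschitz_continuous. Qed.

Lemma derive_le f L v x : elipschitz f L -> derivable f x v -> `|'D_v f x| <= L * enorm v.
Proof.
move=> fL dfv; apply/ler_addgt0Pr => e e0.
have /quoP/(_ e e0)[r r0 rH] : derivable f x v /\ 'D_v f x = 'D_v f x by [].
have r20 : 0 < r / 2 by rewrite divr_gt0.
have := rH (r / 2); rewrite gtr0_norm// r20 /= => /(_ _); rewrite ltr_pdivrMr// ltr_pMr// ltr1n.
move=> /(_ isT) H; have := quo_le v x (r / 2) fL.
by have := ler_distD (quo f v x (r / 2)) ('D_v f x) 0; rewrite !subr0 distrC => ? ?; lra.
Qed.

Lemma lipschitz_quo f L v t x y : elipschitz f L ->
  `|quo f v x t - quo f v y t| <= 2 * L * `|t|^-1 * enorm (x - y).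
Proof.
move=> fL; rewrite /quo -mulrBl normrM normfV mulrAC ler_wpM2r ?invr_ge0//.
rewrite (_ : _ - _ = (f (x + t *: v) - f (y + t *: v)) - (f x - f y)); last by ring.
rewrite (le_trans (ler_normB _ _))//.
have := fL (x + t *: v) (y + t *: v); have := fL x y.
rewrite opprD addrACA subrr addr0; lra.
Qed.

Definition dset f v : set 'cV[R]_n := [set x | derivable f x v].

(** Cauchy's criterion for the difference quotients. It avoids the unknown derivative, and each set
    in the formula is closed when [f] is Lipschitz, so the domain of differentiability is Borel. *)
Lemma dsetE f v L : elipschitz f L -> dset f v =
  \bigcap_j \bigcup_k [set x | forall s t, 0 < `|s| < k.+1%:R^-1 -> 0 < `|t| < k.+1%:R^-1 ->
    `|quo f v x s - quo f v x t| <= j.+1%:R^-1].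
Proof.
move=> fL; apply/seteqP; split => x.
  move=> dfx j _; have j0 : 0 < j.+1%:R^-1 / 2 :> R by rewrite divr_gt0.
  have /quoP/(_ _ j0)[r r0 rH] : derivable f x v /\ 'D_v f x = 'D_v f x by [].
  exists (Num.bound r^-1) => // s t.
  have br : (Num.bound r^-1).+1%:R^-1 < r.
    rewrite invf_plt ?posrE// (lt_le_trans (archi_boundP _)) ?ler_nat//.
    by rewrite invr_ge0 ltW.
  move=> /andP[s0 sb] /andP[t0 tb].
  have := rH s; rewrite s0 (lt_trans sb br) => /(_ isT) h1.
  have := rH t; rewrite t0 (lt_trans tb br) => /(_ isT) h2.
  have := ler_distD ('D_v f x) (quo f v x s) (quo f v x t).
  by move=> /le_trans; apply; rewrite [leRHS]splitr (distrC ('D_v f x)) lerD.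
move=> H.
pose Q (e u : R) := exists2 r : R, 0 < r & forall t, 0 < `|t| < r -> `|quo f v x t - u| <= e.
have [l lH] : exists l, forall e u, 0 < e -> Q e u -> `|u - l| <= e.
  apply: cauchy_net => [e e0|e e' u u' e0 e'0 [r r0 rH] [r' r'0 r'H]].
    have [k _ kH] := H (Num.bound e^-1) I.
    have k20 : 0 < k.+1%:R^-1 / 2 :> R by rewrite divr_gt0.
    exists (quo f v x (k.+1%:R^-1 / 2)), k.+1%:R^-1; first by rewrite invr_gt0.
    move=> t /kH => /(_ (k.+1%:R^-1 / 2)); rewrite gtr0_norm// k20 ltr_pdivrMr// ltr_pMr ?invr_gt0//.
    rewrite ltr1n => /(_ isT) /le_trans; apply.
    rewrite invf_ple ?posrE// ltW// (lt_le_trans (archi_boundP _)) ?ler_nat//.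
    by rewrite invr_ge0 ltW.
  pose t := Num.min r r' / 2.
  have t0 : 0 < t by rewrite divr_gt0// lt_min r0.
  have tr : t < Num.min r r' by rewrite /t ltr_pdivrMr// ltr_pMr ?ltr1n// lt_min r0.
  move: tr; rewrite lt_min => /andP[tr tr'].
  have := rH t; rewrite gtr0_norm// t0 tr => /(_ isT) h1.
  have := r'H t; rewrite gtr0_norm// t0 tr' => /(_ isT) h2.
  by rewrite (le_trans (ler_distD (quo f v x t) _ _))// (distrC u) lerD.
suff /quoP[] : forall e : R, 0 < e -> exists2 r : R, 0 < r &
  forall t, 0 < `|t| < r -> `|quo f v x t - l| <= e by [].
move=> e e0; have e20 : 0 < e / 2 by rewrite divr_gt0.
have [k _ kH] := H (Num.bound (e / 2)^-1) I.
exists k.+1%:R^-1; first by rewrite invr_gt0.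
move=> t tk.
have : Q (e / 2) (quo f v x t).
  exists k.+1%:R^-1; first by rewrite invr_gt0.
  move=> s sk; rewrite (le_trans (kH _ _ sk tk))//.
  rewrite invf_ple ?posrE// ltW// (lt_le_trans (archi_boundP _)) ?ler_nat//.
  by rewrite invr_ge0 ltW.
by move=> /(lH _ _ e20); lra.
Qed.

Lemma closed_borel (A : set 'cV[R]_n) : closed A -> measurable (A : set (borel_mx n 1)).
Proof.
move=> cA; rewrite -[A]setCK; apply: measurableC; apply: sub_sigma_algebra.
exact: closed_openC.
Qed.

Lemma measurable_dset f v L : elipschitz f L -> measurable (dset f v : set (borel_mx n 1)).
Proof.
move=> fL; rewrite (dsetE v fL); apply: bigcapT_measurable => j.
apply: bigcupT_measurable => k; apply: closed_borel.
rewrite (_ : [set x | _] = \bigcap_(st in [set st : R * R | 0 < `|st.1| < k.+1%:R^-1 /\ 0 < `|st.2| < k.+1%:R^-1])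
  [set x | `|quo f v x st.1 - quo f v x st.2| <= j.+1%:R^-1]).
  apply: closed_bigI => -[s t] _ /=.
  apply: (@closed_comp _ _ (fun x => `|quo f v x s - quo f v x t|) [set y | y <= j.+1%:R^-1]).
    move=> x _; apply: (@elipschitz_continuous _ _ _ R^o _ (2 * L * `|s|^-1 + 2 * L * `|t|^-1)) => {}x y.
    rewrite (le_trans (ler_dist_dist _ _))// mulrDl.
    rewrite (_ : _ - _ = (quo f v x s - quo f v y s) - (quo f v x t - quo f v y t)); last by ring.
    by rewrite (le_trans (ler_normB _ _))// lerD// lipschitz_quo.
  exact: closed_le.
apply/seteqP; split => x /= H.
  by move=> [s t] /= [hs ht]; exact: H.
by move=> s t hs ht; exact: (H (s, t)).
Qed.

Lemma measurable_add_scale (v : 'cV[R]_n) :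
  measurable_fun setT (fun xt : borel_mx n 1 * measurableTypeR R => (xt.1 : 'cV[R]_n) + xt.2 *: v : borel_mx n 1).
Proof.
apply: measurable_fun_mx => i j.
apply: (eq_measurable_fun (fun xt : borel_mx n 1 * measurableTypeR R =>
    (xt.1 : 'cV[R]_n) i j + xt.2 * v i j)); first by move=> x _; rewrite !mxE.
apply: measurable_funD; first exact: (measurableT_comp (measurable_coord i j) measurable_fst).
by apply: measurable_funM; [exact: measurable_snd|exact: measurable_cst].
Qed.

(** Fubini without a change of coordinates: by translation invariance the measure of [N] is the
    integral over [x] of the length of those [t] in [[0, 1]] for which [x + t *: v] lies in [N], and
    this length is zero by the one-variable theorem on the line through [x]. *)
Lemma dset_ae f v L : elipschitz f L -> leb n (~` dset f v) = 0%E.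
Proof.
move=> fL; set N := ~` dset f v.
have mN : measurable (N : set (borel_mx n 1)) by apply: measurableC; exact: measurable_dset fL.
pose J := `[0, 1]%classic : set R.
have mJ : measurable (J : set (measurableTypeR R)) by exact: measurable_itv.
pose F (xt : borel_mx n 1 * measurableTypeR R) : \bar R :=
  (\1_N ((xt.1 : 'cV[R]_n) + xt.2 *: v) * \1_J xt.2)%:E.
have mF : measurable_fun setT F.
  apply/measurable_EFinP; apply: measurable_funM.
    apply: (@measurableT_comp _ _ _ _ (borel_mx n 1) _ (\1_N : borel_mx n 1 -> R)).
      exact: measurable_indic.
    exact: measurable_add_scale.
  by apply: (@measurableT_comp _ _ _ _ (measurableTypeR R) _ (\1_J : measurableTypeR R -> R));
    [exact: measurable_indic|exact: measurable_snd].
have F0 z : (0 <= F z)%E by rewrite lee_fin mulr_ge0.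
have := @fubini_tonelli _ _ (borel_mx n 1) (measurableTypeR R) R (leb n) (@lebesgue_measure R) F mF F0.
have mNe : measurable_fun setT (fun x : borel_mx n 1 => (\1_N x : R)%:E).
  by apply/measurable_EFinP; exact: measurable_indic.
have N0 (x : borel_mx n 1) : (0 <= (\1_N x : R)%:E)%E by rewrite lee_fin.
have -> : (\int[lebesgue_measure]_t \int[leb n]_x F (x, t) = leb n N)%E.
  rewrite (_ : (fun t => _) = (fun t => leb n N * (\1_J t)%:E)%E); last first.
    apply/funext => t; rewrite /F/=; under eq_integral do rewrite EFinM muleC.
    have mN1 : measurable_fun setT (fun x : borel_mx n 1 => (\1_N ((x : 'cV[R]_n) + t *: v)%R : R)%:E).
      apply/measurable_EFinP.
      apply: (@measurableT_comp _ _ _ _ (borel_mx n 1) _ (\1_N : borel_mx n 1 -> R)).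
        exact: measurable_indic.
      by have := @measurable_affine R n 1 (t *: v); under eq_fun do rewrite scale1r.
    rewrite ge0_integralZl//.
    rewrite muleC; congr (_ * _)%E.
    by apply: etrans (ge0_integral_translate (t *: v) mNe N0) _; rewrite integral_indic// setIT.
  rewrite ge0_integralZl//; last by apply/measurable_EFinP; exact: measurable_indic.
  by rewrite integral_indic//= setIT /J lebesgue_measure_itv/= lte_fin ltr01 sube0 mule1.
move=> <-; apply: integral0_eq => x _.
have sL (a b : R) : `|f (x + a *: v) - f (x + b *: v)| <= L * enorm v * `|a - b|.
  rewrite (le_trans (fL _ _))// opprD addrACA subrr add0r -scalerBl enormZ; lra.
have [A [mA A0 NA]] := @lipschitz_derivable_ae R (fun t => f (x + t *: v)) _ sL.
pose S : set (measurableTypeR R) := [set t | N (x + t *: v)].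
have mS : measurable S.
  have := measurableT_comp (measurable_add_scale v) (@pair1_measurable _ _ (borel_mx n 1) (measurableTypeR R) x).
  by move=> /(_ measurableT _ mN); rewrite setTI.
have SA : S `<=` A.
  move=> t Nt; apply: NA => dt; apply: Nt.
  suff <- : derivable (fun t : R => f (x + t *: v)) t 1 = dset f v (x + t *: v) by [].
  apply: (congr1 (fun G : R -> R^o => cvg (G h @[h --> 0^']))).
  apply/funext => h; rewrite /= -[h%:A]/(h * 1) mulr1.
  by rewrite scalerDl addrCA.
apply/eqP; rewrite eq_le integral_ge0 ?andbT//.
apply: (@le_trans _ _ (\int[lebesgue_measure]_t (\1_S t)%:E)%E).
  apply: ge0_le_integral => //.
  - exact: measurable_fun_pair2.
  - by apply/measurable_EFinP; exact: measurable_indic.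
  - by move=> t _; rewrite lee_fin /F /= /S -[leRHS]mulr1 ler_wpM2l// indicE; case: (_ \in _).
by rewrite integral_indic//= setIT -A0 le_measure// ?inE.
Qed.


End directional.

Lemma ae_imp d (T : measurableType d) (R : realType) (mu : {measure set T -> \bar R}) (P Q : set T) :
  {ae mu, forall x, P x} -> (forall x, P x -> Q x) -> {ae mu, forall x, Q x}.
Proof. by move=> [A [mA A0 PA]] PQ; exists A; split => // x nQ; apply: PA => Px; apply: nQ; exact: PQ. Qed.

Lemma ae_and d (T : measurableType d) (R : realType) (mu : {measure set T -> \bar R}) (P Q : set T) :
  {ae mu, forall x, P x} -> {ae mu, forall x, Q x} -> {ae mu, forall x, P x /\ Q x}.
Proof.
move=> aeP aeQ; apply: (negligibleS _ (negligibleU aeP aeQ)) => x /= nPQ.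
by have [Px|] := pselect (P x); [right => Qx; apply: nPQ|left].
Qed.

(** * Bounded functions of bounded support as test functions *)

Section density.
Context d (T : measurableType d) (R : realType) (mu : {measure set T -> \bar R}).
Variable g : T -> \bar R.
Hypotheses (mg : measurable_fun setT g) (g0 : forall x, (0 <= g x)%E).

Definition density_measure (_ : measurable_fun setT g) (_ : forall x, (0 <= g x)%E) (A : set T) : \bar R :=
  (\int[mu]_(x in A) g x)%E.
Notation m := (density_measure mg g0).

Let m0 : m set0 = 0%E. Proof. exact: integral_set0. Qed.
Let m_ge0 A : (0 <= m A)%E. Proof. exact: integral_ge0. Qed.
Let m_sigma_additive : semi_sigma_additive m.
Proof.
move=> F mF tF mUF; rewrite /density_measure ge0_integral_bigcup//; last exact: measurable_funTS.
by apply: is_cvg_ereal_nneg_natsum_cond => n _ _; exact: integral_ge0.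
Qed.

HB.instance Definition _ := isMeasure.Build _ _ _ m m0 m_ge0 m_sigma_additive.
End density.

Section bounded_support.
Context {R : realType} (n : nat).
Implicit Types (g w zeta : 'cV[R]_n -> R).
Notation leb := (@leb R n).
Notation Rint g := (Rintegral leb setT g).

(** One domination by a multiple of the indicator of a cube yields integrability, dominated
    convergence and the linearity of [Rint]. *)
Definition bsupp (C r : R) g :=
  measurable_fun setT (g : borel_mx n 1 -> R) /\ forall x, `|g x| <= C * \1_(cbox r) x.

Lemma leb_cbox_lty r : (leb (cbox r) < +oo)%E.
Proof.
have [r0|r0] := leP 0 r; first by rewrite leb_cbox// ltry.
apply: (@le_lt_trans _ _ (leb (cbox 0))); last by rewrite leb_cbox ?ltry.
by apply: (le_outer_measure (@lebesgue_cV R n)) => x xr i; have := xr i; rewrite !mxE oppr0 => ?; lra.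
Qed.

Lemma bsupp_integrable C r g : bsupp C r g -> leb.-integrable setT (EFin \o g).
Proof.
move=> [mg gC]; have mB := @measurable_cbox R n r.
have iB : leb.-integrable setT (EFin \o (fun x => C * \1_(cbox r) x)).
  rewrite (_ : _ \o _ = (fun x => C%:E * (\1_(cbox r) x)%:E)%E); last first.
    by apply/funext => x; rewrite /= EFinM.
  apply: integrableZl => //; apply/integrableP; split.
    by apply/measurable_EFinP; exact: measurable_indic.
  rewrite (eq_integral (fun x : borel_mx n 1 => (\1_(cbox r) x)%:E)); last by move=> x _; rewrite gee0_abs// lee_fin.
  rewrite integral_indic// setIT.
  exact: leb_cbox_lty.
apply: (le_integrable _ _ _ iB) => //; first exact/measurable_EFinP.
move=> x _ /=; rewrite lee_fin (le_trans (gC x))// ler_norm//.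
Qed.

Lemma Rint_cvg C r (g_ : nat -> 'cV[R]_n -> R) g : (forall k, bsupp C r (g_ k)) ->
  measurable_fun setT (g : borel_mx n 1 -> R) ->
  {ae leb, forall x, g_ k x @[k --> \oo] --> g x} ->
  Rint (g_ k) @[k --> \oo] --> Rint g.
Proof.
move=> g_C mg g_g.
have mB := @measurable_cbox R n r.
have bC : bsupp `|C| r (fun x => `|C| * \1_(cbox r) x).
  split; last by move=> x; rewrite ger0_norm// mulr_ge0.
  by apply: measurable_funM => //; exact: measurable_indic.
have iC := bsupp_integrable bC.
have := @dominated_convergence _ _ R leb setT measurableT (fun k => EFin \o g_ k) (EFin \o g)
  (EFin \o (fun x => `|C| * \1_(cbox r) x)).
case => //.
- by move=> k; apply/measurable_EFinP; case: (g_C k).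
- exact/measurable_EFinP.
- by apply: (ae_imp g_g) => x gx _; apply/cvg_EFin => //; exact: nearW.
- apply: aeW => x k _ /=; rewrite lee_fin; case: (g_C k) => _ /(_ x) /le_trans; apply.
  by rewrite ler_wpM2r// ler_norm.
move=> ig _ H; apply: fine_cvg.
by rewrite fineK//; exact: integrable_fin_num.
Qed.

Lemma Rint_translate (a : 'cV[R]_n) g : measurable_fun setT (g : borel_mx n 1 -> R) ->
  Rint (fun x => g (x + a)) = Rint g.
Proof.
move=> mg; congr fine; rewrite [LHS]integralE [RHS]integralE; congr (_ - _)%E.
  have mp : measurable_fun (setT : set (borel_mx n 1)) ((EFin \o g)^\+%E : borel_mx n 1 -> \bar R).
    exact/measurable_funepos/measurable_EFinP.
  have H := ge0_integral_translate a mp (funepos_ge0 _).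
  by apply: eq_trans (eq_trans H _); apply: eq_integral => x _; rewrite !funeposE.
have mp : measurable_fun (setT : set (borel_mx n 1)) ((EFin \o g)^\-%E : borel_mx n 1 -> \bar R).
  exact/measurable_funeneg/measurable_EFinP.
have H := ge0_integral_translate a mp (funeneg_ge0 _).
by apply: eq_trans (eq_trans H _); apply: eq_integral => x _; rewrite !funenegE.
Qed.

Lemma RintD C r C' r' f g : bsupp C r f -> bsupp C' r' g ->
  Rint (fun x => f x + g x) = Rint f + Rint g.
Proof. by move=> bf bg; apply: RintegralD => //; [exact: (bsupp_integrable bf)|exact: (bsupp_integrable bg)]. Qed.

Lemma RintB C r C' r' f g : bsupp C r f -> bsupp C' r' g ->
  Rint (fun x => f x - g x) = Rint f - Rint g.
Proof. by move=> bf bg; apply: RintegralB => //; [exact: (bsupp_integrable bf)|exact: (bsupp_integrable bg)]. Qed.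

Lemma bsuppM C r g (M : R) w : bsupp C r g -> measurable_fun setT (w : borel_mx n 1 -> R) ->
  (forall x, `|w x| <= M) -> bsupp (C * M) r (fun x => g x * w x).
Proof.
move=> [mg gC] mw wM; split; first exact: measurable_funM.
move=> x; rewrite normrM mulrAC; apply: ler_pM => //.
Qed.

(** Distance to the complement of [V], capped at 1 so that the supremum is finite even if [V] is the
    whole space. *)
Definition inner_dist (V : set 'cV[R]_n) x : R :=
  sup [set r | 0 <= r <= 1 /\ forall y, enorm (x - y) < r -> V y].

Lemma inner_dist_sup (V : set 'cV[R]_n) x : has_sup [set r : R | 0 <= r <= 1 /\ forall y, enorm (x - y) < r -> V y].
Proof.
split; last by exists 1 => r [/andP[]].
by exists 0; split; [rewrite lexx ler01|move=> y; rewrite ltNge enorm_ge0].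
Qed.

Lemma inner_dist_ge (V : set 'cV[R]_n) x r : 0 <= r <= 1 -> (forall y, enorm (x - y) < r -> V y) -> r <= inner_dist V x.
Proof. by move=> r01 H; apply: ub_le_sup => //; exact: (inner_dist_sup V x).2. Qed.

Lemma inner_dist_le (V : set 'cV[R]_n) x c : (forall r, 0 <= r <= 1 -> (forall y, enorm (x - y) < r -> V y) -> r <= c) ->
  inner_dist V x <= c.
Proof. by move=> H; apply: ge_sup; [exact: (inner_dist_sup V x).1|move=> r [r01 rV]; exact: H]. Qed.

Lemma inner_dist_ge0 (V : set 'cV[R]_n) x : 0 <= inner_dist V x.
Proof. by apply: inner_dist_ge => [|y]; [rewrite lexx ler01|rewrite ltNge enorm_ge0]. Qed.

Lemma inner_dist_lip (V : set 'cV[R]_n) : elipschitz (inner_dist V : _ -> R^o) 1.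
Proof.
have H x y : inner_dist V x - inner_dist V y <= enorm (x - y).
  rewrite lerBlDr; apply: inner_dist_le => r /andP[r0 r1] rV.
  have [rxy|rxy] := leP r (enorm (x - y)); first by rewrite (le_trans rxy)// lerDl inner_dist_ge0.
  rewrite -lerBlDl; apply: inner_dist_ge.
    by rewrite subr_ge0 ltW//= (le_trans _ r1)// lerBlDr lerDl enorm_ge0.
  move=> z; rewrite ltrBrDr => yz; apply: rV; rewrite (le_lt_trans (enorm_triangle y _ _))//.
  by rewrite addrC.
by move=> x y; rewrite mul1r ler_norml H andbT lerNl opprB enormBC H.
Qed.

Lemma inner_dist_out (V : set 'cV[R]_n) x : ~ V x -> inner_dist V x = 0.
Proof.
move=> Vx; apply/eqP; rewrite eq_le inner_dist_ge0 andbT; apply: inner_dist_le => r /andP[r0 _] rV.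
by rewrite leNgt; apply/negP => r0'; apply: Vx; apply: rV; rewrite subrr enorm0.
Qed.

Lemma inner_dist_gt0 (V : set 'cV[R]_n) x : open V -> V x -> 0 < inner_dist V x.
Proof.
move=> oV Vx; have /nbhs_eball[e e0 eV] := open_nbhs_nbhs (conj oV Vx).
apply: (@lt_le_trans _ _ (Num.min 1 e)); first by rewrite lt_min ltr01.
apply: inner_dist_ge; first by rewrite ge_min lexx /= andbT le_min ler01 ltW.
by move=> y xy; apply: eV; rewrite (lt_le_trans xy)// ge_min lexx orbT.
Qed.

(** Lipschitz functions approximate the indicators of bounded open sets, so [w] has integral zero
    over each of them. Its positive and negative parts are then densities of measures that agree on
    the open sets, which are stable under intersection and generate the Borel sets. *)
Lemma test_zero (M : R) w : measurable_fun setT (w : borel_mx n 1 -> R) -> (forall x, `|w x| <= M) ->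
  (forall zeta L C r, elipschitz (zeta : _ -> R^o) L -> bsupp C r zeta ->
    Rint (fun x => zeta x * w x) = 0) ->
  {ae leb, forall x, w x = 0}.
Proof.
move=> mw wM H.
have oO (N : nat) : open [set x : 'cV[R]_n | enorm x < N%:R].
  by apply: (@open_comp _ _ (@enorm R n 1 : _ -> R^o) [set t | t < N%:R]) => [x _|];
    [exact: continuous_enorm|exact: open_lt].
have RV (V : set 'cV[R]_n) (N : nat) : open V -> V `<=` [set x | enorm x < N%:R] ->
    Rint (fun x => \1_V x * w x) = 0.
  move=> oV VN.
  (* These increase to the indicator of [V]. *)
  pose z (k : nat) x : R := Num.min 1 (k%:R * inner_dist V x).
  have z0 k x : 0 <= z k x by rewrite le_min ler01 mulr_ge0 ?inner_dist_ge0.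
  have zL k : elipschitz (z k : _ -> R^o) k%:R.
    move=> x y; rewrite (@le_trans _ _ `|k%:R * inner_dist V x - k%:R * inner_dist V y|)//.
      rewrite /z; have [h1|h1] := leP 1 (k%:R * inner_dist V x);
        have [h2|h2] := leP 1 (k%:R * inner_dist V y); rewrite ?subrr ?normr0//;
        rewrite ler_norml; apply/andP; have := ler_norm (k%:R * inner_dist V x - k%:R * inner_dist V y);
        have := ler_norm (- (k%:R * inner_dist V x - k%:R * inner_dist V y)); rewrite normrN;
        split; lra.
    rewrite -mulrBr normrM ger0_norm// ler_wpM2l//.
    by have := inner_dist_lip V x y; rewrite mul1r.
  have mz k : measurable_fun setT (z k : borel_mx n 1 -> R).
    by apply: continuous_measurable_mx; exact: (elipschitz_cont (zL k)).
  have bz k : bsupp 1 N%:R (z k).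
    split => // x; rewrite mul1r ger0_norm// indicE.
    case: (boolP (x \in _)) => xN; first by rewrite ge_min lexx.
    rewrite /z inner_dist_out ?mulr0 ?ge_min ?lexx ?orbT// => /VN /= xN'.
    move/negP: xN; apply; rewrite inE; apply/cboxP => //.
    by rewrite (le_trans (mxnorm_le_enorm _))// ltW.
  have mV : measurable (V : set (borel_mx n 1)) by exact: sub_sigma_algebra.
  have : Rint (fun x => z k x * w x) @[k --> \oo] --> Rint (fun x => \1_V x * w x).
    apply: (Rint_cvg (C := 1 * M) (r := N%:R)).
    - by move=> k; exact: bsuppM.
    - by apply: measurable_funM => //; exact: measurable_indic.
    - apply: aeW => x; apply: cvgMl; rewrite indicE; case: (boolP (x \in V)) => xV /=.
        have d0 : 0 < inner_dist V x by apply: inner_dist_gt0 => //; rewrite inE in xV.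
        apply: cvg_near_cst; near=> k; rewrite /z; apply/eqP; rewrite eq_minl.
        rewrite -ler_pdivrMr//; have B := archi_boundP (divr_ge0 ler01 (ltW d0)).
        rewrite (le_trans (ltW B))// ler_nat.
        by near: k; exact: nbhs_infty_ge.
      apply: cvg_near_cst; apply: nearW => k; rewrite /z inner_dist_out ?mulr0; last first.
        by move=> Vx; move/negP: xV; apply; rewrite inE.
      by apply/eqP; rewrite eq_minr.
  under eq_fun do rewrite (H _ _ _ _ (zL _) (bz _)).
  by move=> /(cvg_unique (@Rhausdorff R)); apply; exact: cvg_cst.
have Hae (N : nat) : {ae leb, forall x, enorm x < N%:R -> w x = 0}.
  pose O : set (borel_mx n 1) := [set x : 'cV[R]_n | enorm x < N%:R].
  have mO : measurable O by apply: sub_sigma_algebra; exact: oO.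
  (* On a ball both parts of [w] define finite measures, as uniqueness of measures requires. *)
  pose wp x := (\1_O x * w x).
  have mwp : measurable_fun setT (wp : borel_mx n 1 -> R).
    by apply: measurable_funM => //; exact: measurable_indic.
  have bwp : bsupp M N%:R wp.
    split => // x; rewrite /wp indicE; case: (boolP (x \in _)) => xO; last first.
      by rewrite mul0r normr0 mulr_ge0// (le_trans _ (wM x)).
    rewrite mul1r indicE mem_set ?mulr1//; apply/cboxP => //.
    by rewrite (le_trans (mxnorm_le_enorm _))// ltW//; rewrite inE in xO.
  have iwp := bsupp_integrable bwp.
  have mp := measurable_funepos (measurable_int _ iwp).
  have mn := measurable_funeneg (measurable_int _ iwp).
  have p0 x := funepos_ge0 (EFin \o wp) x; have n0 x := funeneg_ge0 (EFin \o wp) x.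
  pose m1 : {measure set (borel_mx n 1) -> \bar R} := density_measure leb mp p0.
  pose m2 : {measure set (borel_mx n 1) -> \bar R} := density_measure leb mn n0.
  have ip : leb.-integrable setT (EFin \o wp)^\+%E by exact: integrable_funepos.
  have im : leb.-integrable setT (EFin \o wp)^\-%E by exact: integrable_funeneg.
  have Heq A : measurable A -> m1 A = m2 A.
    move: A; apply: (@measure_unique _ R (borel_mx n 1) (@open 'cV[R]_n) (fun=> setT) _ _ _ _ m1 m2) => //.
    - by move=> A1 A2 oA1 oA2; exact: openI.
    - by move=> _; exact: openT.
    - by apply/seteqP; split => // x _; exists 0%N.
    - move=> U oU.
      have mU : measurable (U : set (borel_mx n 1)) by exact: sub_sigma_algebra.
      have oV : open (U `&` O : set 'cV[R]_n) by apply: openI => //; exact: oO.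
      have := RV _ N oV (@subIsetr _ _ _).
      rewrite (_ : (fun x => _) = wp \_ U); last first.
        apply/funext => x; rewrite /wp patchE indicI.
        by rewrite /= !indicE; case: (x \in U); rewrite ?mul1r ?mul0r.
      rewrite -Rintegral_mkcond /Rintegral integralE.
      have fp : (\int[leb]_(x in U) ((EFin \o wp)^\+ x))%E \is a fin_num.
        by apply: integrable_fin_num => //; exact: integrableS ip.
      have fn : (\int[leb]_(x in U) ((EFin \o wp)^\- x))%E \is a fin_num.
        by apply: integrable_fin_num => //; exact: integrableS im.
      rewrite fineB// => /eqP; rewrite subr_eq0 => /eqP E.
      by have := congr1 EFin E; rewrite (fineK fp) (fineK fn); exact.
    - by move=> k; rewrite /m1 /density_measure/= -ge0_fin_numE ?integral_ge0//; exact: integrable_fin_num.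
  have := integral_ae_eq measurableT ip mn (fun E _ mE => Heq E mE).
  move=> /ae_imp; apply => x /(_ I) /= E xN.
  move: E; rewrite funeposE funenegE /= /wp indicE mem_set// mul1r -!EFin_max => -[].
  by have [h1|h1] := leP (w x) 0; have [h2|h2] := leP (- w x) 0; lra.
have := ae_foralln Hae; move=> /ae_imp; apply => x Hx.
by apply: (Hx (Num.bound (enorm x))); rewrite archi_boundP// enorm_ge0.
Unshelve. all: by end_near. Qed.

End bounded_support.

(** * Additivity of directional derivatives almost everywhere *)

Section ae_linear.
Context {R : realType} (n : nat).
Implicit Types (f : 'cV[R]_n -> R^o) (x u v : 'cV[R]_n).
Notation leb := (@leb R n).
Notation Rint g := (Rintegral leb setT g).
Let t_ (k : nat) : R := k.+1%:R^-1.

Let t_gt0 k : 0 < t_ k. Proof. by rewrite invr_gt0. Qed.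
Let t_le1 k : t_ k <= 1. Proof. by rewrite invf_le1// ler1n. Qed.

(** Zero where the derivative does not exist, which makes it bounded and Borel measurable
    everywhere. *)
Definition dder f v x : R := \1_(dset f v) x * 'D_v f x.

Lemma dderE f v x : derivable f x v -> dder f v x = 'D_v f x.
Proof. by move=> dx; rewrite /dder indicE mem_set// mul1r. Qed.

Lemma quo_cvg f v x : dset f v x -> quo f v x (t_ k) @[k --> \oo] --> 'D_v f x.
Proof.
move=> dfv; apply/cvgrPdist_le => e e0.
have /quoP/(_ e e0)[r r0 rH] : derivable f x v /\ 'D_v f x = 'D_v f x by [].
near=> k; rewrite distrC; apply: rH; rewrite gtr0_norm ?t_gt0//=.
by near: k; exact: near_infty_natSinv_lt (PosNum r0).
Unshelve. all: by end_near. Qed.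

Lemma continuous_quo f L v t : elipschitz f L -> continuous ((quo f v)^~ t : _ -> R^o).
Proof.
move=> fL; apply: (@elipschitz_continuous _ _ _ _ _ (2 * L * `|t|^-1)) => x y.
exact: lipschitz_quo.
Qed.

Lemma measurable_quo f L v t : elipschitz f L -> measurable_fun setT ((quo f v)^~ t : borel_mx n 1 -> R).
Proof. by move=> fL; apply: continuous_measurable_mx; exact: continuous_quo fL. Qed.

Lemma dder_cvg f v x : dset f v x -> quo f v x (t_ k) @[k --> \oo] --> dder f v x.
Proof. by move=> dx; rewrite dderE//; exact: quo_cvg. Qed.

Lemma measurable_dder f L v : elipschitz f L -> measurable_fun setT (dder f v : borel_mx n 1 -> R).
Proof.
move=> fL; have mD := measurable_dset v fL.
apply: (@measurable_fun_cvg _ (borel_mx n 1) _ _ (fun k x => \1_(dset f v) x * quo f v x (t_ k))) => [k|x _].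
  by apply: measurable_funM; [exact: measurable_indic|exact: measurable_quo fL].
rewrite /dder indicE; case: (boolP (x \in _)) => xd; last first.
  by rewrite mul0r; under eq_fun do rewrite mul0r; exact: cvg_cst.
by apply: cvgMr; apply: quo_cvg; rewrite inE in xd.
Qed.

Lemma dder_le f L v x : elipschitz f L -> `|dder f v x| <= L * enorm v.
Proof.
move=> fL; rewrite /dder indicE; case: (boolP (x \in _)) => xd /=.
  by rewrite mul1r; apply: derive_le => //; rewrite inE in xd.
by rewrite mul0r normr0 (le_trans (normr_ge0 (quo f v x 0)))//; exact: quo_le.
Qed.

Lemma derivable_ae f L v : elipschitz f L -> {ae leb, forall x, derivable f x v}.
Proof.
move=> fL; exists (~` dset f v); split => //; last exact: dset_ae fL.
by apply: measurableC; exact: measurable_dset fL.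
Qed.

Lemma dder_test_cvg f L v C r (zeta_ : nat -> 'cV[R]_n -> R) zeta : elipschitz f L ->
  (forall k, bsupp C r (zeta_ k)) -> measurable_fun setT (zeta : borel_mx n 1 -> R) ->
  (forall x, zeta_ k x @[k --> \oo] --> zeta x) ->
  Rint (fun x => zeta_ k x * quo f v x (t_ k)) @[k --> \oo] --> Rint (fun x => zeta x * dder f v x).
Proof.
move=> fL bz mz zz; apply: (Rint_cvg (C := C * (L * enorm v)) (r := r)).
- move=> k; apply: bsuppM => //; first exact: measurable_quo fL.
  by move=> x; exact: quo_le.
- by apply: measurable_funM => //; exact: measurable_dder fL.
- apply: (ae_imp (derivable_ae v fL)) => x dx; by apply: cvgM => //; exact: dder_cvg.
Qed.

(** The quotient along [u + v] at [x] is the quotient along [v] at [x + t *: u] plus the quotient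
    along [u] at [x]. Under an integral the translation passes to the test function, which is
    continuous, so the limit [t -> 0] can be taken. *)
Lemma dderD_ae f L u v : elipschitz f L ->
  {ae leb, forall x, dder f (u + v) x - dder f v x - dder f u x = 0}.
Proof.
move=> fL.
have mD w := measurable_dder w fL.
have bD w x := dder_le w x fL.
apply: (@test_zero _ _ (L * enorm (u + v) + L * enorm v + L * enorm u)).
- by apply: measurable_funB => //; exact: measurable_funB.
- move=> x; rewrite (le_trans (ler_normB _ _))// lerD// (le_trans (ler_normB _ _))// lerD//.
move=> z Lz C r zL bz.
have mz := bz.1.
pose z_ k x := z (x - t_ k *: u).
(* A cube large enough for all the translates by [t_ k *: u], since [t_ k <= 1]. *)
have bz' : bsupp `|C| (`|r| + enorm u) z.
  split => // x; apply: (le_trans (bz.2 x)); rewrite (le_trans (ler_wpM2r _ (ler_norm _)))//.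
  rewrite ler_wpM2l// !indicE ler_nat; case: (boolP (x \in cbox r)) => //; rewrite !inE => xr.
  rewrite mem_set//= => i; have := xr i; rewrite !mxE.
  by have := ler_norm r; have := enorm_ge0 u => ? ? /andP[? ?]; apply/andP; split; lra.
have bz_ k : bsupp `|C| (`|r| + enorm u) (z_ k).
  split.
    apply: continuous_measurable_mx => x; apply: (@continuous_comp _ _ _ (fun x => x - t_ k *: u) (z : _ -> R^o)).
      by have := @continuous_affine R n 1 (- (t_ k *: u)) x; under eq_fun do rewrite scale1r.
    exact: (elipschitz_cont zL).
  move=> x; apply: (le_trans (bz.2 _)); rewrite (le_trans (ler_wpM2r _ (ler_norm _)))//.
  rewrite ler_wpM2l// !indicE ler_nat; case: (boolP (_ \in cbox r)) => //; rewrite !inE => xr.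
  rewrite mem_set//= => i; have := xr i; rewrite !mxE.
  have := ler_norm r.
  have : `|t_ k * u i 0| <= enorm u.
    by rewrite normrM gtr0_norm ?t_gt0// -[leRHS]mul1r ler_pM// ?coord_le_enorm// ltW.
  rewrite ler_norml => /andP[? ?] ? /andP[? ?]; apply/andP; split; lra.
have z_z x : z_ k x @[k --> \oo] --> z x.
  apply/cvgrPdist_le => e e0.
  have [Lu|Lu] := leP (Lz * enorm u) 0.
    apply: nearW => k; rewrite /z_ (le_trans (zL _ _))// opprB addrCA subrr addr0 enormZ gtr0_norm ?t_gt0//.
    by rewrite mulrCA (le_trans _ (ltW e0))// pmulr_rle0 ?t_gt0.
  near=> k.
  rewrite /z_ (le_trans (zL _ _))// opprB addrCA subrr addr0 enormZ gtr0_norm ?t_gt0//.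
  have tk : t_ k < e / (Lz * enorm u) by near: k; exact: near_infty_natSinv_lt (PosNum (divr_gt0 e0 Lu)).
  by rewrite mulrCA; move/ltW: tk; rewrite ler_pdivlMr.
have bM k w : bsupp (`|C| * (L * enorm w)) (`|r| + enorm u) (fun x => z x * quo f w x (t_ k)).
  by apply: bsuppM => //; [exact: measurable_quo fL|move=> x; exact: quo_le].
have bM_ k w : bsupp (`|C| * (L * enorm w)) (`|r| + enorm u) (fun x => z_ k x * quo f w x (t_ k)).
  by apply: bsuppM => //; [exact: measurable_quo fL|move=> x; exact: quo_le].
have E k : Rint (fun x => z x * quo f (u + v) x (t_ k)) =
    Rint (fun x => z_ k x * quo f v x (t_ k)) + Rint (fun x => z x * quo f u x (t_ k)).
  rewrite -(Rint_translate (t_ k *: u) (bM_ k v).1).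
  have bT : bsupp (`|C| * (L * enorm (u + v)) + `|C| * (L * enorm u)) (`|r| + enorm u)
      (fun x => z x * quo f (u + v) x (t_ k) - z x * quo f u x (t_ k)).
    split; first by apply: measurable_funB; [exact: (bM k _).1|exact: (bM k _).1].
    by move=> x; rewrite mulrDl (le_trans (ler_normB _ _))// lerD//; [exact: (bM k _).2|exact: (bM k _).2].
  have F x : z_ k (x + t_ k *: u) * quo f v (x + t_ k *: u) (t_ k) =
      z x * quo f (u + v) x (t_ k) - z x * quo f u x (t_ k).
    rewrite /z_ addrK -mulrBr /quo -mulrBl scalerDr addrA; congr (_ * (_ / _)); ring.
  rewrite [X in _ = X + _](_ : _ = Rint (fun x => z x * quo f (u + v) x (t_ k) - z x * quo f u x (t_ k))).
    by rewrite (RintB (bM k _) (bM k _)) subrK.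
  by congr (Rint _); exact: funext F.
have zc x : (fun _ : nat => z x) k @[k --> \oo] --> z x by exact: cvg_cst.
have c1 := dder_test_cvg (v := u + v) fL (fun=> bz') mz zc.
have c2 := dder_test_cvg (v := v) fL bz_ mz z_z.
have c3 := dder_test_cvg (v := u) fL (fun=> bz') mz zc.
have c4 : Rint (fun x => z_ k x * quo f v x (t_ k)) + Rint (fun x => z x * quo f u x (t_ k)) @[k --> \oo] -->
    Rint (fun x => z x * dder f v x) + Rint (fun x => z x * dder f u x) by apply: cvgD; [exact: c2|exact: c3].
move: c1; under eq_fun do rewrite E.
move=> /(cvg_unique (@Rhausdorff R) c4) => {c2 c3 c4} E'.
have bD' w : bsupp (`|C| * (L * enorm w)) (`|r| + enorm u) (fun x => z x * dder f w x).
  by apply: bsuppM => // x.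
have bDD : bsupp (`|C| * (L * enorm (u + v)) + `|C| * (L * enorm v)) (`|r| + enorm u)
    (fun x => z x * dder f (u + v) x - z x * dder f v x).
  split; first by apply: measurable_funB; [exact: (bD' _).1|exact: (bD' _).1].
  by move=> x; rewrite mulrDl (le_trans (ler_normB _ _))// lerD//; [exact: (bD' _).2|exact: (bD' _).2].
rewrite [LHS](_ : _ = Rint (fun x => z x * dder f (u + v) x - z x * dder f v x - z x * dder f u x)).
  by rewrite (RintB bDD (bD' _)) (RintB (bD' _) (bD' _)) -E' -addrA -opprD subrr.
by congr (Rint _); apply: funext => x; rewrite !mulrBr.
Unshelve. all: by end_near. Qed.

Lemma deriveD_dir_ae f L u v : elipschitz f L ->
  {ae leb, forall x, [/\ derivable f x (u + v), derivable f x u, derivable f x v &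
     'D_(u + v) f x = 'D_u f x + 'D_v f x]}.
Proof.
move=> fL.
have dA w := derivable_ae w fL.
apply: (ae_imp (ae_and (ae_and (dA (u + v)) (ae_and (dA u) (dA v))) (dderD_ae u v fL))).
move=> x [[d1 [d2 d3]]]; rewrite !dderE//= -addrA -opprD => /eqP.
by rewrite subr_eq0 [_ + 'D_u f x]addrC => /eqP.
Qed.

End ae_linear.

(** * Total differentiability *)

Section gradient.
Context {R : realType} (n : nat).
Implicit Types (f : 'cV[R]_n -> R^o) (x y g u v : 'cV[R]_n).
Notation leb := (@leb R n).

Definition is_grad f x g := forall e : R, 0 < e -> exists2 r : R, 0 < r &
  forall y, enorm (y - x) < r -> `|f y - f x - mxdot g (y - x)| <= e * enorm (y - x).

Lemma mxdot_delta g i : mxdot g (delta_mx i 0) = g i 0.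
Proof.
rewrite mxdotE (bigD1 i)//= big_ord1 !mxE !eqxx mulr1 big1 ?addr0// => j ji.
by rewrite big_ord1 !mxE (negbTE ji) mulr0.
Qed.

Lemma enorm_delta (i : 'I_n) : enorm (delta_mx i 0 : 'cV[R]_n) = 1.
Proof. by rewrite /enorm mxdot_delta mxE !eqxx sqrtr1. Qed.

Lemma is_grad_derive f x g v : is_grad f x g -> derivable f x v /\ 'D_v f x = mxdot g v.
Proof.
move=> fg; apply/quoP => e e0.
have v0 : 0 < enorm v + 1 by rewrite ltr_wpDl ?enorm_ge0.
have [r r0 rH] := fg (e / (enorm v + 1)) (divr_gt0 e0 v0).
exists (r / (enorm v + 1)); first exact: divr_gt0.
move=> t /andP[t0 tr].
have xtx : x + t *: v - x = t *: v by rewrite addrC addKr.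
have := rH (x + t *: v); rewrite xtx enormZ.
have tvr : `|t| * enorm v < r.
  rewrite (@le_lt_trans _ _ (`|t| * (enorm v + 1)))// ?ler_wpM2l// ?lerDl//.
  by rewrite -ltr_pdivlMr.
move=> /(_ tvr); rewrite mxdotZr => H.
rewrite /quo (_ : _ - _ = (f (x + t *: v) - f x - t * mxdot g v) / t); last first.
  by field; rewrite -normr_gt0.
rewrite normrM normfV ler_pdivrMr// (le_trans H)//.
rewrite (_ : e / (enorm v + 1) * (`|t| * enorm v) = e * `|t| * (enorm v / (enorm v + 1))); last by ring.
by rewrite ler_piMr ?(mulr_ge0 (ltW e0))// ler_pdivrMr// mul1r lerDl.
Qed.

Lemma is_grad_grad f x g : is_grad f x g -> grad f x = g.
Proof.
move=> fg; apply/colP => i; rewrite mxE /partial.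
by have [_ ->] := is_grad_derive (delta_mx i 0) fg; rewrite mxdot_delta.
Qed.

Fact mxdot_linear g : linear (mxdot g : 'cV[R]_n -> R^o).
Proof. by move=> a u v; rewrite mxdotDr mxdotZr. Qed.
HB.instance Definition _ g := GRing.isLinear.Build R _ _ _ (mxdot g : 'cV[R]_n -> R^o) (mxdot_linear g).

(** Links [is_grad], which uses Euclidean balls and an explicit vector, to the differentiability in
    the definition of [regular_frontier]. *)
Lemma differentiableP f x : differentiable f x <-> exists g, is_grad f x g.
Proof.
split => [/diff_locallyP[df dfo]|[g fg]].
  pose g : 'cV[R]_n := \col_i 'd f x (delta_mx i 0).
  have gE v : 'd f x v = mxdot g v.
    rewrite {1}(matrix_sum_delta v) linear_sum mxdotE; apply: eq_bigr => i _.
    by rewrite !big_ord1 linearZ /= mxE [RHS]mulrC.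
  exists g => e e0; move/eqaddoP : dfo => /(_ e e0)/nbhs_eball[r r0 rH].
  exists r => // y yr.
  have := rH (y - x); rewrite sub0r enormN => /(_ yr) /=.
  rewrite !fctE /= subrK gE opprD addrA => /le_trans; apply.
  by rewrite ler_wpM2l ?(ltW e0)// mxnorm_le_enorm.
have cg : continuous (mxdot g : 'cV[R]_n -> R^o) by exact: continuous_mxdot.
have fo : f \o shift x = cst (f x) + (mxdot g : 'cV[R]_n -> R^o) +o_ (0 : 'cV[R]_n) id.
  apply/eqaddoP => e e0; apply/nbhs_eball.
  have N0 : 0 < (n * 1)%:R + 1 :> R by rewrite ltr_wpDl.
  have [r r0 rH] := fg (e / ((n * 1)%:R + 1)) (divr_gt0 e0 N0).
  exists r => // y; rewrite sub0r enormN => yr.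
  have := rH (y + x); rewrite addrK => /(_ yr) H.
  rewrite !fctE /= opprD addrA (le_trans H)// mulrAC -mulrA ler_wpM2l ?(ltW e0)//.
  rewrite ler_pdivrMr// mulrC (le_trans (enorm_le_mxnorm _))// ler_wpM2r// lerDl//.
by apply/diff_locallyP; rewrite (diff_unique cg fo).
Qed.

Lemma derive_scale_dir f x u (c : R) : derivable f x u -> 'D_(c *: u) f x = c * 'D_u f x.
Proof.
move=> du; suff [] : derivable f x (c *: u) /\ 'D_(c *: u) f x = c * 'D_u f x by [].
apply/quoP => e e0.
have [->|c0] := eqVneq c 0.
  by exists 1 => // t _; rewrite scale0r /quo scaler0 addr0 subrr !mul0r subrr normr0 ltW.
have /quoP/(_ (e / `|c|)) : derivable f x u /\ 'D_u f x = 'D_u f x by [].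
rewrite divr_gt0 ?normr_gt0// => /(_ isT)[r r0 rH].
exists (r / `|c|) => [|t /andP[t0 tr]]; first by rewrite divr_gt0 ?normr_gt0.
have := rH (t * c); rewrite normrM mulr_gt0 ?normr_gt0// -?normr_gt0// -ltr_pdivlMr ?normr_gt0// => /(_ tr).
rewrite ler_pdivlMr ?normr_gt0// mulrC -normrM mulrBr; congr (`|_ - _| <= _).
by rewrite /quo scalerA invfM mulrC -!mulrA mulVf// mulr1.
Qed.

Lemma derive_comb_ae f L (v : 'cV[R]_n) : elipschitz f L ->
  {ae leb, forall x, derivable f x v /\ 'D_v f x = mxdot (grad f x) v}.
Proof.
move=> fL.
have H (s : seq 'I_n) : {ae leb, forall x, derivable f x (\sum_(i <- s) v i 0 *: delta_mx i 0) /\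
    'D_(\sum_(i <- s) v i 0 *: delta_mx i 0) f x = \sum_(i <- s) v i 0 * partial i f x}.
  elim: s => [|i s IH].
    apply: aeW => x; rewrite !big_nil; apply/quoP => e e0; exists 1 => // t _.
    by rewrite /quo scaler0 addr0 subrr mul0r subrr normr0 ltW.
  apply: (ae_imp (ae_and IH (ae_and (derivable_ae (delta_mx i 0) fL)
    (deriveD_dir_ae (v i 0 *: delta_mx i 0) (\sum_(i <- s) v i 0 *: delta_mx i 0) fL)))).
  move=> x [[_ E] [di [d1 d2 d3 dE]]]; rewrite !big_cons; split; first exact: d1.
  by rewrite dE E; congr (_ + _); exact: derive_scale_dir.
apply: (ae_imp (H (index_enum 'I_n))) => x [].
rewrite (_ : \sum_(i <- _) _ = v); last first.
  by rewrite [RHS]matrix_sum_delta; apply: eq_bigr => i _; rewrite big_ord1.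
move=> dv ->; split => //; rewrite mxdotE; apply: eq_bigr => i _.
by rewrite big_ord1 mxE mulrC.
Qed.

(** Finite nets of directions with grid coordinates; letting the mesh be [1 / M.+1] gives the
    countable family of directions on which Rademacher's theorem is based. *)
Lemma unit_grid (e : R) : 0 < e -> exists N : nat, forall w : 'cV[R]_n, enorm w = 1 ->
  exists c : {ffun 'I_n -> 'I_N}, enorm (w - \col_i ((c i)%:R * e - 1)) <= n%:R * e.
Proof.
move=> e0; exists (Num.truncn (2 / e)).+1 => w w1.
have wi i : -1 <= w i 0 <= 1 by rewrite -ler_norml -w1 coord_le_enorm.
have wp i : 0 <= (w i 0 + 1) / e by apply: divr_ge0; [have := wi i; lra|exact: ltW].
have ci i : (Num.truncn ((w i 0 + 1) / e)%R < (Num.truncn (2 / e)%R).+1)%N.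
  by rewrite ltnS; apply: le_truncn; apply: ler_wpM2r; [rewrite invr_ge0 ltW|have := wi i; lra].
exists [ffun i => Ordinal (ci i)].
rewrite (le_trans (enorm_le_sum _))// (@le_trans _ _ (\sum_(i < n) e))//; last first.
  by rewrite sumr_const card_ord mulr_natl.
apply: ler_sum => i _; rewrite big_ord1 !mxE ffunE /=.
have /andP[h1 h2] := truncn_itv (wp i).
move: h1; rewrite ler_pdivlMr// => h1; move: h2; rewrite ltr_pdivrMr// -natr1 => h2.
by rewrite ler_norml; apply/andP; split; lra.
Qed.

(** Almost every point has linear directional derivatives along all grid directions simultaneously.
    At such a point finitely many directions form a net of the sphere, and the Lipschitz bound
    transfers the expansion from the net to all directions, uniformly. *)
Theorem rademacher f L : elipschitz f L -> {ae leb, forall x, is_grad f x (grad f x)}.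
Proof.
move=> fL.
have H (N M : nat) (c : {ffun 'I_n -> 'I_N}) := derive_comb_ae (\col_i ((c i)%:R * M.+1%:R^-1 - 1)) fL.
have {H}H : {ae leb, forall x, forall (N M : nat) (c : {ffun 'I_n -> 'I_N}),
    let v := \col_i ((c i)%:R * M.+1%:R^-1 - 1) in
    derivable f x v /\ 'D_v f x = mxdot (grad f x) v}.
  apply: ae_foralln => N; apply: ae_foralln => M.
  have {}H := H N M.
  (* [ae_foralln] ranges over natural numbers, so the finite functions [c] are enumerated by
     [pickle]. *)
  pose P k x := if unpickle k is Some c then
    let v : 'cV[R]_n := \col_i (((c : {ffun 'I_n -> 'I_N}) i)%:R * M.+1%:R^-1 - 1) in
    derivable f x v /\ 'D_v f x = mxdot (grad f x) v else True.
  have HP k : {ae leb, forall x, P k x}.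
    by rewrite /P; case: (unpickle k) => [c|]; [exact: H|exact: aeW].
  by apply: (ae_imp (ae_foralln HP)) => x Px c; have := Px (pickle c); rewrite /P pickleK.
apply: (ae_imp H) => x {}H e e0; set g := grad f x.
(* Replacing a direction by a grid direction at distance [n * d] costs at most [A * d], from the
   variation of [f] and of [mxdot g]; [M] is chosen to make this at most [e / 2]. *)
pose A := (`|L| + enorm g) * n%:R.
have A0 : 0 <= A by rewrite mulr_ge0// addr_ge0// enorm_ge0.
pose M := Num.truncn (A / (e / 2)); pose d : R := M.+1%:R^-1.
have d0 : 0 < d by rewrite invr_gt0.
have Ad : A * d <= e / 2.
  rewrite ler_pdivrMr// mulrC -ler_pdivrMr ?divr_gt0//; apply/ltW/truncnS_gt.
have [N NH] := unit_grid d0.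
pose V (c : {ffun 'I_n -> 'I_N}) : 'cV[R]_n := \col_i ((c i)%:R * d - 1).
have /filter_forall Hr : forall c : {ffun 'I_n -> 'I_N}, \forall r \near 0^'+,
    forall t, 0 < `|t| < r -> `|quo f (V c) x t - mxdot g (V c)| <= e / 2.
  move=> c;  have [rc rc0 rcH] := (quoP f (V c) x _).1 (H N M c) (e / 2) (divr_gt0 e0 (ltr0Sn _ _)).
  near=> r => t /andP[t0 tr]; apply: rcH; rewrite t0 (lt_le_trans tr)//.
  by near: r; exact: nbhs_right_le.
have [r [r0 {}Hr]] : exists r : R, 0 < r /\ forall c : {ffun 'I_n -> 'I_N},
    forall t, 0 < `|t| < r -> `|quo f (V c) x t - mxdot g (V c)| <= e / 2.
  apply: (@filter_ex _ (0^'+ : set_system R)); apply: filterI; first exact: nbhs_right_gt.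
  exact: Hr.
exists r => // y yr; have [->|xy] := eqVneq y x.
  by rewrite !subrr mxdot0r subrr normr0 enorm0 mulr0.
set t := enorm (y - x) in yr *.
have t0 : 0 < t by rewrite enorm_gt0 subr_eq0.
pose w := t^-1 *: (y - x).
have w1 : enorm w = 1 by rewrite enormZ gtr0_norm ?invr_gt0// mulVf// gt_eqF.
have [c cH] := NH w w1; rewrite -[\col_i _]/(V c) in cH; set v := V c in cH.
have yE : y = x + t *: w by rewrite scalerA mulfV ?gt_eqF// scale1r addrC subrK.
have := Hr c t; rewrite gtr0_norm// t0 => /(_ yr); rewrite -/v => Hv.
have -> : f y - f x - mxdot g (y - x) = (f y - f (x + t *: v)) +
    t * (quo f v x t - mxdot g v) + t * mxdot g (v - w).
  have -> : mxdot g (y - x) = t * mxdot g w by rewrite {1}yE addrC addKr mxdotZr.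
  rewrite mxdotBr /quo; move: (f y : R) (f x : R) (f (x + t *: v) : R) (mxdot g v) (mxdot g w) => a b c' p q.
  by field; rewrite gt_eqF.
have h1 : `|f y - f (x + t *: v)| <= t * (`|L| * (n%:R * d)).
  rewrite (le_trans (fL _ _))// {1}yE opprD addrACA subrr add0r -scalerBr enormZ gtr0_norm//.
  rewrite mulrCA ler_wpM2l ?(ltW t0)// (le_trans (ler_wpM2r (enorm_ge0 _) (ler_norm L)))//.
  by rewrite ler_wpM2l.
have h2 : `|t * (quo f v x t - mxdot g v)| <= t * (e / 2).
  by rewrite normrM gtr0_norm// ler_wpM2l// (ltW t0).
have h3 : `|t * mxdot g (v - w)| <= t * (enorm g * (n%:R * d)).
  rewrite normrM gtr0_norm// ler_wpM2l ?(ltW t0)// (le_trans (normr_mxdot _ _))//.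
  by rewrite ler_wpM2l ?enorm_ge0// enormBC.
rewrite (le_trans (ler_normD _ _))// (le_trans (lerD (ler_normD _ _) (lexx _)))//.
rewrite (le_trans (lerD (lerD h1 h2) h3))//.
have -> : t * (`|L| * (n%:R * d)) + t * (e / 2) + t * (enorm g * (n%:R * d)) =
  t * (A * d + e / 2) by rewrite /A; ring.
by rewrite mulrC ler_wpM2r ?(ltW t0)// [leRHS](splitr e) lerD2r.
Unshelve. all: by end_near. Qed.

End gradient.

(** * Gauges of star bodies *)

Section sphere.
Context {R : realType} (n : nat).

Lemma closed_enorm_eq p q (c : R) : closed [set x : 'M[R]_(p, q) | enorm x = c].
Proof.
rewrite (_ : [set x | _] = (@enorm R p q : _ -> R^o) @^-1` [set c])//.
apply: closed_comp => [x _|]; first exact: continuous_enorm.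
exact: closed_eq.
Qed.

Lemma compact_esphere : compact (@esphere R n 1).
Proof.
rewrite (_ : @esphere R n 1 = (@trmx R 1 n) @` (@esphere R 1 n)); last first.
  apply/seteqP; split => [x x1|_ [x x1 <-]]; last by rewrite /esphere/= enorm_tr.
  by exists x^T; rewrite ?trmxK// /esphere/= enorm_tr.
apply: continuous_compact.
  apply: continuous_subspaceT; apply: (@elipschitz_continuous _ _ _ _ _ 1) => x y.
  by rewrite mul1r -raddfB/= (le_trans (mxnorm_le_enorm _))// enorm_tr.
apply: bounded_closed_compact; last exact: closed_enorm_eq.
exists 1; split => // M M1 x /= x1; rewrite (le_trans (mxnorm_le_enorm _))// x1 ltW//.
Qed.

End sphere.

Section gauges.
Context {R : realType} (n : nat).
Implicit Types (K : set 'cV[R]_n) (x y z g v : 'cV[R]_n) (p : 'cV[R]_n -> R^o).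

(** What is retained of the Minkowski functional of a Lipschitz star body; convexity is not among
    the conditions. The inverse of the radial function is globally Lipschitz and turns the body into
    a sublevel set. *)
Definition gauge p := [/\ forall t x, 0 <= t -> p (t *: x) = t * p x,
  exists2 c, 0 < c & forall x, c * enorm x <= p x & exists L, elipschitz p L].

Lemma sup_segment (a : R) : 0 <= a -> sup [set t : R | 0 <= t /\ t <= a] = a.
Proof.
move=> a0; apply/eqP; rewrite eq_le; apply/andP; split.
  by apply: ge_sup => [|t []//]; exists 0.
by apply: ub_le_sup; [exists a => t []|split].
Qed.

(** Radial and spherical increments are separated. With [w] and [v] the directions of [x] and [y],
    [enorm y * enorm (w - v)] is at most twice [enorm (x - y)], whence the factor 2. *)
Lemma homog_lipschitz p (C L : R) : (forall t x, 0 <= t -> p (t *: x) = t * p x) ->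
  (forall x, esphere x -> `|p x| <= C) ->
  (forall x y, esphere x -> esphere y -> `|p x - p y| <= L * enorm (x - y)) ->
  exists L', elipschitz p L'.
Proof.
move=> ph pC pL; exists (`|C| + 2 * `|L|) => x y.
have p0 : p 0 = 0 by rewrite -(scale0r 0) ph// mul0r.
have E z : z != 0 -> exists2 w, esphere w & z = enorm z *: w.
  move=> z0; have z1 : 0 < enorm z by rewrite enorm_gt0.
  exists ((enorm z)^-1 *: z); last by rewrite scalerA mulfV ?gt_eqF// scale1r.
  by rewrite /esphere/= enormZ gtr0_norm ?invr_gt0// mulVf// gt_eqF.
have pC' z : `|p z| <= `|C| * enorm z.
  have [->|z0] := eqVneq z 0; first by rewrite p0 normr0 mulr_ge0// enorm_ge0.
  have [w w1 zE] := E z z0; rewrite {1}zE ph ?enorm_ge0// normrM ger0_norm ?enorm_ge0//.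
  by rewrite mulrC ler_wpM2r ?enorm_ge0// (le_trans (pC _ w1))// ler_norm.
have CL : `|C| <= `|C| + 2 * `|L| by rewrite lerDl mulr_ge0.
have [->|x0] := eqVneq x 0.
  by rewrite p0 !sub0r normrN enormN (le_trans (pC' _))// ler_wpM2r ?enorm_ge0.
have [->|y0] := eqVneq y 0.
  by rewrite p0 !subr0 (le_trans (pC' _))// ler_wpM2r ?enorm_ge0.
have [w w1 xE] := E x x0; have [v v1 yE] := E y y0.
set a := enorm x in xE; set b := enorm y in yE.
have a0 : 0 <= a := enorm_ge0 _; have b0 : 0 <= b := enorm_ge0 _.
have ab : `|a - b| <= enorm (x - y) := ler_enorm_dist _ _.
have bwv : b * enorm (w - v) <= 2 * enorm (x - y).
  rewrite -{1}(ger0_norm b0) -enormZ scalerBr -yE (_ : b *: w = x - (a - b) *: w); last first.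
    by rewrite scalerBl -xE opprB addrCA subrr addr0.
  rewrite addrAC (le_trans (enormB _ _))// enormZ (_ : enorm w = 1)// mulr1.
  by rewrite [2 * _]mulrDl mul1r lerD2l.
rewrite {1}xE {1}yE !ph//.
have := pL _ _ w1 v1; have := pC _ w1; move: (p w : R) (p v : R) => c d cC cd.
rewrite (_ : a * c - b * d = (a - b) * c + b * (c - d)); last by ring.
rewrite (le_trans (ler_normD _ _))// [leRHS]mulrDl lerD//.
  by rewrite normrM mulrC ler_pM// (le_trans cC)// ler_norm.
rewrite normrM (ger0_norm b0) (le_trans (ler_wpM2l b0 cd))//.
rewrite mulrCA (le_trans (ler_wpM2r _ (ler_norm L))) ?mulr_ge0 ?enorm_ge0//.
by rewrite [2 * _]mulrC -mulrA ler_wpM2l.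
Qed.

Lemma star_gauge K : lipschitz_star_body K ->
  gauge (fun x => (radial K x)^-1) /\ K = [set x | (radial K x)^-1 <= 1].
Proof.
move=> [cK [K0 sK] rho_gt0 crho [L rhoL]].
have clK : closed K by apply: compact_closed => //; exact: norm_hausdorff.
have [r r0 Kr] : exists2 r : R, 0 < r & forall x, K x -> enorm x <= r.
  have [M [_ MK]] := compact_bounded cK.
  exists ((n * 1)%:R * (`|M| + 1) + 1); first by rewrite ltr_wpDl ?mulr_ge0// addr_ge0.
  move=> x Kx; rewrite (le_trans (enorm_le_mxnorm _))// -[leLHS]addr0 lerD// ler_wpM2l//.
  by apply: MK => //; rewrite ltr_pwDr// ler_norm.
(* At the origin every scalar is admissible and [sup] of an unbounded set is 0, so that
   [(radial K 0)^-1 = 0] is the correct value of the gauge. *)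
have radial0 : radial K 0 = 0.
  rewrite /radial sup_out// => -[_ [u /(_ (`|u| + 1))]].
  by rewrite /= scaler0 => /(_ (conj (addr_ge0 (normr_ge0 _) ler01) K0)); have := ler_norm u; lra.
have S x : x != 0 -> has_sup [set t : R | 0 <= t /\ K (t *: x)].
  move=> x0; split; first by exists 0; rewrite /= scale0r.
  exists (r / enorm x) => t [t0 /Kr]; rewrite enormZ ger0_norm//.
  by rewrite ler_pdivlMr// enorm_gt0.
have KE x : x != 0 -> forall t, 0 <= t -> K (t *: x) <-> t <= radial K x.
  move=> x0 t t0; split => [Kt|tr]; first by apply: ub_le_sup; [case: (S x x0)|split].
  have rK : K (radial K x *: x).
    have : closed [set t : R^o | K (t *: x)].
      rewrite (_ : [set t | _] = (fun t : R^o => t *: x) @^-1` K)//.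
      apply: closed_comp => // s _; exact: scalel_continuous.
    move=> clS; apply: clS; apply: (closureS _ (closure_sup (S x x0).1 (S x x0).2)).
    by move=> s [].
  have [->|t1] := eqVneq t 0; first by rewrite scale0r.
  have r1 : 0 < radial K x by rewrite (lt_le_trans _ tr)// lt_def t1.
  have := sK _ (t / radial K x) rK; rewrite scalerA divfK ?gt_eqF//; apply.
  by rewrite divr_ge0 ?(ltW r1)//= ler_pdivrMr// mul1r.
have radialZ x s : 0 < s -> radial K (s *: x) = radial K x / s.
  move=> s0; have [->|x0] := eqVneq x 0; first by rewrite scaler0 radial0 mul0r.
  have r1 : 0 <= radial K x by apply/(KE x x0); rewrite // scale0r.
  rewrite {1}/radial -[RHS](sup_segment (divr_ge0 r1 (ltW s0))).
  congr (sup _); apply/seteqP; split => t /= [t0].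
    by rewrite scalerA => /KE; rewrite mulr_ge0 ?(ltW s0)// ler_pdivlMr// => H; split => //; exact: H.
  rewrite ler_pdivlMr// => tr; split => //; rewrite scalerA; apply/(KE x x0) => //.
  by rewrite mulr_ge0// ltW.
have pZ t x : 0 <= t -> (radial K (t *: x))^-1 = t * (radial K x)^-1.
  rewrite le_eqVlt => /predU1P[<-|t0]; first by rewrite scale0r radial0 invr0 mul0r.
  by rewrite radialZ// invf_div.
(* Compactness of the sphere bounds the radial function below, which turns its Lipschitz bound [L]
   into [L / m ^+ 2] for its inverse. *)
have [m m0 mK] : exists2 m : R, 0 < m & forall x, esphere x -> m <= radial K x.
  have [E|/set0P E] := eqVneq (@esphere R n 1) set0.
    by exists 1 => // x; rewrite E.
  have [c cE cmin] := compact_EVT_min E (@compact_esphere R n) crho.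
  by exists (radial K c) => [|x xE]; [apply: rho_gt0; rewrite inE in cE|apply: cmin; rewrite inE].
have x_n0 x : esphere x -> x != 0 by rewrite -enorm_gt0 => ->.
have r_gt0 x : x != 0 -> 0 < radial K x.
  move=> x0; have e0 : 0 < enorm x by rewrite enorm_gt0.
  have := rho_gt0 ((enorm x)^-1 *: x); rewrite radialZ ?invr_gt0// /esphere/= enormZ.
  rewrite gtr0_norm ?invr_gt0// mulVf ?gt_eqF// => /(_ erefl).
  by rewrite invrK pmulr_lgt0.
split; last first.
  apply/seteqP; split => [x Kx|x xK] /=.
    have [->|x0] := eqVneq x 0; first by rewrite radial0 invr0 ler01.
    have r1 : 1 <= radial K x by apply/(KE x x0); rewrite // scale1r.
    by rewrite invf_le1// (lt_le_trans ltr01).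
  have [->//|x0] := eqVneq x 0.
  by rewrite -[x]scale1r; apply/(KE x x0) => //; move: xK; rewrite /= invf_le1 ?r_gt0.
split => //.
  exists r^-1; first by rewrite invr_gt0.
  move=> x; have [->|x0] := eqVneq x 0; first by rewrite enorm0 radial0 invr0 mulr0.
  have rx := r_gt0 x x0.
  have /Kr : K (radial K x *: x) by apply/(KE x x0) => //; exact: ltW.
  rewrite enormZ gtr0_norm// => H.
  by rewrite -[leRHS]mul1r ler_pdivlMr// -mulrA ler_pdivrMl// mulr1 mulrC.
apply: (@homog_lipschitz _ m^-1 (L / m ^+ 2)) => [//|x x1|x y x1 y1].
  by rewrite gtr0_norm ?invr_gt0 ?rho_gt0// lef_pV2 ?posrE ?rho_gt0// mK.
have rx := rho_gt0 x x1; have ry := rho_gt0 y y1.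
rewrite (_ : _ - _ = (radial K y - radial K x) / (radial K x * radial K y)); last first.
  by field; rewrite !gt_eqF.
rewrite normrM normfV [`|_ * _|]gtr0_norm ?mulr_gt0// ler_pdivrMr ?mulr_gt0//.
rewrite distrC (le_trans (rhoL _ _ x1 y1))//.
have m2 : m ^+ 2 <= radial K x * radial K y by rewrite expr2 ler_pM ?(ltW m0)// mK.
have Lxy : 0 <= L * enorm (x - y) := le_trans (normr_ge0 _) (rhoL _ _ x1 y1).
rewrite (_ : L * enorm (x - y) = L / m ^+ 2 * enorm (x - y) * m ^+ 2); last first.
  by field; rewrite gt_eqF.
by rewrite ler_wpM2l// mulrAC divr_ge0// ltW// exprn_gt0.
Qed.

End gauges.

(** * Borel structure of the set of differentiability *)

Section gradient_set.
Context {R : realType} (n : nat).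
Implicit Types (f : 'cV[R]_n -> R^o) (x y z g v : 'cV[R]_n).

(** Differentiability at a fixed precision and scale. The set of such points is closed, and its
    members with a common slope and scale make up the nearly flat boundary pieces. *)
Definition flat f (e : R) g (r : R) x := forall y, enorm (y - x) < r ->
  `|f y - f x - mxdot g (y - x)| <= e * enorm (y - x).

Lemma flatS f e e' g g' r r' x : flat f e g r x -> r' <= r -> e + enorm (g - g') <= e' -> flat f e' g' r' x.
Proof.
move=> H rr' ee' y yr; have := H y (lt_le_trans yr rr') => {}H.
rewrite (_ : _ - _ = (f y - f x - mxdot g (y - x)) + mxdot (g - g') (y - x)); last first.
  by rewrite mxdotBl addrA subrK.
rewrite (le_trans (ler_normD _ _))// (le_trans (lerD H (normr_mxdot _ _)))//.
by rewrite -mulrDl ler_wpM2r ?enorm_ge0.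
Qed.

Lemma flat_slope f e e' g g' r r' x v : 0 < r -> 0 < r' -> v != 0 -> flat f e g r x -> flat f e' g' r' x ->
  `|mxdot (g - g') v| <= (e + e') * enorm v.
Proof.
move=> r0 r'0 v0 H H'; have v1 : 0 < enorm v by rewrite enorm_gt0.
have [t t0 [tr tr']] : exists2 t, 0 < t & t * enorm v < r /\ t * enorm v < r'.
  have m0 : 0 < Num.min r r' by rewrite lt_min r0.
  exists (Num.min r r' / 2 / enorm v); first by rewrite !divr_gt0.
  rewrite divfK ?gt_eqF//.
  have h1 : Num.min r r' <= r by rewrite ge_min lexx.
  have h2 : Num.min r r' <= r' by rewrite ge_min lexx orbT.
  by split; lra.
have E : x + t *: v - x = t *: v by rewrite addrC addKr.
have := H (x + t *: v); have := H' (x + t *: v).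
rewrite E enormZ gtr0_norm// => /(_ tr') h' /(_ tr) h.
rewrite -(ler_pM2l t0) -{1}(gtr0_norm t0) -normrM -mxdotZr mxdotBl.
rewrite mulrCA [e + e']addrC mulrDl.
rewrite (_ : _ - _ = (f (x + t *: v) - f x - mxdot g' (t *: v)) - (f (x + t *: v) - f x - mxdot g (t *: v))).
  by rewrite (le_trans (ler_normB _ _))// lerD.
by move: (f (x + t *: v) : R) (f x : R) => a b; ring.
Qed.

(** Both approximations are compared in the direction [g - g'], where the difference of slopes is
    the squared norm. *)
Lemma flat_dist f e e' g g' r r' x : 0 <= e -> 0 <= e' -> 0 < r -> 0 < r' ->
  flat f e g r x -> flat f e' g' r' x -> enorm (g - g') <= e + e'.
Proof.
move=> e0 e'0 r0 r'0 H H'; have [->|v0] := eqVneq (g - g') 0; first by rewrite enorm0 addr_ge0.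
have := flat_slope r0 r'0 v0 H H'; rewrite -sqr_enorm ger0_norm ?sqr_ge0// expr2.
by rewrite ler_pM2r// enorm_gt0.
Qed.

Lemma closed_flat f L e g r : elipschitz f L -> closed (flat f e g r).
Proof.
move=> fL; rewrite (_ : flat f e g r = \bigcap_(v in [set v | enorm v < r])
    [set x | `|f (x + v) - f x - mxdot g v| <= e * enorm v]).
  apply: closed_bigI => v _ /=.
  apply: (@closed_comp _ _ (fun x => `|f (x + v) - f x - mxdot g v|) [set y | y <= e * enorm v]).
    move=> x _; apply: (@elipschitz_continuous _ _ _ R^o _ (L + L)) => {}x y.
    rewrite (le_trans (ler_dist_dist _ _))// mulrDl.
    rewrite (_ : _ - _ = (f (x + v) - f (y + v)) - (f x - f y)).
      by rewrite (le_trans (ler_normB _ _))// lerD// (le_trans (fL _ _))// opprD addrACA subrr addr0.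
    by move: (f (x + v) : R) (f x : R) (f (y + v) : R) (f y : R) => a b c d; ring.
  exact: closed_le.
apply/seteqP; split => x /= H.
  by move=> v /= vr; have := H (x + v); rewrite [x + v]addrC addrK; apply.
by move=> y yr; have := H (y - x) yr; rewrite /= [x + _]addrC subrK.
Qed.

Lemma rational_approx g (e : R) : 0 < e -> exists q : 'cV[rat]_n, enorm (g - map_mx ratr q) <= e.
Proof.
move=> e0; have n0 : 0 < (n%:R : R) + 1 by rewrite ltr_wpDl.
have d0 : 0 < e / (n%:R + 1) by rewrite divr_gt0.
have H i : exists k : rat, `|g i 0 - ratr k| < e / (n%:R + 1).
  have /rat_in_itvoo[k] : g i 0 - e / (n%:R + 1) < g i 0 + e / (n%:R + 1) by rewrite ltrD2l; lra.
  by rewrite in_itv/= => kx; exists k; rewrite distrC ltr_distl.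
have [q qH] := choice H.
exists (\col_i q i); rewrite (le_trans (enorm_le_sum _))//.
rewrite (@le_trans _ _ (\sum_(i < n) e / (n%:R + 1)))//.
  by apply: ler_sum => i _; rewrite big_ord1 !mxE ltW.
rewrite sumr_const card_ord -[leLHS]mulr_natl mulrCA ler_piMr ?(ltW e0)//.
by rewrite ler_pdivrMr// mul1r lerDl.
Qed.

Definition gradset f := [set x | exists g, is_grad f x g].

(** Rational slopes and radii make the description countable. Conversely, approximate slopes with
    errors [e] and [e'] differ by at most [e + e'], so they converge, and the limit is a
    gradient. *)
Lemma gradsetE f : gradset f =
  \bigcap_k \bigcup_(qj : 'cV[rat]_n * nat) flat f k.+1%:R^-1 (map_mx ratr qj.1) qj.2.+1%:R^-1.
Proof.
apply/seteqP; split => [x [g fg] k _|x H].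
  have k0 : 0 < (k.+1%:R^-1 / 2 : R) by rewrite divr_gt0 ?invr_gt0.
  have [r r0 rH] := fg _ k0; have [q qH] := rational_approx g k0.
  exists (q, Num.truncn r^-1) => //=; apply: (flatS rH).
    by rewrite invf_ple ?posrE// ltW// truncnS_gt.
  by rewrite [leRHS]splitr lerD2l.
pose Q i (e u : R) := exists g r, [/\ 0 < r, flat f e g r x & g i 0 = u].
have exQ e : 0 < e -> exists g r, 0 < r /\ flat f e g r x.
  move=> e0; have [[q j] _ qH] := H (Num.truncn e^-1) I.
  exists (map_mx ratr q), (j.+1%:R^-1); rewrite invr_gt0; split => //.
  apply: (flatS qH) => //; rewrite subrr enorm0 addr0 invf_ple ?posrE// ltW// truncnS_gt//.
have Ql i : exists l, forall e u, 0 < e -> Q i e u -> `|u - l| <= e.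
  apply: cauchy_net => [e e0|e e' u u' e0 e'0 [g [r [r0 h <-]]] [g' [r' [r'0 h' <-]]]].
    by have [g [r [r0 h]]] := exQ e e0; exists (g i 0), g, r.
  apply: le_trans (flat_dist (ltW e0) (ltW e'0) r0 r'0 h h').
  by have := coord_le_enorm (g - g') i 0; rewrite !mxE.
have [l lH] := choice Ql.
exists (\col_i l i) => e e0.
have n0 : 0 < (n%:R : R) + 1 by rewrite ltr_wpDl.
have d0 : 0 < e / (n%:R + 1) by rewrite divr_gt0.
have [g [r [r0 h]]] := exQ _ d0; exists r => //; apply: (flatS h) => //.
rewrite [leRHS](_ : e = e / (n%:R + 1) + n%:R * (e / (n%:R + 1))); last by field; rewrite gt_eqF.
rewrite lerD2l (le_trans (enorm_le_sum _))//.
rewrite (@le_trans _ _ (\sum_(i < n) e / (n%:R + 1)))//.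
  by apply: ler_sum => i _; rewrite big_ord1 !mxE; apply: lH => //; exists g, r.
by rewrite sumr_const card_ord -[leLHS]mulr_natl.
Qed.

Lemma measurable_gradset f L : elipschitz f L -> measurable (gradset f : set (borel_mx n 1)).
Proof.
move=> fL; rewrite gradsetE; apply: bigcapT_measurable => k.
apply: countable_bigcupT_measurable => [|[q j]]; first exact: countableP.
by apply: closed_borel; exact: closed_flat fL.
Qed.

Lemma gradset_ae f L : elipschitz f L -> {ae leb n, forall x, gradset f x}.
Proof. by move=> /rademacher /ae_imp; apply => x fx; exists (grad f x). Qed.

(* [grad] is only meaningful where the partial derivatives exist; [lgrad] replaces
   the missing ones by 0, which makes it Borel measurable for Lipschitz [f]. *)
Definition lgrad f x : 'cV[R]_n := \col_i dder f (delta_mx i 0) x.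

Lemma lgradE f x g : is_grad f x g -> lgrad f x = g.
Proof.
move=> fg; apply/colP => i; rewrite mxE.
have [df dE] := is_grad_derive (delta_mx i 0) fg.
by rewrite dderE// dE mxdot_delta.
Qed.

Lemma measurable_lgrad f L : elipschitz f L -> measurable_fun setT (lgrad f : borel_mx n 1 -> borel_mx n 1).
Proof.
move=> fL; apply: measurable_fun_mx => i j.
rewrite (_ : (fun x => _) = dder f (delta_mx i 0)); last by apply/funext => x; rewrite mxE.
exact: measurable_dder fL.
Qed.

End gradient_set.

Section gauge_theory.
Context {R : realType} (n : nat) (p : 'cV[R]_n -> R^o) (hp : gauge p).
Implicit Types (x y z g v : 'cV[R]_n).
Notation K := [set x | p x <= 1].

Lemma gaugeZ t x : 0 <= t -> p (t *: x) = t * p x. Proof. by case: hp => + _ _; apply. Qed.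

Lemma gauge0 : p 0 = 0. Proof. by rewrite -(scale0r 0) gaugeZ// mul0r. Qed.

Lemma gauge_lip : exists2 L, 0 < L & elipschitz p L.
Proof.
case: hp => _ _ [L pL]; exists (`|L| + 1); first by rewrite ltr_wpDl.
by move=> x y; rewrite (le_trans (pL x y))// ler_wpM2r ?enorm_ge0// (le_trans (ler_norm L))// lerDl.
Qed.

Lemma gauge_ge : exists2 c, 0 < c & forall x, c * enorm x <= p x. Proof. by case: hp. Qed.

Lemma gauge_ge0 x : 0 <= p x.
Proof. by have [c c0 cp] := gauge_ge; rewrite (le_trans _ (cp x))// mulr_ge0 ?(ltW c0)// enorm_ge0. Qed.

Lemma gauge_gt0 x : x != 0 -> 0 < p x.
Proof.
by have [c c0 cp] := gauge_ge => x0; rewrite (lt_le_trans _ (cp x))// mulr_gt0// enorm_gt0.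
Qed.

Lemma gauge_n0 x : 0 < p x -> x != 0.
Proof. by apply: contraTneq => ->; rewrite gauge0 ltxx. Qed.

Lemma gauge_continuous : continuous p.
Proof. by have [L _ pL] := gauge_lip; exact: elipschitz_cont pL. Qed.

Lemma gauge_radial : (0 < n)%N -> radial K = fun x => (p x)^-1.
Proof.
move=> n0; apply/funext => x; rewrite /radial; have [->|x0] := eqVneq x 0.
  rewrite gauge0 invr0 sup_out// => -[_ [u /(_ (`|u| + 1))]].
  rewrite /= scaler0 gauge0 ler01 => /(_ (conj (addr_ge0 (normr_ge0 _) ler01) isT)).
  by have := ler_norm u; lra.
have px := gauge_gt0 x0.
have p0 : 0 <= (p x)^-1 by rewrite invr_ge0 ltW.
rewrite -[RHS](sup_segment p0); congr (sup _); apply/seteqP; split => t /= [t0];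
  by rewrite gaugeZ// -[(p x)^-1]mul1r ler_pdivlMr.
Qed.

Lemma gauge_frontier : frontier K = [set x | p x = 1].
Proof.
have oK : open [set x | p x < 1].
  by apply: (@open_comp _ _ p [set t : R | t < 1]) => [x _|]; [exact: gauge_continuous|exact: open_lt].
have cK : closed K.
  by apply: (@closed_comp _ _ p [set t : R | t <= 1]) => [x _|]; [exact: gauge_continuous|exact: closed_le].
rewrite /frontier -(closure_id K).1//; apply/seteqP; split => x /=.
  move=> [x1 xi]; apply/eqP; rewrite eq_le x1 leNgt; apply/negP => x1'; apply: xi.
  by apply: (filterS _ (open_nbhs_nbhs (conj oK x1'))) => y /ltW.
move=> x1; split; rewrite ?x1// => /nbhs_eball[r r0 rH].
have x0 : 0 < enorm x by rewrite enorm_gt0; apply: gauge_n0; rewrite x1.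
have d0 : 0 < r / 2 / enorm x by rewrite !divr_gt0.
set d := r / 2 / enorm x in d0.
have dr : enorm (x - (1 + d) *: x) < r.
  rewrite scalerDl scale1r opprD addrA subrr add0r enormN enormZ gtr0_norm//.
  by rewrite divfK ?gt_eqF// ltr_pdivrMr// ltr_pMr// ltr1n.
have := rH _ dr; rewrite /= gaugeZ ?addr_ge0 ?(ltW d0)// x1 mulr1; lra.
Qed.

Lemma gauge_is_grad_scale x g t : 0 < t -> is_grad p x g -> is_grad p (t *: x) g.
Proof.
move=> t0 pg e e0; have [r r0 rH] := pg e e0; exists (t * r) => [|y yr]; first exact: mulr_gt0.
have [z yE] : exists z, y = t *: z by exists (t^-1 *: y); rewrite scalerA mulfV ?gt_eqF// scale1r.
move: yr; rewrite yE -scalerBr enormZ gtr0_norm// ltr_pM2l// => /rH.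
by rewrite !gaugeZ ?(ltW t0)// mxdotZr -!mulrBr normrM gtr0_norm// mulrCA ler_pM2l.
Qed.

Lemma gauge_euler x g : is_grad p x g -> mxdot g x = p x.
Proof.
move=> pg; have [_ <-] := is_grad_derive x pg.
suff [] : derivable p x x /\ 'D_x p x = p x by [].
apply/quoP => e e0; exists 1 => // t /andP[t0]; rewrite ltr_norml => /andP[t1 t2].
rewrite /quo -{1}(scale1r x) -scalerDl gaugeZ; last by lra.
have -> : ((1 + t) * p x - p x) / t = p x.
  by move: (p x : R) => a; field; rewrite -normr_gt0.
by rewrite subrr normr0 ltW.
Qed.

(** The gauge is positive along [v] and along [- v], so no linear map approximates it at the
    origin. *)
Lemma gauge_grad_n0 x g : (0 < n)%N -> is_grad p x g -> x != 0.
Proof.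
move=> n0 pg; apply/eqP => x0; rewrite {}x0 in pg.
pose v : 'cV[R]_n := const_mx 1.
have v0 : v != 0.
  by apply/eqP => /colP/(_ (Ordinal n0)); rewrite !mxE => /eqP; rewrite oner_eq0.
have pv := gauge_gt0 v0; have pNv : 0 < p (- v) by rewrite gauge_gt0// oppr_eq0.
have v1 : 0 < enorm v by rewrite enorm_gt0.
have e0 : 0 < p v / 2 / enorm v by rewrite !divr_gt0.
have [r r0 rH] := pg _ e0.
have [t t0 tr] : exists2 t, 0 < t & enorm (t *: v) < r.
  exists (r / 2 / enorm v); first by rewrite !divr_gt0.
  by rewrite enormZ gtr0_norm ?divr_gt0// divfK ?gt_eqF//; lra.
have := rH (t *: v); have := rH (- (t *: v)).
rewrite !subr0 gauge0 !subr0 enormN => /(_ tr) h1 /(_ tr) h2.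
move: h1 h2; rewrite -scalerN !gaugeZ ?(ltW t0)// !mxdotZr mxdotNr enormZ (gtr0_norm t0).
rewrite -!mulrBr !normrM (gtr0_norm t0) mulrCA divfK ?gt_eqF// !ler_pM2l//.
move: (p v : R) (p (- v) : R) (mxdot g v) pv pNv => a b c a0 b0.
by rewrite !ler_norml => /andP[? ?] /andP[? ?]; lra.
Qed.

Lemma gauge_regular : (0 < n)%N -> regular_frontier K = [set z | p z = 1 /\ gradset p z].
Proof.
move=> n0; rewrite /regular_frontier gauge_frontier gauge_radial//.
apply/seteqP; split => z /= [z1 dz]; split => //.
  apply/differentiableP; rewrite (_ : p = (fun x => ((p x)^-1)^-1)); last by apply/funext => x; rewrite invrK.
  by apply: differentiableV => //; rewrite z1 invr1 oner_eq0.
by apply: differentiableV; [apply/differentiableP|rewrite z1 oner_eq0].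
Qed.

(** On the level [p = 1] the gradient of the radial function is [- g], so the sign in [outer_normal]
    cancels. *)
Lemma gauge_normal z g : (0 < n)%N -> p z = 1 -> is_grad p z g ->
  outer_normal K z = (enorm g)^-1 *: g.
Proof.
move=> n0 z1 pg; rewrite /outer_normal gauge_radial//.
have -> : grad (fun x => (p x)^-1) z = - g.
  apply/colP => i; rewrite !mxE /partial.
  have [dp pE] := is_grad_derive (delta_mx i 0) pg.
  rewrite deriveV//; last by rewrite z1 oner_eq0.
  by rewrite pE z1 expr1n invr1 mxdot_delta scaleN1r.
by rewrite enormN scaleNr scalerN opprK.
Qed.

End gauge_theory.

(** * Area formula on the boundary of a star body *)

Section householder.
Context {R : realType} (s : nat).
Implicit Types (x y g : 'cV[R]_(1 + s)).

Lemma enorm_col_mx (t : R) (b : 'cV[R]_s) : enorm (col_mx t%:M b) ^+ 2 = t ^+ 2 + enorm b ^+ 2.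
Proof.
rewrite !sqr_enorm /mxdot tr_col_mx mul_row_col mxtraceD; congr (_ + _).
by rewrite tr_scalar_mx -scalar_mxM mxtrace_scalar expr2.
Qed.

Lemma col_mx_coord x : x = col_mx (x 0 0)%:M (dsubmx x).
Proof.
rewrite -[LHS]vsubmxK; congr col_mx; apply/matrixP => i j.
by rewrite (ord1 i) (ord1 j) !mxE eqxx mulr1n; congr (x _ _); exact: val_inj.
Qed.

Lemma enorm_dsub x : enorm (dsubmx x) <= enorm x.
Proof.
rewrite -(@ler_pXn2r _ 2) ?nnegrE ?enorm_ge0// [in leRHS](col_mx_coord x) enorm_col_mx.
by rewrite lerDr sqr_ge0.
Qed.

Lemma enorm_le_coord_dsub x : enorm x <= `|x 0 0| + enorm (dsubmx x).
Proof.
rewrite -(@ler_pXn2r _ 2) ?nnegrE ?enorm_ge0 ?addr_ge0 ?enorm_ge0//.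
rewrite [in leLHS](col_mx_coord x) enorm_col_mx sqrrD real_normK ?num_real// addrAC lerDl.
by rewrite mulrn_wge0// mulr_ge0 ?enorm_ge0.
Qed.

(** The reflection exchanging [g / enorm g] and the first basis vector; if these coincide then
    [w = 0] and the map is the identity. It provides coordinates whose first one measures the
    component along [g]. *)
Lemma householder g : g != 0 -> exists T : 'cV[R]_(1 + s) -> 'cV[R]_(1 + s),
  [/\ forall a x y, T (a *: x + y) = a *: T x + T y, forall x, enorm (T x) = enorm x &
   forall x, T x 0 0 = mxdot g x / enorm g].
Proof.
move=> g0; have g1 : 0 < enorm g by rewrite enorm_gt0.
pose e0 : 'cV[R]_(1 + s) := delta_mx 0 0.
have e1 : mxdot e0 e0 = 1 by rewrite -sqr_enorm enorm_delta expr1n.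
pose h := (enorm g)^-1 *: g.
have h1 : mxdot h h = 1.
  by rewrite -sqr_enorm enormZ gtr0_norm ?invr_gt0// mulVf ?gt_eqF// expr1n.
have [w wE] : exists w, w = h - e0 by exists (h - e0).
have ww : mxdot w w = - 2 * mxdot w e0.
  by rewrite wE !mxdotBl !mxdotBr h1 e1 (mxdotC e0 h); ring.
exists (fun x => x - (2 * mxdot w x / mxdot w w) *: w); split.
- move=> a x y; rewrite mxdotDr mxdotZr scalerBr scalerA.
  rewrite (_ : 2 * (a * mxdot w x + mxdot w y) / mxdot w w =
    a * (2 * mxdot w x / mxdot w w) + 2 * mxdot w y / mxdot w w); last by ring.
  by rewrite scalerDl opprD addrACA.
- move=> x; have [->|w0] := eqVneq w 0; first by rewrite scaler0 subr0.
  have ww0 : mxdot w w != 0 by rewrite -sqr_enorm expf_neq0// enorm_eq0.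
  apply/eqP; rewrite -(@eqrXn2 _ 2) ?enorm_ge0// !sqr_enorm; apply/eqP.
  rewrite mxdotBl !mxdotBr !mxdotZl !mxdotZr (mxdotC x w); field.
  exact: ww0.
- move=> x; have -> : mxdot g x / enorm g = mxdot e0 x + mxdot w x.
    by rewrite wE mxdotBl addrC subrK /h mxdotZl mulrC.
  have E y : y 0 0 = mxdot e0 y by rewrite mxdotC mxdot_delta.
  rewrite E mxdotBr mxdotZr (mxdotC e0 w); congr (_ + _).
  have [->|w0] := eqVneq w 0; first by rewrite !mxdot0l mulr0 oppr0.
  have ww0 : mxdot w w != 0 by rewrite -sqr_enorm expf_neq0// enorm_eq0.
  move: ww ww0; move: (mxdot w w) (mxdot w e0) (mxdot w x) => c d y -> d0.
  by field; apply: contra_neq d0 => ->; rewrite mulr0.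
Qed.

End householder.

Lemma is_grad_le (R : realType) n (f : 'cV[R]_n -> R^o) L x g : 0 <= L -> elipschitz f L ->
  is_grad f x g -> enorm g <= L.
Proof.
move=> L0 fL fg; have [->|g0] := eqVneq g 0; first by rewrite enorm0.
have [dg dE] := is_grad_derive g fg.
have := derive_le fL dg; rewrite dE -sqr_enorm ger0_norm ?sqr_ge0// expr2.
by rewrite ler_pM2r// enorm_gt0.
Qed.

Section cone.
Context {R : realType} (n : nat) (p : 'cV[R]_n -> R^o) (hp : gauge p).
Notation lam := (@lebesgue_cV R n).

(** The apex is excluded, since dividing by [p] is meaningless there. *)
Definition cone (D : set 'cV[R]_n) : set 'cV[R]_n := [set x | 0 < p x < 1 /\ D ((p x)^-1 *: x)].

Lemma open_gauge_lt c : open [set x | p x < c].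
Proof. by apply: (@open_comp _ _ p [set t : R | t < c]) => [x _|]; [exact: gauge_continuous|exact: open_lt]. Qed.

Lemma open_gauge_gt c : open [set x | c < p x].
Proof. by apply: (@open_comp _ _ p [set t : R | c < t]) => [x _|]; [exact: gauge_continuous|exact: open_gt]. Qed.

Lemma measurable_gauge : measurable_fun setT (p : borel_mx n 1 -> R).
Proof. by apply: continuous_measurable_mx; exact: gauge_continuous. Qed.

Lemma measurable_gauge_inv : measurable_fun setT (fun x : borel_mx n 1 => (p x)^-1).
Proof.
apply: measurable_fun_gt => c; rewrite setTI; have [c0|c0] := ltP c 0.
  rewrite (_ : [set x | _] = setT)//; apply/seteqP; split => // x _ /=.
  by rewrite (lt_le_trans c0)// invr_ge0 gauge_ge0.
rewrite (_ : [set x | _] = [set x | 0 < p x] `&` [set x | c * p x < 1]).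
  apply: measurableI; first by apply: sub_sigma_algebra; exact: open_gauge_gt.
  have := measurable_funM (@measurable_cst _ _ _ _ setT c) measurable_gauge.
  move=> /(_ measurableT _ (measurable_itv `]-oo, 1[)); rewrite setTI.
  by congr measurable; apply/seteqP; split => x /=; rewrite in_itv.
apply/seteqP; split => x /=.
  move=> cp; have p0 : 0 < p x.
    rewrite lt_def gauge_ge0// andbT; apply: contraTneq cp => ->.
    by rewrite invr0 -leNgt.
  by split => //; rewrite -ltr_pdivlMr// mul1r.
by move=> [p0]; rewrite -ltr_pdivlMr// mul1r.
Qed.

Lemma measurable_normalize : measurable_fun setT (fun x : borel_mx n 1 => (p x)^-1 *: (x : 'cV[R]_n) : borel_mx n 1).
Proof.
apply: measurable_fun_mx => i j.
rewrite (_ : (fun x : borel_mx n 1 => _) = (fun x : borel_mx n 1 => (p x)^-1 * (x : 'cV[R]_n) i j)).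
  by apply: measurable_funM; [exact: measurable_gauge_inv|exact: measurable_coord].
by apply/funext => x; rewrite mxE.
Qed.

Lemma measurable_cone (D : set (borel_mx n 1)) : measurable D -> measurable (cone D : set (borel_mx n 1)).
Proof.
move=> mD; rewrite (_ : cone D = ([set x | 0 < p x] `&` [set x | p x < 1]) `&`
    ((fun x : borel_mx n 1 => (p x)^-1 *: (x : 'cV[R]_n) : borel_mx n 1) @^-1` D)).
  apply: measurableI; last by rewrite -[X in measurable X]setTI; exact: measurable_normalize.
  by apply: sub_sigma_algebra; apply: openI; [exact: open_gauge_gt|exact: open_gauge_lt].
by apply/seteqP; split => x /=; [move=> [/andP[]]|move=> [[? ?] ?]; split => //; apply/andP].
Qed.

Lemma cone_bounded : exists2 r, 0 < r & forall x, p x <= 1 -> enorm x <= r.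
Proof.
have [c c0 cp] := gauge_ge hp; exists c^-1; first by rewrite invr_gt0.
by move=> x /(le_trans (cp x)); rewrite -ler_pdivlMl// mulr1.
Qed.

Definition slab (d : R) (D : set 'cV[R]_n) := [set x | exists t z, [/\ 0 <= t < d, D z & x = (1 + t) *: z]].

(** Dilating the cone by [1 + d] adds exactly the slab. The scaling of Lebesgue measure thus gives
    the volume of the slab without any integration. *)
Lemma slab_cone (d : R) (D : set (borel_mx n 1)) : 0 < d -> measurable D -> (forall z, D z -> p z = 1) ->
  (((1 + d) ^+ n)%:E * lam (cone D) = lam (cone D) + lam (slab d D))%E.
Proof.
move=> d0 mD D1; have d1 : 0 < 1 + d by rewrite addr_gt0.
rewrite -lebesgue_cV_scale//.
rewrite (borel_lebesgue_cV (measurable_cone mD)); congr (lam _ + lam _)%E.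
  apply/seteqP; split => [x []//|x xD]; split => //.
  exists ((1 + d)^-1 *: x); last by rewrite scalerA mulfV ?gt_eqF// scale1r.
  move: xD => [/andP[x0 x1] xD]; split.
    rewrite gaugeZ ?invr_ge0 ?(ltW d1)// mulr_gt0 ?invr_gt0//= ltr_pdivrMl// mulr1.
    by rewrite (lt_le_trans x1)// lerDl ltW.
  by rewrite gaugeZ ?invr_ge0 ?(ltW d1)// invfM invrK scalerA mulrAC mulfV ?gt_eqF// mul1r.
apply/seteqP; split => x.
  move=> [[y [/andP[y0 y1] yD] <-{x}] nx].
  have yz : y = p y *: ((p y)^-1 *: y) by rewrite scalerA mulfV ?gt_eqF// scale1r.
  have E : (p ((1 + d) *: y))^-1 *: ((1 + d) *: y) = (p y)^-1 *: y.
    by rewrite gaugeZ ?(ltW d1)// invfM scalerA mulrAC mulVf ?gt_eqF// mul1r.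
  exists ((1 + d) * p y - 1), ((p y)^-1 *: y); split => //.
    rewrite subr_ge0 ltrBlDr [d + 1]addrC gtr_pMr// y1 andbT leNgt; apply/negP => H; apply: nx.
    by split; [rewrite gaugeZ ?(ltW d1)// mulr_gt0|rewrite E].
  have -> : 1 + ((1 + d) * p y - 1) = (1 + d) * p y by move: (p y : R) => a; ring.
  by rewrite -scalerA -yz.
move=> [t [z [/andP[t0 td] Dz ->]]]; have t1 : 0 < 1 + t by lra.
have pz := D1 _ Dz; split.
  exists ((1 + d)^-1 *: ((1 + t) *: z)); last by rewrite scalerA mulfV ?gt_eqF// scale1r.
  have E : p ((1 + d)^-1 *: ((1 + t) *: z)) = (1 + d)^-1 * (1 + t).
    by rewrite !gaugeZ ?invr_ge0 ?(ltW d1) ?(ltW t1)// pz mulr1.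
  split; rewrite E; first by rewrite mulr_gt0 ?invr_gt0//= ltr_pdivrMl// mulr1 ltrD2l.
  by rewrite [_^-1 *: ((1 + t) *: z)]scalerA scalerA mulVf ?scale1r// mulf_neq0 ?invr_eq0 ?gt_eqF.
by move=> [+ _]; rewrite gaugeZ ?(ltW t1)// pz mulr1 => /andP[_]; lra.
Qed.

End cone.

Lemma bernoulli_ge (R : realType) (e : R) n : 0 <= e -> n%:R * e <= (1 + e) ^+ n - 1.
Proof.
move=> e0; elim: n => [|n IH]; first by rewrite mul0r expr0 subrr.
have h : 1 <= (1 + e) ^+ n by rewrite exprn_ege1// lerDl.
rewrite exprS -natr1; have := ler_wpM2l e0 h; move: IH; move: ((1 + e) ^+ n) (n%:R : R) => a b; nra.
Qed.

Lemma bernoulli_le (R : realType) (e : R) n : 0 <= e -> (1 + e) ^+ n - 1 <= n%:R * e * (1 + e) ^+ n.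
Proof.
move=> e0; elim: n => [|n IH]; first by rewrite !mul0r expr0 subrr.
have h : 1 <= (1 + e) ^+ n by rewrite exprn_ege1// lerDl.
rewrite exprS -natr1.
have h1 : 0 <= (n%:R : R) by [].
have h2 : 0 <= e * e * (n%:R + 1) * (1 + e) ^+ n by rewrite !mulr_ge0// ?addr_ge0// (le_trans ler01).
move: IH h2; move: ((1 + e) ^+ n) (n%:R : R) => a b H h2.
have -> : (b + 1) * e * ((1 + e) * a) = b * e * a + e * a + e * e * (b + 1) * a by ring.
have -> : (1 + e) * a - 1 = (a - 1) + e * a by ring.
lra.
Qed.

Lemma col_mx00 (R : realType) s (t : R) (b : 'cV[R]_s) : col_mx t%:M b 0 0 = t.
Proof.
have -> : (0 : 'I_(1 + s)) = lshift s 0 by exact: val_inj.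
by rewrite col_mxEu mxE eqxx mulr1n.
Qed.

Section piece.
Context {R : realType} (s : nat) (s0 : (0 < s)%N).
Variables (p : 'cV[R]_(1 + s) -> R^o) (hp : gauge p).
Notation n := (1 + s)%N.
Notation lam := (@lebesgue_cV R n).
Notation H := (@hausdorff R n 1 s).
Notation alpha := (@hausdorff_density R s).

(** The arithmetic of [area_piece]: [lc], [ls], [lb], [hd] are the volumes of cone, slab and
    projected piece and the Hausdorff measure of the piece. Three distortions of order [n]
    accumulate, from the projection, from the slab and from Bernoulli's inequality, whence the
    exponent [3 * n]. *)
Lemma piece_real (e th N lc ls lb hd : R) : 0 < e -> e <= th -> th <= 2^-1 -> 0 < N ->
  0 <= lc -> 0 <= lb ->
  (1 + e) ^+ n * lc = lc + ls ->
  ls <= (1 - th)^-1 ^+ n * (N^-1 * e * lb) -> N^-1 * e * lb <= (1 - th)^-1 ^+ n * ls ->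
  alpha * lb <= hd -> hd <= (1 - th)^-1 ^+ s * (alpha * lb) ->
  (1 - th) ^+ (3 * n) * hd <= alpha * N * n%:R * lc /\
  (1 - th) ^+ (3 * n) * (alpha * N * n%:R) * lc <= hd.
Proof.
move=> e0 eth th2 N0 lc0 lb0 E1 ls1 ls2 hd1 hd2.
have a0 := @hausdorff_density_gt0 R s s0.
have q0 : 0 < 1 - th by lra.
set Q := (1 - th)^-1 in ls1 ls2 hd2.
have Q0 : 0 < Q by rewrite invr_gt0.
have Q1 : 1 <= Q by rewrite invf_ge1//; lra.
have eQ : 1 + e <= Q.
  rewrite -[leRHS]mul1r ler_pdivlMr//.
  have : 0 <= th * e by rewrite mulr_ge0// ltW// (lt_le_trans e0).
  by move=> h; rewrite mulrDl mulrBr mulrBr; lra.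
have ls_eq : ls = ((1 + e) ^+ n - 1) * lc by rewrite mulrBl mul1r E1 addrC addKr.
have h1 : n%:R * e * lc <= ls by rewrite ls_eq ler_wpM2r// bernoulli_ge// ltW.
have h2 : ls <= n%:R * e * Q ^+ n * lc.
  rewrite ls_eq ler_wpM2r// (le_trans (bernoulli_le _ (ltW e0)))//.
  by rewrite ler_wpM2l ?mulr_ge0 ?(ltW e0)// lerXn2r// ?nnegrE ?(ltW Q0)// addr_ge0// ltW.
have Qn : 1 <= Q ^+ n by rewrite exprn_ege1.
have Q3 : (1 - th) ^+ (3 * n) = (Q ^+ n ^+ 3)^-1 by rewrite -exprM mulnC -exprVn invrK.
have Qn0 : 0 < Q ^+ n by rewrite exprn_gt0.
have Qs : Q ^+ s <= Q ^+ n by rewrite ler_weXn2l.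
rewrite Q3; set A := Q ^+ n in h2 ls1 ls2 Qn Qn0 Qs *.
have A3 : 0 < A ^+ 3 by rewrite exprn_gt0.
have k1 : lb <= N * n%:R * A ^+ 2 * lc.
  have : N^-1 * e * lb <= A * (n%:R * e * A * lc).
    by rewrite (le_trans ls2)// ler_wpM2l// ltW.
  rewrite -ler_pdivlMl ?mulr_gt0 ?invr_gt0//.
  move=> /le_trans; apply; rewrite (_ : _ * (A * _) = N * n%:R * A ^+ 2 * lc)//.
  by field; rewrite !gt_eqF.
have k2 : N * n%:R * lc <= A * lb.
  have : n%:R * e * lc <= A * (N^-1 * e * lb) := le_trans h1 ls1.
  rewrite (_ : _ * lc = (N^-1 * e) * (N * n%:R * lc)); last by field; rewrite gt_eqF.
  rewrite (_ : A * _ = (N^-1 * e) * (A * lb)); last by ring.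
  by rewrite ler_pM2l// mulr_gt0// invr_gt0.
split.
  rewrite ler_pdivrMl// (le_trans hd2)// (le_trans (ler_wpM2r _ Qs))//.
    by rewrite mulr_ge0// ltW.
  rewrite (_ : _ * (_ * lc) = A * (alpha * (N * n%:R * A ^+ 2 * lc))); last by ring.
  by rewrite ler_pM2l// ler_pM2l.
rewrite -mulrA ler_pdivrMl// (_ : _ * lc = alpha * (N * n%:R * lc)); last by ring.
rewrite (le_trans (ler_wpM2l (ltW a0) k2))// mulrCA.
have hd0 : 0 <= hd by rewrite (le_trans _ hd1)// mulr_ge0// ltW.
rewrite (le_trans (ler_wpM2l (ltW Qn0) hd1))// ler_wpM2r//.
by rewrite -[leLHS]expr1 ler_weXn2l.
Qed.

(** Heart of the area formula. Orthogonally to [g] the piece projects almost isometrically, and the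
    slab over it is almost the sheared cylinder of height [e / enorm g] over the projection. The
    volume of the slab, known from the cone, therefore determines the measure of the piece. *)
Lemma area_piece : exists C0 : R, 0 < C0 /\ forall (e : R) g (D : set (borel_mx n 1)),
  0 < e -> C0 * e <= 2^-1 -> measurable D ->
  (forall z : 'cV[R]_n, D z -> p z = 1 /\ exists2 g', is_grad p z g' & enorm (g' - g) <= e) ->
  (forall z w : 'cV[R]_n, D z -> D w -> enorm (z - w) <= e /\ `|mxdot g (z - w)| <= e * enorm (z - w)) ->
  ((((1 - C0 * e) ^+ (3 * n))%:E * H D <= (alpha * enorm g * n%:R)%:E * lam (cone p D))%E /\
  (((1 - C0 * e) ^+ (3 * n) * (alpha * enorm g * n%:R))%:E * lam (cone p D) <= H D)%E).
Proof.
have [L L0 pL] := gauge_lip hp; have [R0 R00 pR0] := cone_bounded hp.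
(* [G] bounds [enorm g] from above, [K1] bounds its inverse, and [M] collects the errors in [XY].
   The equations keep the constants opaque for the arithmetic tactics. *)
have [G GE] : exists G, G = L + 1 by exists (L + 1).
have [K1 K1E] : exists K1, K1 = 2 * R0 by exists (2 * R0).
have G0 : 0 < G by rewrite GE addr_gt0.
have K10 : 0 < K1 by rewrite K1E mulr_gt0.
have [M ME] : exists M, M = (2 * K1 + 1) * (2 * (1 + R0 * G)) + (R0 * K1 + 1) * G.
  by exists ((2 * K1 + 1) * (2 * (1 + R0 * G)) + (R0 * K1 + 1) * G).
have M0 : 0 < M.
  have h1 : 0 < R0 * G by rewrite mulr_gt0.
  have h2 : 0 < R0 * K1 by rewrite mulr_gt0.
  by rewrite ME; apply: addr_gt0; rewrite mulr_gt0 ?mulr_gt0//; lra.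
exists (K1 + 1 + M); split; first by apply: addr_gt0 => //; exact: addr_gt0.
move=> e g D e0; have [th thE] : exists th, th = (K1 + 1 + M) * e by exists ((K1 + 1 + M) * e).
rewrite -thE => th2 mD Dg Dflat.
have [eth Ke Me] : [/\ e <= th, K1 * e <= th & M * e <= th].
  have [h1 h2] : 0 < K1 * e /\ 0 < M * e by rewrite !mulr_gt0.
  by rewrite thE !mulrDl mul1r; split; lra.
have [->|/set0P[z0 Dz0]] := eqVneq D set0.
  have -> : cone p set0 = set0 by apply/seteqP; split => // x [].
  by rewrite !outer_measure0 !mule0.
have D1 z : D z -> p z = 1 by case/Dg.
have DR z : D z -> enorm z <= R0 by move=> /D1 z1; apply: pR0; rewrite z1.
set N := enorm g.
have [N0 NG NK] : [/\ 0 < N, N <= G & 1 <= K1 * N].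
  have [pz0 [g' pg' gg']] := Dg _ Dz0.
  have gL := is_grad_le (ltW L0) pL pg'.
  have e1 : 1 <= enorm g' * R0.
    rewrite -[leLHS]pz0 -(gauge_euler hp pg') (le_trans (mxdot_le _ _))//.
    by rewrite ler_wpM2l ?enorm_ge0// DR.
  have NG : N <= G.
    by have := enormB g' (g' - g); rewrite opprB addrCA subrr addr0 -/N; lra.
  have gN : enorm g' <= N + e.
    by have := enormD g (g' - g); rewrite addrCA subrr addr0 -/N; lra.
  have NK : 1 <= K1 * N.
    have := ler_wpM2r (ltW R00) gN; have := Ke; rewrite K1E; move: (enorm g') e1 => c; nra.
  split => //; rewrite -(ltr_pM2l K10) mulr0; lra.
have g0 : g != 0 by rewrite -enorm_gt0.
have [T [TL Tn T0]] := householder g0; rewrite -/N in T0.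
have TB x y : T (x - y) = T x - T y by rewrite addrC -scaleN1r TL scaleN1r addrC.
have TZ a x : T (a *: x) = a *: T x.
  have T00 : T 0 = 0 by have := TB 0 0; rewrite !subrr.
  by have := TL a x 0; rewrite addr0 T00 addr0.
pose b z := dsubmx (T z).
have bB z w : b (z - w) = b z - b w by rewrite /b TB raddfB.
pose c := N^-1; have c0 : 0 < c by rewrite invr_gt0.
have cK : c <= K1 by rewrite /c -[leLHS]mul1r ler_pdivrMr.
(* In the rotated coordinates the first component hardly varies on [D], so the projection [b]
   shrinks distances by no more than the factor [1 - th]. *)
have F1 z w : D z -> D w -> `|T z 0 0 - T w 0 0| <= K1 * e * enorm (z - w).
  move=> Dz Dw; have [_ h] := Dflat _ _ Dz Dw.
  rewrite !T0 -mulrBl -mxdotBr normrM [`|N^-1|]gtr0_norm// mulrC.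
  rewrite (le_trans (ler_wpM2l (ltW c0) h))// mulrA ler_wpM2r ?enorm_ge0// ler_wpM2r// ltW//.
have F2 z w : D z -> D w -> (1 - th) * enorm (z - w) <= enorm (b z - b w).
  move=> Dz Dw; have := enorm_le_coord_dsub (T (z - w)); rewrite Tn -/(b (z - w)) bB TB.
  have -> : (T z - T w) 0 0 = T z 0 0 - T w 0 0 by rewrite !mxE.
  move=> h; have := F1 _ _ Dz Dw.
  have := ler_wpM2r (enorm_ge0 (z - w)) Ke; rewrite mulrBl mul1r; lra.
have F3 z w : enorm (b z - b w) <= enorm (z - w) by rewrite -bB (le_trans (enorm_dsub _))// Tn.
(* Euler's identity [mxdot g' z = p z = 1] places the piece near height [c = 1 / N], which is
   therefore the normal speed of the dilation. *)
have F4 z : D z -> `|T z 0 0 - c| <= R0 * K1 * e.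
  move=> Dz; have [pz [g' pg' gg']] := Dg _ Dz.
  rewrite T0 -[c]mul1r -mulrBl normrM [`|N^-1|]gtr0_norm// -pz -(gauge_euler hp pg') -mxdotBl.
  rewrite [leRHS]mulrAC ler_pM ?(ltW c0)//.
    by rewrite (le_trans (normr_mxdot _ _))// mulrC enormBC ler_pM ?enorm_ge0// DR.
have F6 z : D z -> enorm (b z) <= R0 by move=> Dz; rewrite (le_trans (enorm_dsub _))// Tn DR.
pose B := b @` D.
have q0 : 0 < 1 - th by lra.
have Q0 : 0 < (1 - th)^-1 by rewrite invr_gt0.
have HB : hausdorff s B = (alpha%:E * @lebesgue_cV R s B)%E.
  by apply: (hausdorff_lebesgue s0 (r := R0)) => _ [z Dz <-]; exact: F6.
have HD1 : (hausdorff s B <= H D)%E.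
  have := @lipschitz_hausdorff R _ n 1 s 1 s D id b 1 ltr01 _.
  rewrite image_id expr1n mul1e; apply => z w _ _; rewrite mul1r; exact: F3.
have HD2 : (H D <= ((1 - th)^-1 ^+ s)%:E * hausdorff s B)%E.
  have := @lipschitz_hausdorff R _ s 1 n 1 s D b id _ Q0 _.
  rewrite image_id; apply => z w Dz Dw; rewrite -ler_pdivrMl// invrK; exact: F2.
(* Slab and cylinder are parametrised by the same pairs [(z, t)], in the form that
   [lipschitz_hausdorff] compares. *)
pose S := [set zt : 'cV[R]_n * R | D zt.1 /\ 0 <= zt.2 < e].
pose X (zt : 'cV[R]_n * R) := (1 + zt.2) *: zt.1.
pose Y (zt : 'cV[R]_n * R) := col_mx (c * zt.2)%:M (b zt.1 + zt.2 *: b z0).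
have XS : X @` S = slab e D.
  apply/seteqP; split => [_ [[z t] [/= Dz te] <-]|_ [t [z [te Dz ->]]]]; first by exists t, z.
  by exists (z, t).
have YS : Y @` S = sheared_cylinder c e (b z0) B.
  apply/seteqP; split => [_ [[z t] [/= Dz te] <-]|_ [t [_ [te [z Dz <-] ->]]]].
    by exists t, (b z); split => //; exists z.
  by exists (z, t).
(* Up to the isometry [T], the increments of [X] and [Y] differ by at most [th] times those of [Y];
   so the comparison has Lipschitz constant [(1 - th)^-1] in both directions. *)
have XY i j : S i -> S j -> enorm (T (X i - X j) - (Y i - Y j)) <= th * enorm (Y i - Y j).
  case: i j => [z t] [w r] [/= Dz /andP[t0 te]] [/= Dw /andP[r0 re]].
  have yE : Y (z, t) - Y (w, r) = col_mx (c * (t - r))%:M (b z - b w + (t - r) *: b z0).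
    rewrite /Y /= opp_col_mx add_col_mx -raddfB/= -mulrBr; congr col_mx.
    by rewrite scalerBl opprD addrACA.
  have XE : T (X (z, t) - X (w, r)) = (1 + t) *: T z - (1 + r) *: T w by rewrite TB !TZ.
  rewrite XE yE; set u := b z - b w + _; set y := col_mx _ u.
  have y00 : y 0 0 = c * (t - r) by rewrite col_mx00.
  have dE : ((1 + t) *: T z - (1 + r) *: T w - y) 0 0 =
      (1 + r) * (T z 0 0 - T w 0 0) + (t - r) * (T z 0 0 - c).
    have gen (a1 a2 : R) (v1 v2 v3 : 'cV[R]_n) :
      (a1 *: v1 - a2 *: v2 - v3) 0 0 = a1 * v1 0 0 - a2 * v2 0 0 - v3 0 0 by rewrite !mxE.
    by rewrite gen y00; ring.
  have ddE : dsubmx ((1 + t) *: T z - (1 + r) *: T w - y) = (t - r) *: (b z - b z0) + r *: (b z - b w).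
    rewrite !raddfB /= !linearZ /= col_mxKd -/(b z) -/(b w) /u.
    by move: (b z) (b w) (b z0) => b1 b2 b3; apply/colP => k; rewrite !mxE; ring.
  rewrite (le_trans (enorm_le_coord_dsub _))// dE ddE.
  have ey := enorm_ge0 y.
  have tr : `|t - r| <= G * enorm y.
    have : c * `|t - r| <= enorm y.
      by rewrite -{1}(gtr0_norm c0) -normrM -y00 coord_le_enorm.
    rewrite /c mulrC ler_pdivrMr// mulrC => /le_trans; apply.
    by rewrite ler_wpM2r.
  have zw : enorm (z - w) <= 2 * (1 + R0 * G) * enorm y.
    have h1 := F2 _ _ Dz Dw; have h2 : enorm u <= enorm y by have := enorm_dsub y; rewrite col_mxKd.
    have h3 : enorm (b z - b w) <= enorm u + `|t - r| * R0.
      have := enormB u ((t - r) *: b z0); rewrite /u addrK => /le_trans; apply.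
      by rewrite lerD2l enormZ ler_wpM2l// F6.
    have h4 := ler_wpM2r (ltW R00) tr.
    have h5 : (1 - th) * enorm (z - w) >= 2^-1 * enorm (z - w) by rewrite ler_wpM2r ?enorm_ge0//; lra.
    rewrite (_ : 2 * _ * _ = 2 * (enorm y + G * enorm y * R0)); last by ring.
    lra.
  have h1 : `|(1 + r) * (T z 0 0 - T w 0 0)| <= 2 * (K1 * e * enorm (z - w)).
    rewrite normrM ger0_norm ?addr_ge0// ler_pM ?addr_ge0 ?F1//; lra.
  have h2 : `|(t - r) * (T z 0 0 - c)| <= `|t - r| * (R0 * K1 * e).
    by rewrite normrM ler_wpM2l// F4.
  have h3 : enorm ((t - r) *: (b z - b z0)) <= `|t - r| * e.
    rewrite enormZ ler_wpM2l// (le_trans (F3 _ _))//; have [//] := Dflat _ _ Dz Dz0.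
  have h4 : enorm (r *: (b z - b w)) <= e * enorm (z - w).
    by rewrite enormZ ger0_norm// ler_pM ?enorm_ge0 ?F3// ltW.
  apply: (@le_trans _ _ (2 * (K1 * e * enorm (z - w)) + `|t - r| * (R0 * K1 * e) +
      (`|t - r| * e + e * enorm (z - w)))).
    by rewrite lerD// (le_trans (ler_normD _ _) (lerD h1 h2), le_trans (enormD _ _) (lerD h3 h4)).
  rewrite (_ : _ + _ = e * ((2 * K1 + 1) * enorm (z - w) + (R0 * K1 + 1) * `|t - r|)); last by ring.
  apply: (@le_trans _ _ (e * (M * enorm y))); last by rewrite mulrA [e * M]mulrC ler_wpM2r.
  rewrite (_ : M * enorm y = (2 * K1 + 1) * (2 * (1 + R0 * G) * enorm y) +
    (R0 * K1 + 1) * (G * enorm y)); last by rewrite ME; ring.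
  have k1 : 0 <= 2 * K1 + 1 by lra.
  have k2 : 0 <= R0 * K1 + 1 by rewrite addr_ge0// mulr_ge0// ltW.
  by rewrite ler_wpM2l ?(ltW e0)// lerD// ler_wpM2l.
have XY1 i j : S i -> S j -> enorm (X i - X j) <= (1 - th)^-1 * enorm (Y i - Y j).
  move=> Si Sj; rewrite -Tn -[T _](subrK (Y i - Y j)) (le_trans (enormD _ _))//.
  rewrite (le_trans (lerD (XY _ _ Si Sj) (lexx _)))// -{2}[enorm (Y i - Y j)]mul1r -mulrDl.
  rewrite ler_wpM2r ?enorm_ge0// -[leRHS]mul1r ler_pdivlMr//.
  have := sqr_ge0 th; rewrite expr2; lra.
have XY2 i j : S i -> S j -> enorm (Y i - Y j) <= (1 - th)^-1 * enorm (X i - X j).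
  move=> Si Sj; rewrite -ler_pdivrMl// invrK -[in leRHS]Tn.
  have := enormB (T (X i - X j)) (T (X i - X j) - (Y i - Y j)).
  rewrite opprB addrCA subrr addr0 => h; have := XY _ _ Si Sj.
  by rewrite mulrBl mul1r; lra.
have th1 : e <= 1 by lra.
have slab_le x : slab e D x -> enorm x <= 2 * R0.
  move=> [t [z [/andP[t0 te] Dz ->]]]; rewrite enormZ ger0_norm ?addr_ge0//.
  by rewrite ler_pM ?enorm_ge0 ?addr_ge0 ?DR//; lra.
have cyl_le x : sheared_cylinder c e (b z0) B x -> enorm x <= c + R0 + R0.
  move=> [t [_ [/andP[t0 te] [z Dz <-] ->]]]; rewrite (le_trans (enorm_le_coord_dsub _))//.
  rewrite col_mx00 col_mxKd -addrA lerD//.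
    by rewrite ger0_norm ?mulr_ge0 ?(ltW c0)// ler_piMr ?(ltW c0)//; lra.
  rewrite (le_trans (enormD _ _))// lerD ?F6// enormZ ger0_norm// -[leRHS]mul1r.
  by rewrite ler_pM ?enorm_ge0 ?F6//; lra.
(* In dimension [n] the Hausdorff measure is a multiple of Lebesgue measure; the multiple is common
   to both sets and cancels at the end. *)
have HS := hausdorff_lebesgue (isT : (0 < n)%N) slab_le.
have HC := hausdorff_lebesgue (isT : (0 < n)%N) cyl_le.
have an0 := @hausdorff_density_gt0 R n isT.
have SC : (hausdorff n (slab e D) <= ((1 - th)^-1 ^+ n)%:E * hausdorff n (sheared_cylinder c e (b z0) B))%E.
  by rewrite -XS -YS; exact: lipschitz_hausdorff.
have CS : (hausdorff n (sheared_cylinder c e (b z0) B) <= ((1 - th)^-1 ^+ n)%:E * hausdorff n (slab e D))%E.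
  by rewrite -XS -YS; exact: lipschitz_hausdorff.
have finB m (A : set 'cV[R]_m) r : (forall x, A x -> enorm x <= r) -> exists2 l : R, 0 <= l & lebesgue_cV A = l%:E.
  move=> Ar; have fA : lebesgue_cV A \is a fin_num.
    by rewrite ge0_fin_numE ?outer_measure_ge0//; exact: (leb_bounded Ar).
  exists (fine (lebesgue_cV A)); last by rewrite fineK.
  by rewrite fine_ge0// outer_measure_ge0.
have [ls ls0 lsE] := finB _ _ _ slab_le.
have [lb lb0 lbE] : exists2 l : R, 0 <= l & lebesgue_cV B = l%:E.
  by apply: (finB _ _ R0) => _ [z Dz <-]; exact: F6.
have [lc lc0 lcE] : exists2 l : R, 0 <= l & lam (cone p D) = l%:E.
  by apply: (finB _ _ R0) => x [/andP[_ /ltW x1] _]; exact: pR0.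
have cylE := lebesgue_sheared_cylinder (b z0) B c0 e0.
rewrite HB lbE in HD1 HD2.
have [hd hdE] : exists hd : R, H D = hd%:E.
  exists (fine (H D)); rewrite fineK// ge0_fin_numE ?outer_measure_ge0//.
  by rewrite (le_lt_trans HD2)// -!EFinM ltry.
rewrite hdE -!EFinM !lee_fin in HD1 HD2.
rewrite HS HC cylE lbE lsE -!EFinM !lee_fin in SC CS.
have := slab_cone hp e0 mD D1; rewrite lcE lsE -EFinM -EFinD => -[E1].
rewrite hdE -!EFinM !lee_fin.
apply: (piece_real e0 eth th2 N0 lc0 lb0 E1) => //.
  by rewrite -(ler_pM2l an0) [leRHS]mulrCA.
by rewrite -(ler_pM2l an0) [leRHS]mulrCA.
Qed.

End piece.

Lemma lee_mul_chain (R : realType) (x y z : \bar R) (r t : R) : 0 <= r ->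
  (x <= r%:E * y)%E -> (y <= t%:E * z)%E -> (x <= (r * t)%:E * z)%E.
Proof. by move=> r0 xy yz; rewrite (le_trans xy)// EFinM -muleA lee_wpmul2l. Qed.

Lemma lee_mul_limit (R : realType) (x y : \bar R) (w : nat -> R) : (0 <= y)%E ->
  (forall N, (x <= (w N)%:E * y)%E) -> w @ \oo --> (1 : R) -> (x <= y)%E.
Proof.
case: y => [r| |//] r0 H wl; last by rewrite leey.
by apply: (lee_cvg_EFin H); rewrite -[X in _ --> X]mul1r; apply: cvgMl.
Qed.

(** An additive error that is small relative to a lower bound [w] of [a] becomes a multiplicative
    error in both directions. The slack [y] allows one factor to serve for [h] and for the norm at
    the same time. *)
Lemma close_ratio (R : realType) (a b w x y : R) : 0 < w -> 0 < x -> 0 < y -> 2 * x + 2 * y <= 2^-1 ->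
  w <= a -> `|a - b| <= x * w ->
  [/\ 0 < b, a <= (1 + (2 * x + 2 * y)) * b & b <= (1 + (2 * x + 2 * y)) * a].
Proof.
move=> w0 x0 y0 xy wa; rewrite ler_norml => /andP[ab1 ab2].
have xw : x * w <= x * a by rewrite ler_wpM2l// ltW.
have xa : x * a <= 4^-1 * a by rewrite ler_wpM2r//; lra.
have b2 : a <= 2 * b by lra.
have b0 : 0 < b by lra.
have xb : x * a <= x * (2 * b) by rewrite ler_wpM2l// ltW.
have yb : 0 <= y * b by rewrite mulr_ge0// ltW.
have ya : 0 <= y * a by rewrite mulr_ge0//; lra.
have xa0 : 0 <= x * a by rewrite mulr_ge0//; lra.
by split => //; rewrite mulrDl mul1r mulrDl -!mulrA; lra.
Qed.

(** * Summation over nearly flat pieces *)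

Section area.
Context {R : realType} (s : nat) (s0 : (0 < s)%N).
Variables (p : 'cV[R]_(1 + s) -> R^o) (hp : gauge p).
Notation n := (1 + s)%N.
Notation lam := (@lebesgue_cV R n).
Notation alpha := (@hausdorff_density R s).

Definition hsd : set (borel_mx n 1) -> \bar R := borel_restriction (@borel_hausdorff R n 1 s).
HB.instance Definition _ := Measure.on hsd.

Definition rfront : set (borel_mx n 1) := [set z | p z = 1 /\ gradset p z].

Lemma measurable_rfront : measurable rfront.
Proof.
have [L _ pL] := gauge_lip hp.
apply: measurableI; last exact: measurable_gradset pL.
by apply: closed_borel; apply: (@closed_comp _ _ p [set 1]) => [x _|]; [exact: gauge_continuous|exact: closed_eq].
Qed.

Definition good_piece (e : R) g (D : set (borel_mx n 1)) := [/\ measurable D,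
  (forall z : 'cV[R]_n, D z -> p z = 1 /\ exists2 g', is_grad p z g' & enorm (g' - g) <= e) &
  (forall z w : 'cV[R]_n, D z -> D w -> enorm (z - w) <= e /\ `|mxdot g (z - w)| <= e * enorm (z - w))].

(** At each point of [rfront] the gauge is approximated by some rational slope at some rational
    scale, which leaves countably many classes; small balls cut them down and [seqDU] makes them
    disjoint. *)
Lemma good_pieces (e : R) : 0 < e -> exists D : nat -> set (borel_mx n 1), exists g : nat -> 'cV[R]_n,
  [/\ trivIset setT D, rfront = \bigcup_k D k & forall k, good_piece e (g k) (D k)].
Proof.
move=> e0; have [L _ pL] := gauge_lip hp.
have e2 : 0 < e / 2 by rewrite divr_gt0.
pose idx := (('cV[rat]_n * nat) * ('cV[rat]_n * nat))%type.
(* The index consists of slope and scale, then centre and radius. The diameter stays below the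
   scale, so that flatness at one point applies to every other point of the piece. *)
pose E (i : idx) : set (borel_mx n 1) := if (2 * i.2.2.+1%:R^-1 <= Num.min e i.1.2.+1%:R^-1) then
  rfront `&` flat p (e / 2) (map_mx ratr i.1.1) i.1.2.+1%:R^-1 `&`
  [set x | enorm (x - map_mx ratr i.2.1) < i.2.2.+1%:R^-1] else set0.
have mE i : measurable (E i).
  rewrite /E; case: ifP => // _; apply: measurableI; first apply: measurableI.
  - exact: measurable_rfront.
  - by apply: closed_borel; exact: closed_flat pL.
  - apply: sub_sigma_algebra; apply: (@open_comp _ _ (fun x : 'cV[R]_n => enorm (x - map_mx ratr i.2.1))
      [set t | t < i.2.2.+1%:R^-1]) => [x _|]; last exact: open_lt.
    apply: (@elipschitz_continuous _ _ _ R^o _ 1) => y z.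
    by rewrite mul1r (le_trans (ler_enorm_dist _ _))// opprB addrA subrK.
have gE i : good_piece e (map_mx ratr i.1.1) (E i).
  split; [exact: mE| |]; rewrite /E; case: ifP => // di.
    move=> z [[[z1 [g' pg']] zf] _]; split => //; exists g' => //.
    have [r r0 rH] := pg' _ e2.
    by rewrite (splitr e); apply: (flat_dist _ _ r0 _ rH zf); rewrite ?(ltW e2)// invr_gt0.
  move=> z w [[[z1 _] zf] zc] [[[w1 _] wf] wc].
  have zw : enorm (z - w) < 2 * i.2.2.+1%:R^-1.
    rewrite (le_lt_trans (enorm_triangle (map_mx ratr i.2.1) _ _))//.
    by rewrite mulr_natl mulr2n ltrD// enormBC.
  move: di; rewrite le_min => /andP[d1 d2].
  split; first by rewrite (le_trans (ltW zw)).
  have := zf w; rewrite enormBC (lt_le_trans zw)// => /(_ isT).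
  rewrite z1 w1 subrr sub0r normrN -opprB mxdotNr normrN => /le_trans; apply.
  by rewrite ler_wpM2r ?enorm_ge0//; lra.
pose F k := if unpickle k is Some i then E i else set0.
pose gF k : 'cV[R]_n := if unpickle k is Some i then map_mx ratr (i : idx).1.1 else 0.
have gpF k : good_piece e (gF k) (F k).
  by rewrite /F /gF; case: unpickle => [i|]; [exact: gE|split].
exists (seqDU F), gF; split; first exact: trivIset_seqDU.
  rewrite -seqDU_bigcup_eq; apply/seteqP; split => [z zf|z [k _]]; last first.
    by rewrite /F; case: unpickle => // i; rewrite /E; case: ifP => // _ [[]].
  have [z1 [v pv]] := zf.
  have e4 : 0 < e / 4 by rewrite divr_gt0.
  have [r r0 rH] := pv _ e4; have [q qv] := rational_approx v e4.
  pose j := Num.truncn r^-1; pose m : R := Num.min e j.+1%:R^-1.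
  have m0 : 0 < m by rewrite lt_min e0 invr_gt0 ltr0Sn.
  pose i := Num.truncn (2 / m).
  have i0 : 0 < (i.+1%:R^-1 / 2 : R) by rewrite divr_gt0 ?invr_gt0.
  have [c cz] := rational_approx z i0.
  exists (pickle (((q, j), (c, i)) : idx)) => //; rewrite /F pickleK /E /= ifT; last first.
    rewrite ler_pdivrMr// mulrC -ler_pdivrMr//; exact/ltW/truncnS_gt.
  split; [split => //|].
    apply: (flatS rH); first by rewrite invf_ple ?posrE// ltW// truncnS_gt.
    by rewrite (_ : e / 2 = e / 4 + e / 4) ?lerD2l//; field.
  by rewrite /= (le_lt_trans cz)// ltr_pdivrMr// ltr_pMr ?invr_gt0// ltr1n.
move=> k; have [mF gF1 gF2] := gpF k; split.
- by apply: seqDU_measurable => l; case: (gpF l).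
- by move=> z zF; apply: gF1; exact: subset_seqDU zF.
- by move=> z w zF wF; apply: gF2; [exact: subset_seqDU zF|exact: subset_seqDU wF].
Qed.

Variables (h : 'cV[R]_n -> R) (c1 M : R).
Hypotheses (c10 : 0 < c1) (M0 : 0 < M) (hc : forall v, c1 * enorm v <= h v)
  (hM : forall v w, `|h v - h w| <= M * enorm (v - w)).

Let u x : R := h (lgrad p x).
Let f x : R := u x / enorm (lgrad p x).

Lemma measurable_grad_fun : measurable_fun setT (u : borel_mx n 1 -> R).
Proof.
have [L _ pL] := gauge_lip hp.
apply: (measurableT_comp (f := (h : borel_mx n 1 -> R))); last exact: measurable_lgrad pL.
by apply: continuous_measurable_mx; apply: (@elipschitz_continuous _ _ _ R^o _ M).
Qed.
Let h_ge0 v : 0 <= h v.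
Proof. by rewrite (le_trans _ (hc v))// mulr_ge0 ?enorm_ge0// ltW. Qed.

Lemma measurable_normal_fun : measurable_fun setT (f : borel_mx n 1 -> R).
Proof.
have [L _ pL] := gauge_lip hp.
have mN : measurable_fun setT (fun x : borel_mx n 1 => enorm (lgrad p x)).
  apply: (measurableT_comp (f := (@enorm R n 1 : borel_mx n 1 -> R))); last exact: measurable_lgrad pL.
  by apply: continuous_measurable_mx; exact: continuous_enorm.
apply: measurable_funM; first exact: measurable_grad_fun.
apply: measurable_fun_gt => c; rewrite setTI; have [c0|c0] := ltP c 0.
  rewrite (_ : [set x | _] = setT)//; apply/seteqP; split => // x _ /=.
  by rewrite (lt_le_trans c0)// invr_ge0 enorm_ge0.
rewrite (_ : [set x | _] = [set x | 0 < enorm (lgrad p x)] `&` [set x | c * enorm (lgrad p x) < 1]).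
  apply: measurableI.
    have := mN measurableT _ (measurable_itv `]0, +oo[); rewrite setTI.
    by congr measurable; apply/seteqP; split => x /=; rewrite in_itv/= andbT.
  have := measurable_funM (@measurable_cst _ _ _ _ setT c) mN.
  move=> /(_ measurableT _ (measurable_itv `]-oo, 1[)); rewrite setTI.
  by congr measurable; apply/seteqP; split => x /=; rewrite in_itv.
apply/seteqP; split => x /=.
  move=> cp; have p0 : 0 < enorm (lgrad p x).
    rewrite lt_def enorm_ge0 andbT; apply: contraTneq cp => ->.
    by rewrite invr0 -leNgt.
  by split => //; rewrite -ltr_pdivlMr// mul1r.
by move=> [q0]; rewrite -ltr_pdivlMr// mul1r.
Qed.

Let F1 (D : set (borel_mx n 1)) := (\int[hsd]_(z in D) (f z)%:E)%E.
Let F2 (D : set (borel_mx n 1)) := (\int[leb n]_(z in D) (u z)%:E)%E.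

Let f0 x : 0 <= f x. Proof. by apply: divr_ge0; [exact: h_ge0|exact: enorm_ge0]. Qed.
Let mu_ : measurable_fun setT (fun z : borel_mx n 1 => (u z)%:E).
Proof. by apply/measurable_EFinP; exact: measurable_grad_fun. Qed.
Let mf_ : measurable_fun setT (fun z : borel_mx n 1 => (f z)%:E).
Proof. by apply/measurable_EFinP; exact: measurable_normal_fun. Qed.

Lemma integral_le_cst d (T : measurableType d) (mu : {measure set T -> \bar R}) (D : set T) (k : T -> R) (a : R) :
  measurable D -> measurable_fun D (EFin \o k) -> 0 <= a -> (forall x, D x -> 0 <= k x <= a) ->
  (\int[mu]_(x in D) (k x)%:E <= a%:E * mu D)%E.
Proof.
move=> mD mk a0 ka; rewrite -integral_cst//; apply: ge0_le_integral => //.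
- by move=> x /ka/andP[]; rewrite lee_fin.
- by move=> x /ka/andP[]; rewrite lee_fin.
Qed.

Lemma integral_ge_cst d (T : measurableType d) (mu : {measure set T -> \bar R}) (D : set T) (k : T -> R) (a : R) :
  measurable D -> measurable_fun D (EFin \o k) -> 0 <= a -> (forall x, D x -> a <= k x) ->
  (a%:E * mu D <= \int[mu]_(x in D) (k x)%:E)%E.
Proof.
move=> mD mk a0 ka; rewrite -integral_cst//; apply: ge0_le_integral => //.
Qed.

(** On a good piece [h] and the norm of the gradient differ from their values at [g] by a factor at
    most [1 + K * e], and both integrals reduce to [area_piece]. This factor occurs twice for the
    quotient [f] and once for [u], whence the cube. *)
Lemma area_piece_integral : exists C0 K : R, [/\ 0 < C0, 0 < K & forall e g D,
  0 < e -> C0 * e <= 2^-1 -> K * e <= 2^-1 -> good_piece e g D ->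
  (F1 D <= ((1 + K * e) ^+ 3 * (1 - C0 * e) ^- (3 * n))%:E * ((alpha * n%:R)%:E * F2 (cone p D)))%E /\
  ((alpha * n%:R)%:E * F2 (cone p D) <= ((1 + K * e) ^+ 3 * (1 - C0 * e) ^- (3 * n))%:E * F1 D)%E].
Proof.
have [C0 [C00 HC0]] := area_piece s0 hp.
have [R0 R00 pR0] := cone_bounded hp.
have a0 := @hausdorff_density_gt0 R s s0.
(* Euler's identity gives [1 / R0 <= enorm g'], so [w0] bounds [h] below on the gradients. [K] is
   what [close_ratio] yields for errors [M * e] in [h] and [e] in the norm. *)
pose w0 := c1 / R0; have w00 : 0 < w0 by rewrite divr_gt0.
have [K KE] : exists K, K = 2 * M / w0 + 2 * R0 by exists (2 * M / w0 + 2 * R0).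
have h1 : 0 < M / w0 by rewrite divr_gt0.
have K0 : 0 < K by rewrite KE -mulrA addr_gt0// mulr_gt0.
exists C0, K; split => // e g D e0 C0e Ke [mD Dg Dflat].
have [->|/set0P[z0 Dz0]] := eqVneq D set0.
  have -> : cone p set0 = set0 by apply/seteqP; split => // x [].
  by rewrite /F1 /F2 !integral_set0 !mule0.
set k := K * e in Ke *; have k0 : 0 < k by rewrite mulr_gt0.
have [B1 B2] := HC0 e g D e0 C0e mD Dg Dflat.
set q := (1 - C0 * e) ^+ (3 * n) in B1 B2 *.
have q0 : 0 < q by rewrite exprn_gt0//; lra.
set N := enorm g in B1 B2.
have cmp (z : 'cV[R]_n) g' : p z = 1 -> is_grad p z g' -> enorm (g' - g) <= e ->
    [/\ 0 < enorm g', 0 < N, 0 < h g, h g' <= (1 + k) * h g & h g <= (1 + k) * h g'] /\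
    (enorm g' <= (1 + k) * N /\ N <= (1 + k) * enorm g').
  move=> z1 pg' gg'.
  have N1 : 1 <= enorm g' * R0.
    rewrite -[leLHS]z1 -(gauge_euler hp pg') (le_trans (mxdot_le _ _))//.
    by rewrite ler_wpM2l ?enorm_ge0// pR0// z1.
  have N1' : R0^-1 <= enorm g' by rewrite -[leLHS]mul1r ler_pdivrMr.
  have hg' : w0 <= h g' by rewrite (le_trans _ (hc g'))// ler_wpM2l// ltW.
  have hh : `|h g' - h g| <= M * e by rewrite (le_trans (hM _ _))// ler_wpM2l// ltW.
  have NN : `|enorm g' - N| <= e by rewrite (le_trans (ler_enorm_dist _ _)).
  have kE : k = 2 * (M * e / w0) + 2 * (e * R0).
    by rewrite /k KE; field; rewrite gt_eqF.
  have x0 : 0 < M * e / w0 by rewrite divr_gt0// mulr_gt0.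
  have y0 : 0 < e * R0 by rewrite mulr_gt0.
  set x := M * e / w0 in kE x0; set y := e * R0 in kE y0.
  have xE : M * e = x * w0 by rewrite /x divfK// gt_eqF.
  have yE : e = y * R0^-1 by rewrite /y mulfK// gt_eqF.
  rewrite xE in hh; rewrite yE in NN; rewrite kE in Ke *.
  have r0 : 0 < R0^-1 by rewrite invr_gt0.
  have := enorm_ge0 g; rewrite -/N => N0.
  have [b1 b2 b3] := close_ratio w00 x0 y0 Ke hg' hh.
  have Ke' : 2 * y + 2 * x <= 2^-1 by lra.
  have [d1 d2 d3] := close_ratio r0 y0 x0 Ke' N1' NN.
  rewrite [2 * y + _]addrC in d2 d3.
  by split; [split => //; exact: lt_le_trans N1'|].
have cmpD z : D z -> exists g', [/\ p z = 1, is_grad p z g' & enorm (g' - g) <= e].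
  by move=> /Dg[z1 [g' pg' gg']]; exists g'.
have [N0 b0] : 0 < N /\ 0 < h g.
  by have [g' [z1 pg' gg']] := cmpD _ Dz0; have [[]] := cmp _ _ z1 pg' gg'.
have mC := measurable_cone hp mD.
have k1 : 0 < 1 + k by rewrite addr_gt0.
have P1 : (F1 D <= ((1 + k) ^+ 2 * h g / N)%:E * hausdorff s D)%E.
  apply: integral_le_cst => //; first exact: measurable_funTS.
    by rewrite divr_ge0 ?enorm_ge0// mulr_ge0 ?(ltW b0)// exprn_ge0// ltW.
  move=> z /cmpD[g' [z1 pg' gg']]; rewrite f0/=.
  have [[N'0 _ _ h2 _] [_ N2]] := cmp _ _ z1 pg' gg'.
  rewrite /f /u (lgradE pg') ler_pdivrMr// mulrAC ler_pdivlMr//.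
  rewrite expr2 (_ : _ * _ * h g * _ = ((1 + k) * h g) * ((1 + k) * enorm g')); last by ring.
  by rewrite ler_pM// ltW.
have P1' : ((h g / N / (1 + k) ^+ 2)%:E * hausdorff s D <= F1 D)%E.
  apply: integral_ge_cst => //; first exact: measurable_funTS.
    by rewrite !divr_ge0 ?enorm_ge0// ?exprn_ge0// ltW.
  move=> z /cmpD[g' [z1 pg' gg']].
  have [[N'0 _ _ _ h2] [N2 _]] := cmp _ _ z1 pg' gg'.
  rewrite /f /u (lgradE pg') ler_pdivrMr ?exprn_gt0// mulrAC ler_pdivlMr// mulrAC ler_pdivrMr//.
  rewrite expr2 (_ : h g' * _ * N = ((1 + k) * h g') * ((1 + k) * N)); last by ring.
  by rewrite ler_pM// ltW.
(* The gradient of a gauge is constant along rays, so the estimates on the piece hold on the whole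
   cone. *)
have coneD x : cone p D x -> exists g', [/\ 0 < h g', lgrad p x = g', h g' <= (1 + k) * h g & h g <= (1 + k) * h g'].
  move=> [/andP[x0 x1] /cmpD[g' [z1 pg' gg']]]; exists g'.
  have [[N'0 _ _ h2 h3] _] := cmp _ _ z1 pg' gg'; split => //.
    by rewrite (lt_le_trans _ (hc g'))// mulr_gt0.
  have := gauge_is_grad_scale hp x0 pg'; rewrite scalerA mulfV ?gt_eqF// scale1r.
  exact: lgradE.
have P3 : ((h g / (1 + k))%:E * lam (cone p D) <= F2 (cone p D))%E.
  apply: integral_ge_cst => //; first exact: measurable_funTS.
    by rewrite divr_ge0// ltW.
  by move=> x /coneD[g' [_ xg' _ h2]]; rewrite /u xg' ler_pdivrMr// mulrC.
have P3' : (F2 (cone p D) <= ((1 + k) * h g)%:E * lam (cone p D))%E.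
  apply: integral_le_cst => //; first exact: measurable_funTS.
    by rewrite mulr_ge0// ltW.
  by move=> x /coneD[g' [_ xg' h2 _]]; rewrite /u xg' h_ge0.
have an0 : 0 < alpha * n%:R by rewrite mulr_gt0.
have aNn0 : 0 < alpha * N * n%:R by rewrite !mulr_gt0.
split.
  have Q1 : (hausdorff s D <= (q^-1 * (alpha * N * n%:R))%:E * lam (cone p D))%E.
    by rewrite EFinM -muleA lee_pdivlMl.
  have Q2 : (lam (cone p D) <= (h g / (1 + k))^-1%:E * F2 (cone p D))%E.
    by rewrite lee_pdivlMl// divr_gt0.
  have r1 : 0 <= (1 + k) ^+ 2 * h g / N by rewrite !mulr_ge0 ?invr_ge0// ltW// exprn_gt0.
  have r2 : 0 <= (1 + k) ^+ 2 * h g / N * (q^-1 * (alpha * N * n%:R)).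
    by rewrite mulr_ge0// mulr_ge0 ?invr_ge0// ltW.
  have := lee_mul_chain r2 (lee_mul_chain r1 P1 Q1) Q2.
  rewrite muleA -EFinM; congr (_ <= _%:E * _)%E.
  by field; rewrite ?gt_eqF.
have Q1 : (lam (cone p D) <= (q * (alpha * N * n%:R))^-1%:E * hausdorff s D)%E.
  by rewrite lee_pdivlMl// mulr_gt0.
have Q2 : (hausdorff s D <= (h g / N / (1 + k) ^+ 2)^-1%:E * F1 D)%E.
  by rewrite lee_pdivlMl// !divr_gt0// exprn_gt0.
have r1 : 0 <= (1 + k) * h g by rewrite mulr_ge0// ltW.
have r2 : 0 <= (1 + k) * h g * (q * (alpha * N * n%:R))^-1.
  by rewrite mulr_ge0// invr_ge0 mulr_ge0// ltW.
have := lee_mul_chain r2 (lee_mul_chain r1 P3' Q1) Q2.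
rewrite -lee_pdivlMl// muleA -EFinM => /le_trans; apply; rewrite le_eqVlt; apply/orP; left.
apply/eqP; congr (_%:E * _)%E.
by field; rewrite ?gt_eqF.
Qed.

Lemma cone_bigcup (D : nat -> set 'cV[R]_n) : cone p (\bigcup_k D k) = \bigcup_k cone p (D k).
Proof.
by apply/seteqP; split => [x [x1 [k _ xk]]|x [k _ [x1 xk]]]; [exists k|split => //; exists k].
Qed.

Lemma area_formula_pos : F1 rfront = ((alpha * n%:R)%:E * F2 (cone p rfront))%E.
Proof.
have [C0 [K [C00 K0 HCK]]] := area_piece_integral.
have a0 := @hausdorff_density_gt0 R s s0.
have an0 : 0 <= alpha * n%:R by rewrite mulr_ge0// ltW.
pose w (e : R) := (1 + K * e) ^+ 3 * (1 - C0 * e) ^- (3 * n).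
have CK0 : 0 < 2 * (C0 + K) by rewrite mulr_gt0// addr_gt0.
(* Tends to 0 with [C0 * e_ N] and [K * e_ N] never exceeding one half. *)
pose e_ (N : nat) : R := (2 * (C0 + K))^-1 * N.+1%:R^-1.
have e0 N : 0 < e_ N by rewrite mulr_gt0 ?invr_gt0.
have e1 N : (C0 + K) * e_ N <= 2^-1.
  rewrite /e_ invfM mulrA mulrCA mulfV ?gt_eqF ?addr_gt0// mulr1 ler_piMr ?invr_ge0//.
  by rewrite invf_le1// ler1n.
have wl : w (e_ N) @[N --> \oo] --> (1 : R).
  have el : e_ N @[N --> \oo] --> (0 : R).
    rewrite -(mulr0 (2 * (C0 + K))^-1); apply: cvgMr; exact: cvg_harmonic.
  have -> : (1 : R) = (1 + K * 0) ^+ 3 * (1 - C0 * 0) ^- (3 * n).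
    by rewrite !mulr0 addr0 subr0 !expr1n invr1 mulr1.
  apply: cvgM.
    apply: (cvg_comp (fun N => 1 + K * e_ N) (fun t => t ^+ 3)); last exact: exprn_continuous.
    by apply: cvgD; [exact: cvg_cst|exact: cvgMr].
  apply: cvgV; first by rewrite mulr0 subr0 expr1n oner_eq0.
  apply: (cvg_comp (fun N => 1 - C0 * e_ N) (fun t => t ^+ (3 * n))); last exact: exprn_continuous.
  by apply: cvgB; [exact: cvg_cst|exact: cvgMr].
have F20 D : (0 <= F2 D)%E by apply: integral_ge0 => x _; rewrite lee_fin h_ge0.
have F10 D : (0 <= F1 D)%E by apply: integral_ge0 => x _; rewrite lee_fin.
have H N : (F1 rfront <= (w (e_ N))%:E * ((alpha * n%:R)%:E * F2 (cone p rfront)))%E /\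
    ((alpha * n%:R)%:E * F2 (cone p rfront) <= (w (e_ N))%:E * F1 rfront)%E.
  have [D [g [tD fD gD]]] := good_pieces (e0 N).
  have [h1 h2] : 0 < C0 * e_ N /\ 0 < K * e_ N by split; apply: mulr_gt0.
  have eN := e1 N; rewrite mulrDl in eN.
  have C1 : C0 * e_ N <= 2^-1 by lra.
  have K1 : K * e_ N <= 2^-1 by lra.
  have HD k := HCK _ _ _ (e0 N) C1 K1 (gD k).
  have w0 : 0 <= w (e_ N) by rewrite mulr_ge0 ?invr_ge0 ?exprn_ge0//; lra.
  have mD k : measurable (D k) by case: (gD k).
  have E1 : F1 rfront = (\sum_(0 <= k <oo) F1 (D k))%E.
    by rewrite fD /F1 ge0_integral_bigcup//; [exact: measurable_funTS|move=> x _; rewrite lee_fin].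
  have E2 : F2 (cone p rfront) = (\sum_(0 <= k <oo) F2 (cone p (D k)))%E.
    rewrite fD cone_bigcup /F2 ge0_integral_bigcup//.
    - by move=> k; exact: measurable_cone.
    - exact: measurable_funTS.
    - by move=> x _; rewrite lee_fin h_ge0.
    - move=> i j _ _ [x [[_ xi] [_ xj]]]; apply: tD => //.
      by exists ((p x)^-1 *: x).
  rewrite E1 E2 -!nneseriesZl//; last first.
  - by move=> k _; rewrite mule_ge0// lee_fin.
  split; apply: lee_nneseries => [k _ _|k _]; rewrite ?mule_ge0 ?lee_fin//; by case: (HD k).
apply/eqP; rewrite eq_le; apply/andP; split.
  by apply: (lee_mul_limit _ (fun N => (H N).1) wl); rewrite mule_ge0.
by apply: (lee_mul_limit _ (fun N => (H N).2) wl).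
Qed.

End area.

Lemma lgrad_le (R : realType) n (f : 'cV[R]_n -> R^o) L x : elipschitz f L -> enorm (lgrad f x) <= n%:R * L.
Proof.
move=> fL; rewrite (le_trans (enorm_le_sum _))// (@le_trans _ _ (\sum_(i < n) L))//.
  apply: ler_sum => i _; rewrite big_ord1 mxE (le_trans (dder_le _ _ fL))//.
  by rewrite enorm_delta mulr1.
by rewrite sumr_const card_ord [leRHS]mulr_natl.
Qed.

Lemma hausdorff_int_eq (R : realType) p q s (D : set 'M[R]_(p, q)) f g : {in D, f =1 g} ->
  hausdorff_int s D f = hausdorff_int s D g.
Proof. by rewrite /hausdorff_int /integral => /eq_restrictP->. Qed.

Section area_formula.
Context {R : realType} (s : nat) (s0 : (0 < s)%N).
Variables (p : 'cV[R]_(1 + s) -> R^o) (hp : gauge p).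
Notation n := (1 + s)%N.
Notation alpha := (@hausdorff_density R s).

Lemma measurable_gauge_lt : measurable ([set x | p x < 1] : set (borel_mx n 1)).
Proof. by apply: sub_sigma_algebra; exact: open_gauge_lt. Qed.

(** By Rademacher's theorem and homogeneity, almost every point of [{p < 1}] lies on a ray through a
    regular boundary point. *)
Lemma integral_cone_rfront (f : 'cV[R]_n -> R) : measurable_fun setT (f : borel_mx n 1 -> R) -> (forall x, 0 <= f x) ->
  (\int[leb n]_(x in cone p (rfront p)) (f x)%:E = \int[leb n]_(x in [set x | (p x < 1)%R]) (f x)%:E)%E.
Proof.
move=> mf f0; have mC := measurable_cone hp (measurable_rfront hp).
have mf' : measurable_fun setT (EFin \o f : borel_mx n 1 -> \bar R) by exact/measurable_EFinP.
have [L _ pL] := gauge_lip hp.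
rewrite integral_mkcond [RHS]integral_mkcond; apply: ge0_ae_eq_integral => //.
- by apply/(measurable_restrictT _ mC); exact: measurable_funTS.
- by apply/(measurable_restrictT _ measurable_gauge_lt); exact: measurable_funTS.
- by move=> x _; apply: erestrict_ge0 => y _; rewrite lee_fin.
- by move=> x _; apply: erestrict_ge0 => y _; rewrite lee_fin.
- apply: (ae_imp (gradset_ae pL)) => x [g pg] _; rewrite !patchE.
  have x0 := gauge_grad_n0 hp isT pg; have px := gauge_gt0 hp x0.
  have -> : (x \in cone p (rfront p)) = (x \in [set x | p x < 1]) => //.
  apply/idP/idP; rewrite !inE; first by move=> [/andP[]].
  move=> x1; split; first by rewrite px.
  split; first by rewrite gaugeZ ?invr_ge0 ?(ltW px)// mulVf// gt_eqF.
  by exists g; apply: gauge_is_grad_scale; rewrite ?invr_gt0.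
Qed.

(** [h] may vanish at nonzero vectors, whereas relative errors require a lower bound by a multiple
    of the norm. So the formula is applied to [h] plus the norm and to the norm alone; the latter
    integrals are finite and are subtracted. *)
Theorem area_formula (h : 'cV[R]_n -> R) (M : R) : (forall v, 0 <= h v) ->
  (forall v w, `|h v - h w| <= M * enorm (v - w)) ->
  (forall t v, 0 <= t -> h (t *: v) = t * h v) ->
  hausdorff_int s (regular_frontier [set x | p x <= 1])
    (fun z => (h (outer_normal [set x | p x <= 1] z))%:E) =
  ((alpha * n%:R)%:E * \int[leb n]_(x in [set x | (p x < 1)%R]) (h (lgrad p x))%:E)%E.
Proof.
move=> h0 hM hZ.
have [L L0 pL] := gauge_lip hp.
have hM' v w : `|h v - h w| <= (`|M| + 1) * enorm (v - w).
  by rewrite (le_trans (hM v w))// ler_wpM2r ?enorm_ge0// (le_trans (ler_norm _))// lerDl.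
pose h' v := h v + enorm v.
have hc' v : 1 * enorm v <= h' v by rewrite mul1r lerDr.
have hM'' v w : `|h' v - h' w| <= (`|M| + 1 + 1) * enorm (v - w).
  rewrite /h' opprD addrACA (le_trans (ler_normD _ _))// mulrDl lerD// mul1r.
  exact: ler_enorm_dist.
have M1 : 0 < `|M| + 1 by rewrite ltr_wpDl.
have M2 : 0 < `|M| + 1 + 1 by rewrite addr_gt0.
have ha (v : 'cV[R]_n) : 1 * enorm v <= enorm v by rewrite mul1r.
have hb (v w : 'cV[R]_n) : `|enorm v - enorm w| <= 1 * enorm (v - w) by rewrite mul1r ler_enorm_dist.
have A1 := area_formula_pos s0 hp ltr01 M2 hc' hM''.
have A2 := area_formula_pos s0 hp ltr01 ltr01 ha hb.
have mh := measurable_grad_fun hp hM'.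
have me := measurable_grad_fun hp hb.
have mfh := measurable_normal_fun hp hM'.
have mfe := measurable_normal_fun hp hb.
have mF := measurable_rfront hp.
have mC := measurable_cone hp mF.
have e0 (x : 'cV[R]_n) : 0 <= enorm (lgrad p x) by exact: enorm_ge0.
have q0 x : 0 <= h (lgrad p x) / enorm (lgrad p x) by rewrite divr_ge0.
have q0' (x : 'cV[R]_n) : 0 <= enorm (lgrad p x) / enorm (lgrad p x) by rewrite divr_ge0.
have fin2 : (\int[leb n]_(x in cone p (rfront p)) (enorm (lgrad p x))%:E)%E \is a fin_num.
  rewrite ge0_fin_numE; last by apply: integral_ge0 => x _; rewrite lee_fin.
  have [r _ pr] := cone_bounded hp.
  have nL0 : 0 <= n%:R * L by rewrite mulr_ge0// ltW.
  apply: (le_lt_trans (integral_le_cst (a := n%:R * L) _ mC _ nL0 _)).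
  - by apply: measurable_funTS; exact/measurable_EFinP.
  - by move=> x _; rewrite e0 lgrad_le.
  rewrite lte_mul_pinfty// ?lee_fin//.
  by apply: (leb_bounded (r := r)) => x [/andP[_ /ltW x1] _]; exact: pr.
have B1 : (\int[@hsd R s]_(z in rfront p) (h' (lgrad p z) / enorm (lgrad p z))%:E =
    \int[@hsd R s]_(z in rfront p) (h (lgrad p z) / enorm (lgrad p z))%:E +
    \int[@hsd R s]_(z in rfront p) (enorm (lgrad p z) / enorm (lgrad p z))%:E)%E.
  rewrite -ge0_integralD//.
  - by apply: eq_integral => x _; rewrite -EFinD /h' mulrDl.
  - by move=> x _; rewrite lee_fin.
  - by apply: measurable_funTS; exact/measurable_EFinP.
  - by move=> x _; rewrite lee_fin.
  - by apply: measurable_funTS; exact/measurable_EFinP.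
have B2 : (\int[leb n]_(z in cone p (rfront p)) (h' (lgrad p z))%:E =
    \int[leb n]_(z in cone p (rfront p)) (h (lgrad p z))%:E +
    \int[leb n]_(z in cone p (rfront p)) (enorm (lgrad p z))%:E)%E.
  rewrite -ge0_integralD//.
  - by move=> x _; rewrite lee_fin.
  - by apply: measurable_funTS; exact/measurable_EFinP.
  - by move=> x _; rewrite lee_fin.
  - by apply: measurable_funTS; exact/measurable_EFinP.
have P1 : (0 <= \int[leb n]_(z in cone p (rfront p)) (h (lgrad p z))%:E)%E.
  by apply: integral_ge0 => x _; rewrite lee_fin.
have P2 : (0 <= \int[leb n]_(z in cone p (rfront p)) (enorm (lgrad p z))%:E)%E.
  by apply: integral_ge0 => x _; rewrite lee_fin.
rewrite B1 B2 A2 (ge0_muleDr _ P1 P2) in A1.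
rewrite -(integral_cone_rfront mh)//.
have fin3 : ((alpha * n%:R)%:E * \int[leb n]_(x in cone p (rfront p)) (enorm (lgrad p x))%:E)%E \is a fin_num.
  by rewrite fin_numM.
have := congr1 (fun x => x - ((alpha * n%:R)%:E * \int[leb n]_(x in cone p (rfront p)) (enorm (lgrad p x))%:E))%E A1.
rewrite !addeK// => <-.
rewrite gauge_regular// -/(rfront p).
have E : hausdorff_int s (rfront p) (fun z => (h (lgrad p z) / enorm (lgrad p z))%:E) =
    (\int[@hsd R s]_(z in rfront p) (h (lgrad p z) / enorm (lgrad p z))%:E)%E.
  apply: borel_restriction_integral => //.
    by apply: measurable_funTS; exact/measurable_EFinP.
  by move=> x _; rewrite lee_fin.
rewrite -E; apply: hausdorff_int_eq => z; rewrite inE => -[z1 [g pg]].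
by rewrite (gauge_normal hp isT z1 pg) (lgradE pg) hZ ?invr_ge0 ?enorm_ge0// mulrC.
Qed.

End area_formula.

(** * Spherical means *)

Section nonmeasurable_integral.
Local Open Scope ereal_scope.
Context d (T : measurableType d) (R : realType) (mu : {measure set T -> \bar R}) (D : set T).
Implicit Types f g : T -> \bar R.
Import HBNNSimple.

Lemma ge0_integral_nnsfun_le f (h : {nnsfun T >-> R}) : (forall x, D x -> 0 <= f x) ->
  (forall x, (h x)%:E <= (f \_ D) x) -> sintegral mu h <= \int[mu]_(x in D) f x.
Proof. by move=> f0 hf; rewrite ge0_integralE//; apply: ereal_sup_ubound; exists h. Qed.

Lemma ge0_integral_le_nnsfun f y : (forall x, D x -> 0 <= f x) ->
  (forall h : {nnsfun T >-> R}, (forall x, (h x)%:E <= (f \_ D) x) -> sintegral mu h <= y) ->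
  \int[mu]_(x in D) f x <= y.
Proof. by move=> f0 H; rewrite ge0_integralE//; apply: ge_ereal_sup => _ [h /= hf <-]; exact: H. Qed.

(** Proved directly from the supremum over simple functions, so as to apply to the arbitrary
    nonnegative integrands in [sphere_mean]. *)
Lemma le_integral_ae f g : (forall x, D x -> 0 <= f x) -> (forall x, D x -> f x <= g x) ->
  \int[mu]_(x in D) f x <= \int[mu]_(x in D) g x.
Proof.
move=> f0 fg; apply: ge0_integral_le_nnsfun => // h hf; apply: ge0_integral_nnsfun_le.
  by move=> x Dx; rewrite (le_trans (f0 x Dx))// fg.
move=> x; rewrite (le_trans (hf x))// !patchE; case: ifP => //; rewrite inE; exact: fg.
Qed.

Lemma integral_scale_ge f (c : R) : (0 < c)%R -> (forall x, D x -> 0 <= f x) ->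
  c%:E * \int[mu]_(x in D) f x <= \int[mu]_(x in D) (c%:E * f x).
Proof.
move=> c0 f0; have c0' := ltW c0; rewrite -lee_pdivlMl//; apply: ge0_integral_le_nnsfun => // h hf.
rewrite lee_pdivlMl// -sintegralrM.
apply: (ge0_integral_nnsfun_le (h := scale_nnsfun h c0')) => [x Dx|x].
  by rewrite mule_ge0// ?f0// lee_fin.
have := hf x; rewrite !patchE /=; case: ifP => _; first by move=> H; rewrite EFinM lee_wpmul2l// lee_fin.
by rewrite !lee_fin => h0; rewrite mulr_ge0_le0.
Qed.

Lemma integral_scale f (c : R) : (0 < c)%R -> (forall x, D x -> 0 <= f x) ->
  \int[mu]_(x in D) (c%:E * f x) = c%:E * \int[mu]_(x in D) f x.
Proof.
move=> c0 f0; have ci : (0 < c^-1)%R by rewrite invr_gt0.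
apply/eqP; rewrite eq_le integral_scale_ge// andbT.
rewrite -lee_pdivrMl//.
apply: (@le_trans _ _ (\int[mu]_(x in D) (c^-1%:E * (c%:E * f x)))).
  by apply: integral_scale_ge => // x Dx; rewrite mule_ge0 ?f0// lee_fin ltW.
apply: le_integral_ae => x Dx; last by rewrite muleA -EFinM mulVf ?gt_eqF// mul1e.
by rewrite mule_ge0 ?lee_fin ?invr_ge0 ?(ltW c0)// mule_ge0 ?f0// lee_fin ltW.
Qed.

End nonmeasurable_integral.

Section involution.
Local Open Scope ereal_scope.
Context d (T : measurableType d) (R : realType) (mu : {measure set T -> \bar R}) (D : set T).
Variable phi : T -> T.
Hypotheses (phiK : involutive phi) (mphi : measurable_fun setT phi)
  (mu_phi : forall A, measurable A -> mu (phi @^-1` A) = mu A) (Dphi : forall x, D x -> D (phi x)).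
Import HBNNSimple.

(** A simple function below [k \o phi] becomes, after composition with [phi], one below [k] with the
    same integral. Since [phi] is an involution, this inequality implies equality. *)
Lemma integral_involutive_le (k : T -> \bar R) : (forall x, D x -> 0 <= k x) ->
  \int[mu]_(x in D) k (phi x) <= \int[mu]_(x in D) k x.
Proof.
move=> k0; apply: ge0_integral_le_nnsfun => [x Dx|h hk]; first exact/k0/Dphi.
have <- : \int[mu]_x (h x)%:E = sintegral mu h := integralT_nnsfun mu h.
have mh : measurable_fun setT (EFin \o h) by exact/measurable_EFinP.
have -> : \int[mu]_x (h x)%:E = \int[mu]_x (h (phi x))%:E.
  rewrite -[RHS](@ge0_integral_pushforward _ _ T T R phi mphi mu setT (EFin \o h))//.
    by apply: eq_measure_integral => A mA _; rewrite -mu_phi.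
  by move=> x _; rewrite lee_fin.
rewrite [leRHS]integral_mkcond; apply: le_integral_ae => x _; first by rewrite lee_fin.
rewrite (le_trans (hk (phi x)))// !patchE phiK; case: ifP => phix; case: ifP => Dx //.
  by move: phix; rewrite inE => /Dphi; rewrite phiK => /mem_set; rewrite Dx.
by rewrite inE in Dx; exact: k0.
Qed.

Lemma integral_involutive f : (forall x, D x -> 0 <= f x) ->
  \int[mu]_(x in D) f (phi x) = \int[mu]_(x in D) f x.
Proof.
move=> f0; apply/eqP; rewrite eq_le integral_involutive_le//=.
have := integral_involutive_le (fun x (Dx : D x) => f0 _ (Dphi Dx)).
by under eq_integral do rewrite phiK.
Qed.

End involution.

Section caratheodory_integral.
Local Open Scope ereal_scope.
Context {R : realType} (T : pointedType) (mu : {outer_measure set T -> \bar R}).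
Implicit Types (D : set T) (f : T -> \bar R).
Notation cint := (@integral _ (caratheodory_type mu) R mu).

(** Exposes the measure on the Carathéodory sigma-algebra, so that general facts on integrals apply
    to [hausdorff_int]. *)
Definition cmeasure : {measure set (caratheodory_type mu) -> \bar R} :=
  (mu : set (caratheodory_type mu) -> \bar R).

Lemma cint_ge0 D f : (forall x, D x -> 0 <= f x) -> 0 <= cint D f.
Proof. by move=> f0; apply: (@integral_ge0 _ _ R cmeasure _ _ f0). Qed.

Lemma cint_le D f g : (forall x, D x -> 0 <= f x) -> (forall x, D x -> f x <= g x) -> cint D f <= cint D g.
Proof. by move=> f0 fg; apply: (@le_integral_ae _ _ R cmeasure _ _ _ f0 fg). Qed.

Lemma cint_scale D f (c : R) : (0 < c)%R -> (forall x, D x -> 0 <= f x) ->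
  cint D (fun x => c%:E * f x) = c%:E * cint D f.
Proof. by move=> c0 f0; apply: (@integral_scale _ _ R cmeasure _ _ _ c0 f0). Qed.

Lemma cint_involutive D f (phi : T -> T) : involutive phi -> (forall A, mu (phi @^-1` A) = mu A) ->
  (forall x, D x -> D (phi x)) -> (forall x, D x -> 0 <= f x) ->
  cint D (fun x => f (phi x)) = cint D f.
Proof.
move=> phiK mu_phi Dphi f0.
have mphi : measurable_fun setT (phi : caratheodory_type mu -> caratheodory_type mu).
  move=> _ A mA; rewrite setTI; have cA : mu.-caratheodory A := mA.
  suff : mu.-caratheodory (phi @^-1` A) by [].
  move=> X; have E (B : set T) : mu (X `&` phi @^-1` B) = mu ((phi @^-1` X) `&` B).
    by rewrite -mu_phi; congr (mu _); apply/seteqP; split => x [/=]; rewrite phiK.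
  by rewrite -(mu_phi X) (cA (phi @^-1` X)) (E A) -(E (~` A)).
exact: (@integral_involutive _ _ R cmeasure D phi phiK mphi (fun A _ => mu_phi A) Dphi f f0).
Qed.

End caratheodory_integral.

Section sphere_mean.
Local Open Scope ereal_scope.
Context {R : realType} (n m : nat).
Hypothesis nm0 : (0 < n * m)%N.
Notation N := (n * m)%N.
Notation V := 'M[R]_(n, m).
Notation H := (@hausdorff R n m N.-1).
Implicit Types g : V -> \bar R.

Lemma npowe_ge0 (x : \bar R) r : 0 <= npowe x r. Proof. exact: poweR_ge0. Qed.

Lemma npowe_le (x y : \bar R) (r : R) : (0 <= r)%R -> 0 <= x -> x <= y -> npowe y r <= npowe x r.
Proof.
move=> r0 x0 xy; have y0 := le_trans x0 xy.
apply: gt0_ler_poweR => //; rewrite ?in_itv/= ?inve_ge0 ?x0 ?y0 ?leey//.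
by rewrite lee_pV2 ?inE.
Qed.

Lemma inve_mul (c : R) (x : \bar R) : (0 < c)%R -> 0 <= x -> (c%:E * x)^-1 = c^-1%:E * x^-1.
Proof.
move=> c0; have ci : (0 < c^-1)%R by rewrite invr_gt0.
case: x => [r| |] //.
  rewrite lee_fin le_eqVlt => /predU1P[<-|r0].
    by rewrite mule0 inve0 gt0_muley ?lte_fin.
  by rewrite -EFinM !inver mulf_eq0 !gt_eqF//= -EFinM invfM.
by move=> _; rewrite gt0_muley ?lte_fin// invey mule0.
Qed.

Lemma npoweM (c : R) (x : \bar R) (r : R) : (0 < c)%R -> 0 <= x ->
  npowe (c%:E * x) r = (c^-1 `^ r)%:E * npowe x r.
Proof.
move=> c0 x0; rewrite /npowe inve_mul// poweRM ?inve_ge0// ?lee_fin ?invr_ge0 ?(ltW c0)//.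
Qed.

Lemma sphere_mean_ge0 g : 0 <= sphere_mean g. Proof. exact: npowe_ge0. Qed.

Lemma sphere_mean_le g g' : (forall u, 0 <= g u) -> (forall u, g u <= g' u) -> sphere_mean g <= sphere_mean g'.
Proof.
move=> g0 gg'; apply: npowe_le; first by rewrite invr_ge0.
  by apply: (@cint_ge0 R V H) => u _; exact: npowe_ge0.
apply: (@cint_le R V H) => u _; first exact: npowe_ge0.
by apply: npowe_le.
Qed.

Lemma sphere_meanZ (c : R) g : (0 < c)%R -> (forall u, 0 <= g u) ->
  sphere_mean (fun u => c%:E * g u) = c%:E * sphere_mean g.
Proof.
move=> c0 g0; have ci : (0 < c^-1 `^ N%:R)%R by rewrite powR_gt0// invr_gt0.
rewrite /sphere_mean /hausdorff_int.
rewrite (_ : (fun u => npowe (c%:E * g u) N%:R) = (fun u => (c^-1 `^ N%:R)%:E * npowe (g u) N%:R)); last first.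
  by apply/funext => u; rewrite npoweM.
have := @cint_scale R V H (@esphere R n m) (fun u => npowe (g u) N%:R) _ ci (fun u _ => npowe_ge0 _ _).
move=> ->.
rewrite npoweM//; last first.
  by apply: (@cint_ge0 R V H) => u _; exact: npowe_ge0.
congr (_%:E * _).
have N0 : (N%:R : R) != 0%R by rewrite pnatr_eq0 -lt0n.
have c0' := ltW c0.
rewrite -(powR_inv1 c0') -powRrM -powRN -powRrM.
by rewrite mulN1r opprK mulfV// powRr1.
Qed.

Lemma hausdorff_opp (A : set V) : H (-%R @^-1` A) = H A.
Proof.
rewrite (_ : -%R @^-1` A = -%R @` A); last first.
  by apply/seteqP; split => [x Ax|_ [x Ax <-]]; [exists (- x)%R; rewrite ?opprK|rewrite /= opprK].
rewrite -[in RHS](image_id A); apply: isometry_hausdorff => x y _ _.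
by rewrite -opprD enormN.
Qed.

(** Absorbs the sign between the outer normal, which points along the gradient of the gauge, and the
    gradient of a test function decreasing in the gauge. *)
Lemma sphere_meanN g : (forall u, 0 <= g u) -> sphere_mean (fun u => g (- u)%R) = sphere_mean g.
Proof.
move=> g0; rewrite /sphere_mean /hausdorff_int; congr npowe.
apply: (@cint_involutive R V H (@esphere R n m) (fun u => npowe (g u) N%:R) (fun u : V => (- u)%R)).
- by move=> u; rewrite opprK.
- by move=> A; exact: hausdorff_opp.
- by move=> u; rewrite /esphere /= enormN.
- by move=> u _; exact: npowe_ge0.
Qed.

End sphere_mean.

(** * Support functions *)

Section support.
Context {R : realType} (n m : nat) (Q : set 'rV[R]_m) (hQ : convex_body_o Q).
Implicit Types (u : 'M[R]_(n, m)) (v w : 'cV[R]_n) (y : 'rV[R]_m).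

Definition hu u v : R := support Q (v^T *m u).

Lemma body_bounded : exists2 r : R, 0 < r & forall y, Q y -> enorm y <= r.
Proof.
have [cQ _ _ _] := hQ; have [M [_ MQ]] := compact_bounded cQ.
exists ((1 * m)%:R * (`|M| + 1) + 1); first by rewrite ltr_wpDl ?mulr_ge0// addr_ge0.
move=> x Qx; rewrite (le_trans (enorm_le_mxnorm _))// -[leLHS]addr0 lerD// ler_wpM2l//.
by apply: MQ => //; rewrite ltr_pwDr// ler_norm.
Qed.

Lemma support_has_sup x : has_sup [set mxdot x y | y in Q].
Proof.
have [_ _ _ Q0] := hQ; have [r r0 Qr] := body_bounded; split; first by exists (mxdot x 0), 0.
exists (enorm x * r) => _ [y /Qr yr <-].
by rewrite (le_trans (mxdot_le _ _))// ler_wpM2l ?enorm_ge0.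
Qed.

(** Exhibits [hu u] as the support function of the vectors [u *m y^T] with [y] in [Q]; its
    sublinearity and duality follow. *)
Lemma mxdot_trmul v u y : mxdot (v^T *m u) y = mxdot (u *m y^T) v.
Proof.
by rewrite /mxdot !trmx_mul !trmxK mxtrace_mulC mulmxA.
Qed.

Lemma hu_ge u v y : Q y -> mxdot (u *m y^T) v <= hu u v.
Proof.
by move=> Qy; rewrite -mxdot_trmul; apply: ub_le_sup; [exact: (support_has_sup _).2|exists y].
Qed.

Lemma hu_le u v c : (forall y, Q y -> mxdot (u *m y^T) v <= c) -> hu u v <= c.
Proof.
move=> H; apply: ge_sup; first exact: (support_has_sup _).1.
by move=> _ [y Qy <-]; rewrite mxdot_trmul; exact: H.
Qed.

Lemma hu_ge0 u v : 0 <= hu u v.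
Proof.
by have [_ _ _ Q0] := hQ; rewrite (le_trans _ (hu_ge u v Q0))// trmx0 mulmx0 mxdot0l.
Qed.

Lemma huD u v w : hu u (v + w) <= hu u v + hu u w.
Proof. by apply: hu_le => y Qy; rewrite mxdotDr lerD// hu_ge. Qed.

Lemma hu_homog u t v : 0 <= t -> hu u (t *: v) = t * hu u v.
Proof.
have H s w : 0 <= s -> hu u (s *: w) <= s * hu u w.
  by move=> s0; apply: hu_le => y Qy; rewrite mxdotZr ler_wpM2l// hu_ge.
move=> t0; have [->|tn] := eqVneq t 0.
  rewrite scale0r mul0r; apply/eqP; rewrite eq_le hu_ge0 andbT; apply: hu_le => y _.
  by rewrite mxdot0r.
apply/eqP; rewrite eq_le H//= -ler_pdivlMl ?lt_def ?tn//.
rewrite -{1}[v]scale1r -(mulVf tn) -scalerA.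
by apply: H; rewrite invr_ge0.
Qed.

Lemma hu0 u : hu u 0 = 0.
Proof. by rewrite -(scale0r 0) hu_homog// mul0r. Qed.

Lemma huN u v : hu u (- v) = hu (- u) v.
Proof. by rewrite /hu raddfN /= mulNmx -mulmxN. Qed.

Lemma hu_lip : exists2 r : R, 0 < r & forall u v w, `|hu u v - hu u w| <= enorm u * r * enorm (v - w).
Proof.
have [r r0 Qr] := body_bounded; exists r => // u.
have H v : hu u v <= enorm u * r * enorm v.
  apply: hu_le => y /Qr yr; rewrite (le_trans (mxdot_le _ _))// ler_wpM2r ?enorm_ge0//.
  by rewrite (le_trans (enorm_mul _ _))// enorm_tr ler_wpM2l ?enorm_ge0.
have D v w : hu u v - hu u w <= enorm u * r * enorm (v - w).
  by rewrite lerBlDr (le_trans _ (lerD (H _) (lexx _)))// (le_trans _ (huD _ _ _))// subrK.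
by move=> v w; rewrite ler_norml D andbT lerNl opprB enormBC D.
Qed.

End support.

(** * Smooth approximation *)

Section derive1.
Context {R : realType}.
Implicit Type f : R -> R.

Lemma is_derive1P f (s D : R) : is_derive s (1 : R) f D <->
  forall e : R, 0 < e -> exists2 r : R, 0 < r & forall h, 0 < `|h| < r -> `|(f (s + h) - f s) / h - D| <= e.
Proof.
split => [/is_derive1_caratheodory[g [fg cg gs]] e e0|H].
  have /cvgrPdist_le/(_ e e0) := cg; rewrite gs.
  rewrite -nbhs_ballE => -[r /= r0 rH]; exists r => // h /andP[h0 hr].
  have hn : h != 0 by rewrite -normr_gt0.
  have := rH (s + h); rewrite /ball /= opprD addrA subrr add0r normrN => /(_ hr).
  by rewrite fg (addrC s) addrK mulfK// distrC.
apply/is_derive1_caratheodory.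
exists (fun z => if z == s then D else (f z - f s) / (z - s)); split.
- move=> z; case: eqVneq => [->|zs]; first by rewrite !subrr mulr0.
  by rewrite divfK// subr_eq0.
- apply/cvgrPdist_le => e e0; rewrite eqxx; have [r r0 rH] := H e e0.
  exists r => // z /= zr.
  case: eqVneq => [_|zs]; first by rewrite subrr normr0 ltW.
  have := rH (z - s); rewrite normr_gt0 subr_eq0 zs distrC zr => /(_ isT).
  by rewrite [s + _]addrC subrK distrC.
- by rewrite eqxx.
Qed.

Lemma derive_bound_lipschitz f (df : R -> R) (C : R) : (forall x, is_derive x (1 : R) f (df x)) ->
  (forall x, `|df x| <= C) -> forall x y, `|f x - f y| <= C * `|x - y|.
Proof.
move=> fd dC.
have H x y : x < y -> `|f y - f x| <= C * `|y - x|.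
  move=> xy; have [c _ ->] := MVT xy (fun z _ => fd z) (derivable_within_continuous (fun z _ => @ex_derive _ _ _ _ _ _ _ (fd z))).
  by rewrite normrM ler_wpM2r.
move=> x y; have [xy|xy|->] := ltgtP x y; last by rewrite !subrr normr0 mulr0.
  by rewrite distrC (distrC x) H.
exact: H.
Qed.

Definition flatexp (k : nat) (t : R) : R := if 0 < t then t^-1 ^+ k * expR (- t^-1) else 0.

(** The exponential series gives [s ^+ k <= k! * expR s] for positive [k]; the summand 1 accounts
    for [k = 0]. *)
Lemma flatexp_bound k t : `|flatexp k t| <= 1 + k`!%:R.
Proof.
rewrite /flatexp; case: ifP => t0; last by rewrite normr0 addr_ge0.
have s0 : 0 < t^-1 by rewrite invr_gt0.
move: (t^-1) s0 => s s0.
rewrite normrM normrX !gtr0_norm ?expR_gt0// expRN ler_pdivrMr ?expR_gt0//.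
have e1 : 0 < expR s by rewrite expR_gt0.
rewrite mulrDl mul1r; case: k => [|k].
  by rewrite expr0 fact0 mul1r; have := expR_ge1Dx s; lra.
have := expR_ge1Dxn k (ltW s0) => H.
have f0 : 0 < ((k.+1)`!%:R : R) by rewrite ltr0n fact_gt0.
have : s ^+ k.+1 <= (k.+1)`!%:R * expR s.
  rewrite -ler_pdivrMl// mulrC (le_trans _ H)// lerDr//.
by move=> /le_trans; apply; rewrite lerDr ltW.
Qed.

Lemma flatexp_ge0 k t : 0 <= flatexp k t.
Proof.
by rewrite /flatexp; case: ifP => // t0; rewrite mulr_ge0 ?expR_ge0// exprn_ge0// invr_ge0 ltW.
Qed.

Lemma is_derive_flatexp k t : is_derive t (1 : R) (flatexp k) (flatexp k.+2 t - k%:R * flatexp k.+1 t).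
Proof.
have [t0|t0] := ltP 0 t; last first.
  have -> : flatexp k.+2 t - k%:R * flatexp k.+1 t = 0 by rewrite /flatexp !ltNge t0 /= mulr0 subr0.
  apply/is_derive1P => e e0; rewrite /flatexp.
  pose C : R := 1 + (k.+2)`!%:R; have C0 : 0 < C by rewrite ltr_wpDr.
  exists (e / C) => [|h /andP[h0 hr]]; first exact: divr_gt0.
  rewrite [0 < t]ltNge t0 /= !subr0; case: ifP => th; last by rewrite mul0r normr0 ltW.
  have h1 : t + h <= h by rewrite gerDr.
  have h2 : 0 < h by rewrite (lt_le_trans th).
  have := flatexp_bound k.+2 (t + h); rewrite /flatexp th -/C.
  move: th h1; set x := t + h => x0 xh H.
  (* Near 0 the function is [x ^+ 2] times the bounded [flatexp k.+2], so its derivative at 0 is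
     zero. *)
  have -> : x^-1 ^+ k * expR (- x^-1) = x ^+ 2 * (x^-1 ^+ k.+2 * expR (- x^-1)).
    by rewrite mulrA; congr (_ * _); rewrite -[k.+2]addn2 exprD mulrCA -exprMn mulfV ?gt_eqF// expr1n mulr1.
  rewrite normrM normfV [`|h|]gtr0_norm// ler_pdivrMr// normrM normrX gtr0_norm//.
  rewrite (@le_trans _ _ (h ^+ 2 * C))//.
    by rewrite ler_pM ?exprn_ge0 ?(ltW x0)// lerXn2r// nnegrE ltW.
  rewrite expr2 -mulrA mulrC ler_wpM2r ?(ltW h2)// -ler_pdivlMr// ltW//.
  by move: hr; rewrite gtr0_norm.
have E : \forall x \near t, (fun x => x^-1 ^+ k * expR (- x^-1)) x = flatexp k x.
  exists t => //= x /=; rewrite ltr_norml => /andP[_ xt]; rewrite /flatexp ifT//; lra.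
apply: (near_eq_is_derive E); rewrite /flatexp t0.
have tn : t != 0 by rewrite gt_eqF.
have d1 : is_derive t (1 : R) (fun x : R => x^-1) (- t ^- 2 * 1) by exact: is_deriveV.
have d2 : is_derive (t^-1) (1 : R) (fun s : R => s ^+ k * expR (- s))
    (t^-1 ^+ k * - expR (- t^-1) + expR (- t^-1) * (k%:R * t^-1 ^+ k.-1)).
  have d3 : is_derive (t^-1) (1 : R) (fun s : R => expR (- s)) (- expR (- t^-1)).
    rewrite -[X in is_derive _ _ _ X]mulrN1; apply: (@is_derive1_comp _ expR (fun s => - s)).
  have d4 : is_derive (t^-1) (1 : R) (fun s : R => s ^+ k) (k%:R * t^-1 ^+ k.-1 * 1).
    have := @is_deriveX R R id k (t^-1) 1 1 (is_derive_id _ _).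
    by rewrite (_ : (id ^+ k) = (fun s : R => s ^+ k))//; apply/funext => s; rewrite exprfctE.
  by rewrite mulr1 in d4; exact: (is_deriveM d4 d3).
have := @is_derive1_comp R (fun s : R => s ^+ k * expR (- s)) (fun x => x^-1) t _ _ d2 d1.
move=> /is_derive_eq; apply.
rewrite mulr1 -exprVn !exprS; case: k E d2 => [|k] _ _; first by rewrite expr0 !mul0r !mulr0 addr0 subr0; ring.
rewrite [k.+1.-1]/= exprS; ring.
Unshelve. all: by end_near. Qed.

Lemma flatexp_lip k : exists L, forall x y, `|flatexp k x - flatexp k y| <= L * `|x - y|.
Proof.
exists (1 + (k.+2)`!%:R + k%:R * (1 + (k.+1)`!%:R)).
apply: (derive_bound_lipschitz (is_derive_flatexp k)) => x.
rewrite (le_trans (ler_normB _ _))// lerD ?flatexp_bound// normrM ger0_norm// ler_wpM2l//.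
exact: flatexp_bound.
Qed.

End derive1.

Section tame.
Context {R : realType} (n : nat).
Implicit Types (f g : 'cV[R]_n -> R^o) (x y z v : 'cV[R]_n).

(* [flatexp k] is t^-k exp(-1/t) for t > 0 and 0 elsewhere; the class is closed under
   partial derivatives and hence consists of smooth functions. *)
Inductive tame : ('cV[R]_n -> R^o) -> Prop :=
| tame_flatexp k i (s r : R) : tame (fun x => flatexp k (s * x i 0 + r))
| tame_cst (c : R) : tame (fun=> c)
| tame_add f g : tame f -> tame g -> tame (fun x => f x + g x)
| tame_mul f g : tame f -> tame g -> tame (fun x => f x * g x).

Lemma tame_bound f : tame f -> exists2 C : R, 0 <= C & forall x, `|f x| <= C.
Proof.
elim => {f} [k i s r|c|f g _ [C C0 fC] _ [D D0 gD]|f g _ [C C0 fC] _ [D D0 gD]].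
- by exists (1 + k`!%:R) => [|x]; [rewrite addr_ge0|exact: flatexp_bound].
- by exists `|c|.
- by exists (C + D) => [|x]; [rewrite addr_ge0|rewrite (le_trans (ler_normD _ _))// lerD].
- by exists (C * D) => [|x]; [rewrite mulr_ge0|rewrite normrM ler_pM].
Qed.

Lemma tame_lip f : tame f -> exists L, elipschitz f L.
Proof.
elim => {f} [k i s r|c|f g _ [L fL] _ [M gM]|f g tf [L fL] tg [M gM]].
- have [L H] := @flatexp_lip R k; exists (`|L| * `|s|) => x y.
  rewrite (le_trans (H _ _))// (le_trans (ler_wpM2r _ (ler_norm L)))// -mulrA ler_wpM2l//.
  rewrite opprD addrACA subrr addr0 -mulrBr normrM ler_wpM2l//.
  by have := coord_le_enorm (x - y) i 0; rewrite !mxE.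
- by exists 0 => x y; rewrite subrr normr0 mul0r.
- exists (L + M) => x y; rewrite opprD addrACA (le_trans (ler_normD _ _))// mulrDl lerD//.
- have [C C0 fC] := tame_bound tf; have [D D0 gD] := tame_bound tg.
  exists (C * M + D * L) => x y.
  have -> : f x * g x - f y * g y = f x * (g x - g y) + g y * (f x - f y).
    by move: (f x : R) (g x : R) (f y : R) (g y : R) => a b c d; ring.
  rewrite (le_trans (ler_normD _ _))// mulrDl !normrM -!mulrA lerD//.
    by rewrite ler_pM ?fC ?gM.
  by rewrite ler_pM ?gD ?fL.
Qed.

Lemma tame_partial f i : tame f -> exists2 g, tame g &
  forall x, derivable f x (delta_mx i 0) /\ 'D_(delta_mx i 0) f x = g x.
Proof.
elim => {f} [k j s r|c|f g tf [f' tf' ff'] tg [g' tg' gg']|f g tf [f' tf' ff'] tg [g' tg' gg']].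
- have [ij|ij] := eqVneq j i; last first.
    exists (fun=> 0) => [|x]; first exact: tame_cst.
    apply/quoP => e e0; exists 1 => // t _; rewrite /quo !mxE (negbTE ij) /= mulr0 addr0.
    by rewrite subrr mul0r subrr normr0 ltW.
  subst j; exists (fun x => s * (flatexp k.+2 (s * x i 0 + r) + (- k%:R) * flatexp k.+1 (s * x i 0 + r))).
    apply: tame_mul; first exact: tame_cst.
    apply: tame_add; first exact: tame_flatexp.
    by apply: tame_mul; [exact: tame_cst|exact: tame_flatexp].
  move=> x; apply/quoP => e e0; rewrite mulNr.
  have s1 : 0 < `|s| + 1 by rewrite ltr_wpDl.
  have /is_derive1P/(_ (e / (`|s| + 1)))[|d d0 dH] := is_derive_flatexp k (s * x i 0 + r).
    by rewrite divr_gt0.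
  exists (d / (`|s| + 1)) => [|t /andP[t0 tr]]; first by rewrite divr_gt0.
  have [->|sn] := eqVneq s 0.
    by rewrite /quo !mul0r subrr mul0r subrr normr0 ltW.
  have tn : t != 0 by rewrite -normr_gt0.
  have st : 0 < `|s * t| < d.
    rewrite normrM mulr_gt0 ?normr_gt0//= (@le_lt_trans _ _ ((`|s| + 1) * `|t|))//.
      by rewrite ler_wpM2r// lerDl.
    by rewrite mulrC -ltr_pdivlMr.
  have := dH _ st; set D := _ - k%:R * _ => H.
  have -> : quo (fun x => flatexp k (s * x i 0 + r)) (delta_mx i 0) x t - s * D =
      s * ((flatexp k (s * x i 0 + r + s * t) - flatexp k (s * x i 0 + r)) / (s * t) - D).
    rewrite /quo !mxE !eqxx mulr1 mulrDr addrAC.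
    move: (flatexp k (s * x i 0 + r + s * t)) (flatexp k (s * x i 0 + r)) => a b.
    by field; rewrite tn.
  rewrite normrM (le_trans (ler_wpM2l _ H))// mulrCA ler_piMr ?(ltW e0)//.
  by rewrite ler_pdivrMr// mul1r lerDl.
- exists (fun=> 0) => [|x]; first exact: tame_cst.
  by apply/quoP => e e0; exists 1 => // t _; rewrite /quo subrr mul0r subrr normr0 ltW.
- exists (fun x => f' x + g' x) => [|x]; first exact: tame_add.
  have [d1 e1] := ff' x; have [d2 e2] := gg' x; split; first exact: derivableD.
  by rewrite -e1 -e2; exact: deriveD.
- exists (fun x => f x * g' x + g x * f' x) => [|x].
    by apply: tame_add; apply: tame_mul.
  have [d1 e1] := ff' x; have [d2 e2] := gg' x; split; first exact: derivableM.
  by rewrite -e1 -e2; exact: deriveM.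
Qed.

Lemma tame_prod (I : Type) (r : seq I) (F : I -> 'cV[R]_n -> R^o) : (forall i, tame (F i)) ->
  tame (fun x => \prod_(i <- r) F i x).
Proof.
move=> tF; elim: r => [|i r IH].
  by rewrite (_ : (fun x => _) = fun=> 1); [exact: tame_cst|apply/funext => x; rewrite big_nil].
rewrite (_ : (fun x => _) = fun x => F i x * \prod_(j <- r) F j x); first exact: tame_mul.
by apply/funext => x; rewrite big_cons.
Qed.

Lemma line_mvt f g v : (forall x, derivable f x v /\ 'D_v f x = g x) ->
  forall x t, exists2 s, `|s| <= `|t| & f (x + t *: v) - f x = t * g (x + s *: v).
Proof.
move=> fg x t.
pose phi (s : R) : R := f (x + s *: v).
have d (s : R) : is_derive s (1 : R) phi (g (x + s *: v)).
  apply/is_derive1P => e e0; have /quoP/(_ e e0)[r r0 rH] := fg (x + s *: v).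
  exists r => // h hr; have := rH h hr.
  by rewrite /quo /phi -addrA -scalerDl.
have cf a b : {within `[a, b], continuous phi}.
  by apply: derivable_within_continuous => z _; apply: ex_derive; exact: d.
have phi0 : phi 0 = f x by rewrite /phi scale0r addr0.
have [t0|t0|->] := ltgtP t 0.
- have [c cI E] := @MVT R phi (fun s => g (x + s *: v)) _ _ t0 (fun a _ => d a) (cf _ _).
  exists c; last first.
    move: E; rewrite phi0 sub0r /phi; move: (f (x + t *: v) : R) (f x : R) (g _ : R) => a b c' h; lra.
  by move: cI; rewrite in_itv /= => /andP[h1 h2]; rewrite !ltr0_norm// lerN2 ltW.
- have [c cI E] := @MVT R phi (fun s => g (x + s *: v)) _ _ t0 (fun a _ => d a) (cf _ _).
  exists c; last first.
    move: E; rewrite phi0 subr0 /phi; move: (f (x + t *: v) : R) (f x : R) (g _ : R) => a b c' h; lra.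
  by move: cI; rewrite in_itv /= => /andP[h1 h2]; rewrite !gtr0_norm// ltW.
- by exists 0; rewrite // scale0r addr0 subrr mul0r.
Qed.

End tame.

(** * Convolution with smooth kernels *)

Section convolution.
Context {R : realType} (n : nat).
Implicit Types (f g q zeta : 'cV[R]_n -> R^o) (x y z v : 'cV[R]_n).
Notation leb := (@leb R n).
Notation Rint g := (Rintegral leb setT g).

(** The variable stands in the kernel, so derivatives fall on the smooth factor; the kernel is
    reflected, which produces the [-1] in [conv_partial]. *)
Definition conv zeta q x : R^o := Rint (fun y => zeta (y - x) * q y).

Variables (q : 'cV[R]_n -> R^o) (C r : R) (bq : bsupp C r q).

Lemma continuous_shift f L x : elipschitz f L -> measurable_fun setT ((fun y => f (y - x)) : borel_mx n 1 -> R).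
Proof.
move=> fL; apply: continuous_measurable_mx; apply: (@elipschitz_continuous _ _ _ R^o _ L) => y z.
by rewrite (le_trans (fL _ _))// opprB addrA subrK.
Qed.

Lemma bsupp_shiftM zeta L B x : elipschitz zeta L -> (forall y, `|zeta y| <= B) ->
  bsupp (C * B) r (fun y => zeta (y - x) * q y).
Proof.
move=> zL zB; have := bsuppM bq (continuous_shift x zL) (fun y => zB (y - x)).
by congr (bsupp _ _ _); apply/funext => y; rewrite mulrC.
Qed.

Lemma Rint_le C1 r1 C2 r2 g1 g2 : bsupp C1 r1 g1 -> bsupp C2 r2 g2 -> (forall x, g1 x <= g2 x) ->
  Rint g1 <= Rint g2.
Proof. by move=> b1 b2 H; apply: le_Rintegral => //; [exact: bsupp_integrable b1|exact: bsupp_integrable b2]. Qed.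

Lemma normr_Rint C1 r1 g : bsupp C1 r1 g -> `|Rint g| <= Rint (fun x => `|g x|).
Proof. by move=> b; apply: le_normr_Rintegral => //; exact: bsupp_integrable b. Qed.

Lemma bsupp_norm C1 r1 g : bsupp C1 r1 g -> bsupp C1 r1 (fun x => `|g x|).
Proof.
move=> [mg gC]; split; last by move=> x; rewrite normr_id.
exact: measurableT_comp.
Qed.

Lemma bsuppZ C1 r1 g (a : R) : bsupp C1 r1 g -> bsupp (`|a| * C1) r1 (fun x => a * g x).
Proof.
move=> [mg gC]; split; first exact: measurable_funM.
by move=> x; rewrite normrM -mulrA ler_wpM2l.
Qed.

Lemma RintZ C1 r1 g (a : R) : bsupp C1 r1 g -> Rint (fun x => a * g x) = a * Rint g.
Proof. by move=> b; apply: RintegralZl => //; exact: bsupp_integrable b. Qed.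

Let I := Rint (fun x => `|q x|).

Lemma conv_dist zeta L B x x' (e : R) : elipschitz zeta L -> (forall y, `|zeta y| <= B) ->
  (forall y, `|zeta (y - x) - zeta (y - x')| <= e) -> `|conv zeta q x - conv zeta q x'| <= e * I.
Proof.
move=> zL zB H; have b1 := bsupp_shiftM x zL zB; have b2 := bsupp_shiftM x' zL zB.
rewrite /conv -(RintB b1 b2).
have e0 : 0 <= e := le_trans (normr_ge0 _) (H 0).
have bB : bsupp (C * e) r (fun y => (zeta (y - x) * q y) - (zeta (y - x') * q y)).
  have := bsuppM bq (measurable_funB (continuous_shift x zL) (continuous_shift x' zL)) H.
  by congr (bsupp _ _ _); apply/funext => y; rewrite mulrC mulrBl.
have bI := bsuppZ e (bsupp_norm bq).
rewrite (le_trans (normr_Rint bB))// -(RintZ e (bsupp_norm bq)).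
apply: (Rint_le (bsupp_norm bB) bI) => y.
by rewrite -mulrBl normrM ler_wpM2r.
Qed.

Lemma continuous_conv zeta : tame zeta -> continuous (conv zeta q).
Proof.
move=> tz; have [L zL] := tame_lip tz; have [B B0 zB] := tame_bound tz.
apply: (@elipschitz_continuous _ _ _ R^o _ (L * I)) => x x'.
rewrite mulrAC; apply: (conv_dist zL zB) => y.
by rewrite (le_trans (zL _ _))// opprB addrC subrKA enormBC.
Qed.

Lemma conv_partial zeta zeta' i : tame zeta -> tame zeta' ->
  (forall x, derivable zeta x (delta_mx i 0) /\ 'D_(delta_mx i 0) zeta x = zeta' x) ->
  forall x, derivable (conv zeta q) x (delta_mx i 0) /\
    'D_(delta_mx i 0) (conv zeta q) x = conv (fun y => -1 * zeta' y) q x.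
Proof.
move=> tz tz' zz x; have [L zL] := tame_lip tz; have [B B0 zB] := tame_bound tz.
have [L' zL'] := tame_lip tz'; have [B' B0' zB'] := tame_bound tz'.
set v := delta_mx i 0; have v1 : enorm v = 1 by exact: enorm_delta.
have I0 : 0 <= I by rewrite /I; apply: Rintegral_ge0 => y _.
apply/quoP => e e0.
have K0 : 0 < `|L'| * I + 1 by rewrite ltr_wpDl// mulr_ge0.
exists (e / (`|L'| * I + 1)) => [|t /andP[t0 tr]]; first exact: divr_gt0.
have tn : t != 0 by rewrite -normr_gt0.
(* Mean value theorem followed by the Lipschitz bound of [zeta']: a second-order remainder uniform
   in [y], which survives integration against [q]. *)
have key y : `|(zeta (y - (x + t *: v)) - zeta (y - x)) + t * zeta' (y - x)| <= `|L'| * `|t| * `|t|.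
  have [s st E] := line_mvt zz (y - x) (- t).
  rewrite opprD addrA -scaleNr E mulNr addrC -mulrBr normrM mulrC ler_wpM2r//.
  rewrite (le_trans (zL' _ _))// (le_trans (ler_wpM2r _ (ler_norm L')))// ?enorm_ge0//.
  rewrite ler_wpM2l// opprD addrA subrr add0r enormN enormZ v1 mulr1.
  by rewrite normrN in st.
have b1 := bsupp_shiftM (x + t *: v) zL zB; have b2 := bsupp_shiftM x zL zB.
have b3 := bsupp_shiftM x zL' zB'.
have bD := bsuppZ (- t) b3.
have b12 : bsupp (C * B + C * B) r (fun y => zeta (y - (x + t *: v)) * q y - zeta (y - x) * q y).
  split; first by apply: measurable_funB; [exact: b1.1|exact: b2.1].
  by move=> y; rewrite mulrDl (le_trans (ler_normB _ _))// lerD//; [exact: b1.2|exact: b2.2].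
have bN : Rint (fun y => -1 * zeta' (y - x) * q y) = - Rint (fun y => zeta' (y - x) * q y).
  rewrite (_ : - Rint _ = -1 * Rint (fun y => zeta' (y - x) * q y)); last by rewrite mulN1r.
  by rewrite -(RintZ _ b3); congr (Rint _); apply/funext => y; rewrite mulrA.
have E : conv zeta q (x + t *: v) - conv zeta q x - t * conv (fun y => -1 * zeta' y) q x =
    Rint (fun y => (zeta (y - (x + t *: v)) * q y - zeta (y - x) * q y) - (- t) * (zeta' (y - x) * q y)).
  rewrite (RintB b12 bD) (RintB b1 b2) (RintZ _ b3) /conv bN.
  by rewrite mulrN mulNr.
have bT : bsupp (C * B + C * B + `|- t| * (C * B')) r
    (fun y => (zeta (y - (x + t *: v)) * q y - zeta (y - x) * q y) - (- t) * (zeta' (y - x) * q y)).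
  split; first by apply: measurable_funB; [exact: b12.1|exact: bD.1].
  by move=> y; rewrite mulrDl (le_trans (ler_normB _ _))// lerD//; [exact: b12.2|exact: bD.2].
have H : `|conv zeta q (x + t *: v) - conv zeta q x - t * conv (fun y => -1 * zeta' y) q x| <=
    `|L'| * `|t| * `|t| * I.
  rewrite E (le_trans (normr_Rint bT))// -(RintZ _ (bsupp_norm bq)).
  apply: (Rint_le (bsupp_norm bT) (bsuppZ _ (bsupp_norm bq))) => y.
  rewrite -mulrBl mulNr opprK mulrA -mulrDl normrM ler_wpM2r//.
have -> : quo (conv zeta q) v x t - conv (fun y => -1 * zeta' y) q x =
    (conv zeta q (x + t *: v) - conv zeta q x - t * conv (fun y => -1 * zeta' y) q x) / t.
  by rewrite /quo [RHS]mulrBl [t * _]mulrC mulfK.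
rewrite normrM normfV ler_pdivrMr// (le_trans H)// mulrAC ler_wpM2r//.
have LI : `|t| * (`|L'| * I + 1) <= e by rewrite -ler_pdivlMr// ltW.
have := mulr_ge0 (normr_ge0 L') I0; move: LI; rewrite mulrDr mulr1 => LI LI0.
rewrite (le_trans _ LI)// [`|L'| * _]mulrC -mulrA lerDl//.
Qed.

Lemma conv_Ck k zeta : tame zeta -> Ck k (conv zeta q).
Proof.
elim: k zeta => [|k IH] zeta tz; split => //; try exact: continuous_conv.
move=> i; have [zeta' tz' zz] := tame_partial i tz.
have H := conv_partial tz tz' zz; split; first by move=> x; case: (H x).
rewrite (_ : partial i (conv zeta q) = conv (fun y => -1 * zeta' y) q).
  by apply: IH; apply: tame_mul => //; exact: tame_cst.
by apply/funext => x; rewrite /partial; case: (H x).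
Qed.

Lemma convE zeta L B x : elipschitz zeta L -> (forall y, `|zeta y| <= B) ->
  conv zeta q x = Rint (fun z => zeta z * q (x + z)).
Proof.
move=> zL zB; rewrite /conv -(Rint_translate x (bsupp_shiftM x zL zB).1).
by congr (Rint _); apply/funext => z; rewrite addrK addrC.
Qed.

End convolution.

Section bump.
Context {R : realType} (n : nat) (n0 : (0 < n)%N).
Notation leb := (@leb R n).
Notation Rint g := (Rintegral leb setT g).

Lemma bump_exists (d : R) : 0 < d -> exists eta : 'cV[R]_n -> R^o, exists C,
  [/\ tame eta, forall x, 0 <= eta x, bsupp C d eta & Rint eta = 1].
Proof.
move=> d0.
(* Each factor vanishes unless the coordinate lies strictly between [- d] and [d]; the product is at
   least [m'] on the cube of half the size, so its integral is positive. *)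
pose b (x : 'cV[R]_n) : R^o := \prod_(i < n) (flatexp 0 (1 * x i 0 + d) * flatexp 0 (-1 * x i 0 + d)).
have tb : tame b by apply: tame_prod => i; apply: tame_mul; exact: tame_flatexp.
have b0 x : 0 <= b x by apply: prodr_ge0 => i _; rewrite mulr_ge0 ?flatexp_ge0.
have [C C0 bC] := tame_bound tb; have [L bL] := tame_lip tb.
have bout x : ~ cbox d x -> b x = 0.
  move=> xd; have [i xi] : exists i, ~ (- d <= x i 0 <= d).
    by apply/not_existsP => H; apply: xd => i; rewrite !mxE; apply: contrapT; exact: H.
  rewrite /b (bigD1 i)//= mul1r mulN1r /flatexp; case: ltP => h1; last by rewrite !mul0r.
  case: ltP => h2; last by rewrite mulr0 mul0r.
  by exfalso; apply: xi; apply/andP; split; lra.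
have bbs : bsupp C d b.
  split; first by apply: continuous_measurable_mx; exact: (elipschitz_cont bL).
  move=> x; rewrite indicE; case: (boolP (x \in cbox d)) => xd; first by rewrite mulr1.
  by rewrite bout ?normr0 ?mulr0// => /mem_set; rewrite (negbTE xd).
have bpos x : cbox (d / 2) x -> 0 < b x.
  move=> xd; apply: prodr_gt0 => i _; have := xd i; rewrite !mxE => /andP[h1 h2].
  by rewrite mul1r mulN1r /flatexp !ifT ?mulr_gt0 ?expR_gt0 ?exprn_gt0 ?invr_gt0//; lra.
have d2 : 0 < d / 2 by rewrite divr_gt0.
pose m : R := flatexp 0 (d / 2) ^+ 2; pose m' := m ^+ n.
have fmono (x y : R) : 0 < x -> x <= y -> flatexp 0 x <= flatexp 0 y.
  move=> x0 xy; have y0 := lt_le_trans x0 xy.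
  by rewrite /flatexp x0 y0 !expr0 !mul1r ler_expR lerN2 lef_pV2.
have f0 : 0 < flatexp 0 (d / 2) by rewrite /flatexp d2 expr0 mul1r expR_gt0.
have m0 : 0 < m' by rewrite !exprn_gt0.
have bge x : cbox (d / 2) x -> m' <= b x.
  move=> xd; rewrite /m' -[n in X in X <= _]card_ord -prodr_const; apply: ler_prod => i _.
  have := xd i; rewrite !mxE => /andP[h1 h2].
  rewrite ltW ?exprn_gt0//= /m expr2 mul1r mulN1r ler_pM ?(ltW f0)//; apply: fmono => //; lra.
have I0 : 0 < Rint b.
  have bm : bsupp m' (d / 2) (fun x : 'cV[R]_n => m' * \1_(cbox (d / 2)) x).
    split; first by apply: measurable_funM => //; apply: measurable_indic; exact: measurable_cbox.
    by move=> x; rewrite ger0_norm// mulr_ge0// ltW.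
  apply: (@lt_le_trans _ _ (Rint (fun x => m' * \1_(cbox (d / 2)) x))).
    have b1 : bsupp 1 (d / 2) (fun x : 'cV[R]_n => \1_(cbox (d / 2)) x : R).
      split; first by apply: measurable_indic; exact: measurable_cbox.
      by move=> x; rewrite mul1r ger0_norm.
    rewrite (RintZ _ b1) mulr_gt0// /Rintegral integral_indic//; last exact: measurable_cbox.
    have E : leb (cbox (d / 2)) = ((2 * (d / 2)) ^+ n)%:E by rewrite leb_cbox// ltW.
    rewrite (_ : fine _ = (2 * (d / 2)) ^+ n); first by rewrite exprn_gt0// mulr_gt0.
    by rewrite setIT; move: (congr1 (@fine R) E); exact.
  apply: (Rint_le bm bbs) => x /=; rewrite indicE; case: (boolP (x \in _)) => xd.
    by rewrite mulr1 bge//; rewrite inE in xd.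
  by rewrite mulr0.
exists (fun x => (Rint b)^-1 * b x), (`|(Rint b)^-1| * C); split.
- by apply: tame_mul => //; exact: tame_cst.
- by move=> x; rewrite mulr_ge0// invr_ge0 ltW.
- exact: bsuppZ.
- by rewrite (RintZ _ bbs) mulVf// gt_eqF.
Qed.

End bump.

(** * Functions of the gauge *)

Section gradients.
Context {R : realType} (n : nat).
Implicit Types (f q : 'cV[R]_n -> R^o) (x y z g v : 'cV[R]_n).

Lemma is_grad_affine_near f q x g (a b r : R) : 0 < r ->
  (forall y, enorm (y - x) < r -> f y = a + b * q y) -> is_grad q x g -> is_grad f x (b *: g).
Proof.
move=> r0 fq qg e e0; have b1 : 0 < `|b| + 1 by rewrite ltr_wpDl.
have [s s0 sH] := qg (e / (`|b| + 1)) (divr_gt0 e0 b1).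
exists (Num.min r s); first by rewrite lt_min r0.
move=> y; rewrite lt_min => /andP[yr ys].
rewrite fq// [f x]fq ?subrr ?enorm0// mxdotZl.
have -> : a + b * q y - (a + b * q x) - b * mxdot g (y - x) = b * (q y - q x - mxdot g (y - x)).
  by move: (q y : R) (q x : R) => c d; ring.
rewrite normrM (le_trans (ler_wpM2l _ (sH y ys)))// mulrA ler_wpM2r ?enorm_ge0//.
by rewrite mulrCA ler_piMr ?(ltW e0)// ler_pdivrMr// mul1r lerDl.
Qed.

(** Fermat's rule; the sign of [s] selects maxima or minima. *)
Lemma is_grad_extremum f x g (s : R) : s != 0 -> (forall y, s * f y <= s * f x) -> is_grad f x g -> g = 0.
Proof.
move=> s0 fx fg; apply/eqP; rewrite -enorm_eq0 -normr_le0 ger0_norm ?enorm_ge0//.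
have [->|g0] := eqVneq g 0; first by rewrite enorm0.
have g1 : 0 < enorm g by rewrite enorm_gt0.
apply/ler_addgt0Pr => e e0; rewrite add0r; have [r r0 rH] := fg e e0.
have [t t0 [tr ts]] : exists2 t, t != 0 & `|t| * enorm g < r /\ 0 < s * t.
  exists (r / 2 / enorm g * Num.sg s).
    by rewrite mulf_neq0 ?sgr_eq0// gt_eqF// !divr_gt0.
  rewrite normrM normr_sg s0 mulr1 gtr0_norm ?divr_gt0// divfK ?gt_eqF//; split; first by lra.
  by rewrite mulrCA [s * _]mulrC -normrEsg mulr_gt0 ?divr_gt0// normr_gt0.
have E : x + t *: g - x = t *: g by rewrite addrC addKr.
have := rH (x + t *: g); rewrite E enormZ => /(_ tr); rewrite mxdotZr -sqr_enorm.
have := fx (x + t *: g); move: (f (x + t *: g) : R) (f x : R) => a b sab.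
have tn : 0 < `|t| by rewrite normr_gt0.
have sn : 0 < `|s| by rewrite normr_gt0.
have sst : s * t = `|s| * `|t| by rewrite -normrM gtr0_norm.
move=> H; have : `|s| * `|a - b - t * enorm g ^+ 2| <= `|s| * (e * (`|t| * enorm g)) by rewrite ler_wpM2l.
rewrite -normrM ler_norml => /andP[H1 _]; move: H1.
have -> : s * (a - b - t * enorm g ^+ 2) = s * a - s * b - s * t * enorm g ^+ 2 by ring.
rewrite sst => H1.
have : `|s| * `|t| * enorm g ^+ 2 <= `|s| * `|t| * (e * enorm g).
  have -> : `|s| * `|t| * (e * enorm g) = `|s| * (e * (`|t| * enorm g)) by ring.
  lra.
by rewrite ler_pM2l ?mulr_gt0// expr2 ler_pM2r.
Qed.

End gradients.

Lemma clamp_lip (R : realType) (s t : R) :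
  `|Num.min 1 (Num.max 0 s) - Num.min 1 (Num.max 0 t)| <= `|s - t|.
Proof.
wlog st : s t / s <= t.
  by move=> H; have [/H//|/ltW/H] := leP s t; rewrite distrC [leRHS]distrC.
have e1 : Num.max 0 s <= Num.max 0 t by rewrite ge_max !le_max lexx st orbT.
have e2 : Num.min 1 (Num.max 0 s) <= Num.min 1 (Num.max 0 t).
  by rewrite le_min !ge_min lexx e1 orbT.
rewrite distrC [leRHS]distrC !ger0_norm ?subr_ge0//.
case: (leP t 0) => t0.
  by rewrite [Num.max 0 s]max_l ?(le_trans st t0)// subrr subr_ge0.
case: (leP s 0) => s0.
  rewrite [Num.min 1 0]min_r// subr0 ge_min; apply/orP; right.
  by rewrite lerBrDr gerDl.
case: (leP 1 s) => s1.
  by rewrite min_l ?(le_trans s1 st)// subrr subr_ge0.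
by rewrite lerD2r ge_min lexx orbT.
Qed.

Section levels.
Context {R : realType} (n : nat) (n0 : (0 < n)%N) (p : 'cV[R]_n -> R^o) (hp : gauge p).
Implicit Types (x y z g v : 'cV[R]_n).
Notation leb := (@leb R n).

(** Where [p] equals [c] the function [|p - c|] is minimal, so its gradient could only be zero; but
    along the ray it grows at a positive rate. Thus it is not differentiable there, and Rademacher's
    theorem applies. *)
Lemma level_ae (c : R) : 0 < c -> {ae leb, forall x, p x != c}.
Proof.
move=> c0; have [L _ pL] := gauge_lip hp.
have qL : elipschitz (fun x => `|p x - c| : R^o) L.
  move=> x y; rewrite (le_trans (ler_dist_dist _ _))//.
  by rewrite opprB addrA subrK; exact: pL.
apply: (ae_imp (gradset_ae qL)) => x [g qg]; apply/eqP => px.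
have g0 : g = 0.
  by apply: (is_grad_extremum (s := -1) _ _ qg); rewrite ?oppr_eq0 ?oner_eq0// => y;
    rewrite !mulN1r lerN2 px subrr normr0.
have x0 : 0 < enorm x by rewrite enorm_gt0; apply: (gauge_n0 hp); rewrite px.
have e0 : 0 < c / 2 / enorm x by rewrite !divr_gt0.
have [r r0 rH] := qg _ e0.
have [t t0 tE] : exists2 t, 0 < t & t * enorm x = r / 2.
  by exists (r / 2 / enorm x); [rewrite !divr_gt0|rewrite divfK ?gt_eqF].
have E : x + t *: x - x = t *: x by rewrite addrC addKr.
have := rH (x + t *: x); rewrite E enormZ (gtr0_norm t0) tE.
have r2 : r / 2 < r by lra.
move=> /(_ r2); rewrite g0 mxdot0l subr0 px subrr normr0 subr0.
rewrite -{1}[x]scale1r -scalerDl gaugeZ ?addr_ge0 ?(ltW t0)// px.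
have -> : (1 + t) * c - c = t * c by ring.
have tc : 0 < t * c by rewrite mulr_gt0.
rewrite normr_id (gtr0_norm tc) -tE mulrCA divfK ?gt_eqF// mulrA [t * c]mulrC ler_pdivlMr//.
rewrite [c * t]mulrC ger_pMr//; lra.
Qed.

Variables (h : 'cV[R]_n -> R) (M : R).
Hypotheses (h0 : forall v, 0 <= h v) (hM : forall v w, `|h v - h w| <= M * enorm (v - w))
  (hZ : forall t v, 0 <= t -> h (t *: v) = t * h v).

Let u x := h (- lgrad p x).

Lemma measurable_h_comp (w : 'cV[R]_n -> 'cV[R]_n) : measurable_fun setT (w : borel_mx n 1 -> borel_mx n 1) ->
  measurable_fun setT ((fun x => h (w x)) : borel_mx n 1 -> R).
Proof.
move=> mw; apply: (measurableT_comp (f := (h : borel_mx n 1 -> R))); last exact: mw.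
by apply: continuous_measurable_mx; apply: (@elipschitz_continuous _ _ _ R^o _ M).
Qed.

Lemma measurable_neg (w : 'cV[R]_n -> 'cV[R]_n) : measurable_fun setT (w : borel_mx n 1 -> borel_mx n 1) ->
  measurable_fun setT ((fun x => - w x) : borel_mx n 1 -> borel_mx n 1).
Proof.
move=> mw; apply: (measurableT_comp (f := (-%R : borel_mx n 1 -> borel_mx n 1))); last exact: mw.
apply: continuous_measurable_mxmx; apply: (@elipschitz_continuous _ _ _ _ _ 1) => x y.
by rewrite mul1r -opprD normrN mxnorm_le_enorm.
Qed.

Lemma measurable_level_grad : measurable_fun setT (u : borel_mx n 1 -> R).
Proof.
have [L _ pL] := gauge_lip hp.
by apply: measurable_h_comp; apply: measurable_neg; exact: measurable_lgrad pL.
Qed.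

Definition level_integral (t : R) : \bar R := (\int[leb]_(x in [set x | (p x < t)%R]) (u x)%:E)%E.

Lemma measurable_level (t : R) : measurable ([set x | p x < t] : set (borel_mx n 1)).
Proof. by apply: sub_sigma_algebra; exact: open_gauge_lt. Qed.

Let mu_ : measurable_fun setT (fun z : borel_mx n 1 => (u z)%:E).
Proof. by apply/measurable_EFinP; exact: measurable_level_grad. Qed.

(** The gradient of the gauge is homogeneous of degree 0, so only the volume scales. *)
Lemma level_integral_scale (t : R) : 0 < t -> level_integral t = ((t ^+ n)%:E * level_integral 1)%E.
Proof.
move=> t0; have [L _ pL] := gauge_lip hp.
pose k s (x : borel_mx n 1) := (((fun z => (u z)%:E) \_ ([set x | (p x < s)%R])) x)%E.
have mk s : measurable_fun setT (k s).
  by apply/(measurable_restrictT _ (measurable_level s)); exact: measurable_funTS.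
have k0 s x : (0 <= k s x)%E by apply: erestrict_ge0 => y _; rewrite lee_fin; exact: h0.
have E s : level_integral s = (\int[leb]_x k s x)%E by rewrite /level_integral integral_mkcond.
rewrite !E; have := ge0_integral_affine 0 t0 (mk t) (k0 t).
rewrite (_ : (\int[leb]_x k t (t *: (x : 'cV[R]_n) + 0)%R)%E = (\int[leb]_x k 1%R x)%E); last first.
  apply: ge0_ae_eq_integral => //.
  - by apply: (measurableT_comp (mk t)); exact: measurable_affine.
  - apply: (ae_imp (gradset_ae pL)) => x [g pg] _; rewrite /k !patchE addr0.
    rewrite /u (lgradE (gauge_is_grad_scale hp t0 pg)) (lgradE pg).
    have -> : (t *: x \in [set x0 | p x0 < t]) = (x \in [set x0 | p x0 < 1]) => //.
    by apply/idP/idP; rewrite !inE /= gaugeZ ?(ltW t0)// gtr_pMr.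
move=> ->; rewrite muleA -EFinM exprVn mulfV ?mul1e//.
by rewrite expf_neq0// gt_eqF.
Qed.

Lemma level_integral_fin t : level_integral t \is a fin_num.
Proof.
have [L L0 pL] := gauge_lip hp; have [c c0 cp] := gauge_ge hp.
rewrite ge0_fin_numE; last by rewrite /level_integral; apply: integral_ge0 => x _; rewrite lee_fin; exact: h0.
have nL0 : 0 <= `|M| * (n%:R * L) by rewrite mulr_ge0// mulr_ge0// ltW.
have hz : h 0 = 0 by rewrite -(scale0r 0) hZ// mul0r.
apply: (le_lt_trans (integral_le_cst (a := `|M| * (n%:R * L)) _ (measurable_level t) _ nL0 _)).
- exact: measurable_funTS.
- move=> x _; rewrite h0 /u -[h _]subr0 -hz (le_trans (ler_norm _))// (le_trans (hM _ _))//.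
  rewrite subr0 enormN (le_trans (ler_wpM2r (enorm_ge0 _) (ler_norm M)))// ler_wpM2l//.
  exact: lgrad_le.
rewrite lte_mul_pinfty// ?lee_fin//.
apply: (leb_bounded (r := `|t| / c)) => x xt.
rewrite ler_pdivlMr// mulrC (le_trans (cp x))// (le_trans (ltW xt))// ler_norm//.
Qed.

Section cutoff.
Variables (a b : R) (a0 : 0 < a) (ab : a < b).

Definition cutoff x : R^o := Num.min 1 (Num.max 0 ((b - p x) / (b - a))).

Let ba0 : 0 < b - a. Proof. by rewrite subr_gt0. Qed.

Lemma cutoff01 x : 0 <= cutoff x <= 1.
Proof. by rewrite le_min ler01 le_max lexx ge_min lexx. Qed.

Lemma cutoff1 x : p x <= a -> cutoff x = 1.
Proof.
move=> xa; apply/eqP; rewrite eq_minl le_max; apply/orP; right.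
by rewrite ler_pdivlMr// mul1r lerD2l lerN2.
Qed.

Lemma cutoff0 x : b <= p x -> cutoff x = 0.
Proof.
move=> xb; rewrite /cutoff max_l ?min_r//.
by rewrite pmulr_lle0 ?invr_gt0// subr_le0.
Qed.

Lemma cutoffE x : a <= p x <= b -> cutoff x = b / (b - a) + (- (b - a)^-1) * p x.
Proof.
move=> /andP[xa xb]; rewrite /cutoff max_r; last by rewrite divr_ge0 ?subr_ge0// ltW.
rewrite min_r; last by rewrite ler_pdivrMr// mul1r lerD2l lerN2.
by rewrite mulrBl mulNr [p x / _]mulrC.
Qed.

Lemma cutoff_lip : exists L, elipschitz cutoff L.
Proof.
have [L _ pL] := gauge_lip hp; exists (L / (b - a)) => x y.
rewrite (le_trans (clamp_lip _ _))// -mulrBl normrM normfV (gtr0_norm ba0) opprB addrC addrA subrK.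
by rewrite distrC mulrAC ler_wpM2r ?invr_ge0 ?(ltW ba0).
Qed.

Lemma cutoff_grad x g g' : p x != a -> p x != b -> is_grad p x g -> is_grad cutoff x g' ->
  g' = if a < p x < b then - (b - a)^-1 *: g else 0.
Proof.
move=> xa xb pg cg; case: ifP => [/andP[h1 h2]|].
  have oA : open ([set y | a < p y] `&` [set y | p y < b]).
    by apply: openI; [exact: open_gauge_gt|exact: open_gauge_lt].
  have /nbhs_eball[r r0 rH] := open_nbhs_nbhs (conj oA (conj h1 h2)).
  have cg' : is_grad cutoff x (- (b - a)^-1 *: g).
    apply: (is_grad_affine_near r0 _ pg) => y yr; apply: cutoffE.
    by have := rH y; rewrite enormBC => /(_ yr)[/ltW h1' /ltW h2']; rewrite h1' h2'.
  by rewrite -(lgradE cg) (lgradE cg').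
move=> /negbT; rewrite negb_and -!leNgt => /orP[px|px].
  apply: (is_grad_extremum (s := 1) _ _ cg); rewrite ?oner_eq0// => y.
  by rewrite !mul1r (cutoff1 px); case/andP: (cutoff01 y).
apply: (is_grad_extremum (s := -1) _ _ cg); rewrite ?oppr_eq0 ?oner_eq0// => y.
by rewrite !mulN1r lerN2 (cutoff0 px); case/andP: (cutoff01 y).
Qed.

Lemma cutoff_lgrad_ae : {ae leb, forall x, lgrad cutoff x = if a < p x < b then - (b - a)^-1 *: lgrad p x else 0}.
Proof.
have [L _ pL] := gauge_lip hp; have [L' cL] := cutoff_lip.
have b0 := lt_trans a0 ab.
apply: (ae_imp (ae_and (ae_and (level_ae a0) (level_ae b0)) (ae_and (gradset_ae pL) (gradset_ae cL)))).
move=> x [[xa xb] [[g pg] [g' cg]]]; rewrite (lgradE pg) (lgradE cg).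
exact: cutoff_grad.
Qed.

(** The gradient of the cutoff is [- (b - a)^-1] times that of [p] on the shell between the levels,
    and the shell is a difference of dilates. The quotient tends to [n] when both levels tend to
    1. *)
Lemma cutoff_integral : (\int[leb]_x (h (lgrad cutoff x))%:E =
  ((b ^+ n - a ^+ n) / (b - a))%:E * level_integral 1)%E.
Proof.
have [L' cL] := cutoff_lip; have b0 := lt_trans a0 ab.
have mA : measurable ([set x | p x < b] `\` [set x | p x < a] : set (borel_mx n 1)).
  by apply: measurableD; exact: measurable_level.
have bi : 0 <= (b - a)^-1 by rewrite invr_ge0 ltW.
have hz : h 0 = 0 by rewrite -(scale0r 0) hZ// mul0r.
rewrite (_ : (\int[leb]_x (h (lgrad cutoff x))%:E)%E =
    (\int[leb]_(x in [set x | (p x < b)%R] `\` [set x | (p x < a)%R]) ((b - a)^-1 * u x)%:E)%E); last first.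
  rewrite [RHS]integral_mkcond; apply: ge0_ae_eq_integral => //.
  - by apply/measurable_EFinP; apply: measurable_h_comp; exact: measurable_lgrad cL.
  - apply/(measurable_restrictT _ mA); apply: measurable_funTS; apply/measurable_EFinP.
    by apply: measurable_funM => //; exact: measurable_level_grad.
  - by move=> x _; rewrite lee_fin.
  - by move=> x _; apply: erestrict_ge0 => y _; rewrite lee_fin mulr_ge0//; exact: h0.
  - apply: (ae_imp (ae_and cutoff_lgrad_ae (level_ae a0))) => x [E xa] _; rewrite patchE E.
    have -> : (x \in [set x0 | p x0 < b] `\` [set x0 | p x0 < a]) = (a < p x < b).
      apply/idP/idP; rewrite !inE /=.
        by move=> [-> /negP]; rewrite -leNgt andbT lt_neqAle eq_sym xa.
      by move=> /andP[h1 h2]; split => //; apply/negP; rewrite -leNgt ltW.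
    by case: ifP => _; [rewrite scaleNr -scalerN hZ|rewrite hz].
have -> : (\int[leb]_(x in [set x | (p x < b)%R] `\` [set x | (p x < a)%R]) ((b - a)^-1 * u x)%:E =
    (b - a)^-1%:E * \int[leb]_(x in [set x | (p x < b)%R] `\` [set x | (p x < a)%R]) (u x)%:E)%E.
  rewrite -ge0_integralZl//; first exact: measurable_funTS.
  by move=> x _; rewrite lee_fin; exact: h0.
have S : level_integral b = (level_integral a +
    \int[leb]_(x in [set x | (p x < b)%R] `\` [set x | (p x < a)%R]) (u x)%:E)%E.
  rewrite /level_integral -ge0_integral_setU//.
  - congr integral; apply/seteqP; split => x /=; last by case=> [xa|[]//]; exact: lt_trans ab.
    by move=> xb; have [xa|xa] := ltP (p x) a; [left|right; split => //; apply/negP; rewrite -leNgt].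
  - exact: measurable_level.
  - exact: measurable_funTS.
  - by move=> x _; rewrite lee_fin; exact: h0.
  - by rewrite disj_set2E; apply/eqP/seteqP; split => // x [/= h1 [_ h2]].
have Fa := level_integral_fin a.
have -> : (\int[leb]_(x in [set x | (p x < b)%R] `\` [set x | (p x < a)%R]) (u x)%:E =
    level_integral b - level_integral a)%E by rewrite S addeAC subee// add0e.
rewrite (level_integral_scale a0) (level_integral_scale b0).
have [j ->] : exists j, level_integral 1 = j%:E by exists (fine (level_integral 1)); rewrite fineK ?level_integral_fin.
have bn : b - a != 0 by rewrite gt_eqF.
move: (a ^+ n) (b ^+ n) => c d; have -> : (d%:E * j%:E - c%:E * j%:E = ((d - c) * j)%:E)%E.
  by rewrite mulrBl EFinB !EFinM.
by rewrite -!EFinM mulrA [_^-1 * _]mulrC.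
Qed.

End cutoff.
End levels.

(** * Capacity of star bodies *)

Section integrals.
Context {R : realType} (n : nat).
Implicit Types (f g q : 'cV[R]_n -> R^o) (x y z v : 'cV[R]_n).
Notation leb := (@leb R n).
Notation Rint g := (Rintegral leb setT g).

Lemma closed_bounded_compact (A : set 'cV[R]_n) (B : R) : closed A -> (forall x, A x -> enorm x <= B) -> compact A.
Proof.
move=> cA AB; rewrite (_ : A = (@trmx R 1 n) @` ((@trmx R 1 n) @^-1` A)); last first.
  apply/seteqP; split => [x x1|_ [x x1 <-]//]; exists x^T; rewrite ?trmxK//= trmxK//.
have tc a b : continuous (@trmx R a b).
  move=> x; apply: (@elipschitz_continuous _ _ _ _ _ 1) => {}x y.
  by rewrite mul1r -raddfB/= (le_trans (mxnorm_le_enorm _))// enorm_tr.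
apply: continuous_compact; first by apply: continuous_subspaceT; exact: tc.
apply: bounded_closed_compact; last by apply: closed_comp => // x _; exact: tc.
exists B; split; first exact: num_real; move=> M M1 x /= /AB x1; rewrite (le_trans (mxnorm_le_enorm _))// -enorm_tr (le_trans x1)// ltW//.
Qed.

Lemma bsuppD C r C' f g : bsupp C r f -> bsupp C' r g -> bsupp (C + C') r (fun x => f x + g x).
Proof.
move=> [mf fC] [mg gC]; split; first exact: measurable_funD.
by move=> x; rewrite mulrDl (le_trans (ler_normD _ _))// lerD.
Qed.

Lemma bsupp0 r : bsupp 0 r (fun _ : 'cV[R]_n => 0).
Proof. by split => [|x]; [exact: measurable_cst|rewrite normr0 mul0r]. Qed.

Lemma Rint_sum (I : Type) (s : seq I) (c : I -> R) (g : I -> 'cV[R]_n -> R) C r : (forall i, bsupp C r (g i)) ->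
  (exists C', bsupp C' r (fun x => \sum_(i <- s) c i * g i x)) /\
  Rint (fun x => \sum_(i <- s) c i * g i x) = \sum_(i <- s) c i * Rint (g i).
Proof.
move=> bg; elim: s => [|i s [[C' bs] IH]].
  rewrite (_ : (fun x => _) = (fun _ : 'cV[R]_n => 0 : R)); last by apply/funext => x; rewrite big_nil.
  rewrite big_nil; split; first by exists 0; exact: bsupp0.
  by rewrite /Rintegral integral0.
rewrite (_ : (fun x => _) = (fun x : 'cV[R]_n => c i * g i x + \sum_(i <- s) c i * g i x)); last first.
  by apply/funext => x; rewrite big_cons.
have bi := bsuppZ (c i) (bg i); split; first by exists (`|c i| * C + C'); exact: bsuppD.
by rewrite (RintD bi bs) big_cons IH (RintZ _ (bg i)).
Qed.

Lemma derive_shift q x z v l : (derivable (fun w => q (x + w) : R^o) z v /\ 'D_v (fun w => q (x + w) : R^o) z = l) <->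
  (derivable q (x + z) v /\ 'D_v q (x + z) = l).
Proof.
split=> /quoP H; apply/quoP => e e0; have [r r0 rH] := H e e0; exists r => // t tr; have := rH t tr;
by rewrite /quo addrA.
Qed.

Lemma dder_shift q x z v : dder (fun w => q (x + w) : R^o) v z = dder q v (x + z).
Proof.
have dder0 g y : ~ derivable g y v -> dder g v y = 0 by move=> H; rewrite /dder indicE (memNset (H : ~ dset g v y)) mul0r.
have [dq|dq] := pselect (derivable q (x + z) v).
  have [dx dE] := (derive_shift q x z v _).2 (conj dq erefl).
  by rewrite (dderE dx) (dderE dq) dE.
have dx : ~ derivable (fun w => q (x + w) : R^o) z v.
  by move=> dx; apply: dq; case: ((derive_shift q x z v _).1 (conj dx erefl)).
by rewrite (dder0 _ _ dq) (dder0 _ _ dx).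
Qed.

Lemma elipschitz_shift q L x : elipschitz q L -> elipschitz (fun w => q (x + w) : R^o) L.
Proof. by move=> qL y z; rewrite (le_trans (qL _ _))// opprD addrACA subrr add0r. Qed.

Lemma bsupp_out C r f x : bsupp C r f -> ~ cbox r x -> f x = 0.
Proof.
move=> [_ fC] xr; apply/normr0_eq0/eqP; rewrite eq_le normr_ge0 andbT (le_trans (fC x))//.
by rewrite indicE memNset// mulr0.
Qed.

Lemma enorm_cbox d x : 0 <= d -> cbox d x -> enorm x <= n%:R * d.
Proof.
move=> d0 /(cboxP _ d0) xd; rewrite (le_trans (enorm_le_mxnorm x))// muln1 ler_wpM2l//.
Qed.

Lemma measurable_addmx : measurable_fun setT (fun xz : borel_mx n 1 * borel_mx n 1 => (xz.1 : 'cV[R]_n) + xz.2 : borel_mx n 1).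
Proof.
apply: measurable_fun_mx => i j.
rewrite (_ : (fun w0 => _) = (fun xz : borel_mx n 1 * borel_mx n 1 => (xz.1 : 'cV[R]_n) i j + (xz.2 : 'cV[R]_n) i j)); last first.
  by apply/funext => x; rewrite mxE.
apply: measurable_funD; apply: (measurableT_comp (f := fun x : borel_mx n 1 => (x : 'cV[R]_n) i j)).
- exact: measurable_coord.
- exact: measurable_fst.
- exact: measurable_coord.
- exact: measurable_snd.
Qed.

End integrals.

(** * Mollification and Jensen's inequality *)

Section smoothing.
Context {R : realType} (n : nat).
Implicit Types (f g : 'cV[R]_n -> R^o) (x y z v : 'cV[R]_n).
Notation leb := (@leb R n).
Notation Rint g := (Rintegral leb setT g).
Variables (q : 'cV[R]_n -> R^o) (r Lq : R) (bq : bsupp 1 r q) (qL : elipschitz q Lq).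
Variables (eta : 'cV[R]_n -> R^o) (C d : R) (te : tame eta) (e0 : forall x, 0 <= eta x)
  (be : bsupp C d eta) (e1 : Rint eta = 1).
Let f := conv eta q.

Lemma conv_smooth : smooth f. Proof. by move=> k; exact: conv_Ck bq _ _ te. Qed.

Let fE x : f x = Rint (fun z => eta z * q (x + z)).
Proof.
have [L zL] := tame_lip te; have [B B0 zB] := tame_bound te.
exact: (convE bq x zL zB).
Qed.

Let bM x (w : 'cV[R]_n -> R) M : measurable_fun setT (w : borel_mx n 1 -> R) -> (forall y, `|w y| <= M) ->
  bsupp (C * M) d (fun z => eta z * w z).
Proof. exact: bsuppM. Qed.

Let mshift (w : 'cV[R]_n -> R) x : measurable_fun setT (w : borel_mx n 1 -> R) ->
  measurable_fun setT ((fun z => w (x + z)) : borel_mx n 1 -> R).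
Proof.
move=> mw; have := measurable_affine 1 x => ma.
rewrite (_ : (fun z => _) = (w : borel_mx n 1 -> R) \o (fun z : borel_mx n 1 => 1 *: (z : 'cV[R]_n) + x : borel_mx n 1)).
  exact: measurableT_comp.
by apply/funext => z /=; rewrite scale1r addrC.
Qed.

Let q1 y : `|q y| <= 1.
Proof. by rewrite (le_trans (bq.2 y))// mul1r indicE lern1 leq_b1. Qed.

Let bqs x : bsupp (C * 1) d (fun z => eta z * q (x + z)).
Proof. by apply: bM => //; apply: mshift; exact: bq.1. Qed.

(** Difference quotients of [f] are means of difference quotients of [q]; these are bounded and
    converge almost everywhere, so dominated convergence moves the derivative to [q]. *)
Lemma conv_partialE x i : partial i f x = Rint (fun z => eta z * dder q (delta_mx i 0) (x + z)).
Proof.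
set e := delta_mx i 0; pose t_ (k : nat) : R := k.+1%:R^-1.
have dx : dset f e x by case: (conv_smooth 1) => _ /(_ i) [+ _]; apply.
have H1 : quo f e x (t_ k) @[k --> \oo] --> 'D_e f x by exact: quo_cvg.
have H2 := dder_test_cvg (v := e) (zeta_ := fun=> eta) (elipschitz_shift x qL) (fun=> be) be.1 _.
have {}H2 := H2 (fun y => cvg_cst _).
apply: (cvg_unique (@Rhausdorff R) H1).
have -> : Rint (fun z => eta z * dder q e (x + z)) = Rint (fun z => eta z * dder (fun w => q (x + w) : R^o) e z).
  by congr (Rint _); apply/funext => z; rewrite dder_shift.
rewrite (_ : (fun k => quo f e x (t_ k)) = (fun k => Rint (fun z => eta z * quo (fun w => q (x + w) : R^o) e z (t_ k)))).
  exact: H2.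
apply/funext => k; rewrite /quo !fE [LHS]mulrC mulrBr -(RintZ _ (bqs _)) -(RintZ _ (bqs x)).
rewrite -(RintB (bsuppZ _ (bqs _)) (bsuppZ _ (bqs _))); congr (Rint _); apply/funext => z.
by rewrite -mulrBr -mulrBr mulrC -mulrA -[x + _ + z]addrA [_ *: e + z]addrC.
Qed.

Section energy.
Variables (h : 'cV[R]_n -> R) (M : R).
Hypotheses (h0 : forall v, 0 <= h v) (hM : forall v w, `|h v - h w| <= M * enorm (v - w)) (hz : h 0 = 0)
  (hsub : forall v c, (forall w, (forall y, mxdot w y <= h y) -> mxdot w v <= c) -> h v <= c).
Let H x := h (lgrad q x).

Let mH : measurable_fun setT (H : borel_mx n 1 -> R).
Proof. by apply: (measurable_h_comp hM); exact: measurable_lgrad qL. Qed.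

Let HB x : `|H x| <= `|M| * (n%:R * `|Lq|).
Proof.
rewrite /H -[h _]subr0 -hz (le_trans (hM _ _))// subr0 (le_trans (ler_wpM2r (enorm_ge0 _) (ler_norm M)))// ler_wpM2l//.
by rewrite (le_trans (lgrad_le x qL))// ler_wpM2l// ler_norm.
Qed.

Let bH x : bsupp (C * (`|M| * (n%:R * `|Lq|))) d (fun z => eta z * H (x + z)).
Proof. by apply: bM => //; exact: mshift. Qed.

(** By [hsub], [h] is controlled by its linear minorants, and a linear function commutes with the
    mean against [eta]. *)
Lemma conv_jensen x : h (grad f x) <= Rint (fun z => eta z * H (x + z)).
Proof.
apply: hsub => w wh.
pose g (i : 'I_n) z := eta z * dder q (delta_mx i 0) (x + z).
have bg i : bsupp (C * Lq) d (g i).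
  apply: bM => //; first by apply: mshift; exact: measurable_dder qL.
  by move=> y; rewrite (le_trans (dder_le _ _ qL))// enorm_delta mulr1.
have [[C' bs] sE] := Rint_sum (index_enum 'I_n) (fun i => w i 0) bg.
have -> : mxdot w (grad f x) = \sum_i w i 0 * Rint (g i).
  by rewrite mxdotE; apply: eq_bigr => i _; rewrite big_ord1 mxE conv_partialE.
rewrite -sE; apply: (Rint_le bs (bH x)) => z.
rewrite (_ : \sum_i _ = eta z * mxdot w (lgrad q (x + z))); first by rewrite ler_wpM2l ?e0//; exact: wh.
by rewrite mxdotE mulr_sumr; apply: eq_bigr => i _; rewrite big_ord1 mxE /g mulrCA.
Qed.

Let mF : measurable_fun setT (fun xz : borel_mx n 1 * borel_mx n 1 => (eta xz.2 * H ((xz.1 : 'cV[R]_n) + xz.2))%:E).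
Proof.
apply/measurable_EFinP; apply: measurable_funM.
  by apply: (measurableT_comp (f := (eta : borel_mx n 1 -> R))); [exact: be.1|exact: measurable_snd].
by apply: (measurableT_comp (f := (H : borel_mx n 1 -> R))); [exact: mH|exact: measurable_addmx].
Qed.

(** After integrating Jensen's inequality and exchanging the integrals, translation invariance makes
    the inner integral independent of [z], and [eta] has mass 1. *)
Lemma conv_energy : (\int[leb]_x (h (grad f x))%:E <= \int[leb]_x (H x)%:E)%E.
Proof.
have mHe : measurable_fun setT (fun x : borel_mx n 1 => (H x)%:E) by apply/measurable_EFinP.
have H0 (x : borel_mx n 1) : (0 <= (H x)%:E)%E by rewrite lee_fin; exact: h0.
have K (z : borel_mx n 1) : (\int[leb]_x (eta z * H ((x : 'cV[R]_n) + z))%:E = (eta z)%:E * \int[leb]_x (H x)%:E)%E.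
  have HT := ge0_integral_translate z mHe H0.
  have [ez|ez] := eqVneq (eta z) 0.
    by rewrite ez mul0e; under eq_integral do rewrite mul0r; rewrite integral0.
  have ez0 : 0 < eta z by rewrite lt_def ez e0.
  have Z := @integral_scale _ _ R leb setT (fun x => (H ((x : 'cV[R]_n) + z))%:E) (eta z) ez0 (fun x _ => H0 _).
  by rewrite -HT -Z; apply: eq_integral => x _; rewrite EFinM.
have F0 (z : borel_mx n 1 * borel_mx n 1) : (0 <= (eta z.2 * H ((z.1 : 'cV[R]_n) + z.2))%:E)%E.
  by rewrite lee_fin mulr_ge0 ?e0//; exact: h0.
have Fub := @fubini_tonelli _ _ (borel_mx n 1) (borel_mx n 1) R leb leb _ mF F0.
have E1 : (\int[leb]_x (h (grad f x))%:E <= \int[leb]_x \int[leb]_z (eta z * H ((x : 'cV[R]_n) + z))%:E)%E.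
  apply: le_integral_ae => x _; first by rewrite lee_fin h0.
  have F := integrable_fin_num measurableT (bsupp_integrable (bH x)).
  have E : (\int[leb]_z (eta z * H (x + z))%:E = (Rint (fun z => eta z * H (x + z)))%:E)%E.
    by symmetry; exact: fineK F.
  by rewrite E lee_fin; exact: conv_jensen.
apply: (le_trans E1); move: Fub => /= ->.
have -> : (\int[leb]_z \int[leb]_x (eta z * H ((x : 'cV[R]_n) + z))%:E = \int[leb]_z ((eta z)%:E * \int[leb]_x (H x)%:E))%E.
  by apply: eq_integral => z _; exact: K.
rewrite ge0_integralZr//.
- rewrite (_ : (\int[leb]_x (eta x)%:E)%E = 1%E) ?mul1e//.
  have F := integrable_fin_num measurableT (bsupp_integrable be).
  by rewrite -e1; symmetry; exact: fineK F.
- by apply/measurable_EFinP; exact: be.1.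
- by move=> z _; rewrite lee_fin e0.
- by apply: integral_ge0 => x _; exact: H0.
Qed.

End energy.
End smoothing.

Lemma measurable_grad (R : realType) n (f : 'cV[R]_n -> R^o) : smooth f ->
  measurable_fun setT (grad f : borel_mx n 1 -> borel_mx n 1).
Proof.
move=> sf; apply: measurable_fun_mx => i j.
rewrite (_ : (fun w0 => _) = partial i f); last by apply/funext => x; rewrite mxE.
by apply: continuous_measurable_mx; case: (sf 1) => _ /(_ i) [_ []].
Qed.

(** * Upper bound by mollified cutoffs *)

Section upper_bound.
Context {R : realType} (s m : nat) (s0 : (0 < s)%N) (m0 : (0 < m)%N).
Notation n := (1 + s)%N.
Variables (p : 'cV[R]_n -> R^o) (hp : gauge p) (Q : set 'rV[R]_m) (hQ : convex_body_o Q).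
Notation K := [set x : 'cV[R]_n | p x <= 1].
Notation alpha := (@hausdorff_density R s).
Notation J u := (level_integral p (hu Q u) 1).
Implicit Types (x y z v : 'cV[R]_n) (u : 'M[R]_(n, m)).

Lemma hu_dual u v c : (forall w, (forall y, mxdot w y <= hu Q u y) -> mxdot w v <= c) -> hu Q u v <= c.
Proof. by move=> H; apply: (hu_le hQ) => y Qy; apply: H => w; exact: hu_ge. Qed.

(** The normal is a multiple of the gradient of [p], whereas [J u] evaluates at its opposite; hence
    the argument [- u]. *)
Lemma projection_level u : support_projection_body Q K (- u) = ((alpha * n%:R)%:E * J u)%E.
Proof.
have [r r0 rH] := hu_lip n hQ.
have := area_formula s0 hp (h := hu Q (- u)) (hu_ge0 hQ _) (rH _) (hu_homog hQ _).
rewrite /support_projection_body /hu => ->; congr (_ * _)%E.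
by apply: eq_integral => x _; rewrite -/(hu Q u (- lgrad p x)) huN.
Qed.

Lemma level_ge0 u : (0 <= J u)%E.
Proof. by apply: integral_ge0 => x _; rewrite lee_fin; exact: (hu_ge0 hQ). Qed.

Lemma mean_level : sphere_mean (fun u => n%:R%:E * J u)%E = ((alpha)^-1%:E * integral_affine_surface_area Q K)%E.
Proof.
have nm0 : (0 < n * m)%N by rewrite muln_gt0 m0.
have a0 := @hausdorff_density_gt0 R s s0.
have P0 u : (0 <= support_projection_body Q K u)%E.
  rewrite -[u]opprK projection_level mule_ge0 ?level_ge0// lee_fin mulr_ge0// ltW//.
rewrite /integral_affine_surface_area -(sphere_meanN P0) -(sphere_meanZ nm0).
- congr sphere_mean; apply/funext => u; rewrite projection_level muleA -EFinM mulrA mulVf ?mul1r//.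
  by rewrite gt_eqF.
- by rewrite invr_gt0.
- by move=> u; exact: P0.
Qed.

Lemma directional_energyE (f : 'cV[R]_n -> R^o) u : smooth f ->
  directional_energy Q f u = (\int[@leb R n]_x (hu Q u (grad f x))%:E)%E.
Proof.
move=> sf; have [r r0 rH] := hu_lip n hQ.
have mg := measurable_grad sf.
rewrite /directional_energy (lebesgue_intE (f := fun x => (hu Q u (grad f x))%:E))//.
  by apply/measurable_EFinP; exact: (measurable_h_comp (rH u)).
by move=> x; rewrite lee_fin; exact: (hu_ge0 hQ).
Qed.

(** One function must serve all [u], because the infimum in the capacity is taken outside the mean
    over the sphere. *)
Lemma upper_competitor (d : R) : 0 < d -> exists f : 'cV[R]_n -> R^o,
  [/\ smooth f, compactly_supported f, forall x, K x -> 1 <= f x &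
    forall u, (directional_energy Q f u <= ((1 + 2 * d) ^+ s)%:E * (n%:R%:E * J u))%E].
Proof.
move=> d0; have [L L0 pL] := gauge_lip hp; have [c c0 pc] := gauge_ge hp.
have a0 : 0 < 1 + d by lra.
have ab : 1 + d < 1 + 2 * d by lra.
pose q := cutoff p (1 + d) (1 + 2 * d).
have [Lq qL] : exists Lq, elipschitz q Lq := cutoff_lip hp ab.
pose r := (1 + 2 * d) / c.
have r0 : 0 <= r by rewrite divr_ge0// ltW//; lra.
have qr x : r < enorm x -> q x = 0.
  move=> /ltW xr; apply: cutoff0 => //; move: xr.
  by rewrite /r ler_pdivrMr// [_ * c]mulrC => xr; exact: le_trans (pc x).
have q01 x : 0 <= q x <= 1 by exact: cutoff01.
have bq : bsupp 1 r q.
  split; first by apply: continuous_measurable_mx; exact: elipschitz_cont qL.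
  move=> x; rewrite mul1r indicE; case: (boolP (x \in cbox r)) => xr.
    by case/andP: (q01 x) => h0 h1; rewrite ger0_norm.
  rewrite qr ?normr0// ltNge; apply: contra xr => xr; rewrite inE; apply/cboxP => //.
  by rewrite (le_trans (mxnorm_le_enorm x)).
(* The kernel is supported in a ball of radius [n * D], over which [p] varies by at most [d]. The
   cutoff equals 1 up to the level [1 + d], so its mean is still 1 on [K]. *)
pose D := d / (L * n%:R).
have D0 : 0 < D by rewrite divr_gt0// mulr_gt0.
have [eta [C [te e0 be e1]]] := bump_exists n D0.
have [Le eL] := tame_lip te; have [B B0 eB] := tame_bound te.
have fE x : conv eta q x = Rintegral (@leb R n) setT (fun z => eta z * q (x + z)) := convE bq x eL eB.
have etaD z : eta z != 0 -> enorm z <= n%:R * D.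
  move=> ez; apply: enorm_cbox; first exact: ltW.
  by apply: contrapT => zD; move: ez; rewrite (bsupp_out be zD) eqxx.
exists (conv eta q); split.
- exact: (conv_smooth bq te).
- apply: (closed_bounded_compact (B := r + n%:R * D)); first exact: closed_closure.
  have cl : closed [set x : 'cV[R]_n | enorm x <= r + n%:R * D].
    apply: (@closed_comp _ _ (@enorm R n 1 : _ -> R^o) [set t | t <= r + n%:R * D]) => [x _|].
      exact: continuous_enorm.
    exact: closed_le.
  move=> x /(closure_subset _) H; rewrite -/([set x : 'cV[R]_n | enorm x <= r + n%:R * D] x).
  rewrite ((closure_id _).1 cl); apply: H => {}x /= fx.
  rewrite leNgt; apply: contra fx => xr; rewrite fE (_ : (fun z => _) = fun _ => 0).
    by rewrite /Rintegral integral0.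
  apply/funext => z; have [->|/etaD zD] := eqVneq (eta z) 0; first by rewrite mul0r.
  rewrite qr ?mulr0// -(ltrD2r (n%:R * D)) (lt_le_trans xr)//.
  have -> : enorm x = enorm (x + z - z) by rewrite addrK.
  by rewrite (le_trans (enormB _ _))// lerD2l.
- move=> x Kx; rewrite fE (_ : (fun z => _) = eta) ?e1//.
  apply/funext => z; have [->|/etaD zD] := eqVneq (eta z) 0; first by rewrite mul0r.
  rewrite [q _]cutoff1 ?mulr1//.
  have := pL (x + z) x; have -> : x + z - x = z by rewrite addrC addKr.
  move=> /ler_normlW; rewrite lerBlDl => /le_trans; apply.
  apply: lerD; first exact: Kx.
  have dE : L * (n%:R * D) = d by rewrite mulrA /D mulrC divfK// gt_eqF// mulr_gt0.
  by rewrite -dE ler_wpM2l// ltW.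
move=> u; have [M M0 rH] := hu_lip n hQ; rewrite directional_energyE; last exact: (conv_smooth bq te).
apply: (le_trans (conv_energy bq qL te e0 be e1 (hu_ge0 hQ u) (rH u) (hu0 hQ u) (@hu_dual u))).
rewrite (cutoff_integral hp (hu_ge0 hQ u) (rH u) (hu_homog hQ u) a0 ab) muleA -EFinM.
apply: lee_wpmul2r; first exact: level_ge0.
(* After factoring the difference of [n]-th powers, each of the [n] terms is at most the [s]-th
   power of the larger level. *)
rewrite lee_fin ler_pdivrMr ?subr_gt0// subrXX mulrC ler_wpM2r ?subr_ge0 ?(ltW ab)//.
have -> : (1 + 2 * d) ^+ s * n%:R = \sum_(i < n) (1 + 2 * d) ^+ s by rewrite sumr_const card_ord mulr_natr.
apply: ler_sum => i _.
have -> : (1 + 2 * d) ^+ s = (1 + 2 * d) ^+ (n.-1 - i) * (1 + 2 * d) ^+ i.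
  by rewrite -exprD subnK// -ltnS; exact: ltn_ord.
rewrite ler_wpM2l ?exprn_ge0 ?lerXn2r// ?nnegrE; lra.
Qed.

Lemma pow_limit (c : R) k : (1 + c * j.+1%:R^-1) ^+ k @[j --> \oo] --> (1 : R).
Proof.
have H : (1 + c * j.+1%:R^-1) @[j --> \oo] --> (1 : R).
  rewrite -[X in _ --> X]addr0; apply: cvgD; first exact: cvg_cst.
  by rewrite -(mulr0 c); apply: cvgMr; exact: cvg_harmonic.
elim: k => [|k IH].
  by rewrite (_ : (fun j : nat => _) = fun=> 1); [exact: cvg_cst|apply/funext => j; rewrite expr0].
rewrite (_ : (fun j : nat => _) = fun j => (1 + c * j.+1%:R^-1) * (1 + c * j.+1%:R^-1) ^+ k); last first.
  by apply/funext => j; rewrite exprS.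
by rewrite -[X in _ --> X]mulr1; exact: cvgM H IH.
Qed.

Theorem capacity_le : (affine_capacity Q K <= (alpha^-1)%:E * integral_affine_surface_area Q K)%E.
Proof.
have nm0 : (0 < n * m)%N by rewrite muln_gt0 m0.
have nJ0 u : (0 <= n%:R%:E * J u)%E by rewrite mule_ge0 ?level_ge0// lee_fin.
rewrite -mean_level; apply: (lee_mul_limit (w := fun j => (1 + 2 * j.+1%:R^-1) ^+ s)).
- exact: sphere_mean_ge0.
- move=> j; have d0 : 0 < (j.+1%:R^-1 : R) by rewrite invr_gt0.
  have [f [sf cf f1 fE]] := upper_competitor d0.
  apply: (@le_trans _ _ (sphere_mean (directional_energy Q f))); first by apply: ereal_inf_lbound; exists f.
  have w0 : 0 < (1 + 2 * j.+1%:R^-1 : R) ^+ s by rewrite exprn_gt0//; lra.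
  rewrite -(sphere_meanZ nm0 w0 nJ0).
  apply: sphere_mean_le => // u; rewrite directional_energyE//; apply: integral_ge0 => x _.
  by rewrite lee_fin; exact: (hu_ge0 hQ).
- exact: pow_limit.
Qed.

End upper_bound.

(** * Capacity of ellipsoids *)

Section dirichlet.
Context {R : realType} (n : nat).
Implicit Types (f F G H q : 'cV[R]_n -> R^o) (x y z v : 'cV[R]_n).
Notation leb := (@leb R n).
Notation Rint g := (Rintegral leb setT g).
Let t_ (k : nat) : R := k.+1%:R^-1.
Let t_gt0 k : 0 < t_ k. Proof. by rewrite invr_gt0. Qed.
Let t_le1 k : t_ k <= 1. Proof. by rewrite invf_le1// ler1n. Qed.

Lemma Rint_eq_ae C r (g g' : 'cV[R]_n -> R) : bsupp C r g -> measurable_fun setT (g' : borel_mx n 1 -> R) ->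
  {ae leb, forall x, g x = g' x} -> Rint g = Rint g'.
Proof.
move=> bg mg' gg'; have H : {ae leb, forall x, (fun=> g x) k @[k --> \oo] --> g' x}.
  by apply: (ae_imp gg') => x ->; exact: cvg_cst.
have := Rint_cvg (g_ := fun=> g) (fun=> bg) mg' H.
by apply: (cvg_unique (@Rhausdorff R)); exact: cvg_cst.
Qed.

Lemma Rint_le_ae C r C' r' (g g' : 'cV[R]_n -> R) : bsupp C r g -> bsupp C' r' g' ->
  {ae leb, forall x, g x <= g' x} -> Rint g <= Rint g'.
Proof.
move=> bg bg' gg'.
have mm : measurable_fun setT ((fun x => Num.max (g x) (g' x)) : borel_mx n 1 -> R).
  exact: (measurable_maxr bg.1 bg'.1).
have im := integrableD measurableT (bsupp_integrable (bsupp_norm bg)) (bsupp_integrable (bsupp_norm bg')).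
have -> : Rint g' = Rint (fun x => Num.max (g x) (g' x)).
  by apply: (Rint_eq_ae bg' mm); apply: (ae_imp gg') => x /max_r ->.
apply: le_Rintegral => //; first exact: bsupp_integrable bg.
  apply: (le_integrable measurableT _ _ im); first exact/measurable_EFinP.
  move=> x _ /=; rewrite lee_fin; apply: le_trans (ler_norm _).
  by case: (leP (g x) (g' x)) => _; rewrite ?lerDl ?lerDr.
by move=> x _; rewrite le_max lexx.
Qed.

Lemma bsupp_shift C r g v : 0 <= r -> 0 <= C -> bsupp C r g -> bsupp C (r + `|v|) (fun x => g (x + v)).
Proof.
move=> r0 C0 [mg gC]; split.
  rewrite (_ : (fun w0 => _) = (g : borel_mx n 1 -> R) \o (fun z : borel_mx n 1 => 1 *: (z : 'cV[R]_n) + v : borel_mx n 1)).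
    by apply: measurableT_comp => //; exact: measurable_affine.
  by apply/funext => z /=; rewrite scale1r.
move=> x; apply: (le_trans (gC _)); rewrite ler_wpM2l// !indicE ler_nat.
case: (boolP (_ \in cbox r)) => //; rewrite inE => /(cboxP _ r0) xr; rewrite mem_set//.
apply/cboxP; first by rewrite addr_ge0.
have xE : x = x + v - v by rewrite addrK.
by rewrite {1}xE (le_trans (ler_normB _ _))// lerD2r.
Qed.

Section parts.
Variables (H : 'cV[R]_n -> R^o) (LH : R) (HL : elipschitz H LH)
  (Hsub : forall x v, 2 * H x <= H (x + v) + H (x - v)) (v : 'cV[R]_n).
Variable r : R.
Hypothesis r0 : 0 <= r.

Let w t x := quo H v x t.
Let mw t : measurable_fun setT ((w t) : borel_mx n 1 -> R). Proof. exact: measurable_quo HL. Qed.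
Let wb t x : `|w t x| <= LH * enorm v. Proof. exact: quo_le. Qed.
Let w' t x := w t (x - t *: v).
Let mw' t : measurable_fun setT ((w' t) : borel_mx n 1 -> R).
Proof.
rewrite (_ : w' t = (w t : borel_mx n 1 -> R) \o (fun z : borel_mx n 1 => 1 *: (z : 'cV[R]_n) + (- (t *: v)) : borel_mx n 1)).
  by apply: measurableT_comp => //; exact: measurable_affine.
by apply/funext => z /=; rewrite scale1r.
Qed.

(* Discrete integration by parts: after division by t the last factor is minus a second
   difference of [H], so the left side is monotone in [F] when [H] is convex. *)
Lemma quo_parts F C t : 0 <= C -> bsupp C r F -> 0 < t ->
  Rint (fun x => quo F v x t * w t x) = t^-1 * Rint (fun x => F x * (w' t x - w t x)).
Proof.
move=> C0 bF t0; have bs := bsupp_shift (t *: v) r0 C0 bF.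
have b1 := bsuppM bs (mw t) (wb t); have b2 := bsuppM bF (mw t) (wb t).
have b3 := bsuppM bF (mw' t) (fun x => wb t (x - t *: v)).
have -> : Rint (fun x => F x * (w' t x - w t x)) = Rint (fun x => F x * w' t x) - Rint (fun x => F x * w t x).
  by rewrite -(RintB b3 b2); congr (Rint _); apply/funext => x; rewrite mulrBr.
have -> : Rint (fun x => F x * w' t x) = Rint (fun x => F (x + t *: v) * w t x).
  by rewrite -(Rint_translate (- (t *: v)) b1.1); congr (Rint _); apply/funext => x; rewrite subrK.
rewrite mulrBr -(RintZ _ b1) -(RintZ _ b2) -(RintB (bsuppZ _ b1) (bsuppZ _ b2)).
congr (Rint _); apply/funext => x; rewrite /quo -mulrBr -mulrBl.
by rewrite mulrA [t^-1 * _]mulrC.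
Qed.

Lemma quo_parts_le F G C t : 0 <= C -> bsupp C r F -> bsupp C r G -> (forall x, F x <= G x) -> 0 < t ->
  Rint (fun x => quo G v x t * w t x) <= Rint (fun x => quo F v x t * w t x).
Proof.
move=> C0 bF bG FG t0; rewrite (quo_parts C0 bF t0) (quo_parts C0 bG t0) ler_pM2l ?invr_gt0//.
have wd x : `|w' t x - w t x| <= LH * enorm v + LH * enorm v.
  by rewrite (le_trans (ler_normB _ _))// lerD ?wb.
have mwd : measurable_fun setT ((fun x => w' t x - w t x) : borel_mx n 1 -> R) by exact: measurable_funB.
apply: (Rint_le (bsuppM bG mwd wd) (bsuppM bF mwd wd)) => x.
apply: ler_wnM2r => //; rewrite subr_le0 /w' /w /quo subrK ler_pM2r ?invr_gt0//.
have := Hsub x (t *: v); move: (H x : R) (H (x + _) : R) (H (x - _) : R) => a b c; lra.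
Qed.

Lemma bsupp_quo F L C t : elipschitz F L -> 0 <= L -> bsupp C r F -> 0 < t <= 1 ->
  bsupp (L * enorm v) (r + `|v|) (fun x => quo F v x t).
Proof.
move=> FL L0 bF /andP[t0 t1]; split; first exact: measurable_quo FL.
move=> x; rewrite indicE; case: (boolP (x \in _)) => xr; first by rewrite mulr1; exact: quo_le.
have out y : y = x \/ y = x + t *: v -> F y = 0.
  move=> yx; apply: (bsupp_out bF) => /(cboxP _ r0) yr; move/negP: xr; apply; rewrite inE.
  apply/cboxP; first by rewrite addr_ge0.
  case: yx => yE; first by rewrite -yE (le_trans yr)// lerDl.
  have -> : x = y - t *: v by rewrite yE addrK.
  rewrite (le_trans (ler_normB _ _))// lerD// normrZ ger0_norm ?(ltW t0)//.
  by rewrite ler_piMl.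
by rewrite /quo !out ?subrr ?mul0r ?normr0 ?mulr0//; [left|right].
Qed.

Lemma bsupp_dder F L C : elipschitz F L -> 0 <= L -> bsupp C r F -> bsupp (L * enorm v) (r + `|v|) (dder F v).
Proof.
move=> FL L0 bF; split; first exact: measurable_dder FL.
move=> x; rewrite indicE; case: (boolP (x \in _)) => xr; first by rewrite mulr1; exact: dder_le.
have [dx|dx] := pselect (dset F v x); last by rewrite /dder indicE memNset// mul0r normr0 mulr0.
have q0 k : quo F v x (t_ k) = 0.
  have tk : 0 < t_ k <= 1 by rewrite t_gt0 t_le1.
  by apply: (bsupp_out (bsupp_quo FL L0 bF tk)) => xr'; move/negP: xr; apply; rewrite inE.
suff -> : dder F v x = 0 by rewrite normr0 mulr0.
apply: (cvg_unique (@Rhausdorff R) (dder_cvg dx)).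
rewrite (_ : (fun k => _) = fun=> 0); first exact: cvg_cst.
by apply/funext => k; exact: q0.
Qed.

Lemma dirichlet_cvg F L C : elipschitz F L -> 0 <= L -> bsupp C r F ->
  Rint (fun x => quo F v x (t_ k) * w (t_ k) x) @[k --> \oo] --> Rint (fun x => dder F v x * dder H v x).
Proof.
move=> FL L0 bF; apply: (Rint_cvg (C := L * enorm v * (LH * enorm v)) (r := r + `|v|)).
- by move=> k; apply: bsuppM => //; apply: (bsupp_quo FL L0 bF); rewrite t_gt0 t_le1.
- by apply: measurable_funM; [exact: measurable_dder FL|exact: measurable_dder HL].
- apply: (ae_imp (ae_and (derivable_ae v FL) (derivable_ae v HL))) => x [dF dH].
  by apply: cvgM; [exact: (dder_cvg dF)|exact: (dder_cvg dH)].
Qed.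

(** Formally both sides are minus the integral of the function against the second derivative of [H],
    which is nonnegative. The inequality is proved for quotients and passes to the limit. *)
Lemma dirichlet_le F G LF LG C : elipschitz F LF -> 0 <= LF -> elipschitz G LG -> 0 <= LG -> 0 <= C ->
  bsupp C r F -> bsupp C r G -> (forall x, F x <= G x) ->
  Rint (fun x => dder G v x * dder H v x) <= Rint (fun x => dder F v x * dder H v x).
Proof.
move=> FL LF0 GL LG0 C0 bF bG FG.
apply: (ler_cvg_to (dirichlet_cvg GL LG0 bG) (dirichlet_cvg FL LF0 bF)).
by apply: nearW => k; exact: (quo_parts_le C0 bF bG FG (t_gt0 k)).
Qed.

End parts.
End dirichlet.

(** * Energy estimate for ellipsoids *)

Section ellipsoid.
Context {R : realType} (n : nat).
Implicit Types (f F G H q : 'cV[R]_n -> R^o) (x y z v w g : 'cV[R]_n).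
Notation leb := (@leb R n).
Notation Rint g := (Rintegral leb setT g).
Variables (phi : 'M[R]_n) (phiU : phi \in unitmx).
Let psi := invmx phi.
(** Multiplication by the inverse of [phi *m phi^T]. *)
Let metric x : 'cV[R]_n := psi^T *m (psi *m x).

Definition ellipsoid_gauge x : R^o := enorm (psi *m x).
Notation p := ellipsoid_gauge.

Lemma ellipsoid_gaugeP : gauge p.
Proof.
split.
- by move=> t x t0; rewrite /p -scalemxAr enormZ ger0_norm.
- have c0 : 0 < enorm phi + 1 by rewrite ltr_wpDl ?enorm_ge0.
  exists (enorm phi + 1)^-1; first by rewrite invr_gt0.
  move=> x; rewrite mulrC ler_pdivrMr//.
  have {1}-> : x = phi *m (psi *m x) by rewrite mulmxA mulmxV// mul1mx.
  rewrite (le_trans (enorm_mul _ _))// mulrC ler_wpM2l ?enorm_ge0// lerDl//.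
- exists (enorm psi) => x y; rewrite (le_trans (ler_enorm_dist _ _))// -mulmxBr; exact: enorm_mul.
Qed.

Lemma ellipsoidE : [set phi *m x | x in @eball R n] = [set x | p x <= 1].
Proof.
apply/seteqP; split => [_ [x x1 <-]|x x1] /=; first by rewrite /p mulmxA mulVmx// mul1mx.
by exists (psi *m x) => //; rewrite mulmxA mulmxV// mul1mx.
Qed.

(** By Cauchy-Schwarz [p] minus the linear form of the candidate [b] is nonnegative, and it vanishes
    at [x]; so [x] is a minimum and [g - b] is zero. *)
Lemma ellipsoid_grad x g : is_grad p x g -> x != 0 -> g = (p x)^-1 *: metric x.
Proof.
move=> pg x0; have p0 : 0 < p x by exact: gauge_gt0 ellipsoid_gaugeP _ x0.
set b := _ *: _; have bE y : mxdot b y = (p x)^-1 * mxdot (psi *m x) (psi *m y).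
  by rewrite mxdotZl mxdot_mul trmxK.
apply/eqP; rewrite -subr_eq0; apply/eqP.
apply: (is_grad_extremum (f := fun y => p y - mxdot b y : R^o) (x := x) (s := -1)).
- by rewrite oppr_eq0 oner_eq0.
- move=> y; rewrite !mulN1r lerN2 !bE -sqr_enorm expr2 mulKf ?gt_eqF// subrr subr_ge0.
  by rewrite ler_pdivrMl//; exact: mxdot_le.
- move=> e e0; have [r r0 rH] := pg e e0; exists r => // y yr.
  rewrite mxdotBl (_ : p y - mxdot b y - _ - _ = p y - p x - mxdot g (y - x)); first exact: rH.
  rewrite [mxdot b (y - x)]mxdotBr; move: (p y : R) (p x : R) (mxdot b y) (mxdot b x) (mxdot g _) => a1 a2 a3 a4 a5.
  by ring.
Qed.

Variables (h : 'cV[R]_n -> R) (M : R).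
Hypotheses (hM : forall v w, `|h v - h w| <= M * enorm (v - w))
  (hZ : forall t v, 0 <= t -> h (t *: v) = t * h v) (hD : forall v w, h (v + w) <= h v + h w).

Let H x : R^o := h (- metric x).
Let LH := `|M| * (enorm psi^T * enorm psi).

Let HL : elipschitz H LH.
Proof.
move=> x y; rewrite /H (le_trans (hM _ _))// (le_trans (ler_wpM2r (enorm_ge0 _) (ler_norm M)))//.
rewrite -mulrA ler_wpM2l// -opprD enormN /metric -!mulmxBr (le_trans (enorm_mul _ _))// -mulrA.
by rewrite ler_wpM2l ?enorm_ge0//; exact: enorm_mul.
Qed.

Let HD x y : H (x + y) <= H x + H y.
Proof. by rewrite /H /metric !mulmxDr opprD; exact: hD. Qed.

Let HZ t x : 0 <= t -> H (t *: x) = t * H x.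
Proof. by move=> t0; rewrite /H /metric -!scalemxAr -scalerN hZ. Qed.

Let Hsub x v : 2 * H x <= H (x + v) + H (x - v).
Proof.
rewrite -HZ// (le_trans _ (HD _ _))//.
by rewrite addrACA subrr addr0 scaler_nat mulr2n.
Qed.

(** Subadditivity and homogeneity bound every difference quotient of [H] in direction [w] by
    [H w]. *)
Let H_subgrad x gH w : is_grad H x gH -> mxdot gH w <= H w.
Proof.
move=> HG; have [dH <-] := is_grad_derive w HG.
apply: (ler_cvg_to (quo_cvg (dH : dset H w x)) (cvg_cst (H w))).
apply: nearW => k; have t0 : 0 < (k.+1%:R^-1 : R) by rewrite invr_gt0.
rewrite /quo ler_pdivrMr// lerBlDl [H w * _]mulrC -HZ ?(ltW t0)//; exact: HD.
Qed.

Let H_euler x gH : is_grad H x gH -> mxdot gH x = H x.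
Proof.
move=> HG; have [_ <-] := is_grad_derive x HG.
suff [] : derivable H x x /\ 'D_x H x = H x by [].
apply/quoP => e e0; exists 1 => // t /andP[t0]; rewrite ltr_norml => /andP[t1 t2].
rewrite /quo -{1}(scale1r x) -scalerDl HZ; last by lra.
have -> : ((1 + t) * H x - H x) / t = H x.
  by move: (H x : R) => a; field; rewrite -normr_gt0.
by rewrite subrr normr0 ltW.
Qed.

(* - grad F . (phi phi^T) grad H, written with the columns of phi *)
Let S F x := \sum_(k < n) -1 * (dder F (col k phi) x * dder H (col k phi) x).

Let SE F x g gH : is_grad F x g -> is_grad H x gH -> S F x = mxdot gH (- (phi *m (phi^T *m g))).
Proof.
move=> Fg HG; have E q g0 k : is_grad q x g0 -> dder q (col k phi) x = (phi^T *m g0) k 0.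
  move=> qg; have [dq dE] := is_grad_derive (col k phi) qg.
  by rewrite (dderE dq) dE mxdotE mxE; apply: eq_bigr => i _; rewrite big_ord1 !mxE mulrC.
rewrite mxdotNr mxdotC mxdot_mul mxdotE /S -sumrN; apply: eq_bigr => k _.
by rewrite big_ord1 (E _ _ _ Fg) (E _ _ _ HG) mulN1r.
Qed.

(** [H_subgrad] at [w = - phi *m (phi^T *m g)]; there [metric] undoes the matrix and [H w] is
    [h g]. *)
Let S_le F L : elipschitz F L -> {ae leb, forall x, S F x <= h (lgrad F x)}.
Proof.
move=> FL; apply: (ae_imp (ae_and (gradset_ae FL) (gradset_ae HL))) => x [[g Fg] [gH HG]].
rewrite (SE Fg HG) (lgradE Fg) (le_trans (H_subgrad _ HG))// /H /metric !mulmxN opprK.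
rewrite (mulmxA psi) mulVmx// mul1mx mulmxA -trmx_mul mulmxV// trmx1 mul1mx//.
Qed.

Let r' (r : R) := r + \sum_(k < n) `|col k phi|.

Lemma bsupp_wider C r1 r2 q : r1 <= r2 -> 0 <= C -> bsupp C r1 q -> bsupp C r2 q.
Proof.
move=> r12 C0 [mq qC]; split => // x; rewrite (le_trans (qC x))// ler_wpM2l// !indicE ler_nat.
case: (boolP (_ \in cbox r1)) => //; rewrite inE => xr; rewrite mem_set// => i.
by have := xr i; rewrite !mxE => /andP[h1 h2]; apply/andP; split; lra.
Qed.

Let bS F L C r : elipschitz F L -> 0 <= L -> 0 <= r -> bsupp C r F ->
  (exists C', bsupp C' (r' r) (S F)) /\
  Rint (S F) = \sum_(k < n) -1 * Rint (fun x => dder F (col k phi) x * dder H (col k phi) x).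
Proof.
move=> FL L0 r0 bF.
pose D := L * (\sum_(k < n) enorm (col k phi)) * (LH * \sum_(k < n) enorm (col k phi)).
have ek k : enorm (col k phi) <= \sum_(k < n) enorm (col k phi).
  by rewrite (bigD1 k)//= lerDl sumr_ge0// => i _; exact: enorm_ge0.
have LH0 : 0 <= LH by rewrite !mulr_ge0 ?enorm_ge0.
have b k : bsupp D (r' r) (fun x => dder F (col k phi) x * dder H (col k phi) x).
  apply: bsuppM; last 2 first.
  - exact: measurable_dder HL.
  - by move=> x; rewrite (le_trans (dder_le _ _ HL))// ler_wpM2l.
  have bk := bsupp_dder (col k phi) r0 FL L0 bF.
  have {}bk : bsupp (L * enorm (col k phi)) (r' r) (dder F (col k phi)).
    apply: bsupp_wider bk; last by rewrite mulr_ge0 ?enorm_ge0.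
    by rewrite lerD2l (bigD1 k)//= lerDl sumr_ge0.
  split; first exact: bk.1.
  by move=> x; rewrite (le_trans (bk.2 x))// ler_wpM2r// ler_wpM2l.
exact: (Rint_sum (index_enum 'I_n) (fun=> -1) b).
Qed.

Let S_mono F G LF LG C r : elipschitz F LF -> 0 <= LF -> elipschitz G LG -> 0 <= LG -> 0 <= C -> 0 <= r ->
  bsupp C r F -> bsupp C r G -> (forall x, F x <= G x) -> Rint (S F) <= Rint (S G).
Proof.
move=> FL LF0 GL LG0 C0 r0 bF bG FG.
rewrite (bS FL LF0 r0 bF).2 (bS GL LG0 r0 bG).2; apply: ler_sum => k _.
have D := dirichlet_le HL Hsub (col k phi) r0 FL LF0 GL LG0 C0 bF bG FG.
by apply: ler_wnM2l; [rewrite oppr_le0 ler01|exact: D].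
Qed.

Let hz : h 0 = 0. Proof. by rewrite -(scale0r 0) hZ// mul0r. Qed.

Let b_grad F L C r : elipschitz F L -> 0 <= L -> 0 <= r -> bsupp C r F ->
  bsupp (`|M| * (n%:R * L)) (r + 1) (fun x => h (lgrad F x)).
Proof.
move=> FL L0 r0 bF; split; first by apply: (measurable_h_comp hM); exact: measurable_lgrad FL.
move=> x; rewrite indicE; case: (boolP (x \in _)) => xr.
  rewrite mulr1 -[h _]subr0 -hz (le_trans (hM _ _))// subr0.
  rewrite (le_trans (ler_wpM2r (enorm_ge0 _) (ler_norm M)))// ler_wpM2l//; exact: lgrad_le.
have -> : lgrad F x = 0.
  apply/colP => i; rewrite !mxE; apply: (bsupp_out (bsupp_dder _ r0 FL L0 bF)) => xc; move/negP: xr; apply.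
  rewrite inE => k; have := xc k; rewrite !mxE.
  have := mxnorm_le_enorm (delta_mx i 0 : 'cV[R]_n); rewrite enorm_delta.
  by move=> h1 /andP[h2 h3]; apply/andP; split; lra.
by rewrite hz normr0 mulr0.
Qed.

(** The gradient of the cutoff is a nonpositive multiple of [metric x], which turns the vector in
    [SE] into a nonnegative multiple of [x] itself; there Euler's identity gives equality. *)
Let S_cutoff a : 0 < a -> a < 1 -> {ae leb, forall x, S (cutoff p a 1) x = h (lgrad (cutoff p a 1) x)}.
Proof.
move=> a0 a1; have hp := ellipsoid_gaugeP; have [L cL] := cutoff_lip hp a1; have [Lp _ pL] := gauge_lip hp.
apply: (ae_imp (ae_and (ae_and (gradset_ae cL) (gradset_ae HL)) (ae_and (gradset_ae pL) (cutoff_lgrad_ae hp a0 a1)))).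
move=> x [[[g cg] [gH HG]] [[g1 pg] E]].
rewrite (SE cg HG) (lgradE cg) -(lgradE cg) E (lgradE pg); case: ifP => [/andP[xa _]|_]; last first.
  by rewrite !mulmx0 oppr0 mxdot0r hz.
have p0 := lt_trans a0 xa.
rewrite (ellipsoid_grad pg (gauge_n0 hp p0)) scalerA.
have c0 : 0 <= (1 - a)^-1 * (p x)^-1 by rewrite mulr_ge0// invr_ge0 ltW// subr_gt0.
have K : phi *m (phi^T *m metric x) = x.
  by rewrite /metric (mulmxA phi^T) -trmx_mul mulVmx// trmx1 mul1mx mulmxA mulmxV// mul1mx.
by rewrite mulNr scaleNr -scalerN hZ// -!scalemxAr !mulmxN K scalerN opprK mxdotZr (H_euler HG).
Qed.

(** The outer level of the cutoff is exactly 1: it vanishes outside the body and so lies below every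
    nonnegative [F] that is at least 1 on it. *)
Lemma ellipsoid_energy F L C r a : elipschitz F L -> 0 <= L -> 1 <= C -> 0 <= r -> bsupp C r F ->
  0 < a -> a < 1 -> (forall x, 0 <= F x) -> (forall x, p x <= 1 -> 1 <= F x) ->
  (\int[leb]_x (h (lgrad (cutoff p a 1) x))%:E <= \int[leb]_x (h (lgrad F x))%:E)%E.
Proof.
move=> FL L0 C1 r0 bF a0 a1 F0 F1; have hp := ellipsoid_gaugeP; have [L' cL'] := cutoff_lip hp a1.
have [Lc Lc0 cL] : exists2 Lc, 0 <= Lc & elipschitz (cutoff p a 1) Lc.
  by exists `|L'| => // x y; rewrite (le_trans (cL' x y))// ler_wpM2r ?enorm_ge0// ler_norm.
have cF x : cutoff p a 1 x <= F x.
  have [p1|p1] := leP (p x) 1; first by case/andP: (cutoff01 p a 1 x) => _ h1; rewrite (le_trans h1)// F1.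
  by rewrite (cutoff0 a1 (ltW p1)).
have C0 : 0 <= C by lra.
have bc : bsupp C r (cutoff p a 1).
  split; first by apply: continuous_measurable_mx; exact: elipschitz_cont cL.
  move=> x; case/andP: (cutoff01 p a 1 x) => h1 _; rewrite ger0_norm// (le_trans (cF x))//.
  by rewrite (le_trans (ler_norm _))//; exact: bF.2.
have [[C' bSF] _] := bS FL L0 r0 bF; have [[C'' bSc] _] := bS cL Lc0 r0 bc.
have b1 := b_grad FL L0 r0 bF; have b2 := b_grad cL Lc0 r0 bc.
have E1 := Rint_le_ae bSF b1 (S_le FL).
have E2 := Rint_eq_ae bSc b2.1 (S_cutoff a0 a1).
have E3 := S_mono cL Lc0 FL L0 C0 r0 bc bF cF.
have K q Cq rq : bsupp Cq rq (fun x => h (lgrad q x)) ->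
    (\int[leb]_x (h (lgrad q x))%:E = (Rint (fun x => h (lgrad q x)))%:E)%E.
  by move=> bq; symmetry; exact: fineK (integrable_fin_num measurableT (bsupp_integrable bq)).
rewrite (K _ _ _ b1) (K _ _ _ b2) lee_fin -E2; exact: le_trans E3 E1.
Qed.

End ellipsoid.

(** * Test functions and their positive parts *)

Section test_function.
Context {R : realType} (n : nat).
Implicit Types (f g : 'cV[R]_n -> R^o) (x y z v : 'cV[R]_n).

Lemma bounded_of_support (A : set 'cV[R]_n) g : compact A -> continuous g -> (forall x, ~ A x -> g x = 0) ->
  exists2 C : R, 0 <= C & forall x, `|g x| <= C.
Proof.
move=> cA cg gA; have := compact_bounded (continuous_compact (continuous_subspaceT cg) cA).
move=> [N [_ HN]]; exists (`|N| + 1); first by rewrite addr_ge0.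
move=> x; have [Ax|Ax] := pselect (A x); last by rewrite gA// normr0 addr_ge0.
have N1 : N < `|N| + 1 by rewrite (le_lt_trans (ler_norm N))// ltrDl.
by apply: (HN _ N1 (g x)); exists x.
Qed.

Lemma smooth_bounds f : smooth f -> compactly_supported f -> exists C r L : R,
  [/\ 0 <= r, 0 <= L, elipschitz f L & bsupp C r f].
Proof.
move=> sf cf; rewrite /compactly_supported in cf; set A := closure _ in cf.
have cont : continuous f by case: (sf 0).
have fA x : ~ A x -> f x = 0.
  by move=> Ax; apply: contrapT => fx; apply: Ax; apply: subset_closure; apply/eqP.
have [C C0 fC] := bounded_of_support cf cont fA.
have [N [_ HN]] := compact_bounded cf.
have N1 : N < `|N| + 1 by rewrite (le_lt_trans (ler_norm N))// ltrDl.
have r0 : 0 <= `|N| + 1 by rewrite addr_ge0.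
have pA i x : ~ A x -> partial i f x = 0.
  move=> Ax; have oA : open (~` A) by apply: closed_openC; exact: closed_closure.
  have /nbhs_eball[r r1 rH] := open_nbhs_nbhs (conj oA Ax).
  have fg : is_grad f x (0 *: 0).
    apply: (is_grad_affine_near (q := fun=> 0) (a := 0) (b := 0) r1).
      by move=> y yr; rewrite mul0r addr0 fA//; apply: rH; rewrite enormBC.
    by move=> e e0; exists 1 => // y _; rewrite mxdot0l !subrr normr0 mulr_ge0 ?enorm_ge0// ltW.
  by rewrite /partial (is_grad_derive _ fg).2 scaler0 mxdot0l.
have /choice[M HM] : forall i, exists m : R, 0 <= m /\ forall x, `|partial i f x| <= m.
  move=> i; have cp : continuous (partial i f) by case: (sf 1) => _ /(_ i) [_ []].
  by have [m m0 mH] := bounded_of_support cf cp (pA i); exists m.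
pose B := \sum_i M i; have MB i : M i <= B by rewrite /B (bigD1 i)//= lerDl sumr_ge0// => j _; case: (HM j).
have B0 : 0 <= B by apply: sumr_ge0 => i _; case: (HM i).
exists C, (`|N| + 1), (n%:R * B); split => //; first exact: mulr_ge0.
  (* The points [z k] change [y] into [x] one coordinate at a time, so bounds on the partial
     derivatives give a Lipschitz constant. *)
  move=> x y; pose z (k : nat) : 'cV[R]_n := \col_i (if (i < k)%N then x i 0 else y i 0).
  have H k : (k <= n)%N -> `|f (z k) - f y| <= k%:R * (B * enorm (x - y)).
    elim: k => [_|k IH kn].
      rewrite (_ : z 0%N = y) ?subrr ?normr0 ?mul0r//.
      by apply/colP => i; rewrite mxE.
    pose i := Ordinal kn.
    have zE : z k.+1 = z k + (x i 0 - y i 0) *: delta_mx i 0.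
      apply/colP => j; rewrite !mxE eqxx andbT ltnS leq_eqVlt.
      have [->|ji] := eqVneq j i; first by rewrite /= eqxx ltnn /= mulr1 addrC subrK.
      have -> : (nat_of_ord j == k) = false by apply/negbTE; apply: contra ji => /eqP jk; apply/eqP/val_inj.
      by rewrite /= mulr0 addr0.
    have d1 w : derivable f w (delta_mx i 0) /\ 'D_(delta_mx i 0) f w = partial i f w.
      by split => //; case: (sf 1) => _ /(_ i) [].
    have [c _ E] := line_mvt d1 (z k) (x i 0 - y i 0).
    have st : `|f (z k.+1) - f (z k)| <= B * enorm (x - y).
      rewrite zE E normrM mulrC ler_pM//; first exact: le_trans ((HM i).2 _) (MB i).
      by have := coord_le_enorm (x - y) i 0; rewrite !mxE.
    rewrite -addn1 natrD mulrDl mul1r addn1 [leRHS]addrC.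
    rewrite (_ : f (z k.+1) - f y = (f (z k.+1) - f (z k)) + (f (z k) - f y)); last by rewrite addrA subrK.
    by rewrite (le_trans (ler_normD _ _))// lerD// IH// ltnW.
  have := H n (leqnn n); rewrite (_ : z n = x) ?mulrA//.
  by apply/colP => i; rewrite mxE ltn_ord.
split; first exact: continuous_measurable_mx.
move=> x; rewrite indicE; case: (boolP (x \in _)) => xr; first by rewrite mulr1.
rewrite fA ?normr0 ?mulr0// => Ax; move/negP: xr; apply; rewrite inE; apply/cboxP => //.
exact: HN _ N1 x Ax.
Qed.

Lemma pos_lip (a b : R) : `|Num.max 0 a - Num.max 0 b| <= `|a - b|.
Proof.
wlog ab : a b / a <= b.
  by move=> H; have [/H//|/ltW/H] := leP a b; rewrite distrC [leRHS]distrC.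
have e1 : Num.max 0 a <= Num.max 0 b by rewrite ge_max !le_max lexx ab orbT.
rewrite distrC [leRHS]distrC !ger0_norm ?subr_ge0//.
case: (leP b 0) => b0; first by rewrite [Num.max 0 a]max_l ?(le_trans ab b0)// subrr subr_ge0.
by rewrite lerD2l lerN2 le_max lexx orbT.
Qed.

(** Points with [f x <= 0] are minima of the positive part, so a gradient there is zero; where [f]
    is positive the two functions agree nearby. *)
Lemma positive_part_lgrad f L : smooth f -> elipschitz f L -> {ae leb n, forall x,
  lgrad (fun x => Num.max 0 (f x) : R^o) x = if 0 < f x then grad f x else 0}.
Proof.
move=> sf fL; have FL : elipschitz (fun x => Num.max 0 (f x) : R^o) L.
  by move=> x y; rewrite (le_trans (pos_lip _ _)).
apply: (ae_imp (gradset_ae FL)) => x [g Fg]; rewrite (lgradE Fg); case: ifP => [fx|/negbT].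
  have cont : continuous f by case: (sf 0).
  have oA : open [set y | 0 < f y] by apply: (@open_comp _ _ f [set t : R | 0 < t]) => [y _|]; [exact: cont|exact: open_gt].
  have /nbhs_eball[r r0 rH] := open_nbhs_nbhs (conj oA (fx : [set y | 0 < f y] x)).
  have fg : is_grad f x (1 *: g).
    apply: (is_grad_affine_near (a := 0) r0 _ Fg) => y yr; rewrite add0r mul1r max_r// ltW//.
    by apply: rH; rewrite enormBC.
  by rewrite (is_grad_grad fg) scale1r.
rewrite -leNgt => fx; apply: (is_grad_extremum (s := -1) _ _ Fg); rewrite ?oppr_eq0 ?oner_eq0// => y.
by rewrite !mulN1r lerN2 (max_l fx) le_max lexx.
Qed.

End test_function.

(** * Lower bound for ellipsoids *)

Section lower_bound.
Context {R : realType} (s m : nat) (s0 : (0 < s)%N) (m0 : (0 < m)%N).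
Notation n := (1 + s)%N.
Variables (phi : 'M[R]_n) (phiU : phi \in unitmx) (Q : set 'rV[R]_m) (hQ : convex_body_o Q).
Notation p := (ellipsoid_gauge phi).
Notation K := [set x : 'cV[R]_n | p x <= 1].
Notation alpha := (@hausdorff_density R s).
Notation J u := (level_integral p (hu Q u) 1).
Implicit Types (x y z v : 'cV[R]_n) (u : 'M[R]_(n, m)).

Lemma energy_ge (f : 'cV[R]_n -> R^o) u a : smooth f -> compactly_supported f -> (forall x, K x -> 1 <= f x) ->
  0 < a -> a < 1 -> ((a ^+ s)%:E * (n%:R%:E * J u) <= directional_energy Q f u)%E.
Proof.
move=> sf cf f1 a0 a1; have [C [r [L [r0 L0 fL bf]]]] := smooth_bounds sf cf.
have [M M0 hM] := hu_lip n hQ; have hp := ellipsoid_gaugeP phiU.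
(* A test function may be negative off [K], while the comparison with the cutoff needs a nonnegative
   function. *)
pose F x : R^o := Num.max 0 (f x).
have FL : elipschitz F L by move=> x y; rewrite (le_trans (pos_lip _ _)).
have bF : bsupp (`|C| + 1) r F.
  split; first by apply: continuous_measurable_mx; exact: elipschitz_cont FL.
  move=> x; rewrite ger0_norm; last by rewrite le_max lexx.
  have i0 : 0 <= \1_(cbox r) x :> R by [].
  rewrite ge_max mulr_ge0 ?addr_ge0//= (le_trans (ler_norm _))// (le_trans (bf.2 x))// ler_wpM2r//.
  by rewrite (le_trans (ler_norm C))// lerDl.
rewrite directional_energyE//.
have mg := measurable_h_comp (hM u) (measurable_grad sf).
have mG := measurable_h_comp (hM u) (measurable_lgrad FL).
have h0 := hu_ge0 hQ u.
(* The comparison of integrands is known almost everywhere only; taking the minimum of the two makes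
   it pointwise. *)
have E1 : (\int[leb n]_x (hu Q u (lgrad F x))%:E <= \int[leb n]_x (hu Q u (grad f x))%:E)%E.
  rewrite (_ : (\int[leb n]_x (hu Q u (lgrad F x))%:E)%E =
      (\int[leb n]_x (Num.min (hu Q u (lgrad F x)) (hu Q u (grad f x)))%:E)%E).
    apply: le_integral_ae => x _; first by rewrite lee_fin le_min !h0.
    by rewrite lee_fin ge_min lexx orbT.
  apply: ge0_ae_eq_integral => //.
  - exact/measurable_EFinP.
  - by apply/measurable_EFinP; exact: (measurable_minr mG mg).
  - by move=> x _; rewrite lee_fin.
  - by move=> x _; rewrite lee_fin le_min !h0.
  - apply: (ae_imp (positive_part_lgrad sf fL)) => x E _; rewrite min_l// /F E.
    by case: ifP => // _; rewrite (hu0 hQ).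
apply: (le_trans _ E1).
have C1 : 1 <= `|C| + 1 by rewrite lerDr.
have F0 x : 0 <= F x by rewrite /F le_max lexx.
have F1 x : p x <= 1 -> 1 <= F x by move=> /f1 fx; rewrite /F le_max fx orbT.
apply: (le_trans _ (ellipsoid_energy phiU (hM u) (hu_homog hQ u) (huD hQ u) FL L0 C1 r0 bF a0 a1 F0 F1)).
rewrite (cutoff_integral hp h0 (hM u) (hu_homog hQ u) a0 a1) muleA -EFinM.
apply: lee_wpmul2r; first exact: level_ge0.
rewrite lee_fin ler_pdivlMr ?subr_gt0// subrXX mulrC ler_wpM2l ?subr_ge0 ?(ltW a1)//.
have -> : a ^+ s * n%:R = \sum_(i < n) a ^+ s by rewrite sumr_const card_ord mulr_natr.
apply: ler_sum => i _; rewrite expr1n mul1r; apply: ler_wiXn2l; rewrite ?(ltW a0) ?(ltW a1)//.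
by rewrite -ltnS; exact: ltn_ord.
Qed.

Theorem capacity_ge : ((alpha^-1)%:E * integral_affine_surface_area Q K <= affine_capacity Q K)%E.
Proof.
have hp := ellipsoid_gaugeP phiU.
rewrite -(mean_level s0 m0 hp hQ); apply: le_ereal_inf_tmp => _ [f [sf cf f1] <-].
have nJ0 u : (0 <= n%:R%:E * J u)%E by rewrite mule_ge0 ?(level_ge0 _ hQ)// lee_fin.
apply: sphere_mean_le => // u.
(* The inner level is [1 - 1 / (2 (j + 1))]; the factor one half keeps it positive at [j = 0]. *)
apply: (lee_mul_limit (w := fun j => ((1 + - 2^-1 * j.+1%:R^-1) ^+ s)^-1)).
- by rewrite directional_energyE//; apply: integral_ge0 => x _; rewrite lee_fin; exact: (hu_ge0 hQ).
- move=> j; have d0 : 0 < (j.+1%:R^-1 : R) by rewrite invr_gt0.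
  have d1 : (j.+1%:R^-1 : R) <= 1 by rewrite invf_le1// ler1n.
  have [a [aE a0 a1]] : exists a : R, [/\ a = 1 + - 2^-1 * j.+1%:R^-1, 0 < a & a < 1].
    by move: (j.+1%:R^-1 : R) d0 d1 => t t0 t1; exists (1 + - 2^-1 * t); split => //; lra.
  have as0 : 0 < a ^+ s by rewrite exprn_gt0.
  rewrite -aE; have := energy_ge u sf cf f1 a0 a1 => H.
  have := lee_wpmul2l (_ : (0 <= ((a ^+ s)^-1)%:E)%E) H; rewrite lee_fin invr_ge0 (ltW as0) => /(_ isT).
  by rewrite muleA -EFinM mulVf ?mul1e// gt_eqF.
- have := cvgV (oner_neq0 R) (pow_limit (- 2^-1) s); rewrite invr1; exact.
Qed.

End lower_bound.

(** * Comparison of the ratios *)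

Local Open Scope ereal_scope.

Theorem theorem5p6 (R : realType) (n m : nat) (hn : (2 <= n)%N) (hm : (1 <= m)%N)
    (Q : set 'rV[R]_m) (hQ : convex_body_o Q)
    (K : set 'cV[R]_n) (hK : lipschitz_star_body K) :
  affine_capacity Q K / affine_capacity Q (@eball R n) <=
    integral_affine_surface_area Q K /
      integral_affine_surface_area Q (@eball R n) /\
  (origin_symmetric_ellipsoid K ->
   affine_capacity Q K / affine_capacity Q (@eball R n) =
    integral_affine_surface_area Q K /
      integral_affine_surface_area Q (@eball R n)).
Proof.
(* With [n >= 2] the dimension [s] of the boundary is positive, so that the density constant is
   defined and positive. *)
case: n hn K hK => [//|[//|s']] _ K hK; set s := s'.+1.
have s0 : (0 < s)%N by [].
have a0 := @hausdorff_density_gt0 R s s0.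
have ai : (0 < (@hausdorff_density R s)^-1 :> R)%R by rewrite invr_gt0.
have ellipsoid_capacity (E : set 'cV[R]_(1 + s)) : origin_symmetric_ellipsoid E ->
    affine_capacity Q E = ((@hausdorff_density R s)^-1%:E * integral_affine_surface_area Q E)%E.
  move=> [phi phiU ->]; rewrite (ellipsoidE phiU); apply/eqP; rewrite eq_le.
  rewrite (capacity_le s0 hm (ellipsoid_gaugeP phiU) hQ).
  exact: (capacity_ge s0 hm phiU hQ).
have ball : origin_symmetric_ellipsoid (@eball R (1 + s)).
  exists 1%:M; first exact: unitmx1.
  by apply/seteqP; split => [x x1|_ [x x1 <-]]; [exists x|]; rewrite ?mul1mx.
have area_ge0 (E : set 'cV[R]_(1 + s)) : 0 <= integral_affine_surface_area Q E by exact: sphere_mean_ge0.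
(* Only the positive real constant is cancelled, so the identity holds under the conventions for
   extended reals whatever values the areas take. *)
have ratio (x : \bar R) : (@hausdorff_density R s)^-1%:E * x / affine_capacity Q (@eball R (1 + s)) =
    x / integral_affine_surface_area Q (@eball R (1 + s)).
  rewrite (ellipsoid_capacity _ ball) inve_mul// invrK muleACA -EFinM mulVf ?mul1e//.
  by rewrite gt_eqF.
split; last by move=> /ellipsoid_capacity ->; exact: ratio.
have [hp KE] := star_gauge hK.
rewrite -(ratio (integral_affine_surface_area Q K)); apply: lee_wpmul2r.
  by rewrite inve_ge0 (ellipsoid_capacity _ ball) mule_ge0// lee_fin ltW.
by rewrite {1 2}KE; exact: (capacity_le s0 hm hp hQ).
Qed.
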